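(* Let $\Omega_1,\Omega_2\subset\mathbb{R}^2$ be the two polygons (warped propellers) built from seven copies of a scalene triangle $T$ as described in the context. Let $C=(c_{ij})_{i,j\in\{1,2\}}\colon T\to M_{2\times2}(\mathbb{C})$ be a bounded measurable map for which there exists $\mu>0$ with $\operatorname{Re}\sum_{i,j=1}^2c_{ij}\,\xi_i\,\overline{\xi_j}\ge\mu|\xi|^2$ for all $\xi\in\mathbb{C}^2$, almost everywhere on $T$. For $n\in\{1,2\}$ let $A_n$ be the operator on $L_2(\Omega_n)$ associated with the elliptic form $a_n\colon H^1(\Omega_n)\times H^1(\Omega_n)\to\mathbb{C}$, $$a_n(u,v)=\sum_{k=1}^7\int_{T^{(n)}_k}\sum_{i,j=1}^2\big(C_{\tau^{(n)}_k}\big)_{ij}\,(\partial_iu)\,\overline{\partial_jv},$$ and let $S^n=(S^n_t)_{t>0}$ be the semigroup generated by $-A_n$. Let $U=\Phi_2^{-1}\,\Phi\,\Phi_1\colon L_2(\Omega_1)\to L_2(\Omega_2)$, with $\Phi_1,\Phi_2,\Phi$ as defined in the context. Then $$S^1_t=U^{-1}\,S^2_t\,U$$ for all $t>0$. In particular, the operators $A_1$ on $L_2(\Omega_1)$ and $A_2$ on $L_2(\Omega_2)$ are similar even though $\Omega_1$ and $\Omega_2$ are not congruent.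
   Context: The domains. Let $T\subset\mathbb{R}^2$ be an open scalene triangle with sides $\Gamma_1,\Gamma_2,\Gamma_3$, and let $\rho_j$ be the reflection of $\mathbb{R}^2$ in the line containing $\Gamma_j$. Consider the gluing patterns $E_1=\{(1,2;1),(4,7;1),(1,3;2),(2,5;2),(1,4;3),(3,6;3)\}$ and $E_2=\{(1,2;1),(3,6;1),(1,3;2),(4,7;2),(1,4;3),(2,5;3)\}$. For $n\in\{1,2\}$ let $\tau^{(n)}_1,\dots,\tau^{(n)}_7$ be the isometries of $\mathbb{R}^2$ determined by $\tau^{(n)}_1=\mathrm{id}$ and $\tau^{(n)}_l=\tau^{(n)}_k\circ\rho_j$ for every $(k,l;j)\in E_n$; put $T^{(n)}_k=\tau^{(n)}_k(T)$ and let $\Omega_n$ be the interior of $\bigcup_{k=1}^7\overline{T^{(n)}_k}$. So $(k,l;j)\in E_n$ means that the $k$-th and $l$-th triangles share their sides corresponding to $\Gamma_j$. It is assumed that $T$ is such that, for each $n$, the seven triangles $T^{(n)}_k$ are pairwise disjoint, the six shared sides (without endpoints) lie in $\Omega_n$, and $\partial\Omega_n$ is a simple closed polygonal curve consisting of the remaining nine sides; thus $\Omega_n$ is an open polygon (a Lipschitz domain). Congruent means that an isometry of $\mathbb{R}^2$ maps one set onto the other. For an isometry $\tau$ of $\mathbb{R}^2$ define $C_\tau\colon\tau(T)\to M_{2\times2}(\mathbb{C})$ by $C_\tau(y)=(D\tau)\,C(\tau^{-1}(y))\,(D\tau)^{-1}$, where $D\tau$ is the derivative of $\tau$. The unitary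 map $\Phi_n\colon L_2(\Omega_n)\to L_2(T)^7$ is $\Phi_n(w)=(w|_{T^{(n)}_1}\circ\tau^{(n)}_1,\dots,w|_{T^{(n)}_7}\circ\tau^{(n)}_7)$. The map $\Phi\colon L_2(T)^7\to L_2(T)^7$ is $(\Phi u)_k=\sum_{l=1}^7b_{kl}\,u_l$ with $$B=(b_{kl})=\begin{pmatrix}0&1&1&1&0&0&0\\1&0&1&0&0&0&1\\1&0&0&1&1&0&0\\1&1&0&0&0&1&0\\0&0&0&1&0&1&1\\0&1&0&0&1&0&1\\0&0&1&0&1&1&0\end{pmatrix}.$$ The operator $A$ in a Hilbert space $H$ associated with a form $a\colon V\times V\to\mathbb{C}$ has domain $D(A)=\{u\in V:\exists f\in H\ \forall v\in V\ a(u,v)=(f,v)_H\}$ and $Au=f$. Operators $A_1,A_2$ are called similar if there is an invertible $\Psi\in\mathcal{L}(L_2(\Omega_1),L_2(\Omega_2))$ with $\Psi(D(A_1))=D(A_2)$ and $A_2\Psi u=\Psi A_1u$ for all $u\in D(A_1)$; equivalently $\Psi^{-1}S^2_t\Psi=S^1_t$ for all $t>0$. *)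

(* Defs.v *)
From HB Require Import structures.
From mathcomp Require Import all_boot all_order all_algebra.
From mathcomp Require Import all_classical all_reals all_analysis.
From mathcomp Require Import measurable_realfun complex ring.

Set Implicit Arguments.
Unset Strict Implicit.
Unset Printing Implicit Defensive.
Import Order.TTheory GRing.Theory Num.Theory.
Import numFieldNormedType.Exports.

Local Open Scope classical_set_scope.
Local Open Scope ring_scope.
Local Open Scope quotient_scope.

Local Notation Re := (@complex.Re _).
Local Notation Im := (@complex.Im _).

Section Plane.
Variable R : realType.
Local Notation R2 := (R * R)%type.

Definition coord (i : 'I_2) (x : R2) : R := if i == 0 then x.1 else x.2.

Definition basis_vec (i : 'I_2) : R2 := ((i == 0)%:R, (i == 1)%:R).

Definition edot (x y : R2) : R := \sum_i coord i x * coord i y.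

(* The norm of the normedModType R * R is the sup norm, hence this one. *)
Definition edist (x y : R2) : R := Num.sqrt (edot (x - y) (x - y)).

Definition isometry (f : R2 -> R2) : Prop :=
  forall x y, edist (f x) (f y) = edist x y.

Definition congruent (A B : set R2) : Prop :=
  exists2 f, isometry f & f @` A = B.

Definition segment (a b : R2) : set R2 :=
  [set x | exists2 t : R, 0 <= t <= 1 & x = (1 - t) *: a + t *: b].

Definition open_segment (a b : R2) : set R2 :=
  [set x | exists2 t : R, 0 < t < 1 & x = (1 - t) *: a + t *: b].

Definition reflection (a b x : R2) : R2 :=
  2 *: (a + (edot (x - a) (b - a) / edot (b - a) (b - a)) *: (b - a)) - x.

Definition jacobian (f : R2 -> R2) (x : R2) : 'M[R]_2 :=
  \matrix_(i, j) coord i ('D_(basis_vec j) f x).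

Definition boundary (A : set R2) : set R2 := closure A `\` A°.

End Plane.

Section Lebesgue.
Variable R : realType.
Local Notation R2 := (R * R)%type.
Local Notation C := R[i].
Local Notation mR := (measurableTypeR R).

Definition leb2 : {measure set (mR * mR)%type -> \bar R} :=
  (@lebesgue_measure R \x @lebesgue_measure R)%E.

(* Borel measurability on the plane of the extension of f by zero outside D;
   for a measurable D this is measurable_fun D f. *)
Definition borel_on (D : set R2) (f : R2 -> R) : Prop :=
  @measurable_fun _ _ (mR * mR)%type mR setT (f \_ D).

Definition ae_on (D : set R2) (P : R2 -> Prop) : Prop :=
  {ae leb2, forall x, D x -> P x}.

(* Lebesgue measurable: Borel measurable up to a null set.  (The library's
   sigma-algebra on the plane is the Borel one.) *)
Definition lebesgue_measurable_on (D : set R2) (f : R2 -> C) : Prop :=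
  exists g : R2 -> C,
    [/\ borel_on D (Re \o g), borel_on D (Im \o g)
      & ae_on D (fun x => f x = g x)].

(* The squared modulus, as a real number (the library's norm on R[i] takes its
   values in R[i]). *)
Definition sqmod (z : C) : R := Re z ^+ 2 + Im z ^+ 2.

Definition cintegral (D : set R2) (f : R2 -> C) : C :=
  Complex (\int[leb2]_(x in D) Re (f x)) (\int[leb2]_(x in D) Im (f x)).

End Lebesgue.

(* L_2(D): square-integrable functions R * R -> R[i], of which only the values
   on D matter, modulo equality almost everywhere on D. *)
Section L2.
Variables (R : realType) (D : set (R * R)%type).
Local Notation R2 := (R * R)%type.
Local Notation C := R[i].
Local Notation mR := (measurableTypeR R).
Local Notation mu := (@leb2 R).

Definition sqintegrable (f : R2 -> C) : Prop :=
  [/\ borel_on D (Re \o f), borel_on D (Im \o f)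
    & (\int[mu]_(x in D) (sqmod (f x))%:E < +oo)%E].

Definition L2fun : {pred R2 -> C} := mem [set f | sqintegrable f].

Lemma borel_onZD (a : R) (f g : R2 -> R) :
  borel_on D f -> borel_on D g -> borel_on D (fun x => a * f x + g x).
Proof.
move=> mf mg; rewrite /borel_on.
have -> : (fun x => a * f x + g x) \_ D = (fun x => a * (f \_ D) x + (g \_ D) x).
  apply/funext => x; rewrite !patchE; case: ifP => // _.
  by rewrite mulr0 addr0.
by apply: measurable_funD => //; exact: measurable_funM.
Qed.

Lemma integral_sqmod_patch (f : R2 -> C) :
  (\int[mu]_(x in D) (sqmod (f x))%:E =
   \int[mu]_x (((Re \o f) \_ D) x ^+ 2 + ((Im \o f) \_ D) x ^+ 2)%:E)%E.
Proof.
rewrite integral_mkcond; apply: eq_integral => x _.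
by rewrite !patchE; case: ifP => // _; rewrite expr0n addr0.
Qed.

Lemma measurable_sqmod_patch (f : R2 -> C) :
  borel_on D (Re \o f) -> borel_on D (Im \o f) ->
  @measurable_fun _ _ (mR * mR)%type (\bar R) setT
    (fun x => (((Re \o f) \_ D) x ^+ 2 + ((Im \o f) \_ D) x ^+ 2)%:E).
Proof.
move=> rf jf; apply/measurable_EFinP.
by apply: measurable_funD; apply: measurable_funX.
Qed.

Lemma ReZD (a z w : C) :
  Re (a * z + w) = Re a * Re z + (- Im a * Im z + Re w).
Proof. by case: a z w => [a b] [c d] [e f]; rewrite addrA mulNr. Qed.

Lemma ImZD (a z w : C) :
  Im (a * z + w) = Re a * Im z + (Im a * Re z + Im w).
Proof. by case: a z w => [a b] [c d] [e f]; rewrite addrA. Qed.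

Lemma sqmodZD (a z w : C) :
  sqmod (a * z + w) <= 2 * sqmod a * sqmod z + 2 * sqmod w.
Proof.
case: a z w => [a b] [c d] [e f]; rewrite /sqmod /=.
rewrite -subr_ge0.
rewrite (_ : _ - _ = (a * c - b * d - e) ^+ 2 + (a * d + b * c - f) ^+ 2).
  by rewrite addr_ge0 // sqr_ge0.
by ring.
Qed.

Lemma L2fun_submod_closed : submod_closed L2fun.
Proof.
have b0 : borel_on D (fun=> 0 : R).
  rewrite /borel_on (_ : _ \_ D = cst 0); first exact: measurable_cst.
  by apply/funext => x; rewrite patchE; case: ifP.
split.
  apply/mem_set; split => //=.
  rewrite (eq_integral (cst 0%E)) ?integral0 ?ltry// => x _.
  by rewrite /sqmod /= expr0n addr0.
move=> a f g /set_mem[rf jf sf] /set_mem[rg jg sg].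
have rh : borel_on D (Re \o (a *: f + g)).
  have -> : Re \o (a *: f + g) =
      fun x => Re a * Re (f x) + (- Im a * Im (f x) + Re (g x)).
    apply/funext => x; exact: ReZD.
  by apply: borel_onZD => //; exact: borel_onZD.
have jh : borel_on D (Im \o (a *: f + g)).
  have -> : Im \o (a *: f + g) =
      fun x => Re a * Im (f x) + (Im a * Re (f x) + Im (g x)).
    apply/funext => x; exact: ImZD.
  by apply: borel_onZD => //; exact: borel_onZD.
apply/mem_set; split => //; rewrite integral_sqmod_patch.
pose F (f : R2 -> C) x :=
  (((Re \o f) \_ D) x ^+ 2 + ((Im \o f) \_ D) x ^+ 2)%:E.
have F0 h x : (0 <= F h x)%E by rewrite lee_fin addr_ge0 ?sqr_ge0.
have mF := measurable_sqmod_patch.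
apply: (@le_lt_trans _ _ (\int[mu]_x
    ((2 * sqmod a)%:E * F f x + 2%:E * F g x))%E).
  apply: ge0_le_integral => //.
  - by move=> x _; exact: F0.
  - exact: mF.
  - by apply: emeasurable_funD; apply: measurable_funeM; exact: mF.
  move=> x _; rewrite /F !patchE; case: ifP => _; last first.
    by rewrite expr0n !addr0 !mule0 adde0.
  rewrite -!EFinM -EFinD lee_fin.
  exact: (sqmodZD a (f x) (g x)).
have a0 : 0 <= 2 * sqmod a by rewrite mulr_ge0// addr_ge0 ?sqr_ge0.
rewrite ge0_integralD //; last 4 first.
- by move=> x _; rewrite mule_ge0.
- by apply: measurable_funeM; exact: mF.
- by move=> x _; rewrite mule_ge0.
- by apply: measurable_funeM; exact: mF.
rewrite !ge0_integralZl //; [|exact: mF|exact: mF].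
rewrite -!integral_sqmod_patch lte_add_pinfty //.
  by rewrite lte_mul_pinfty.
by rewrite lte_mul_pinfty.
Qed.

HB.instance Definition _ :=
  GRing.isSubmodClosed.Build C (R2 -> C) L2fun L2fun_submod_closed.

Record L2sub : Type := L2Sub { L2val :> R2 -> C ; _ : L2val \in L2fun }.

HB.instance Definition _ := [isSub for L2val].
HB.instance Definition _ := [Choice of L2sub by <:].
HB.instance Definition _ := [SubChoice_isSubLmodule of L2sub by <:].

Definition L2null : {pred L2sub} := mem [set f : L2sub | ae_on D (fun x => f x = 0)].

Lemma L2null_submod_closed : submod_closed L2null.
Proof.
have aZD0 (b : C) : b * 0 + 0 = 0 by rewrite mulr0 addr0.
split; first by apply/mem_set; exact: aeW.
move=> a f g /set_mem f0 /set_mem g0; apply/mem_set.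
move: f0 g0; rewrite /= /ae_on; apply: (filterS2 (F:=almost_everywhere mu)) => x f0 g0 Dx.
exact: (etrans (congr2 (fun z w : C => a * z + w) (f0 Dx) (g0 Dx)) (aZD0 a)).
Qed.

HB.instance Definition _ :=
  GRing.isSubmodClosed.Build C L2sub L2null L2null_submod_closed.

Definition L2 : Type := Quotient.quot L2null.

HB.instance Definition _ := GRing.Zmodule.on L2.
HB.instance Definition _ := EqQuotient.on L2.
HB.instance Definition _ := ZmodQuotient.on L2.

Definition L2scale (a : C) : L2 -> L2 := lift_op1 L2 ( *:%R a).

Lemma pi_L2scale a : {morph \pi_L2 : u / a *: u >-> L2scale a u}.
Proof.
move=> u; unlock L2scale; apply/eqP; rewrite -Quotient.idealrBE.
rewrite -scalerBr rpredZ// Quotient.idealrBE.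
by rewrite reprK.
Qed.

Lemma L2scalerA a b u : L2scale a (L2scale b u) = L2scale (a * b) u.
Proof. by rewrite -[u]reprK -!pi_L2scale scalerA. Qed.

Lemma L2scale1r : left_id 1 L2scale.
Proof. by move=> u; rewrite -[u]reprK -pi_L2scale scale1r. Qed.

Lemma L2scalerDr : right_distributive L2scale +%R.
Proof.
move=> a u v; rewrite -[u]reprK -[v]reprK -!pi_L2scale.
have pD : {morph \pi_L2 : x y / x + y} by exact: Quotient.pi_add.
by rewrite -!pD -pi_L2scale scalerDr.
Qed.

Lemma L2scalerDl u : {morph L2scale^~ u : a b / a + b}.
Proof.
move=> a b; rewrite -[u]reprK -!pi_L2scale scalerDl; exact: Quotient.pi_add.
Qed.

HB.instance Definition _ := GRing.Zmodule_isLmodule.Build C L2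
  L2scalerA L2scale1r L2scalerDr L2scalerDl.

HB.instance Definition _ := isPointed.Build L2 0.

Definition L2rep (u : L2) : R2 -> C := repr u.

(* The class of f; 0 if f is not square-integrable on D. *)
Definition L2class (f : R2 -> C) : L2 := \pi_L2 (insubd (0 : L2sub) f).

Definition L2dot (u v : L2) : C :=
  cintegral D (fun x => L2rep u x * (L2rep v x)^*).

Definition L2norm (u : L2) : R :=
  Num.sqrt (\int[mu]_(x in D) sqmod (L2rep u x)).

End L2.

Coercion L2rep : L2 >-> Funclass.

Section Operators.
Variable R : realType.
Local Notation R2 := (R * R)%type.
Local Notation C := R[i].

Definition bounded_operator (D1 D2 : set R2) (F : L2 D1 -> L2 D2) : Prop :=
  linear F /\ exists M : R, forall u, L2norm (F u) <= M * L2norm u.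

Definition invertible_operator (D1 D2 : set R2) (F : L2 D1 -> L2 D2) : Prop :=
  bounded_operator F /\
  exists G : L2 D2 -> L2 D1, [/\ bounded_operator G, cancel F G & cancel G F].

Section Domain.
Variable D : set R2.

(* An unbounded operator A in L_2(D) is given by its graph: A (u, f) means
   that u is in the domain of A and A u = f. *)
Definition op_dom (A : set (L2 D * L2 D)) : set (L2 D) :=
  [set u | exists f, A (u, f)].

Definition associated_operator (V : set (L2 D)) (a : L2 D -> L2 D -> C) :
    set (L2 D * L2 D) :=
  [set p | V p.1 /\ forall v, V v -> a p.1 v = L2dot p.2 v].

(* Strongly continuous semigroups (S_t)_{t > 0}; the values of S at t <= 0
   are irrelevant. *)
Definition C0_semigroup (S : R -> L2 D -> L2 D) : Prop :=
  [/\ forall t, 0 < t -> bounded_operator (S t),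
      forall s t, 0 < s -> 0 < t -> forall u, S (s + t) u = S s (S t u)
    & forall u, L2norm (S t u - u) @[t --> 0^'+] --> (0 : R)].

Definition generator (S : R -> L2 D -> L2 D) : set (L2 D * L2 D) :=
  [set p | L2norm ((t^-1)%:C%C *: (S t p.1 - p.1) - p.2) @[t --> 0^'+] -->
           (0 : R)].

Definition generated_by_opp (A : set (L2 D * L2 D)) (S : R -> L2 D -> L2 D) :
    Prop :=
  C0_semigroup S /\ generator S = [set p | A (p.1, - p.2)].

Fixpoint of_class_C (n : nat) (phi : R2 -> R) : Prop :=
  if n is m.+1 then
    [/\ continuous phi, forall i x, derivable phi x (basis_vec R i)
      & forall i, of_class_C m (fun x => 'D_(basis_vec R i) phi x)]
  else continuous phi.

Definition support_of (phi : R2 -> R) : set R2 :=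
  closure [set x | phi x != 0].

Definition test_function (phi : R2 -> R) : Prop :=
  [/\ forall n, of_class_C n phi, compact (support_of phi)
    & support_of phi `<=` D].

Definition weak_partial (i : 'I_2) (u g : L2 D) : Prop :=
  forall phi, test_function phi ->
    cintegral D (fun x => u x * ('D_(basis_vec R i) phi x)%:C%C) =
    - cintegral D (fun x => g x * (phi x)%:C%C).

Definition sobolev_H1 : set (L2 D) :=
  [set u | forall i, exists g, weak_partial i u g].

(* The i-th weak partial derivative of u (unique if it exists). *)
Definition wD (i : 'I_2) (u : L2 D) : L2 D := xget 0 (weak_partial i u).

End Domain.

Definition similar_operators (D1 D2 : set R2)
    (A1 : set (L2 D1 * L2 D1)) (A2 : set (L2 D2 * L2 D2)) : Prop :=
  exists Psi : L2 D1 -> L2 D2,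
    [/\ invertible_operator Psi, Psi @` op_dom A1 = op_dom A2
      & forall u f, A1 (u, f) -> A2 (Psi u, Psi f)].

End Operators.

Section Propeller.
Variable R : realType.
Local Notation R2 := (R * R)%type.
Local Notation C := R[i].

Section Triangle.
(* The triangle has the vertices P 0, P 1, P 2; its j-th side is the one
   opposite to P j.  Indices in 'I_3 are taken modulo 3. *)
Variable P : 'I_3 -> R2.

Definition triangle : set R2 :=
  [set x | exists l : 'I_3 -> R,
     [/\ forall i, 0 < l i, \sum_i l i = 1 & x = \sum_i l i *: P i]].

Definition side (j : 'I_3) : set R2 := segment (P (j + 1)) (P (j + 2)).

Definition open_side (j : 'I_3) : set R2 :=
  open_segment (P (j + 1)) (P (j + 2)).

Definition side_length (j : 'I_3) : R := edist (P (j + 1)) (P (j + 2)).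

Definition affinely_independent : Prop :=
  forall l : 'I_3 -> R, \sum_i l i = 0 -> \sum_i l i *: P i = 0 ->
    forall i, l i = 0.

Definition scalene : Prop :=
  affinely_independent /\ injective side_length.

Definition side_reflection (j : 'I_3) : R2 -> R2 :=
  reflection (P (j + 1)) (P (j + 2)).

End Triangle.

(* A gluing pattern is a set of triples (k, l; j), numbered from 1 on. *)
Definition gluing1 : seq (nat * nat * nat) :=
  [:: (1, 2, 1); (4, 7, 1); (1, 3, 2); (2, 5, 2); (1, 4, 3); (3, 6, 3)]%N.

Definition gluing2 : seq (nat * nat * nat) :=
  [:: (1, 2, 1); (3, 6, 1); (1, 3, 2); (4, 7, 2); (1, 4, 3); (2, 5, 3)]%N.

Definition glued (E : seq (nat * nat * nat)) (k l : 'I_7) (j : 'I_3) : bool :=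
  (k.+1, l.+1, j.+1) \in E.

Definition shared (E : seq (nat * nat * nat)) (k : 'I_7) (j : 'I_3) : bool :=
  [exists l, glued E k l j || glued E l k j].

Section Unfolding.
Variables (P : 'I_3 -> R2) (E : seq (nat * nat * nat)) (tau : 'I_7 -> R2 -> R2).

Definition unfolding : Prop :=
  tau 0 = id /\
  forall k l j, glued E k l j -> tau l = tau k \o side_reflection P j.

Definition tile (k : 'I_7) : set R2 := tau k @` triangle P.

Definition polygon : set R2 := (\bigcup_k closure (tile k))°.

(* The boundary of the polygon is a simple closed polygonal curve with
   vertices v 0, ..., v 8 (in cyclic order) whose edges are the sides of the
   tiles that are not shared. *)
Definition simple_boundary : Prop :=
  exists (v : 'I_9 -> R2) (s : 'I_9 -> 'I_7 * 'I_3),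
    let edge i := segment (v i) (v (i + 1)) in
    [/\ injective s,
        range s = [set p | ~~ shared E p.1 p.2],
        forall i, tau (s i).1 @` side P (s i).2 = edge i,
        [/\ injective v,
            forall i, edge i `&` edge (i + 1) = [set v (i + 1)]
          & forall i j, j != i -> j != i + 1 -> i != j + 1 ->
              edge i `&` edge j = set0]
      & boundary polygon = \bigcup_i edge i].

Definition warped_propeller : Prop :=
  [/\ forall k l, k != l -> tile k `&` tile l = set0,
      forall k l j, glued E k l j -> tau k @` open_side P j `<=` polygon
    & simple_boundary].

End Unfolding.

Definition mixing_matrix : 'M[C]_7 := \matrix_(k, l)
  (nth 0%N (nth [::]
     [:: [:: 0; 1; 1; 1; 0; 0; 0];
         [:: 1; 0; 1; 0; 0; 0; 1];
         [:: 1; 0; 0; 1; 1; 0; 0];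
         [:: 1; 1; 0; 0; 0; 1; 0];
         [:: 0; 0; 0; 1; 0; 1; 1];
         [:: 0; 1; 0; 0; 1; 0; 1];
         [:: 0; 0; 1; 0; 1; 1; 0]]%N k) l)%:R.

Definition Phi_mix (T : set R2) (u : 'I_7 -> L2 T) : 'I_7 -> L2 T :=
  fun k => \sum_l mixing_matrix k l *: u l.

Definition Phi (T Omega : set R2) (tau : 'I_7 -> R2 -> R2) (w : L2 Omega) :
    'I_7 -> L2 T :=
  fun k => L2class T (w \o tau k).

Definition transplantation (T Omega1 Omega2 : set R2)
    (tau1 tau2 : 'I_7 -> R2 -> R2) : L2 Omega1 -> L2 Omega2 :=
  pinv setT (Phi T tau2) \o @Phi_mix T \o Phi T tau1.

Definition transport (tau : R2 -> R2) (c : R2 -> 'M[C]_2) (y : R2) : 'M[C]_2 :=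
  let x := pinv setT tau y in
  let Dtau := map_mx (real_complex R) (jacobian tau x) in
  Dtau *m c x *m invmx Dtau.

Definition elliptic_coefficients (T : set R2) (c : R2 -> 'M[C]_2) : Prop :=
  [/\ forall i j, lebesgue_measurable_on T (fun x => c x i j),
      exists M : R, forall x i j, T x -> `|c x i j| <= M%:C%C
    & exists2 mu : R, 0 < mu & ae_on T (fun x => forall xi : 'I_2 -> C,
        mu * \sum_i sqmod (xi i) <=
        Re (\sum_i \sum_j c x i j * xi i * (xi j)^*))].

(* c, hence the integrand, need only be Lebesgue measurable.  The library's
   integral of a nonnegative function is a supremum over the simple functions
   below it, so it is unchanged when the integrand is replaced by an almost
   everywhere equal Borel function. *)
Definition elliptic_form (T Omega : set R2) (tau : 'I_7 -> R2 -> R2)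
    (c : R2 -> 'M[C]_2) (u v : L2 Omega) : C :=
  \sum_k cintegral (tau k @` T) (fun y =>
    \sum_i \sum_j transport (tau k) c y i j * wD i u y * (wD j v y)^*).

Definition elliptic_operator (T Omega : set R2) (tau : 'I_7 -> R2 -> R2)
    (c : R2 -> 'M[C]_2) : set (L2 Omega * L2 Omega) :=
  associated_operator (@sobolev_H1 R Omega) (elliptic_form T tau c).

End Propeller.

(* Main.v *)
(* Let p_j and q_j be the involutions sending a tile of Omega_1, respectively
   Omega_2, to its neighbour across the j-th side, and fixing the tiles whose
   j-th side lies on the boundary.  The mixing matrix N satisfies
   N(q_j k, p_j l) = N(k, l), and so do its transpose and its inverse with p and
   q exchanged.  A function which is weakly differentiable on each tile is so on
   the glued domain if and only if its traces from the two sides of every shared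
   side agree.  By the commutation relation mixing the tiles with N preserves
   this matching: the jump of the mixed function across a side is the mixture of
   the jumps of the original one.  No condition at the vertices is lost, as all
   of them lie on the boundary, away from the supports of test functions.  Hence
   N and its transpose map H^1 to H^1.  Both forms are sums over the tiles of one
   sesquilinear form on the triangle, so a_2(U u, w) = a_1(u, U^* w), and
   A_1 u = f implies A_2 (U u) = U f; the same holds for the inverse.  Then
   U^-1 S^2 U is a strongly continuous semigroup whose generator extends that of
   S^1, and the two coincide.

   The domains are not congruent: the polar moment of inertia of Omega_n about z
   is |T| sum_k |g_k - z|^2 plus a constant independent of z and n, where g_k is
   the centroid of the k-th tile.  Its minimum over z is invariant under
   congruence and equals, up to such a constant,
   sum_k |g_k - g_1|^2 - |sum_k (g_k - g_1)|^2 / 7.  The first sums coincide, but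
   for the squared side lengths a, b, c the difference of the squared norms is a
   nonzero multiple of (a - b)(b - c)(c - a) |T|^4 / (a b c)^2. *)

Require Import Defs.
From mathcomp Require Import all_boot all_order all_algebra.
From mathcomp Require Import all_classical all_reals all_analysis.
From mathcomp Require Import measurable_realfun complex ring lra.

Set Implicit Arguments.
Unset Strict Implicit.
Unset Printing Implicit Defensive.
Import Order.TTheory GRing.Theory Num.Theory.
Import numFieldNormedType.Exports.

Local Open Scope classical_set_scope.
Local Open Scope ring_scope.

(** * Plane isometries and Lebesgue measure *)

Section Isometry.
Variable R : realType.
Local Notation R2 := (R * R)%type.

(** Traces are never constructed as functions. The trace on a side is seen only through the means
    [side_mean], taken against bumps that concentrate at the side; differentiating a cutoff of the
    triangle makes these means the boundary term of Green's formula. Matching of traces ([trace0])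
    is then a limit statement, linear in the function, and passes to mixtures without a trace
    theorem or density of smooth functions. Tests vanish near the vertices, so that the three sides
    do not interact.

    Uniqueness of the semigroup rests on elementary estimates: Riemann sums in place of
    vector-valued integrals give density of the domain, nested balls give local boundedness, and
    continuous induction on one-sided increments shows that s |-> F (t - s) (E s v) is constant.

    Moments of inertia are used because a congruence need not respect the tilings: the moment
    forgets the tiling, yet is computed from the tile centroids. With G the centroid of the
    triangle, the first sums coincide because the distance from rho_i (rho_j G) to G is that from
    rho_j G to rho_i G, which is symmetric in i and j. *)

Lemma edotE (x y : R2) : edot x y = x.1 * y.1 + x.2 * y.2.
Proof. by rewrite /edot big_ord_recr big_ord1 /=. Qed.

Lemma edot_ge0 (x : R2) : 0 <= edot x x.
Proof. by rewrite edotE addr_ge0 // -expr2 sqr_ge0. Qed.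

Lemma isometryP (f : R2 -> R2) : Defs.isometry f <->
  forall x y, edot (f x - f y) (f x - f y) = edot (x - y) (x - y).
Proof.
split => h x y; last by congr Num.sqrt; exact: h.
by have /(congr1 (fun z => z ^+ 2)) := h x y; rewrite /edist !sqr_sqrtr ?edot_ge0.
Qed.

Lemma isometry_comp (f g : R2 -> R2) : Defs.isometry f -> Defs.isometry g -> Defs.isometry (f \o g).
Proof. by move=> hf hg x y; rewrite /= hf hg. Qed.

Definition affine_map (m : 'M[R]_2) (t x : R2) : R2 :=
  (m 0 0 * x.1 + m 0 1 * x.2 + t.1, m 1 0 * x.1 + m 1 1 * x.2 + t.2).

(** Orthonormality of the columns, in entries so that [ring] and [lra] can use it; the rows follow
    by [orthogonal2_inv]. *)
Definition orthogonal2 (m : 'M[R]_2) : Prop :=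
  [/\ m 0 0 ^+ 2 + m 1 0 ^+ 2 = 1, m 0 1 ^+ 2 + m 1 1 ^+ 2 = 1
    & m 0 0 * m 0 1 + m 1 0 * m 1 1 = 0].

(** With t = f 0, the vectors e1, e2 from t to the images of the basis are orthonormal by
    polarization, and the products of y = f x - t with them are the coordinates of x. Hence the
    squared distance of y from x.1 e1 + x.2 e2 expands to 0. *)
Lemma isometry_affine (f : R2 -> R2) : Defs.isometry f ->
  exists (m : 'M[R]_2) (t : R2), orthogonal2 m /\ f = affine_map m t.
Proof.
move=> /isometryP hf.
pose t := f 0; pose e1 := f (1, 0) - t; pose e2 := f (0, 1) - t.
pose m := \matrix_(i < 2, j < 2) Defs.coord i (if j == 0 then e1 else e2).
have m00 : m 0 0 = e1.1 by rewrite mxE.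
have m01 : m 0 1 = e2.1 by rewrite mxE.
have m10 : m 1 0 = e1.2 by rewrite mxE.
have m11 : m 1 1 = e2.2 by rewrite mxE.
exists m, t.
have h1 := hf (1, 0) 0; have h2 := hf (0, 1) 0; have h12 := hf (1, 0) (0, 1).
move: h1 h2 h12; rewrite !edotE /=.
rewrite -/t -/e1 -/e2.
have -> : (f (1, 0)).1 - (f (0, 1)).1 = e1.1 - e2.1 by rewrite /e1 /e2 /=; ring.
have -> : (f (1, 0)).2 - (f (0, 1)).2 = e1.2 - e2.2 by rewrite /e1 /e2 /=; ring.
move=> h1 h2 h12.
have o1 : e1.1 ^+ 2 + e1.2 ^+ 2 = 1 by rewrite -[RHS]/1; move: h1; rewrite /e1 /=; lra.
have o2 : e2.1 ^+ 2 + e2.2 ^+ 2 = 1 by move: h2; rewrite /e2 /=; lra.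
have o12 : e1.1 * e2.1 + e1.2 * e2.2 = 0 by move: h12; lra.
split; first by split; rewrite ?m00 ?m01 ?m10 ?m11.
apply/funext => x; rewrite /affine_map m00 m01 m10 m11.
have := hf x 0; have := hf x (1, 0); have := hf x (0, 1).
rewrite !edotE /= -/t !subr0.
set y := f x - t.
have -> : (f x).1 - (f (0, 1)).1 = y.1 - e2.1 by rewrite /y /e2 /=; ring.
have -> : (f x).2 - (f (0, 1)).2 = y.2 - e2.2 by rewrite /y /e2 /=; ring.
have -> : (f x).1 - (f (1, 0)).1 = y.1 - e1.1 by rewrite /y /e1 /=; ring.
have -> : (f x).2 - (f (1, 0)).2 = y.2 - e1.2 by rewrite /y /e1 /=; ring.
have -> : (f x).1 - t.1 = y.1 by [].
have -> : (f x).2 - t.2 = y.2 by [].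
move=> k2 k1 k0.
have l1 : y.1 * e1.1 + y.2 * e1.2 = x.1 by lra.
have l2 : y.1 * e2.1 + y.2 * e2.2 = x.2 by lra.
have z0 : (y.1 - (x.1 * e1.1 + x.2 * e2.1)) ^+ 2 +
          (y.2 - (x.1 * e1.2 + x.2 * e2.2)) ^+ 2 = 0.
  transitivity ((y.1 * y.1 + y.2 * y.2) - 2 * x.1 * (y.1 * e1.1 + y.2 * e1.2)
    - 2 * x.2 * (y.1 * e2.1 + y.2 * e2.2)
    + x.1 ^+ 2 * (e1.1 ^+ 2 + e1.2 ^+ 2) + x.2 ^+ 2 * (e2.1 ^+ 2 + e2.2 ^+ 2)
    + 2 * x.1 * x.2 * (e1.1 * e2.1 + e1.2 * e2.2)); first by ring.
  by rewrite l1 l2 o1 o2 o12 k0; ring.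
move/eqP: z0; rewrite paddr_eq0 ?sqr_ge0 // !sqrf_eq0 !subr_eq0 => /andP[/eqP y1 /eqP y2].
have -> : f x = (y.1 + t.1, y.2 + t.2) by rewrite /y /= !subrK; case: (f x).
by rewrite y1 y2 /e1 /e2 /=; congr pair; ring.
Qed.

(** Lagrange's identity: for columns c1, c2 the squared determinant is |c1|^2 |c2|^2 - (c1 .
    c2)^2. *)
Lemma orthogonal2_det (m : 'M[R]_2) : orthogonal2 m ->
  `|m 0 0 * m 1 1 - m 0 1 * m 1 0| = 1.
Proof.
move=> [h1 h2 h3].
have : (m 0 0 * m 1 1 - m 0 1 * m 1 0) ^+ 2 = 1.
  transitivity ((m 0 0 ^+ 2 + m 1 0 ^+ 2) * (m 0 1 ^+ 2 + m 1 1 ^+ 2)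
     - (m 0 0 * m 0 1 + m 1 0 * m 1 1) ^+ 2); first by ring.
  by rewrite h1 h2 h3; ring.
move/eqP; rewrite sqrf_eq1 => /orP[]/eqP ->; rewrite ?normrN normr1 //.
Qed.

(** The column relations force m 0 0 and m 1 1 to have equal squares, so the rows have norm 1;
    Lagrange's identity for the rows then makes their product vanish. *)
Lemma orthogonal2_inv (m : 'M[R]_2) : orthogonal2 m -> orthogonal2 (m^T).
Proof.
move=> /[dup] /orthogonal2_det /(congr1 (fun z => z ^+ 2)).
rewrite real_normK ?num_real // expr1n => d [h1 h2 h3].
rewrite /orthogonal2 !mxE.
have e1 : m 0 0 ^+ 2 = m 1 1 ^+ 2.
  have : m 0 0 ^+ 2 * m 0 1 ^+ 2 = m 1 0 ^+ 2 * m 1 1 ^+ 2.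
    by rewrite -!exprMn (_ : m 0 0 * m 0 1 = - (m 1 0 * m 1 1)) ?sqrrN //; lra.
  rewrite (_ : m 0 1 ^+ 2 = 1 - m 1 1 ^+ 2); last by lra.
  rewrite (_ : m 1 0 ^+ 2 = 1 - m 0 0 ^+ 2); last by lra.
  by lra.
split; [lra|lra|].
have := congr1 (fun z => (m 0 0 * m 1 1 - m 0 1 * m 1 0) * z) h3.
have : (m 0 0 * m 1 0 + m 0 1 * m 1 1) ^+ 2 = 0; last first.
  by move=> /eqP; rewrite sqrf_eq0 => /eqP.
transitivity ((m 0 0 ^+ 2 + m 0 1 ^+ 2) * (m 1 0 ^+ 2 + m 1 1 ^+ 2) -
   (m 0 0 * m 1 1 - m 0 1 * m 1 0) ^+ 2); first by ring.
rewrite d (_ : m 0 0 ^+ 2 + m 0 1 ^+ 2 = 1); last by lra.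
by rewrite (_ : m 1 0 ^+ 2 + m 1 1 ^+ 2 = 1); [ring|lra].
Qed.

Lemma orthogonal2_affine_isometry m (t : R2) : orthogonal2 m -> Defs.isometry (affine_map m t).
Proof.
move=> [h1 h2 h3]; apply/isometryP => x y; rewrite !edotE /=.
transitivity ((x.1 - y.1) ^+ 2 * (m 0 0 ^+ 2 + m 1 0 ^+ 2)
  + (x.2 - y.2) ^+ 2 * (m 0 1 ^+ 2 + m 1 1 ^+ 2)
  + 2 * (x.1 - y.1) * (x.2 - y.2) * (m 0 0 * m 0 1 + m 1 0 * m 1 1)); first by ring.
by rewrite h1 h2 h3; ring.
Qed.

Lemma isometry_inverse (f : R2 -> R2) : Defs.isometry f ->
  exists g, [/\ Defs.isometry g, cancel f g & cancel g f].
Proof.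
move=> /isometry_affine[m [t [om ->]]].
have [h1 h2 h3] := om.
have [h1' h2' h3'] := orthogonal2_inv om; rewrite !mxE in h1' h2' h3'.
exists (affine_map m^T (- (m 0 0 * t.1 + m 1 0 * t.2), - (m 0 1 * t.1 + m 1 1 * t.2))).
split; first by apply: orthogonal2_affine_isometry; exact: orthogonal2_inv.
- move=> [x y]; rewrite /affine_map /= !mxE; congr pair.
  + transitivity (x * (m 0 0 ^+ 2 + m 1 0 ^+ 2) + y * (m 0 0 * m 0 1 + m 1 0 * m 1 1)); first by ring.
    by rewrite h1 h3; ring.
  + transitivity (y * (m 0 1 ^+ 2 + m 1 1 ^+ 2) + x * (m 0 0 * m 0 1 + m 1 0 * m 1 1)); first by ring.
    by rewrite h2 h3; ring.
- move=> [x y]; rewrite /affine_map /= !mxE; congr pair.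
  + transitivity ((x - t.1) * (m 0 0 ^+ 2 + m 0 1 ^+ 2) + (y - t.2) * (m 0 0 * m 1 0 + m 0 1 * m 1 1) + t.1); first by ring.
    by rewrite h1' h3'; ring.
  + transitivity ((y - t.2) * (m 1 0 ^+ 2 + m 1 1 ^+ 2) + (x - t.1) * (m 0 0 * m 1 0 + m 0 1 * m 1 1) + t.2); first by ring.
    by rewrite h2' h3'; ring.
Qed.

Lemma isometry_continuous (f : R2 -> R2) : Defs.isometry f -> continuous f.
Proof.
move=> /isometry_affine[m [t [_ ->]]] x.
have c1 : {for x, continuous (fun z : R2 => z.1)} by exact: cvg_fst.
have c2 : {for x, continuous (fun z : R2 => z.2)} by exact: cvg_snd.
apply: (@cvg_pair _ _ _ _ (nbhs (m 0 0 * x.1 + m 0 1 * x.2 + t.1)) (nbhs (m 1 0 * x.1 + m 1 1 * x.2 + t.2))).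
  apply: cvgD; last exact: cvg_cst.
  by apply: cvgD; apply: cvgMr.
apply: cvgD; last exact: cvg_cst.
by apply: cvgD; apply: cvgMr.
Qed.

End Isometry.

(** * Measure-preserving maps of the plane *)

Section Measure.
Variable R : realType.
Local Notation mR := (measurableTypeR R).
Local Notation R2 := (R * R)%type.
Local Notation leb1 := (@lebesgue_measure R).
Local Notation mu := (@leb2 R).

Definition mpres (f : mR * mR -> mR * mR) : Prop :=
  measurable_fun setT f /\
  forall A, measurable A -> mu (f @^-1` A) = mu A.

Lemma mpres_comp f g : mpres f -> mpres g -> mpres (f \o g).
Proof.
move=> [mf pf] [mg pg]; split; first exact: measurableT_comp.
move=> A mA; rewrite comp_preimage pg ?pf //.
by rewrite -[X in measurable X]setTI; exact: mf.
Qed.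

Lemma leb1_shift (a : R) (A : set mR) : measurable A ->
  leb1 ((fun x : mR => x + a : mR) @^-1` A) = leb1 A.
Proof.
move=> mA.
have mf : measurable_fun setT (fun x : mR => x + a : mR).
  exact: measurable_funD.
rewrite -[LHS]/(pushforward leb1 (fun x : mR => x + a : mR) A).
apply/esym/lebesgue_measure_unique => //= _ [[b c]] _ <-.
rewrite /pushforward.
have -> : (fun x : R => x + a) @^-1` `]b, c]%classic = `](b - a), (c - a)]%classic.
  by apply/seteqP; split => x /=; rewrite !in_itv /= ltrBlDr lerBrDr.
rewrite !lebesgue_measure_itv /= !lte_fin ltrD2r.
by rewrite -!EFinB opprB addrA subrK.
Qed.

(** Cavalieri's principle for maps that move points along horizontal lines and preserve length on
    each of them. *)
Lemma mpres_fiber1 (p : R -> R -> R) :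
  measurable_fun [set: mR * mR] (fun z : mR * mR => p z.2 z.1 : mR) ->
  (forall y (A : set mR), measurable A -> leb1 (p y @^-1` A) = leb1 A) ->
  mpres (fun z => (p z.2 z.1, z.2)).
Proof.
move=> mp pp.
have mf : measurable_fun [set: mR * mR] (fun z : mR * mR => (p z.2 z.1, z.2) : mR * mR).
  exact: measurable_fun_pair.
split => // A mA.
have mfA : measurable ((fun z : mR * mR => (p z.2 z.1, z.2) : mR * mR) @^-1` A).
  by rewrite -[X in measurable X]setTI; exact: mf.
(* [leb2] integrates the lengths of vertical sections; by uniqueness of the product measure it can
   be computed from horizontal ones as well. *)
have E2 B : measurable B -> mu B = (leb1 \x^ leb1)%E B.
  move=> mB; apply: product_measure_unique => //= C D mC mD.
  by rewrite product_measure2E.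
rewrite !E2 // /product_measure2 /=.
apply: eq_integral => y _ /=.
by rewrite -[RHS](pp y) //; exact: measurable_ysection.
Qed.

Lemma mpres_fiber2 (p : R -> R -> R) :
  measurable_fun [set: mR * mR] (fun z : mR * mR => p z.1 z.2 : mR) ->
  (forall y (A : set mR), measurable A -> leb1 (p y @^-1` A) = leb1 A) ->
  mpres (fun z => (z.1, p z.1 z.2)).
Proof.
move=> mp pp.
have mf : measurable_fun [set: mR * mR] (fun z : mR * mR => (z.1, p z.1 z.2) : mR * mR).
  exact: measurable_fun_pair.
split => // A mA.
have mfA : measurable ((fun z : mR * mR => (z.1, p z.1 z.2) : mR * mR) @^-1` A).
  by rewrite -[X in measurable X]setTI; exact: mf.
rewrite /leb2 /= /product_measure1 /=.
apply: eq_integral => y _ /=.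
by rewrite -[RHS](pp y) //; exact: measurable_xsection.
Qed.

Lemma mpres_shear1 (a b : R) : mpres (fun z => (z.1 + (a * z.2 + b), z.2)).
Proof.
apply: (@mpres_fiber1 (fun y x => x + (a * y + b))) => [|y A].
  apply: measurable_funD => //; apply: measurable_funD => //.
  exact: measurable_funM.
exact: leb1_shift.
Qed.

Lemma mpres_shear2 (a b : R) : mpres (fun z => (z.1, z.2 + (a * z.1 + b))).
Proof.
apply: (@mpres_fiber2 (fun x y => y + (a * x + b))) => [|y A].
  apply: measurable_funD => //; apply: measurable_funD => //.
  exact: measurable_funM.
exact: leb1_shift.
Qed.

Lemma mpres_flip : mpres (fun z => (- z.1, z.2)).
Proof.
apply: (@mpres_fiber1 (fun y x => - x)) => [|y A mA].
  exact: measurableT_comp.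
exact: lebesgue_measureN.
Qed.

(** A matrix of determinant 1 is a product of shears, which preserve area; determinant -1 is reduced
    to 1 by a flip. *)
Lemma mpres_affine (a b c d s t : R) : `|a * d - b * c| = 1 ->
  mpres (fun z => (a * z.1 + b * z.2 + s, c * z.1 + d * z.2 + t)).
Proof.
have sl2 a' b' c' d' : c' != 0 -> a' * d' - b' * c' = 1 ->
    mpres (fun z => (a' * z.1 + b' * z.2, c' * z.1 + d' * z.2)).
  move=> c0 det1.
  (* Three shears with parameters u, c', v multiply to a matrix with lower left entry c' and
     diagonal 1 + u c', 1 + c' v; the determinant then fixes b'. *)
  pose u := (a' - 1) / c'; pose v := (d' - 1) / c'.
  have := mpres_comp (mpres_shear1 u 0) (mpres_comp (mpres_shear2 c' 0) (mpres_shear1 v 0)).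
  congr mpres; apply/funext => -[x y] /=.
  have -> : b' = (a' * d' - 1) / c' by rewrite -det1; field.
  by rewrite /u /v; congr pair; field.
have sl a' b' c' d' : a' * d' - b' * c' = 1 ->
    mpres (fun z => (a' * z.1 + b' * z.2, c' * z.1 + d' * z.2)).
  move=> det1; have [c0|c0] := eqVneq c' 0; last exact: sl2.
  have a0 : a' != 0.
    by apply/eqP => a0; move: det1; rewrite a0 c0 mul0r mulr0 subr0 => /eqP; rewrite eq_sym oner_eq0.
  (* For c' = 0, adding the first row to the second puts a' <> 0 in the lower left corner; a shear
     undoes this. *)
  have S : mpres (fun z => (a' * z.1 + b' * z.2, a' * z.1 + (b' + d') * z.2)).
    by apply: sl2 => //; rewrite -det1 c0; ring.
  have := mpres_comp (mpres_shear2 (-1) 0) S.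
  by congr mpres; apply/funext => -[x y] /=; rewrite c0; congr pair; ring.
move=> det1.
have L : mpres (fun z => (a * z.1 + b * z.2, c * z.1 + d * z.2)).
  have [p|n] := leP 0 (a * d - b * c).
    by apply: sl; rewrite -[LHS]ger0_norm.
  have S : mpres (fun z => ((- a) * z.1 + b * z.2, (- c) * z.1 + d * z.2)).
    apply: sl; move: det1; rewrite ltr0_norm // => <-; ring.
  have := mpres_comp S mpres_flip.
  by congr mpres; apply/funext => -[x y] /=; rewrite !mulrNN.
have := mpres_comp (mpres_shear1 0 s) (mpres_comp (mpres_shear2 0 t) L).
by congr mpres; apply/funext => -[x y] /=; rewrite !mul0r !add0r.
Qed.

Lemma mpres_ge0_integral f D (g : R2 -> \bar R) : mpres f ->
  @measurable _ (mR * mR)%type D ->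
  @measurable_fun _ _ (mR * mR)%type _ D g ->
  (forall x, D x -> (0 <= g x)%E) ->
  (\int[mu]_(x in f @^-1` D) g (f x) = \int[mu]_(x in D) g x)%E.
Proof.
move=> [mf pf] mD mg g0.
transitivity (\int[pushforward mu f]_(y in D) g y)%E.
  rewrite (ge0_integral_pushforward mf) //.
  by move=> y; rewrite inE => /g0.
by apply: eq_measure_integral => A mA _; exact: pf.
Qed.

Lemma mpres_integral f D (g : R2 -> \bar R) : mpres f ->
  @measurable _ (mR * mR)%type D ->
  @measurable_fun _ _ (mR * mR)%type _ D g ->
  (\int[mu]_(x in f @^-1` D) g (f x) = \int[mu]_(x in D) g x)%E.
Proof.
move=> pf mD mg; rewrite integralE [RHS]integralE.
have eP : (fun x => g (f x))^\+%E = g^\+%E \o f := funepos_comp g f.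
have eN : (fun x => g (f x))^\-%E = g^\-%E \o f := funeneg_comp g f.
rewrite eP eN.
congr (_ - _)%E.
  exact: (mpres_ge0_integral pf mD (measurable_funepos mg) (fun x _ => funepos_ge0 g x)).
exact: (mpres_ge0_integral pf mD (measurable_funeneg mg) (fun x _ => funeneg_ge0 g x)).
Qed.

Lemma mpres_negligible f N : mpres f -> mu.-negligible N -> mu.-negligible (f @^-1` N).
Proof.
move=> [mf pf] [A [mA A0 NA]]; exists (f @^-1` A); split.
- by rewrite -[X in measurable X]setTI; exact: mf.
- by rewrite -A0; exact: pf.
- by move=> x /NA.
Qed.

End Measure.

(** * Boxes, open sets and null lines *)

Section Boxes.
Variable R : realType.
Local Notation mR := (measurableTypeR R).
Local Notation R2 := (R * R)%type.
Local Notation mu := (@leb2 R).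

Definition box (q : R * R * R * R) : set R2 :=
  [set z | q.1.1.1 < z.1 < q.1.1.2 /\ q.1.2 < z.2 < q.2].

Lemma open_bigcup_box (U : set R2) : open U ->
  exists F : nat -> R * R * R * R, U = \bigcup_n box (F n).
Proof.
move=> oU.
pose rq (q : rat * rat * rat * rat) : R * R * R * R :=
  (ratr q.1.1.1, ratr q.1.1.2, ratr q.1.2, ratr q.2).
(* Numbers that encode no rational box inside U are sent to the empty box [(0, 0, 0, 0)]. *)
pose F n := if unpickle n is Some q then
  if `[< box (rq q) `<=` U >] then rq q else (0, 0, 0, 0) else (0, 0, 0, 0).
exists F; apply/seteqP; split=> [x Ux|x [n _]]; last first.
  have box0 : ~ box (0, 0, 0, 0) x.
    by rewrite /box /= => -[/andP[h1 h2]]; have := lt_trans h1 h2; rewrite ltxx.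
  rewrite /F; case: unpickle => // q; case: asboolP => // + h; exact.
have [e /= e0 he] : exists2 e : R, 0 < e & ball x e `<=` U.
  by apply/nbhs_ballP; exact: open_nbhs_nbhs.
have rt (a b : R) : a < b -> exists q : rat, a < ratr q < b.
  by move=> /rat_in_itvoo[q]; rewrite in_itv /=; exists q.
have [a /andP[a1 a2]] := rt (x.1 - e) x.1 ltac:(by rewrite ltrBlDr ltrDl).
have [b /andP[b1 b2]] := rt x.1 (x.1 + e) ltac:(by rewrite ltrDl).
have [c /andP[c1 c2]] := rt (x.2 - e) x.2 ltac:(by rewrite ltrBlDr ltrDl).
have [d /andP[d1 d2]] := rt x.2 (x.2 + e) ltac:(by rewrite ltrDl).
exists (pickle (a, b, c, d)) => //.
rewrite /F pickleK; case: asboolP => [_|[]].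
  by split; rewrite /= ?a2 ?b1 ?c2 ?d1.
move=> z [/andP[/= h1 h2] /andP[/= h3 h4]]; apply: he.
by split; rewrite /= /ball /= ltr_distlC; apply/andP; split; lra.
Qed.

Lemma measurable_box q : @measurable _ (mR * mR)%type (box q).
Proof.
have -> : box q = `]q.1.1.1, q.1.1.2[%classic `*` `]q.1.2, q.2[%classic.
  by apply/seteqP; split=> z; rewrite /box /= !in_itv /=.
by apply: measurableX; exact: measurable_itv.
Qed.

(** The measurable sets of the plane are generated by rectangles, so an open set is first written as
    a countable union of boxes. *)
Lemma open_measurable2 (U : set R2) : open U -> @measurable _ (mR * mR)%type U.
Proof.
move=> /open_bigcup_box[F ->]; apply: bigcupT_measurable => n.
exact: measurable_box.
Qed.

Lemma continuous_measurable2 (f : R2 -> R) : continuous f ->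
  @measurable_fun _ _ (mR * mR)%type mR setT f.
Proof.
move=> cf; apply: (measurability _ (RGenOpens.measurableE R)) => //.
move=> _ [_ [a [b ->]] <-]; rewrite setTI.
apply: open_measurable2; by apply: open_comp (interval_open _ _) => // x _; exact: cf.
Qed.

(** If b <> 0, every vertical section is a single point; otherwise the coordinates are exchanged by
    a measure-preserving map. *)
Lemma line_negligible (a b c : R) : (a != 0) || (b != 0) ->
  mu.-negligible [set z | a * z.1 + b * z.2 = c].
Proof.
wlog b0 : a b / b != 0 => [h ab|_].
  have [b0|] := eqVneq b 0; last by move=> b0; apply: h => //; rewrite b0 orbT.
  have a0 : a != 0 by move: ab; rewrite b0 eqxx orbF.
  have sw : mpres (fun z : R2 => (0 * z.1 + 1 * z.2 + 0, 1 * z.1 + 0 * z.2 + 0)).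
    by apply: mpres_affine; rewrite mul0r mul1r sub0r normrN normr1.
  have := mpres_negligible sw (h b a a0 _).
  rewrite a0 orbT => /(_ isT); congr negligible.
  by apply/seteqP; split=> z /=; rewrite !mul0r !mul1r !addr0 add0r addrC.
have mf : @measurable_fun _ _ (mR * mR)%type mR setT (fun z => a * z.1 + b * z.2).
  by apply: measurable_funD; apply: measurable_funM.
have mS : @measurable _ (mR * mR)%type [set z | a * z.1 + b * z.2 = c].
  by rewrite -[X in measurable X]setTI; exact: (mf measurableT [set c] (measurable_set1 c)).
exists [set z | a * z.1 + b * z.2 = c]; split => //.
rewrite /leb2 /= /product_measure1 /=.
rewrite (eq_integral (cst 0%E)) ?integral0 // => x _ /=.
rewrite (_ : xsection _ _ = [set (c - a * x) / b]) ?lebesgue_measure_set1 //.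
apply/seteqP; split=> y; rewrite /xsection /= ?inE /=.
  by move=> <-; field.
by move=> ->; field.
Qed.

End Boxes.

(** * Smooth cutoff functions *)

Section Flat.
Variable R : realType.

(* The derivatives of [exp (- 1 / x)] on the positive half line all have this form. *)
Definition flat (p : {poly R}) (x : R) : R :=
  if 0 < x then p.[x^-1] * expR (- x^-1) else 0.

(** With y = 1/x >= 1, the bound exp y >= y^(d+2) / (d+2)! beats |p.[y]| <= A y^d by two powers. The
    factor x^2 that remains makes the derivative at 0 vanish. *)
Lemma flat_bound p : exists2 C : R, 0 <= C &
  forall x, 0 < x <= 1 -> `|flat p x| <= C * x ^+ 2.
Proof.
pose A : R := \sum_(i < size p) `|p`_i|; pose d := size p.
have A0 : 0 <= A by exact: sumr_ge0.
exists (A * (d.+2)`!%:R); first by rewrite mulr_ge0.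
move=> x /andP[x0 x1]; rewrite /flat x0.
set y := x^-1.
have y0 : 0 < y by rewrite invr_gt0.
have y1 : 1 <= y by rewrite invf_ge1.
have hp : `|p.[y]| <= A * y ^+ d.
  rewrite horner_coef (le_trans (ler_norm_sum _ _ _)) // /A mulr_suml.
  apply: ler_sum => i _; rewrite normrM ler_wpM2l // ger0_norm; last by rewrite exprn_ge0 // ltW.
  by rewrite ler_weXn2l // ltnW.
have he : expR (- y) <= (d.+2)`!%:R / y ^+ d.+2.
  rewrite expRN -[leRHS]invrK invf_div lef_pV2 ?posrE ?expR_gt0 ?divr_gt0 ?exprn_gt0 ?ltr0n ?fact_gt0 //.
  by apply: (le_trans _ (expR_ge1Dxn d.+1 (ltW y0))); rewrite lerDr.
rewrite normrM (ger0_norm (expR_ge0 _)).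
apply: (le_trans (ler_pM _ _ hp he)); rewrite ?expR_ge0 //.
rewrite le_eqVlt; apply/orP; left; apply/eqP.
rewrite (_ : x = y^-1); last by rewrite invrK.
rewrite (_ : y ^+ d.+2 = y ^+ d * y ^+ 2); last by rewrite -exprD addn2.
by field; rewrite expf_neq0 gt_eqF.
Qed.

(** For x > 0 the derivative of p(1/x) exp(-1/x) is x^-2 (p - p')(1/x) exp(-1/x), so the family
    [flat] is closed under differentiation. *)
Definition flat' p := 'X^2 * (p - p^`()) : {poly R}.

Lemma is_derive_flat p (x : R) : is_derive x 1 (flat p) (flat (flat' p) x).
Proof.
case: (ltgtP 0 x) => [x0|x0|<-].
- rewrite {2}/flat x0.
  have dV : is_derive x 1 (fun y : R => y^-1) (- x ^- 2).
    have := @is_deriveV R id x 1 1 (lt0r_neq0 x0) (is_derive_id _ _).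
    by move/is_derive_eq; apply; rewrite scaler1.
  have d1 : is_derive x 1 (horner p \o (fun y : R => y^-1)) (p^`().[x^-1] * - x ^- 2).
    by apply: is_derive1_comp; rewrite ?derivE.
  have dN : is_derive x 1 (fun y : R => - y^-1) (x ^- 2).
    by rewrite -[x ^- 2]opprK; exact: is_deriveN.
  have d2 : is_derive x 1 (expR \o (fun y : R => - y^-1)) (expR (- x^-1) * x ^- 2).
    exact: is_derive1_comp.
  have d3 := is_deriveM d1 d2.
  apply: (near_eq_is_derive _ (is_derive_eq d3 _)).
    near=> y; rewrite /flat ifT //; near: y; exact: lt_nbhsr.
  rewrite /flat' !hornerE /= /GRing.scale /= exprVn; ring.
- rewrite {2}/flat ltNge (ltW x0) /=.
  apply: (near_eq_is_derive _ (is_derive_cst 0 _ _)).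
  near=> y; rewrite /flat ifF //; apply/negbTE; rewrite -leNgt ltW //.
  near: y; exact: lt_nbhsl.
- rewrite {2}/flat ltxx.
  have [C C0 hC] := flat_bound p.
  have L : (fun h : R => h^-1 *: ((flat p \o shift 0) (h *: 1) - flat p 0)) @ 0^' --> (0 : R).
    apply/cvgrPdist_le => e e0; near=> h.
    have h0 : h != 0 by near: h; exact: nbhs_dnbhs_neq.
    rewrite /= sub0r normrN addr0 [h *: 1]mulr1 {2}/flat ltxx subr0.
    rewrite /GRing.scale /= normrM.
    have [hp|hn] := ltP 0 h; last by rewrite /flat ltNge hn /= normr0 mulr0 ltW.
    have h1 : `|h| <= 1 by near: h; apply: dnbhs0_le.
    have he : `|h| <= e / (C + 1) by near: h; apply: dnbhs0_le; rewrite divr_gt0 // ltr_wpDl.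
    rewrite gtr0_norm // in h1 he.
    rewrite (@ger0_norm _ h^-1) ?invr_ge0 ?(ltW hp) //.
    apply: (@le_trans _ _ (h^-1 * (C * h ^+ 2))).
      by rewrite ler_wpM2l ?invr_ge0 ?(ltW hp) //; apply: hC; rewrite hp /=.
    rewrite (_ : h^-1 * _ = C * h); last by field.
    apply: (@le_trans _ _ ((C + 1) * h)); first by rewrite ler_wpM2r ?lerDl // ltW.
    by rewrite mulrC -ler_pdivlMr // ltr_wpDl.
  by apply: DeriveDef; [apply/cvg_ex; exists 0|exact: cvg_lim].
Unshelve. all: by end_near. Qed.

Lemma continuous_flat p : continuous (flat p).
Proof.
move=> x; apply: differentiable_continuous; apply/derivable1_diffP.
by have [] := is_derive_flat p x.
Qed.

Lemma flat1_le : {homo flat 1 : x y / x <= y}.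
Proof.
move=> x y xy; rewrite /flat !hornerE; case: ifP => [x0|_]; last first.
  by case: ifP => // _; rewrite !mul1r expR_ge0.
by rewrite (lt_le_trans x0 xy) ler_expR lerN2 lef_pV2 // posrE // (lt_le_trans x0).
Qed.

Lemma flat1_gt0 x : (0 < flat 1 x) = (0 < x).
Proof. by rewrite /flat; case: ifP; rewrite ?ltxx // hornerE mul1r expR_gt0. Qed.

(** The smooth step is built from compositions with [flat 1] alone: [step_base] decreases and
    vanishes from 2 on, so [step_base 1 - step_base s] is nonpositive up to 1 and constant from 2
    on. Smoothness then follows from [of_class_C_flat]. *)
Definition step_base (s : R) : R := flat 1 (2 - s).

Definition step (s : R) : R :=
  flat 1 (step_base 1 - step_base s) / flat 1 (step_base 1).

Definition step' (s : R) : R :=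
  flat (flat' 1) (step_base 1 - step_base s) * flat (flat' 1) (2 - s) /
  flat 1 (step_base 1).

Lemma step_base1_gt0 : 0 < step_base 1.
Proof. by rewrite /step_base flat1_gt0; lra. Qed.

Lemma is_derive_step (s : R) : is_derive s 1 step (step' s).
Proof.
have d1 : is_derive s 1 (fun s : R => 2 - s) (- 1).
  by have := is_deriveB (is_derive_cst (2 : R) s 1) (is_derive_id s 1); rewrite sub0r.
have d2 : is_derive s 1 (flat 1 \o (fun s : R => 2 - s)) (flat (flat' 1) (2 - s) * - 1).
  by apply: is_derive1_comp => //; exact: is_derive_flat.
have d3 := is_deriveB (is_derive_cst (step_base 1) s 1) d2.
have d4 := is_derive1_comp (is_derive_flat 1 _) d3.
have d5 := is_deriveM d4 (is_derive_cst ((flat 1 (step_base 1))^-1) s 1).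
move/is_derive_eq: d5; apply.
by rewrite /step' /GRing.scale /= /step_base mulr0 add0r; ring.
Qed.

Lemma step_eq0 s : s <= 1 -> step s = 0.
Proof.
move=> s1; rewrite /step {1}/flat ifF ?mul0r //; apply/negbTE.
by rewrite -leNgt subr_le0; apply: flat1_le; lra.
Qed.

Lemma step_eq1 s : 2 <= s -> step s = 1.
Proof.
move=> s2; rewrite /step (_ : step_base s = 0) ?subr0 ?divff //.
  by rewrite gt_eqF // flat1_gt0 step_base1_gt0.
by rewrite /step_base /flat ifF //; apply/negbTE; rewrite -leNgt; lra.
Qed.

Lemma step_itv s : 0 <= step s <= 1.
Proof.
have c0 : 0 < flat 1 (step_base 1) by rewrite flat1_gt0 step_base1_gt0.
have h x : 0 <= flat 1 x by rewrite /flat; case: ifP => // _; rewrite hornerE mul1r expR_ge0.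
rewrite /step divr_ge0 ?(ltW c0) //= ler_pdivrMr // mul1r; apply: flat1_le.
by rewrite lerBlDr lerDl; exact: h.
Qed.

Lemma step'_eq0 s : (s < 1) || (2 < s) -> step' s = 0.
Proof.
move=> h; have [_ <-] := is_derive_step s.
have /near_eq_derive -> : \forall t \near s, step t = cst (step s) t.
  case/orP: h => h; near=> t.
    rewrite /cst !step_eq0 // ?ltW //; near: t; exact: lt_nbhsl.
  rewrite /cst !step_eq1 // ?ltW //; near: t; exact: lt_nbhsr.
exact: derive_cst.
Unshelve. all: by end_near. Qed.

Lemma continuous_step' : continuous step'.
Proof.
have c2 : continuous (fun s : R => 2 - s).
  by move=> s; apply: cvgB; [exact: cvg_cst|exact: cvg_id].
have cf p : continuous (flat p \o (fun s : R => 2 - s)).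
  by move=> s; apply: continuous_comp; [exact: c2|exact: continuous_flat].
have cb : continuous (fun s : R => step_base 1 - step_base s).
  by move=> s; apply: cvgB; [exact: cvg_cst|exact: cf].
have cb' p : continuous (flat p \o (fun s : R => step_base 1 - step_base s)).
  by move=> s; apply: continuous_comp; [exact: cb|exact: continuous_flat].
by move=> s; apply: cvgMl; apply: cvgM; [exact: cb'|exact: cf].
Qed.

(** Taken at (n + 1) s, this bounds s * stepn' n s uniformly in n; dominated convergence near a side
    depends on it. *)
Lemma step'_bound : exists2 M, 0 <= M & forall s, `|s * step' s| <= M.
Proof.
have c : {within `[1, 2], continuous (fun s => `|s * step' s|)}.
  apply: continuous_subspaceT => s; apply: cvg_norm.
  by apply: cvgM; [exact: cvg_id|exact: continuous_step'].
have [t _ ht] := EVT_max (ler1n _ 2) c.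
exists `|t * step' t| => // s.
have [s1|s1] := ltP s 1; first by rewrite step'_eq0 ?s1 // mulr0 normr0.
have [s2|s2] := ltP 2 s; first by rewrite (@step'_eq0 s) ?s2 ?orbT // mulr0 normr0.
by apply: ht; rewrite in_itv /= s1 s2.
Qed.

(** Rises from 0 to 1 between 1 / (n + 1) and 2 / (n + 1). *)
Definition stepn (n : nat) (s : R) : R := step (n.+1%:R * s).
Definition stepn' (n : nat) (s : R) : R := n.+1%:R * step' (n.+1%:R * s).

Lemma is_derive_stepn n (s : R) : is_derive s 1 (stepn n) (stepn' n s).
Proof.
have d1 : is_derive s 1 (fun s : R => n.+1%:R * s) n.+1%:R.
  have := is_deriveZ n.+1%:R (is_derive_id s (1 : R)).
  by move/is_derive_eq; apply; rewrite /GRing.scale /= mulr1.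
by have := is_derive1_comp (is_derive_step _) d1; rewrite /stepn' mulrC.
Qed.

Lemma stepn_cvg s : 0 < s -> \forall n \near \oo, stepn n s = 1.
Proof.
move=> s0; near=> n; apply: step_eq1.
rewrite -ler_pdivrMr //; near: n; apply: filterS (nbhs_infty_ger (2 / s)) => n /le_trans; apply.
by rewrite ler_nat.
Unshelve. all: by end_near. Qed.

End Flat.

(** * Functions of class C^n on the plane *)

Section Smooth.
Variable R : realType.
Local Notation R2 := (R * R)%type.
Local Notation bv := (basis_vec R).
Local Notation D i f x := ('D_(bv i) f x).

Definition smooth (f : R2 -> R) : Prop := forall n, of_class_C n f.

Lemma of_class_C_continuous n (f : R2 -> R) : of_class_C n f -> continuous f.
Proof. by case: n => [|n] // []. Qed.

Lemma of_class_C_le n (f : R2 -> R) : of_class_C n.+1 f -> of_class_C n f.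
Proof.
elim: n f => [|n IH] f; first by case.
by case=> cf df sf; split => // i; apply: IH; exact: sf.
Qed.

Lemma of_class_C_cst n (c : R) : of_class_C n (fun _ : R2 => c).
Proof.
elim: n c => [|n IH] c /=; first exact: cst_continuous.
split=> [|i x|i]; [exact: cst_continuous|exact: derivable_cst|].
by under eq_fun do rewrite derive_cst; exact: IH.
Qed.

Lemma of_class_CD n (f g : R2 -> R) :
  of_class_C n f -> of_class_C n g -> of_class_C n (fun x => f x + g x).
Proof.
elim: n f g => [|n IH] f g /=; first by move=> cf cg x; exact: cvgD (cf x) (cg x).
move=> [cf df sf] [cg dg sg]; split=> [x|i x|i].
- exact: cvgD (cf x) (cg x).
- exact: (derivableD (df i x) (dg i x)).
- rewrite (_ : (fun x => _) = (fun x => D i f x + D i g x)); first exact: IH.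
  by apply/funext => x; rewrite -deriveD.
Qed.

Lemma of_class_CM n (f g : R2 -> R) :
  of_class_C n f -> of_class_C n g -> of_class_C n (fun x => f x * g x).
Proof.
elim: n f g => [|n IH] f g; first by move=> cf cg x; exact: cvgM (cf x) (cg x).
move=> /[dup] /of_class_C_le sf0 [cf df sf] /[dup] /of_class_C_le sg0 [cg dg sg]; split=> [x|i x|i].
- exact: cvgM (cf x) (cg x).
- exact: (derivableM (df i x) (dg i x)).
- rewrite (_ : (fun x => _) = (fun x => f x * D i g x + g x * D i f x)); last first.
    by apply/funext => x; rewrite (deriveM (df i x) (dg i x)).
  by apply: of_class_CD; apply: IH => //; [exact: sg|exact: sf].
Qed.

Lemma of_class_CN n (f : R2 -> R) : of_class_C n f -> of_class_C n (fun x => - f x).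
Proof.
move=> sf; rewrite (_ : (fun x => _) = (fun x => -1 * f x)).
  by apply: of_class_CM => //; exact: of_class_C_cst.
by apply/funext => x; rewrite mulN1r.
Qed.

(** Reduces directional derivatives to one variable, where the chain rule and the mean value theorem
    are at hand. *)
Lemma is_derive_dir (f : R2 -> R) (x v : R2) (l : R) :
  is_derive x v f l <-> is_derive (0 : R) 1 (fun t : R => f (t *: v + x)) l.
Proof.
have E : (fun h : R => h^-1 *: ((f \o shift x) (h *: v) - f x)) =
    (fun h : R => h^-1 *: (((fun t : R => f (t *: v + x)) \o shift 0) (h *: 1) -
                   (fun t : R => f (t *: v + x)) 0)).
  by apply/funext => h /=; rewrite addr0 scale0r add0r [h *: 1]mulr1.
split=> -[d <-].
  by apply: DeriveDef; rewrite /derivable /derive; [rewrite -E|rewrite E].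
by apply: DeriveDef; rewrite /derivable /derive; [rewrite E|rewrite -E].
Qed.

Lemma is_derive_comp1 (h : R -> R) (f : R2 -> R) (x v : R2) (a b : R) :
  is_derive (f x) 1 h a -> is_derive x v f b -> is_derive x v (h \o f) (a * b).
Proof.
move=> dh /is_derive_dir df; apply/is_derive_dir.
rewrite (_ : (fun t => _) = h \o (fun t : R => f (t *: v + x))) //.
by apply: is_derive1_comp; rewrite ?scale0r ?add0r.
Qed.

Lemma of_class_C_flat n p (f : R2 -> R) : of_class_C n f -> of_class_C n (flat p \o f).
Proof.
elim: n p f => [|n IH] p f.
  by move=> cf x; apply: continuous_comp; [exact: cf|exact: continuous_flat].
move=> /[dup] /of_class_C_le sf0 [cf df sf].
have d i x : is_derive x (bv i) (flat p \o f) (flat (flat' p) (f x) * D i f x).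
  by apply: is_derive_comp1; [exact: is_derive_flat|exact: derivableP].
split=> [x|i x|i].
- by apply: continuous_comp; [exact: cf|exact: continuous_flat].
- by have [] := d i x.
- rewrite (_ : (fun x => _) = (fun x => (flat (flat' p) \o f) x * D i f x)); last first.
    by apply/funext => x; have [_ ->] := d i x.
  by apply: of_class_CM; [exact: IH|exact: sf].
Qed.

Lemma of_class_C_step n (f : R2 -> R) : of_class_C n f -> of_class_C n (@step R \o f).
Proof.
move=> sf.
have -> : @step R \o f = (fun x => (flat 1 \o (fun y => step_base 1 +
    - (flat 1 \o (fun z => 2 + - f z)) y)) x * (flat 1 (step_base (1 : R)))^-1) by [].
apply: of_class_CM; last exact: of_class_C_cst.
apply: of_class_C_flat; apply: of_class_CD; first exact: of_class_C_cst.
apply: of_class_CN; apply: of_class_C_flat; apply: of_class_CD; first exact: of_class_C_cst.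
exact: of_class_CN.
Qed.

Definition affine_form (a b c : R) (x : R2) : R := a * x.1 + b * x.2 + c.

Lemma affine_form_continuous a b c : continuous (affine_form a b c).
Proof.
move=> x; apply: cvgD; last exact: cvg_cst.
apply: cvgD; apply: cvgMr; [exact: cvg_fst|exact: cvg_snd].
Qed.

Lemma is_derive_affine_form a b c (x v : R2) :
  is_derive x v (affine_form a b c) (a * v.1 + b * v.2).
Proof.
apply/is_derive_dir.
rewrite (_ : (fun t => _) = (fun t : R => (a * v.1 + b * v.2) * t + affine_form a b c x)).
  have d := is_deriveD (is_deriveZ (a * v.1 + b * v.2) (is_derive_id (0 : R) 1))
    (is_derive_cst (affine_form a b c x) (0 : R) 1).
  by apply: (is_derive_eq d); rewrite addr0 /GRing.scale /= mulr1.
by apply/funext => t; rewrite /affine_form /GRing.scale /= /GRing.scale /=; ring.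
Qed.

Lemma of_class_C_affine_form n a b c : of_class_C n (affine_form a b c).
Proof.
case: n => [|n]; first exact: affine_form_continuous.
split=> [|i x|i]; first exact: affine_form_continuous.
  by have [] := is_derive_affine_form a b c x (bv i).
rewrite (_ : (fun x => _) = (fun x => a * (bv i).1 + b * (bv i).2)); first exact: of_class_C_cst.
by apply/funext => x; have [_ ->] := is_derive_affine_form a b c x (bv i).
Qed.

Lemma MVT_any (F F' : R -> R) : (forall s : R, is_derive s 1 F (F' s)) ->
  forall a b, exists c, `|c - a| <= `|b - a| /\ F b - F a = F' c * (b - a).
Proof.
move=> dF a b.
have cF : continuous F.
  move=> s; apply: differentiable_continuous; apply/derivable1_diffP.
  by have [] := dF s.
have [ab|ba] := leP a b.
  have [c] := MVT_segment ab (fun s _ => dF s) (continuous_subspaceT cF).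
  rewrite in_itv /= => /andP[ac cb] E; exists c; split => //.
  by rewrite !ger0_norm ?subr_ge0 // lerD2r.
have [c] := MVT_segment (ltW ba) (fun s _ => dF s) (continuous_subspaceT cF).
rewrite in_itv /= => /andP[bc ca] E; exists c; split; last by lra.
by rewrite !ler0_norm ?subr_le0 ?(ltW ba) // lerN2 lerD2r.
Qed.

Lemma ord2P (i : 'I_2) : i = 0 \/ i = 1.
Proof. by case: i => -[|[|//]] p; [left|right]; exact: val_inj. Qed.

(** [of_class_C] provides partial derivatives along the axes only. The increment is taken along an
    axis-parallel path, the mean value theorem is applied to both pieces, and continuity of the
    partial derivatives moves the intermediate points to x. *)
Lemma of_class_C1_is_derive (f : R2 -> R) (x v : R2) : of_class_C 1 f ->
  is_derive x v f (v.1 * D 0 f x + v.2 * D 1 f x).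
Proof.
move=> [cf df cdf].
have dx (s t : R) : is_derive s 1 (fun s => f (s, t)) (D 0 f (s, t)).
  have /is_derive_dir d := derivableP (df 0 (s, t)).
  have dS : is_derive s 1 (fun r : R => r - s) (1 : R).
    by have := is_deriveB (is_derive_id s (1 : R)) (is_derive_cst s s (1 : R)); rewrite subr0.
  rewrite -(subrr s) in d.
  have := is_derive1_comp (g := fun r : R => r - s) d dS.
  rewrite mulr1; congr (is_derive _ _ _ _); apply/funext => r /=.
  by congr f; congr pair; rewrite /= /GRing.scale /= ?mulr1 ?mulr0 ?add0r // subrK.
have dy (s t : R) : is_derive t 1 (fun t => f (s, t)) (D 1 f (s, t)).
  have /is_derive_dir d := derivableP (df 1 (s, t)).
  have dS : is_derive t 1 (fun r : R => r - t) (1 : R).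
    by have := is_deriveB (is_derive_id t (1 : R)) (is_derive_cst t t (1 : R)); rewrite subr0.
  rewrite -(subrr t) in d.
  have := is_derive1_comp (g := fun r : R => r - t) d dS.
  rewrite mulr1; congr (is_derive _ _ _ _); apply/funext => r /=.
  by congr f; congr pair; rewrite /= /GRing.scale /= ?mulr1 ?mulr0 ?add0r // subrK.
set l := (X in is_derive _ _ _ X).
suff L : (fun h : R => h^-1 *: ((f \o shift x) (h *: v) - f x)) @ 0^' --> l.
  by apply: DeriveDef; [apply/cvg_ex; exists l|exact: cvg_lim].
apply/cvgrPdist_le => e e0.
(* Positive even for v = 0, and |h| V bounds the displacement in either coordinate. *)
pose V := `|v.1| + `|v.2| + 1.
have V0 : 0 < V by rewrite ltr_wpDl // addr_ge0.
have near0 (i : 'I_2) : exists2 d : R, 0 < d &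
    forall y, ball x d y -> `|D i f x - D i f y| <= e / V.
  have /cvgrPdist_le /(_ (e / V)) := cdf i x.
  by rewrite divr_gt0 // => /(_ isT) /nbhs_ballP[d d0 hd]; exists d.
have [a a0 ha] := near0 0; have [b b0 hb] := near0 1.
near=> h.
have h0 : h != 0 by near: h; exact: nbhs_dnbhs_neq.
have hlt : `|h| < Num.min a b / V by near: h; apply: dnbhs0_lt; rewrite divr_gt0 // lt_min a0 b0.
rewrite ltr_pdivlMr // lt_min in hlt; case/andP: hlt => hla hlb.
have hv1 : `|h * v.1| <= `|h| * V by rewrite normrM ler_wpM2l // /V -addrA lerDl addr_ge0.
have hv2 : `|h * v.2| <= `|h| * V.
  by rewrite normrM ler_wpM2l // /V addrC addrA lerDr addr_ge0.
have [c1 [hc1 e1]] := MVT_any (dx^~ (h * v.2 + x.2)) x.1 (h * v.1 + x.1).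
have [c2 [hc2 e2]] := MVT_any (dy x.1) x.2 (h * v.2 + x.2).
rewrite addrK in hc1 e1; rewrite addrK in hc2 e2.
have -> : h^-1 *: ((f \o shift x) (h *: v) - f x) =
    v.1 * D 0 f (c1, h * v.2 + x.2) + v.2 * D 1 f (x.1, c2).
  transitivity (h^-1 * ((f (h * v.1 + x.1, h * v.2 + x.2) - f (x.1, h * v.2 + x.2)) +
     (f (x.1, h * v.2 + x.2) - f (x.1, x.2)))).
    by rewrite addrA subrK -surjective_pairing.
  by rewrite e1 e2; field.
have {}ha : `|D 0 f x - D 0 f (c1, h * v.2 + x.2)| <= e / V.
  apply: ha; split; rewrite /ball /=; rewrite distrC.
    by apply: le_lt_trans hc1 _; apply: le_lt_trans hv1 _.
  by rewrite addrK; apply: le_lt_trans hv2 _.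
have {}hb : `|D 1 f x - D 1 f (x.1, c2)| <= e / V.
  apply: hb; split; rewrite /ball /=; rewrite distrC ?subrr ?normr0 //.
  by apply: le_lt_trans hc2 _; apply: le_lt_trans hv2 _.
rewrite /l (_ : _ - _ = v.1 * (D 0 f x - D 0 f (c1, h * v.2 + x.2)) +
   v.2 * (D 1 f x - D 1 f (x.1, c2))); last by ring.
apply: le_trans (ler_normD _ _) _; rewrite !normrM.
apply: (@le_trans _ _ (`|v.1| * (e / V) + `|v.2| * (e / V))).
  by rewrite lerD // ler_wpM2l.
rewrite -mulrDl mulrCA ler_piMr ?(ltW e0) // ler_pdivrMr // mul1r.
by rewrite /V lerDl.
Unshelve. all: by end_near. Qed.

Lemma is_derive_affine_comp (f : R2 -> R) m t i x : of_class_C 1 f ->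
  is_derive x (bv i) (f \o affine_map m t)
   (m 0 i * D 0 f (affine_map m t x) + m 1 i * D 1 f (affine_map m t x)).
Proof.
move=> sf; apply/is_derive_dir.
have /is_derive_dir := of_class_C1_is_derive (affine_map m t x) (m 0 i, m 1 i) sf.
congr (is_derive _ _ _ _); apply/funext => h /=; congr f; rewrite /affine_map /=.
apply: injective_projections; rewrite /= /GRing.scale /=.
  by case: (ord2P i) => ->; rewrite /=; ring.
by case: (ord2P i) => ->; rewrite /=; ring.
Qed.

Lemma affine_map_continuous m t : continuous (affine_map m t : R2 -> R2).
Proof.
move=> x; apply: (@cvg_pair _ _ _ _ (nbhs (affine_map m t x).1) (nbhs (affine_map m t x).2)).
  exact: (@affine_form_continuous (m 0 0) (m 0 1) t.1).
exact: (@affine_form_continuous (m 1 0) (m 1 1) t.2).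
Qed.

Lemma of_class_C_affine_comp n (f : R2 -> R) m t :
  of_class_C n f -> of_class_C n (f \o affine_map m t).
Proof.
elim: n f => [|n IH] f.
  by move=> cf x; apply: continuous_comp; [exact: affine_map_continuous|exact: cf].
move=> sf; have sf1 : of_class_C 1 f.
  by elim: n sf {IH} => // n IH /of_class_C_le.
case: sf => cf df sf; split=> [x|i x|i].
- by apply: continuous_comp; [exact: affine_map_continuous|exact: cf].
- by have [] := is_derive_affine_comp m t i x sf1.
rewrite (_ : (fun x => _) = (fun x => m 0 i * ('D_(bv 0) f \o affine_map m t) x +
    m 1 i * ('D_(bv 1) f \o affine_map m t) x)); last first.
  by apply/funext => x; have [_ ->] := is_derive_affine_comp m t i x sf1.
by apply: of_class_CD; (apply: of_class_CM; [exact: of_class_C_cst|apply: IH; exact: sf]).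
Qed.

End Smooth.

(** * Barycentric coordinates *)

Section Triangle.
Variable R : realType.
Local Notation R2 := (R * R)%type.

Lemma ord3P (i : 'I_3) : [\/ i = 0, i = 1 | i = 2%:R].
Proof.
by case: i => -[|[|[|//]]] p; [apply: Or31|apply: Or32|apply: Or33]; exact: val_inj.
Qed.

Lemma sum3 (V : nmodType) (F : 'I_3 -> V) : \sum_i F i = F 0 + F 1 + F 2%:R.
Proof.
rewrite !big_ord_recl big_ord0 addr0 -addrA.
by congr (_ + (_ + _)); congr F; exact: val_inj.
Qed.

Lemma ord3_succ (i : 'I_3) :
  [/\ (0 + 1 = 1 :> 'I_3), (0 + 2 = 2%:R :> 'I_3), (1 + 1 = 2%:R :> 'I_3),
      (1 + 2 = 0 :> 'I_3) & (2%:R + 1 = 0 :> 'I_3) /\ (2%:R + 2 = 1 :> 'I_3)].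
Proof. by split; [..|split]; exact: val_inj. Qed.

Section Barycentric.
Variable P : 'I_3 -> R2.
Hypothesis aiP : affinely_independent P.

Definition cross (u v : R2) : R := u.1 * v.2 - u.2 * v.1.

(** Twice the signed area of the triangle. *)
Definition tri_det : R := cross (P 1 - P 0) (P 2%:R - P 0).

(** If the determinant of the edge vectors u, v were 0, the combinations v.1 u - u.1 v and v.2 u -
    u.2 v would vanish; by independence all coordinates of u and v are then 0, and 1 u + 0 v = 0 is
    a contradiction. *)
Lemma tri_det_neq0 : tri_det != 0.
Proof.
apply/eqP => D0.
pose u := P 1 - P 0; pose v := P 2%:R - P 0.
have H a b : a * u.1 + b * v.1 = 0 -> a * u.2 + b * v.2 = 0 -> a = 0 /\ b = 0.
  move=> h1 h2; pose l (i : 'I_3) : R := if i == 0 then - a - b else if i == 1 then a else b.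
  have l1 : \sum_i l i = 0 by rewrite sum3 /l /=; ring.
  have l2 : \sum_i l i *: P i = 0.
    rewrite sum3 /l /=; apply: injective_projections; rewrite /= /GRing.scale /=.
      by rewrite -h1 /u /v /=; ring.
    by rewrite -h2 /u /v /=; ring.
  by split; [have := aiP l1 l2 1|have := aiP l1 l2 2%:R].
have D : u.1 * v.2 - u.2 * v.1 = 0 by [].
have [v1 u1] : v.1 = 0 /\ - u.1 = 0 by apply: H; [ring|move: D; lra].
have [v2 u2] : v.2 = 0 /\ - u.2 = 0 by apply: H; [rewrite -D; ring|ring].
have [/eqP] : (1 : R) = 0 /\ (0 : R) = 0.
  by apply: H; rewrite ?v1 ?v2 ?mulr0 ?mul0r ?addr0 ?mul1r; lra.
by rewrite oner_eq0.
Qed.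

Definition tri_edge (j : 'I_3) : R2 := P (j + 2) - P (j + 1).

(** The j-th edge turned by a right angle, over twice the area: a normal of the j-th side pointing
    towards [P j]. *)
Definition lam_grad (j : 'I_3) : R2 := (- (tri_edge j).2 / tri_det, (tri_edge j).1 / tri_det).

(** The barycentric coordinate at [P j], with the constant chosen to make it vanish at [P (j + 1)].
    As an [affine_form] it is smooth with constant gradient. *)
Definition lam (j : 'I_3) : R2 -> R :=
  affine_form (lam_grad j).1 (lam_grad j).2
    (- ((lam_grad j).1 * (P (j + 1)).1 + (lam_grad j).2 * (P (j + 1)).2)).

Lemma sum_lam x : \sum_j lam j x = 1.
Proof.
have [e1 e2 e3 e4 [e5 e6]] := ord3_succ 0.
have := tri_det_neq0; rewrite sum3 /lam /affine_form /lam_grad /tri_edge !(e1, e2, e3, e4, e5, e6) /tri_det /cross /=.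
by move=> D0; field.
Qed.

Lemma lam_sum x : x = \sum_j lam j x *: P j.
Proof.
have [e1 e2 e3 e4 [e5 e6]] := ord3_succ 0.
have := tri_det_neq0; rewrite sum3 /lam /affine_form /lam_grad /tri_edge !(e1, e2, e3, e4, e5, e6) /tri_det /cross /=.
by move=> D0; apply: injective_projections; rewrite /= /GRing.scale /=; field.
Qed.

Lemma lam_vertex i j : lam i (P j) = (i == j)%:R.
Proof.
have [e1 e2 e3 e4 [e5 e6]] := ord3_succ 0.
have := tri_det_neq0; rewrite /lam /affine_form /lam_grad /tri_edge.
case: (ord3P i) => ->; rewrite !(e1, e2, e3, e4, e5, e6); case: (ord3P j) => ->;
  rewrite /tri_det /cross /= => D0; by field.
Qed.

Lemma lam_comb i (l : 'I_3 -> R) : \sum_j l j = 1 -> lam i (\sum_j l j *: P j) = l i.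
Proof.
move=> l1.
have -> : lam i (\sum_j l j *: P j) = \sum_j l j * lam i (P j).
  move: l1; rewrite !sum3 /lam /affine_form /= /GRing.scale /= => l1.
  set c := - _; rewrite -[X in _ + X = _]mulr1 -l1; ring.
under eq_bigr do rewrite lam_vertex.
by rewrite (bigD1 i) //= eqxx mulr1 big1 ?addr0 // => j; rewrite eq_sym => /negbTE ->; rewrite mulr0.
Qed.

Lemma lam_segment i (e : R) x y :
  lam i ((1 - e) *: x + e *: y) = (1 - e) * lam i x + e * lam i y.
Proof.
rewrite /lam /affine_form; move: (lam_grad i) (P (i + 1)) => g A.
by rewrite /= /GRing.scale /=; ring.
Qed.

Lemma triangleE : triangle P = [set x | forall j, 0 < lam j x].
Proof.
apply/seteqP; split=> x.
  by case=> l [l0 l1 ->] j; rewrite lam_comb.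
by move=> h; exists (lam^~ x); split => //; [exact: sum_lam|exact: lam_sum].
Qed.

Lemma lam_continuous j : continuous (lam j).
Proof. exact: affine_form_continuous. Qed.

Lemma triangle_open : open (triangle P).
Proof.
have -> : triangle P = [set x | 0 < lam 0 x] `&` [set x | 0 < lam 1 x] `&` [set x | 0 < lam 2%:R x].
  rewrite triangleE; apply/seteqP; split=> x; first by move=> h; split; [split|]; exact: h.
  by move=> [[h0 h1] h2] j; case: (ord3P j) => ->.
have o j : open [set x | 0 < lam j x].
  by apply: (@open_comp _ _ (lam j) [set t | 0 < t]) => [x _|]; [exact: lam_continuous|exact: open_gt].
by apply: openI => //; exact: openI.
Qed.

Definition tri_cl : set R2 := [set x | forall j, 0 <= lam j x].

Lemma tri_cl_closed : closed tri_cl.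
Proof.
have -> : tri_cl = [set x | 0 <= lam 0 x] `&` [set x | 0 <= lam 1 x] `&` [set x | 0 <= lam 2%:R x].
  apply/seteqP; split=> x; first by move=> h; split; [split|]; exact: h.
  by move=> [[h0 h1] h2] j; case: (ord3P j) => ->.
have o j : closed [set x | 0 <= lam j x].
  by apply: (@closed_comp _ _ (lam j) [set t | 0 <= t]) => [x _|]; [exact: lam_continuous|exact: closed_ge].
by apply: closedI => //; exact: closedI.
Qed.

Lemma sub_tri_cl : triangle P `<=` tri_cl.
Proof. by move=> x; rewrite triangleE => h j; exact: ltW. Qed.

Lemma lam_le1 x j : tri_cl x -> lam j x <= 1.
Proof.
move=> h; rewrite -(sum_lam x) (bigD1 j) //= lerDl; exact: sumr_ge0.
Qed.

Definition tri_bound : R := \sum_j (`|(P j).1| + `|(P j).2|).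

Lemma tri_cl_bound x : tri_cl x -> `|x.1| <= tri_bound /\ `|x.2| <= tri_bound.
Proof.
move=> h; rewrite (lam_sum x) /tri_bound !sum3 /= /GRing.scale /=.
have l j : 0 <= lam j x <= 1 by rewrite h lam_le1.
have key j (c : R) : `|lam j x * c| <= `|c|.
  by have /andP[l0 l1] := l j; rewrite normrM ger0_norm // ler_piMl.
have key1 j (c d : R) : `|lam j x * c| <= `|c| + `|d| by apply: le_trans (key _ _) _; rewrite lerDl.
have key2 j (c d : R) : `|lam j x * c| <= `|d| + `|c| by apply: le_trans (key _ _) _; rewrite lerDr.
by split; (apply: le_trans (ler_normD _ _) _; apply: lerD;
  first (apply: le_trans (ler_normD _ _) _; apply: lerD));
  first [exact: key1|exact: key2].
Qed.

Lemma compact_box2 (a b c d : R) : compact ([set x : R2 | a <= x.1 <= b /\ c <= x.2 <= d]).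
Proof.
have -> : [set x : R2 | a <= x.1 <= b /\ c <= x.2 <= d] = `[a, b]%classic `*` `[c, d]%classic.
  by apply/seteqP; split=> x /=; rewrite !in_itv.
apply: compact_setX; exact: segment_compact.
Qed.

Lemma tri_cl_compact : compact tri_cl.
Proof.
apply: subclosed_compact; [exact: tri_cl_closed|exact: (@compact_box2 (- tri_bound) tri_bound (- tri_bound) tri_bound)|].
by move=> x /tri_cl_bound[]; rewrite !ler_norml.
Qed.

Lemma side_lam j x : side P j x <-> tri_cl x /\ lam j x = 0.
Proof.
have [e1 e2 e3 e4 [e5 e6]] := ord3_succ 0.
split.
  case=> t /andP[t0 t1] ->.
  have E : (1 - t) *: P (j + 1) + t *: P (j + 2) = \sum_i (if i == j + 1 then 1 - t else if i == j + 2 then t else 0) *: P i.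
    rewrite sum3; case: (ord3P j) => ->; rewrite !(e1, e2, e3, e4, e5, e6) /= !scale0r ?addr0 ?add0r //.
    by rewrite addrC.
  rewrite E; split.
    move=> i; rewrite lam_comb; last first.
      by rewrite sum3; case: (ord3P j) => ->; rewrite !(e1, e2, e3, e4, e5, e6) /=; ring.
    by case: ifP => _; [lra|case: ifP => _; lra].
  rewrite lam_comb; last first.
    by rewrite sum3; case: (ord3P j) => ->; rewrite !(e1, e2, e3, e4, e5, e6) /=; ring.
  by case: (ord3P j) => ->; rewrite !(e1, e2, e3, e4, e5, e6).
case=> h h0; exists (lam (j + 2) x).
  by rewrite h lam_le1.
have s1 := sum_lam x; rewrite [LHS](lam_sum x); rewrite !sum3 in s1 *.
case: (ord3P j) h0 => E h0; subst j; rewrite !(e1, e2, e3, e4, e5, e6) h0 scale0r ?add0r ?addr0.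
- by rewrite (_ : 1 - _ = lam 1 x) //; lra.
- by rewrite (_ : 1 - _ = lam 2%:R x) 1?addrC //; lra.
- by rewrite (_ : 1 - _ = lam 0 x) //; lra.
Qed.

Lemma open_side_lam j x : (forall i, i != j -> 0 < lam i x) -> lam j x = 0 -> open_side P j x.
Proof.
have [e1 e2 e3 e4 [e5 e6]] := ord3_succ 0.
move=> h h0; exists (lam (j + 2) x).
  have := sum_lam x; rewrite sum3.
  case: (ord3P j) h h0 => -> h h0; rewrite !(e1, e2, e3, e4, e5, e6) h0 => s1.
  - by have := h 1 isT; have := h 2%:R isT; lra.
  - by have := h 0 isT; have := h 2%:R isT; lra.
  - by have := h 0 isT; have := h 1 isT; lra.
have s1 := sum_lam x; rewrite [LHS](lam_sum x); rewrite !sum3 in s1 *.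
case: (ord3P j) h0 => E h0; subst j; rewrite !(e1, e2, e3, e4, e5, e6) h0 scale0r ?add0r ?addr0.
- by rewrite (_ : 1 - _ = lam 1 x) //; lra.
- by rewrite (_ : 1 - _ = lam 2%:R x) 1?addrC //; lra.
- by rewrite (_ : 1 - _ = lam 0 x) //; lra.
Qed.

Lemma vertex_lam i x : (forall j, j != i -> lam j x = 0) -> x = P i.
Proof.
move=> h; have := sum_lam x; rewrite (lam_sum x) -(lam_sum x).
rewrite (bigD1 i) //= big1 ?addr0 => [hi|j /h //].
rewrite {1}(lam_sum x) (bigD1 i) //= hi scale1r big1 ?addr0 // => j /h ->.
by rewrite scale0r.
Qed.

Definition gnorm2 (j : 'I_3) : R := (lam_grad j).1 ^+ 2 + (lam_grad j).2 ^+ 2.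

Lemma lam_grad_neq0 j : ((lam_grad j).1 != 0) || ((lam_grad j).2 != 0).
Proof.
have := lam_vertex j j; have := lam_vertex j (j + 1).
rewrite eqxx (_ : (j == j + 1) = false) /lam /affine_form.
  case: eqP => // ->; case: eqP => // ->; rewrite !mul0r => h1 h2.
  by move: h2 => /eqP; rewrite !addr0 !add0r oppr0 eq_sym oner_eq0.
by case: (ord3P j) => ->.
Qed.

Lemma gnorm2_gt0 j : 0 < gnorm2 j.
Proof.
rewrite lt_neqAle addr_ge0 ?sqr_ge0 // andbT eq_sym paddr_eq0 ?sqr_ge0 // !sqrf_eq0 negb_and.
exact: lam_grad_neq0.
Qed.

(** Householder's matrix 1 - 2 g g^T / |g|^2 for g = [lam_grad j]. *)
Definition refl_mx (j : 'I_3) : 'M[R]_2 := \matrix_(a, b)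
  ((a == b)%:R - 2 / gnorm2 j * Defs.coord a (lam_grad j) * Defs.coord b (lam_grad j)).

(** The signed distance of x from the line of the side is lam j x / |g|; the reflection subtracts
    twice this distance along the unit normal g / |g|. *)
Lemma side_reflectionE j x :
  side_reflection P j x = x - (lam j x * (2 / gnorm2 j)) *: lam_grad j.
Proof.
have [e1 e2 e3 e4 [e5 e6]] := ord3_succ 0.
have D0 := tri_det_neq0; have := gnorm2_gt0 j.
rewrite /side_reflection /reflection !edotE /gnorm2 /lam /affine_form /lam_grad /tri_edge /=.
set D := tri_det; rewrite -/D in D0.
move: (P (j + 1)) (P (j + 2)) => A B /=.
have -> : (- (B.2 - A.2) / D) ^+ 2 + ((B.1 - A.1) / D) ^+ 2 =
   ((B.1 - A.1) ^+ 2 + (B.2 - A.2) ^+ 2) / D ^+ 2 by field.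
rewrite pmulr_lgt0 ?invr_gt0 ?exprn_even_gt0 // => /lt0r_neq0 n0.
have n0' : (B.1 - A.1) * (B.1 - A.1) + (B.2 - A.2) * (B.2 - A.2) != 0 by rewrite -!expr2.
by apply: injective_projections; rewrite /= /GRing.scale /=; field; rewrite ?D0 ?n0 ?n0'.
Qed.

Lemma lam_reflection j x : lam j (side_reflection P j x) = - lam j x.
Proof.
have := gnorm2_gt0 j; rewrite side_reflectionE /lam /affine_form /gnorm2.
move: (lam_grad j) (P (j + 1)) => g A /lt0r_neq0 n0; rewrite /= /GRing.scale /=.
by field.
Qed.

Lemma lam_reflection_neq i j x : lam i (side_reflection P j x) =
  lam i x - lam j x * (2 / gnorm2 j * edot (lam_grad i) (lam_grad j)).
Proof.
rewrite side_reflectionE edotE; set l := lam j x.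
by rewrite /lam /affine_form /= /GRing.scale /=; ring.
Qed.

Lemma side_reflectionK j : involutive (side_reflection P j).
Proof.
move=> x; rewrite [LHS]side_reflectionE lam_reflection side_reflectionE.
by rewrite mulNr scaleNr opprK subrK.
Qed.

Lemma side_reflection_id j x : lam j x = 0 -> side_reflection P j x = x.
Proof. by rewrite side_reflectionE => ->; rewrite mul0r scale0r subr0. Qed.

Lemma side_reflection_affine j : exists t, side_reflection P j = affine_map (refl_mx j) t.
Proof.
exists (- (- ((lam_grad j).1 * (P (j + 1)).1 + (lam_grad j).2 * (P (j + 1)).2) * (2 / gnorm2 j)) *: lam_grad j).
apply/funext => x; rewrite side_reflectionE /affine_map !mxE /Defs.coord /=.
apply: injective_projections; rewrite /= /lam /affine_form /GRing.scale /=; ring.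
Qed.

Lemma side_reflection_isometry j : Defs.isometry (side_reflection P j).
Proof.
apply/isometryP => x y; rewrite !side_reflectionE !edotE.
have := gnorm2_gt0 j; rewrite /gnorm2 /lam /affine_form.
move: (lam_grad j) (P (j + 1)) => g A /lt0r_neq0 n0; rewrite /= /GRing.scale /=.
by field.
Qed.

End Barycentric.
End Triangle.

(** * Glued domains *)

Section Gluing.
Variable R : realType.
Local Notation R2 := (R * R)%type.
Variable P : 'I_3 -> R2.

(* [p j k] is the tile glued to the k-th tile along its j-th side, and k itself
   if this side lies on the boundary. *)
Record glued_domain (tau : 'I_7 -> R2 -> R2) (p : 'I_3 -> 'I_7 -> 'I_7)
    (Omega : set R2) : Prop := GluedDomain {
  gd_isometry : forall k, Defs.isometry (tau k);
  gd_involutive : forall j, involutive (p j);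
  gd_reflection : forall j k, p j k != k -> tau (p j k) = tau k \o side_reflection P j;
  gd_disjoint : forall k l, k != l -> tile P tau k `&` tile P tau l = set0;
  gd_open : open Omega;
  gd_tile : forall k, tile P tau k `<=` Omega;
  gd_cover : Omega `<=` \bigcup_k closure (tile P tau k);
  gd_side : forall j k, p j k != k -> tau k @` open_side P j `<=` Omega;
  gd_boundary : forall j k, p j k = k -> tau k @` side P j `&` Omega = set0;
  gd_vertex : forall k i, ~ Omega (tau k (P i)) }.

Definition swap (tbl : seq (seq nat)) (j k : nat) : nat := nth 0%N (nth [::] tbl j) k.

Definition partner (tbl : seq (seq nat)) (j : 'I_3) (k : 'I_7) : 'I_7 := inord (swap tbl j k).

(** Row j gives, for each tile numbered from 0, its neighbour across the j-th side, or the tile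
    itself if that side is not shared. *)
Definition gluing_table1 : seq (seq nat) :=
  [:: [:: 1; 0; 2; 6; 4; 5; 3]; [:: 2; 4; 0; 3; 1; 5; 6]; [:: 3; 1; 5; 0; 4; 2; 6]]%N.

Definition gluing_table2 : seq (seq nat) :=
  [:: [:: 1; 0; 5; 3; 4; 2; 6]; [:: 2; 1; 0; 6; 4; 5; 3]; [:: 3; 4; 2; 0; 1; 5; 6]]%N.

Definition all3 (f : pred nat) := all f (iota 0 3).
Definition all7 (f : pred nat) := all f (iota 0 7).

(** The combinatorial input of [glued_domain], decided by computation. The last two clauses have a
    geometric purpose: every vertex of a tile lies on an unshared side of this tile or of a
    neighbour with the same vertex, and every tile is reached from tile 0 by at most two
    reflections. *)
Definition gluing_check (E : seq (nat * nat * nat)) (tbl : seq (seq nat)) : bool :=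
  let s := swap tbl in
  [&& all3 (fun j => all7 (fun k => (s j k < 7)%N && (s j (s j k) == k))),
      all3 (fun j => all7 (fun k => (s j k == k) ||
         ((k.+1, (s j k).+1, j.+1) \in E) || (((s j k).+1, k.+1, j.+1) \in E))),
      all3 (fun j => all7 (fun k => (s j k != k) ||
         all7 (fun l => ((k.+1, l.+1, j.+1) \notin E) && ((l.+1, k.+1, j.+1) \notin E)))),
      all3 (fun i => all7 (fun k => has (fun j => (j != i) &&
        ((s j k == k) || has (fun j' => (j' != i) && (s j' (s j k) == s j k)) (iota 0 3)))
           (iota 0 3)))
    & all7 (fun k => (k == 0%N) || has (fun j => (s j 0%N == k) ||
        has (fun j' => s j' (s j 0%N) == k) (iota 0 3)) (iota 0 3))].

Lemma gluing_check1 : gluing_check gluing1 gluing_table1.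
Proof. by vm_compute. Qed.

Lemma gluing_check2 : gluing_check gluing2 gluing_table2.
Proof. by vm_compute. Qed.

Lemma all3P (f : pred nat) (j : 'I_3) : all3 f -> f j.
Proof. by move=> /allP; apply; rewrite mem_iota /=. Qed.

Lemma all7P (f : pred nat) (k : 'I_7) : all7 f -> f k.
Proof. by move=> /allP; apply; rewrite mem_iota /=. Qed.

Lemma has3P (f : pred nat) : has f (iota 0 3) -> exists j : 'I_3, f j.
Proof. by move=> /hasP[j]; rewrite mem_iota /= => hj fj; exists (Ordinal hj). Qed.

Lemma warped_propeller_glued_domain E tbl (tau : 'I_7 -> R2 -> R2) :
  gluing_check E tbl -> affinely_independent P -> unfolding P E tau ->
  warped_propeller P E tau -> glued_domain tau (partner tbl) (polygon P tau).
Proof.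
move=> /and5P[c1 c2 c3 c4 c5] aiP [tau0 tauE] [disj sides sb].
have vp j k : (partner tbl j k : nat) = swap tbl j k.
  by rewrite /partner inordK //; have := all7P k (all3P j c1) => /andP[].
have inv j : involutive (partner tbl j).
  by move=> k; apply: val_inj; rewrite /= !vp; have := all7P k (all3P j c1) => /andP[_ /eqP].
have gl j k : partner tbl j k != k ->
    glued E k (partner tbl j k) j \/ glued E (partner tbl j k) k j.
  move=> nk; have := all7P k (all3P j c2); rewrite /glued !vp.
  have -> : (swap tbl j k == k) = false.
    by apply/negbTE; apply: contra nk => /eqP h; apply/eqP; apply: val_inj; rewrite /= vp.
  by rewrite orFb => /orP[]; [left|right].
have refl j k : partner tbl j k != k -> tau (partner tbl j k) = tau k \o side_reflection P j.
  move=> /gl[/tauE //|/tauE ->].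
  by apply/funext => x; rewrite /= side_reflectionK.
have isostep j k : Defs.isometry (tau k) -> Defs.isometry (tau (partner tbl j k)).
  have [->|/refl ->] := eqVneq (partner tbl j k) k; first by [].
  by move=> ik; apply: isometry_comp => //; exact: side_reflection_isometry.
have iso0 : Defs.isometry (tau 0) by rewrite tau0.
have iso k : Defs.isometry (tau k).
  have /orP[/eqP k0|/has3P[j /orP[/eqP h|/has3P[j' /eqP h]]]] := all7P k c5.
  - by rewrite (_ : k = 0) //; exact: val_inj.
  - rewrite (_ : k = partner tbl j 0); first exact: isostep.
    by apply: val_inj; rewrite /= vp -h.
  - rewrite (_ : k = partner tbl j' (partner tbl j 0)); first by apply/isostep/isostep.
    by apply: val_inj; rewrite /= !vp -h.
have tile_open k : open (tile P tau k).
  have [g [ig gK Kg]] := isometry_inverse (iso k).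
  have -> : tile P tau k = g @^-1` triangle P.
    apply/seteqP; split=> x; first by move=> [y Ty <-]; rewrite /= gK.
    by move=> /= h; exists (g x).
  apply: open_comp; last exact: triangle_open.
  by move=> x _; exact: isometry_continuous.
have oO : open (polygon P tau) by exact: open_interior.
(* An unshared side is an edge of the boundary curve, and an open set does not meet its own
   boundary. *)
have bnd j k : partner tbl j k = k -> tau k @` side P j `&` polygon P tau = set0.
  move=> pk; case: sb => v [s [_ rs sE _ bE]].
  have : range s (k, j).
    rewrite rs /shared /=; apply/existsP => -[l].
    have := all7P k (all3P j c3); rewrite -vp pk eqxx /= => /(@all7P _ l)/andP[].
    by rewrite /glued => /negbTE -> /negbTE ->.
  case=> i _ si; apply/seteqP; split=> // x [xs Ox].
  have : boundary (polygon P tau) x.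
    by rewrite bE; exists i => //; rewrite /= -sE si.
  by case=> _; case; move: oO; rewrite openE => /(_ _ Ox).
have vert0 k i : (exists2 j, j != i & partner tbl j k = k) -> ~ polygon P tau (tau k (P i)).
  case=> j ji pk Oi.
  have : (tau k @` side P j `&` polygon P tau) (tau k (P i)).
    split=> //; exists (P i) => //; apply/side_lam => //.
    by split=> [l|]; rewrite lam_vertex // (negbTE ji).
  by rewrite bnd.
split => //.
- by move=> k x tx; apply: (filterS _ (open_nbhs_nbhs (conj (tile_open k) tx))) => y ty; exists k => //; exact: subset_closure.
- by move=> x /interior_subset.
- move=> j k nk; case: (gl j k nk) => g; first exact: (sides _ _ _ g).
  move=> _ [x sx <-].
  have l0 : lam P j x = 0.
    have : side P j x by case: sx => t /andP[t0 t1] ->; exists t => //; rewrite !ltW.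
    by case/(side_lam aiP).
  apply: (sides _ _ _ g); exists x => //.
  by rewrite (refl j k nk) /= side_reflection_id.
- move=> k i.
  have /has3P[j /andP[ji h]] := all7P k (all3P i c4).
  case/orP: h => [/eqP h|/has3P[j' /andP[ji' /eqP h]]].
    by apply: vert0; exists j => //; apply: val_inj; rewrite /= vp.
  (* The reflection in side j fixes the end points of that side, so both tiles have the same vertex
     at [P i], and the neighbour has it on an unshared side. *)
  have V : ~ polygon P tau (tau (partner tbl j k) (P i)).
    by apply: vert0; exists j' => //; apply: val_inj; rewrite /= !vp.
  have [pk|nk] := eqVneq (partner tbl j k) k; first by rewrite -pk.
  move: V; rewrite (refl j k nk) /= side_reflection_id //.
  by rewrite lam_vertex //; case: (eqVneq j i) ji => // ->; rewrite eqxx.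
Qed.

Definition mixing_table : seq (seq nat) :=
  [:: [:: 0; 1; 1; 1; 0; 0; 0];
      [:: 1; 0; 1; 0; 0; 0; 1];
      [:: 1; 0; 0; 1; 1; 0; 0];
      [:: 1; 1; 0; 0; 0; 1; 0];
      [:: 0; 0; 0; 1; 0; 1; 1];
      [:: 0; 1; 0; 0; 1; 0; 1];
      [:: 0; 0; 1; 0; 1; 1; 0]]%N.

Definition real_mixing : 'M[R]_7 := \matrix_(k, l) (nth 0%N (nth [::] mixing_table k) l)%:R.

Lemma mixing_matrixE : mixing_matrix R = map_mx (real_complex R) real_mixing.
Proof. by apply/matrixP => k l; rewrite !mxE rmorph_nat. Qed.

Lemma real_mixing_partner j k l :
  real_mixing (partner gluing_table2 j k) (partner gluing_table1 j l) = real_mixing k l.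
Proof.
have c : all3 (fun j => all7 (fun k => all7 (fun l =>
   (swap gluing_table2 j k < 7)%N && (swap gluing_table1 j l < 7)%N &&
   (nth 0%N (nth [::] mixing_table (swap gluing_table2 j k)) (swap gluing_table1 j l)
     == nth 0%N (nth [::] mixing_table k) l)))) by vm_compute.
have := all7P l (all7P k (all3P j c)) => /andP[/andP[h1 h2] /eqP h].
by rewrite !mxE /partner !inordK // h.
Qed.

End Gluing.

(** * Integration over the tiles *)

Section TileIntegral.
Variable R : realType.
Local Notation mR := (measurableTypeR R).
Local Notation R2 := (R * R)%type.
Local Notation mu := (@leb2 R).
Local Notation meas2 := (@measurable _ (mR * mR)%type).

Lemma isometry_mpres (f : R2 -> R2) : Defs.isometry f -> mpres f.
Proof.
move=> /isometry_affine[m [t [om ->]]].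
exact: (mpres_affine _ _ (orthogonal2_det om)).
Qed.

Lemma ae_onP (D : set R2) (Q : R2 -> Prop) :
  ae_on D Q <-> mu.-negligible (D `&` ~` Q).
Proof.
rewrite /ae_on /almost_everywhere /=; split; apply: negligibleS.
- by move=> x [Dx nQ] /(_ Dx).
- by move=> x /= /not_implyP[Dx nQ]; split.
Qed.

Lemma negligible_ord n (F : 'I_n -> set R2) :
  (forall k, mu.-negligible (F k)) -> mu.-negligible (\bigcup_k F k).
Proof.
move=> nF.
pose G m := if insub m is Some k then F k else set0.
apply: (@negligibleS _ _ _ mu (\bigcup_m G m)).
  by move=> x [k _ Fx]; exists (k : nat) => //; rewrite /G valK.
apply: negligible_bigcup => m; rewrite /G; case: insub => [k|]; first exact: nF.
exact: negligible_set0.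
Qed.

Variables (P : 'I_3 -> R2) (aiP : affinely_independent P).
Local Notation T := (triangle P).

Lemma triangle_measurable : meas2 T.
Proof. by apply: open_measurable2; exact: triangle_open. Qed.

Lemma lam_zero_negligible : mu.-negligible [set x | exists j, lam P j x = 0].
Proof.
apply: (@negligibleS _ _ _ mu (\bigcup_j [set x | lam P j x = 0])).
  by move=> x [j h]; exists j.
apply: negligible_ord => j.
have := line_negligible ((lam_grad P j).1 * (P (j + 1)).1 + (lam_grad P j).2 * (P (j + 1)).2) (lam_grad_neq0 aiP j).
apply: negligibleS => x /=; rewrite /lam /affine_form => h.
by apply/eqP; rewrite -subr_eq0; apply/eqP.
Qed.

Lemma triangle_bounded_measure : (mu T < +oo)%E.
Proof.
pose b := tri_bound P + 1.
apply: (@le_lt_trans _ _ (mu (`[- b, b]%classic `*` `[- b, b]%classic))).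
  apply: le_measure; rewrite ?inE.
  - exact: triangle_measurable.
  - by apply: measurableX; exact: measurable_itv.
  move=> x /(sub_tri_cl aiP)/(tri_cl_bound aiP)[]; rewrite !ler_norml /= !in_itv /= /b.
  by move=> /andP[h1 h2] /andP[h3 h4]; split; apply/andP; split; lra.
pose I : set mR := `[- b, b]%classic.
have -> : mu (I `*` I) = (lebesgue_measure I * lebesgue_measure I)%E.
  by apply: product_measure1E; exact: measurable_itv.
by rewrite !lebesgue_measure_itv /=; case: ifP => _; rewrite -?EFinB -?EFinM ltry.
Qed.

Variables (tau : 'I_7 -> R2 -> R2) (p : 'I_3 -> 'I_7 -> 'I_7) (Omega : set R2).
Hypothesis gd : glued_domain P tau p Omega.

Lemma gd_measurable : meas2 Omega.
Proof. by apply: open_measurable2; exact: gd_open gd. Qed.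

Lemma tile_preimage k : tau k @^-1` tile P tau k = T.
Proof.
have [g [ig gK Kg]] := isometry_inverse (gd_isometry gd k).
apply/seteqP; split=> x; last by exists x.
by move=> [y Ty /(can_inj gK) <-].
Qed.

Lemma tile_open k : open (tile P tau k).
Proof.
have [g [ig gK Kg]] := isometry_inverse (gd_isometry gd k).
have -> : tile P tau k = g @^-1` T.
  apply/seteqP; split=> x; first by move=> [y Ty <-]; rewrite /= gK.
  by move=> /= h; exists (g x).
apply: open_comp; last exact: triangle_open.
by move=> x _; exact: isometry_continuous.
Qed.

Lemma tile_measurable k : meas2 (tile P tau k).
Proof. by apply: open_measurable2; exact: tile_open. Qed.

Lemma closure_tile k : closure (tile P tau k) `<=` tau k @` tri_cl P.
Proof.
have [g [ig gK Kg]] := isometry_inverse (gd_isometry gd k).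
have cl : closed (g @^-1` tri_cl P).
  apply: closed_comp; last exact: tri_cl_closed.
  by move=> x _; exact: isometry_continuous.
have : tile P tau k `<=` g @^-1` tri_cl P.
  by move=> x [y Ty <-]; rewrite /= gK; exact: sub_tri_cl.
move=> /closureS; rewrite -((closure_id _).1 cl) => h x /h gx.
by exists (g x).
Qed.

(** A point of Omega outside the open tiles lies in a closed tile and has a vanishing barycentric
    coordinate there, hence lies on one of finitely many lines. *)
Lemma gd_remainder : mu.-negligible (Omega `\` \bigcup_k tile P tau k).
Proof.
pose N k := tau k @` (tri_cl P `&` [set x | exists j, lam P j x = 0]).
apply: (@negligibleS _ _ _ mu (\bigcup_k N k)).
  move=> x [/(gd_cover gd)[k _ /closure_tile[y cy <-]]] nt.
  exists k => //; exists y => //; split => //.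
  apply: contrapT => /forallNP h; apply: nt; exists k => //; exists y => //.
  rewrite triangleE // => j; rewrite lt_neqAle eq_sym cy andbT.
  by apply/eqP; exact: h.
apply: negligible_ord => k.
have [g [ig gK Kg]] := isometry_inverse (gd_isometry gd k).
apply: negligibleS (mpres_negligible (isometry_mpres ig) lam_zero_negligible).
by move=> x [y [_ hy] <-]; rewrite /= gK.
Qed.

Lemma bigcup_tile_measurable : meas2 (\bigcup_k tile P tau k).
Proof.
by apply: open_measurable2; apply: bigcup_open => k _; exact: tile_open.
Qed.

Lemma sub_bigcup_tile : \bigcup_k tile P tau k `<=` Omega.
Proof. by move=> x [k _]; exact: (gd_tile gd). Qed.

Lemma ae_on_tiles (Q : R2 -> Prop) :
  ae_on Omega Q <-> forall k, ae_on T (fun x => Q (tau k x)).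
Proof.
split=> [/ae_onP h k|h].
  apply/ae_onP; apply: negligibleS (mpres_negligible (isometry_mpres (gd_isometry gd k)) h).
  by move=> x [Tx nQ]; split => //; apply: (gd_tile gd); exists x.
apply/ae_onP.
apply: (@negligibleS _ _ _ mu ((Omega `\` \bigcup_k tile P tau k) `|` \bigcup_k (tile P tau k `&` ~` Q))).
  move=> x [Ox nQ]; have [[k _ kx]|nt] := pselect ((\bigcup_k tile P tau k) x).
    by right; exists k.
  by left.
apply: negligibleU; first exact: gd_remainder.
apply: negligible_ord => k.
have [g [ig gK Kg]] := isometry_inverse (gd_isometry gd k).
have /ae_onP hk := h k.
apply: negligibleS (mpres_negligible (isometry_mpres ig) hk).
by move=> x [[y Ty <-] nQ]; rewrite /= gK.
Qed.

Lemma ge0_integral_tiles (f : R2 -> \bar R) :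
  @measurable_fun _ _ (mR * mR)%type _ Omega f ->
  (forall x, Omega x -> (0 <= f x)%E) ->
  (\int[mu]_(x in Omega) f x = \sum_k \int[mu]_(x in T) f (tau k x))%E.
Proof.
move=> mf f0.
pose V := \bigcup_k tile P tau k.
have mV := bigcup_tile_measurable; have mO := gd_measurable.
have VO := sub_bigcup_tile.
have -> : (\int[mu]_(x in Omega) f x = \int[mu]_(x in V) f x)%E.
  rewrite -(setDUK VO) ge0_integral_setU //=.
  - rewrite -[RHS]adde0; congr (_ + _)%E.
    apply: null_set_integral; [exact: measurableD|apply: measurable_funS mf => //; exact: subDsetl|].
    have [N [mN N0 sN]] := gd_remainder.
    apply/eqP; rewrite -measure_le0 -N0; apply: le_measure; rewrite ?inE //; exact: measurableD.
  - exact: measurableD.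
  - by rewrite setDUK.
  - by move=> x [/VO|[]]; [exact: f0|move=> ? _; exact: f0].
  - by apply/disj_setPS => x [Vx [_ nV]].
have -> : V = \big[setU/set0]_(k < 7) tile P tau k.
  by rewrite /V; apply/seteqP; split=> x; rewrite -bigcup_seq; [move=> [k _ h]; exists k => //=; rewrite mem_index_enum|move=> [k _ h]; exists k].
rewrite ge0_integral_bigsetU //=.
- apply: eq_bigr => k _.
  rewrite -(mpres_ge0_integral (isometry_mpres (gd_isometry gd k)) (tile_measurable k)).
  + by rewrite tile_preimage.
  + by apply: measurable_funS mf => //; exact: (gd_tile gd).
  + by move=> x tx; apply: f0; exact: (gd_tile gd tx).
- exact: tile_measurable.
- exact: index_enum_uniq.
- by move=> k l _ _ [x [kx lx]]; apply/eqP/negPn/negP => kl; have := gd_disjoint gd kl; move/seteqP => [/(_ x) + _]; apply.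
- by apply: measurable_funS mf => // x; rewrite -bigcup_seq => -[k _]; exact: (gd_tile gd).
- by move=> x; rewrite -bigcup_seq => -[k _ kx]; apply: f0; exact: (gd_tile gd kx).
Qed.

End TileIntegral.

(** * Traces of weakly differentiable functions on the sides *)

Section PlaneIntegrals.
Variable R : realType.
Local Notation mR := (measurableTypeR R).
Local Notation R2 := (R * R)%type.
Local Notation mu := (@leb2 R).
Local Notation meas2 := (@measurable _ (mR * mR)%type).

Definition int_on (D : set R2) (u : R2 -> R) : Prop := mu.-integrable D (EFin \o u).

Lemma int_on_measurable D u : meas2 D -> int_on D u ->
  @measurable_fun _ _ (mR * mR)%type mR D u.
Proof. by move=> mD /measurable_int /measurable_EFinP. Qed.

Lemma int_onD D u v : meas2 D -> int_on D u -> int_on D v -> int_on D (fun x => u x + v x).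
Proof. by move=> mD iu iv; exact: (integrableD mD iu iv). Qed.

Lemma int_onZ D u c : meas2 D -> int_on D u -> int_on D (fun x => c * u x).
Proof. by move=> mD iu; exact: (integrableZl mD c iu). Qed.

Lemma int_onB D u v : meas2 D -> int_on D u -> int_on D v -> int_on D (fun x => u x - v x).
Proof. by move=> mD iu iv; exact: (integrableB mD iu iv). Qed.

Lemma int_on0 D : int_on D (fun=> 0).
Proof. exact: integrable0. Qed.

Lemma int_on_sum D I (s : seq I) (F : I -> R2 -> R) : meas2 D ->
  (forall i, int_on D (F i)) -> int_on D (fun x => \sum_(i <- s) F i x).
Proof.
move=> mD iF; elim: s => [|i s IH].
  by under eq_fun do rewrite big_nil; exact: int_on0.
by under eq_fun do rewrite big_cons; apply: int_onD.
Qed.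

Lemma int_on_le D u v : meas2 D -> int_on D v ->
  @measurable_fun _ _ (mR * mR)%type mR D u ->
  (forall x, D x -> `|u x| <= v x) -> int_on D u.
Proof.
move=> mD iv mf le; apply: le_integrable iv => //; first exact/measurable_EFinP.
move=> x Dx; rewrite /= lee_fin (le_trans (le x Dx)) // ler_norm //.
Qed.

Lemma int_on_eq (D : set R2) u v : meas2 D -> (forall x, D x -> u x = v x) -> int_on D u -> int_on D v.
Proof. by move=> mD e; apply: eq_integrable => // x; rewrite inE /= => /e ->. Qed.

Lemma continuous_bounded (K : set R2) (h : R2 -> R) : compact K -> continuous h ->
  exists2 M : R, 0 <= M & forall x, K x -> `|h x| <= M.
Proof.
move=> cK ch.
have : compact (h @` K) by apply: continuous_compact => //; exact: continuous_subspaceT.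
move=> /compact_bounded[M [Mr hM]].
exists (`|M| + 1); first by rewrite addr_ge0.
by move=> x Kx; apply: hM; [rewrite (le_lt_trans (ler_norm _)) // ltrDl|exists x].
Qed.

Lemma int_onM D u (h : R2 -> R) M : meas2 D -> int_on D u -> continuous h ->
  (forall x, D x -> `|h x| <= M) -> int_on D (fun x => u x * h x).
Proof.
move=> mD iu ch hM.
apply: (@int_on_le _ _ (fun x => M * `|u x|)) => //.
- by apply: int_onZ => //; exact: integrable_norm.
- apply: measurable_funM; first exact: int_on_measurable.
  by apply: measurable_funTS; exact: continuous_measurable2.
- by move=> x Dx; rewrite normrM mulrC ler_wpM2r // hM.
Qed.

Lemma int_onMK D K u (h : R2 -> R) : meas2 D -> compact K -> D `<=` K ->
  int_on D u -> continuous h -> int_on D (fun x => u x * h x).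
Proof.
move=> mD cK DK iu ch; have [M _ hM] := continuous_bounded cK ch.
by apply: (int_onM mD iu ch (M := M)) => x /DK; exact: hM.
Qed.

Lemma Rint_dominated D (f_ : nat -> R2 -> R) (f g : R2 -> R) : meas2 D ->
  (forall n, @measurable_fun _ _ (mR * mR)%type mR D (f_ n)) ->
  (forall x, D x -> f_ ^~ x @ \oo --> f x) -> int_on D g ->
  (forall n x, D x -> `|f_ n x| <= g x) ->
  (fun n => \int[mu]_(x in D) f_ n x) @ \oo --> \int[mu]_(x in D) f x.
Proof.
move=> mD mf cf ig le.
have mfl : @measurable_fun _ _ (mR * mR)%type mR D f.
  by apply: (measurable_fun_cvg (h := f_)) => // x Dx; exact: cf.
have ce x : D x -> (fun n => (f_ n x)%:E) @ \oo --> (f x)%:E.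
  by move=> Dx; apply/fine_cvgP; split; [exact: nearW|exact: cf].
have [i1 _ c] := @dominated_convergence _ _ _ mu D mD (fun n => EFin \o f_ n) (EFin \o f) (EFin \o g)
  (fun n => (measurable_EFinP _ _).2 (mf n)) ((measurable_EFinP _ _).2 mfl)
  (aeW _ ce) ig
  (aeW _ (fun x n Dx => le n x Dx)).
apply: (@fine_cvg _ _ _ _ (fun n => \int[mu]_(x in D) (f_ n x)%:E)%E).
by rewrite /Rintegral fineK //; exact: integrable_fin_num.
Qed.

Lemma Rint_sum D n (F : 'I_n -> R2 -> R) : meas2 D -> (forall i, int_on D (F i)) ->
  \int[mu]_(x in D) (\sum_i F i x) = \sum_i \int[mu]_(x in D) F i x.
Proof.
move=> mD iF; elim: n F iF => [|n IH] F iF.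
  rewrite big_ord0; under eq_Rintegral do rewrite big_ord0.
  by rewrite /Rintegral integral0.
under eq_Rintegral do rewrite big_ord_recl.
by rewrite RintegralD ?IH // ?big_ord_recl //; [exact: iF|exact: int_on_sum].
Qed.

Lemma smooth_continuous (phi : R2 -> R) : smooth phi -> continuous phi.
Proof. by move/(_ 0%N). Qed.

Lemma smooth_derive (phi : R2 -> R) i : smooth phi -> smooth (fun x => 'D_(basis_vec R i) phi x).
Proof. by move=> s n; have [_ _ h] := s n.+1; exact: h. Qed.

(** The real counterpart of [weak_partial], for functions instead of classes: test functions are
    real, so real and imaginary parts can be treated separately. *)
Definition weakd (D : set R2) (i : 'I_2) (u g : R2 -> R) : Prop :=
  forall phi, test_function D phi ->
    \int[mu]_(x in D) (u x * 'D_(basis_vec R i) phi x) =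
    - \int[mu]_(x in D) (g x * phi x).

End PlaneIntegrals.

Section Traces.
Variable R : realType.
Local Notation R2 := (R * R)%type.
Local Notation mu := (@leb2 R).
Local Notation bv := (basis_vec R).
Variables (P : 'I_3 -> R2) (aiP : affinely_independent P).
Local Notation T := (triangle P).
Local Notation lam := (lam P).
Local Notation lg j i := (Defs.coord i (lam_grad P j)).

(** Vanishing near the vertices, which are the places where two barycentric coordinates are small at
    once. *)
Definition vertex_free (phi : R2 -> R) : Prop :=
  exists2 d : R, 0 < d & forall x, T x -> forall a b, a != b ->
    lam a x < d -> lam b x < d -> phi x = 0.

(* A mean value of f near the j-th side, which tends to the integral of the
   trace of f over that side. *)
Definition side_mean (j : 'I_3) (n : nat) (f : R2 -> R) : R :=
  \int[mu]_(x in T) (f x * stepn' n (lam j x)).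

Lemma continuous_stepn'_lam n j : continuous (fun x => stepn' n (lam j x)).
Proof.
move=> x; apply: (@continuous_comp _ _ _ (lam j) (@stepn' R n)); first exact: lam_continuous.
move=> y; apply: cvgMr; apply: (@continuous_comp _ _ _ (fun s : R => n.+1%:R * s) (@step' R)).
  by apply: cvgMr; exact: cvg_id.
exact: continuous_step'.
Qed.

Lemma int_T u h : int_on T u -> continuous h -> int_on T (fun x => u x * h x).
Proof.
apply: int_onMK; [exact: triangle_measurable|exact: (tri_cl_compact aiP)|exact: sub_tri_cl].
Qed.

Lemma stepn'_eq0 n (s : R) : 2 < n.+1%:R * s -> stepn' n s = 0.
Proof. by move=> h; rewrite /stepn' step'_eq0 ?mulr0 // h orbT. Qed.

Lemma stepn'_neq0 n (s : R) : stepn' n s != 0 -> s <= 2 / n.+1%:R.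
Proof.
rewrite ler_pdivlMr // mulrC; apply: contraNle => h.
by apply/eqP; exact: stepn'_eq0.
Qed.

Lemma stepn_eq1 n (s : R) : 2 / n.+1%:R <= s -> stepn n s = 1.
Proof. by rewrite ler_pdivrMr // mulrC => h; rewrite /stepn step_eq1. Qed.

Lemma near_small (d : R) : 0 < d -> \forall n \near \oo, 2 / n.+1%:R < d.
Proof.
move=> d0; apply: filterS (nbhs_infty_gtr (2 / d)) => n h.
rewrite ltr_pdivrMr // mulrC -ltr_pdivrMr // (lt_trans h) //.
by rewrite ltr_nat.
Qed.

Lemma stepn'_cvg0 (s : R) : 0 < s -> stepn' n s @[n --> \oo] --> (0 : R).
Proof.
move=> s0; apply: cvg_near_cst; apply: filterS (near_small s0) => n h.
by apply: stepn'_eq0; rewrite mulrC -ltr_pdivrMr.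
Qed.

(** The reflection moves x by [lam j x] times a fixed vector w. The mean value theorem applies along
    this segment, which stays in the compact box K. *)
Lemma lip_reflection j (psi : R2 -> R) : of_class_C 1 psi ->
  exists2 C : R, 0 <= C & forall x, T x ->
    `|psi x - psi (side_reflection P j x)| <= C * lam j x.
Proof.
move=> s1; have [cf df cdf] := s1.
pose w := (- (2 / gnorm2 P j)) *: lam_grad P j.
pose b := tri_bound P; pose K := [set z : R2 | - (b + `|w.1|) <= z.1 <= b + `|w.1| /\
    - (b + `|w.2|) <= z.2 <= b + `|w.2|].
have cK : compact K by exact: compact_box2.
have [M0 M00 h0] := continuous_bounded cK (cdf 0).
have [M1 M10 h1] := continuous_bounded cK (cdf 1).
exists (`|w.1| * M0 + `|w.2| * M1); first by rewrite addr_ge0 // mulr_ge0.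
move=> x Tx; have l0 : 0 < lam j x by move: Tx; rewrite triangleE //; exact.
have l1 : lam j x <= 1 by apply: lam_le1 => //; exact: sub_tri_cl.
pose F t := psi (t *: w + x).
have dF (t : R) : is_derive t 1 F (w.1 * 'D_(bv 0) psi (t *: w + x) + w.2 * 'D_(bv 1) psi (t *: w + x)).
  have /is_derive_dir d := of_class_C1_is_derive (t *: w + x) w s1.
  have dS : is_derive t 1 (fun r : R => r - t) (1 : R).
    by have := is_deriveB (is_derive_id t (1 : R)) (is_derive_cst t t (1 : R)); rewrite subr0.
  rewrite -(subrr t) in d.
  have := is_derive1_comp (g := fun r : R => r - t) d dS.
  rewrite mulr1; congr (is_derive _ _ _ _); apply/funext => r /=.
  by rewrite /F addrA -scalerDl subrK.
have [c [hc E]] := MVT_any dF 0 (lam j x).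
rewrite subr0 in hc E; rewrite subr0 in hc.
have -> : psi x = F 0 by rewrite /F scale0r add0r.
have -> : psi (side_reflection P j x) = F (lam j x).
  by rewrite /F side_reflectionE // addrC /w scalerA mulrN scaleNr.
have c1 : `|c| <= 1 by apply: le_trans hc _; rewrite gtr0_norm.
rewrite distrC E subr0 normrM (gtr0_norm l0) ler_wpM2r ?(ltW l0) //.
have Kc : K (c *: w + x).
  have [b1 b2] := tri_cl_bound aiP (sub_tri_cl aiP Tx).
  have kb (y e : R) : `|e| <= b -> - (b + `|y|) <= c * y + e <= b + `|y|.
    move=> he; rewrite -ler_norml (le_trans (ler_normD _ _)) // addrC lerD //.
    by rewrite normrM ler_piMl.
  by split; exact: kb.
apply: le_trans (ler_normD _ _) _.
apply: lerD; rewrite normrM.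
  exact: (ler_wpM2l (normr_ge0 _) (h0 _ Kc)).
exact: (ler_wpM2l (normr_ge0 _) (h1 _ Kc)).
Qed.

(** Near the side psi and its reflection differ by at most C lam j, while lam j * stepn' n (lam j)
    is bounded by M; so C M |u| dominates, and the bumps tend to 0 pointwise. Reflecting a test
    function therefore does not change the limit of its side means. *)
Lemma side_mean_reflection j u (psi : R2 -> R) : int_on T u -> of_class_C 1 psi ->
  (fun n => side_mean j n (fun x => u x * (psi x - psi (side_reflection P j x)))) @ \oo --> (0 : R).
Proof.
move=> iu s1; have [C C0 hC] := lip_reflection j s1.
have [M M0 hM] := step'_bound R.
have cpsi : continuous (fun x => psi x - psi (side_reflection P j x)).
  have cpsi := of_class_C_continuous s1.
  move=> x; apply: cvgB; first exact: cpsi.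
  apply: (@continuous_comp _ _ _ (side_reflection P j) psi); last exact: cpsi.
  by apply: isometry_continuous; exact: side_reflection_isometry.
have mT := triangle_measurable aiP.
rewrite -[X in _ --> X](_ : \int[mu]_(x in T) (0 : R) = 0); last first.
  by rewrite /Rintegral integral0.
apply: (Rint_dominated mT (g := fun x => C * M * `|u x|)).
- move=> n; apply: int_on_measurable => //; apply: int_T; last exact: continuous_stepn'_lam.
  exact: int_T.
- move=> x Tx; rewrite -(mulr0 (u x * (psi x - psi (side_reflection P j x)))).
  by apply: cvgMr; apply: stepn'_cvg0; move: Tx; rewrite triangleE //; exact.
- by apply: int_onZ => //; exact: integrable_norm.
move=> n x Tx; rewrite -mulrA normrM mulrC ler_wpM2r // normrM.
have l0 : 0 < lam j x by move: Tx; rewrite triangleE //; exact.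
apply: (@le_trans _ _ (C * lam j x * `|stepn' n (lam j x)|)); first by rewrite ler_wpM2r // hC.
rewrite -mulrA ler_wpM2l //.
have := hM (n.+1%:R * lam j x); rewrite normrM /stepn' (normrM n.+1%:R) => h.
by apply: le_trans h; rewrite le_eqVlt; apply/orP; left; apply/eqP; rewrite normrM (gtr0_norm l0); ring.
Qed.

Definition cutoff (n : nat) (x : R2) : R := stepn n (lam 0 x) * stepn n (lam 1 x) * stepn n (lam 2%:R x).

Lemma of_class_C_stepn_lam m n j : of_class_C m (fun x => stepn n (lam j x)).
Proof.
apply: (@of_class_C_step _ m (fun x => n.+1%:R * lam j x)).
by apply: of_class_CM; [exact: of_class_C_cst|exact: of_class_C_affine_form].
Qed.

Lemma of_class_C_cutoff m n : of_class_C m (cutoff n).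
Proof.
apply: of_class_CM; last exact: of_class_C_stepn_lam.
by apply: of_class_CM; exact: of_class_C_stepn_lam.
Qed.

Lemma stepn_itv n (s : R) : 0 <= stepn n s <= 1.
Proof. exact: step_itv. Qed.

Lemma cutoff_norm n x : `|cutoff n x| <= 1.
Proof.
have h (s : R) := stepn_itv n s.
have h' (s : R) : `|stepn n s| <= 1.
  by have /andP[h0 h1] := h s; rewrite ger0_norm.
have h2 (a b : R) : `|a| <= 1 -> `|b| <= 1 -> `|a * b| <= 1.
  by move=> ha hb; rewrite normrM mulr_ile1.
exact: h2 (h2 _ _ (h' _) (h' _)) (h' _).
Qed.

Lemma stepn_lam_neq0 n (s : R) : stepn n s != 0 -> n.+1%:R^-1 <= s.
Proof.
apply: contraNle => h; apply/eqP; rewrite /stepn step_eq0 //.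
by rewrite -ler_pdivlMl // mulr1 ltW.
Qed.

Lemma test_function_cutoff n (phi : R2 -> R) : smooth phi ->
  test_function T (fun x => phi x * cutoff n x).
Proof.
move=> sphi.
pose S := [set x | forall j, n.+1%:R^-1 <= lam j x].
have ST : S `<=` T.
  by move=> x h; rewrite triangleE // => j; apply: lt_le_trans (h j); rewrite invr_gt0.
have cS : closed S.
  have -> : S = [set x | n.+1%:R^-1 <= lam 0 x] `&` [set x | n.+1%:R^-1 <= lam 1 x] `&` [set x | n.+1%:R^-1 <= lam 2%:R x].
    apply/seteqP; split=> x; first by move=> h; split; [split|]; exact: h.
    by move=> [[h0 h1] h2] j; case: (ord3P j) => ->.
  have o j : closed [set x | n.+1%:R^-1 <= lam j x].
    by apply: (@closed_comp _ _ (lam j) [set t | n.+1%:R^-1 <= t]) => [x _|]; [exact: lam_continuous|exact: closed_ge].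
  by apply: closedI => //; exact: closedI.
have sS : support_of (fun x => phi x * cutoff n x) `<=` S.
  rewrite /support_of.
  have : [set x | phi x * cutoff n x != 0] `<=` S.
    move=> x nz j; apply: stepn_lam_neq0; apply: contra_neq nz => e.
    by rewrite /cutoff; case: (ord3P j) e => -> ->; rewrite ?(mulr0, mul0r).
  by move=> /closureS; rewrite -((closure_id _).1 cS).
split.
- by move=> m; apply: of_class_CM; [exact: sphi|exact: of_class_C_cutoff].
- apply: (subclosed_compact _ (tri_cl_compact aiP)); first exact: closed_closure.
  by move=> x /sS/ST; exact: sub_tri_cl.
- by move=> x /sS/ST.
Qed.

Lemma is_derive_stepn_lam n j (i : 'I_2) x :
  is_derive x (bv i) (fun x => stepn n (lam j x)) (stepn' n (lam j x) * lg j i).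
Proof.
apply: (@is_derive_comp1 _ (@stepn R n) (lam j)); first exact: is_derive_stepn.
apply: (is_derive_eq (is_derive_affine_form _ _ _ _ _)).
by case: (ord2P i) => ->; rewrite /Defs.coord /=; ring.
Qed.

Definition cutoff' (i : 'I_2) (n : nat) (x : R2) : R :=
  lg 0 i * (stepn' n (lam 0 x) * stepn n (lam 1 x) * stepn n (lam 2%:R x)) +
  lg 1 i * (stepn' n (lam 1 x) * stepn n (lam 0 x) * stepn n (lam 2%:R x)) +
  lg 2%:R i * (stepn' n (lam 2%:R x) * stepn n (lam 0 x) * stepn n (lam 1 x)).

Lemma is_derive_cutoff i n x : is_derive x (bv i) (cutoff n) (cutoff' i n x).
Proof.
have d j := is_derive_stepn_lam n j i x.
apply: (is_derive_eq (is_deriveM (is_deriveM (d 0) (d 1)) (d 2%:R))).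
have alg (a b c a' b' c' l m k : R) : (a * b) * (c' * k) + c * (a * (b' * m) + b * (a' * l)) =
  l * (a' * b * c) + m * (b' * a * c) + k * (c' * a * b) by ring.
exact: alg.
Qed.

(** Once 2 / (n + 1) < d, a nonzero [stepn' n (lam a x)] puts lam a below d. Either a further
    coordinate is below d and phi vanishes, or the other factors of the cutoff equal 1. *)
Lemma vertex_free_cutoff' i (phi : R2 -> R) : vertex_free phi ->
  \forall n \near \oo, forall x, T x ->
    phi x * cutoff' i n x = \sum_j lg j i * (phi x * stepn' n (lam j x)).
Proof.
move=> [d d0 hd]; apply: filterS (near_small d0) => n nd x Tx.
have key a b : a != b -> phi x * (stepn' n (lam a x) * stepn n (lam b x)) = phi x * stepn' n (lam a x).
  move=> ab; have [->|/stepn'_neq0 la] := eqVneq (stepn' n (lam a x)) 0; first by rewrite mul0r.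
  have [lb|lb] := ltP (lam b x) d; first by rewrite (hd x Tx a b ab) ?mul0r // (le_lt_trans la).
  by rewrite stepn_eq1 ?mulr1 // (le_trans (ltW nd)).
have key2 a b c : a != b -> a != c ->
    phi x * (stepn' n (lam a x) * stepn n (lam b x) * stepn n (lam c x)) = phi x * stepn' n (lam a x).
  by move=> ab ac; rewrite mulrA key // -mulrA key.
rewrite sum3 /cutoff' !mulrDr.
by congr (_ + _ + _); rewrite mulrCA key2.
Qed.

Lemma cutoff_cvg x : T x -> cutoff n x @[n --> \oo] --> (1 : R).
Proof.
rewrite triangleE // => h; apply: cvg_near_cst.
have s j : \forall n \near \oo, stepn n (lam j x) = 1 by apply: stepn_cvg; exact: h.
apply: filterS3 (s 0) (s 1) (s 2%:R) => n e0 e1 e2.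
by rewrite /cutoff e0 e1 e2 !mulr1.
Qed.

(** Green's formula on the triangle, with the boundary term as a limit. The weak derivative is
    tested with phi * cutoff n; where the derivative falls on the cutoff, it produces side means
    weighted by the inner normals [lam_grad]. *)
Lemma side_mean_cvg i u g phi : int_on T u -> int_on T g -> weakd T i u g ->
  smooth phi -> vertex_free phi ->
  (fun n => \sum_j lg j i * side_mean j n (fun x => u x * phi x)) @ \oo -->
    - \int[mu]_(x in T) (u x * 'D_(bv i) phi x + g x * phi x).
Proof.
move=> iu ig wu sphi vphi.
have mT := triangle_measurable aiP.
have cphi := smooth_continuous sphi.
have cdphi := smooth_continuous (smooth_derive i sphi).
have i1 : int_on T (fun x => u x * 'D_(bv i) phi x) by exact: int_T.
have i2 : int_on T (fun x => g x * phi x) by exact: int_T.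
have ccut n : continuous (cutoff n).
  exact: (of_class_C_cutoff 0).
pose h x := u x * 'D_(bv i) phi x + g x * phi x.
have ih : int_on T h by exact: int_onD.
have L : (fun n => - \int[mu]_(x in T) (h x * cutoff n x)) @ \oo --> - \int[mu]_(x in T) h x.
  apply: cvgN; apply: (Rint_dominated mT (g := fun x => `|h x|)).
  - by move=> n; apply: int_on_measurable => //; exact: int_T.
  - move=> x Tx; rewrite -[X in _ --> X]mulr1; apply: cvgMr; exact: cutoff_cvg.
  - exact: integrable_norm.
  - by move=> n x Tx; rewrite normrM ler_piMr // cutoff_norm.
apply: cvg_trans L; apply: near_eq_cvg.
apply: filterS (vertex_free_cutoff' i vphi) => n key.
have ij j : int_on T (fun x => lg j i * (u x * phi x * stepn' n (lam j x))).
  apply: int_onZ => //; apply: int_T; last exact: continuous_stepn'_lam.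
  exact: int_T.
have := wu _ (test_function_cutoff n sphi).
have -> : \int[mu]_(x in T) (u x * 'D_(bv i) (fun x0 => phi x0 * cutoff n x0) x) =
    \int[mu]_(x in T) (u x * 'D_(bv i) phi x * cutoff n x) +
    \sum_j lg j i * side_mean j n (fun x => u x * phi x).
  transitivity (\int[mu]_(x in T) (u x * 'D_(bv i) phi x * cutoff n x +
      \sum_j lg j i * (u x * phi x * stepn' n (lam j x)))).
    apply: eq_Rintegral => x; rewrite inE => Tx.
    have [_ _ ] := sphi 1%N => _.
    have [_ dphi _] := sphi 1%N.
    have [_ ->] := is_deriveM (derivableP (dphi i x)) (is_derive_cutoff i n x).
    rewrite /GRing.scale /= key // mulrDr mulr_sumr addrC; congr (_ + _); first by ring.
    by apply: eq_bigr => j _; ring.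
  rewrite RintegralD //; [|exact: int_T|exact: int_on_sum].
  congr (_ + _); rewrite Rint_sum //; apply: eq_bigr => j _.
  by rewrite /side_mean RintegralZl //; apply: int_T; [exact: int_T|exact: continuous_stepn'_lam].
have -> : \int[mu]_(x in T) (g x * (phi x * cutoff n x)) =
    \int[mu]_(x in T) (g x * phi x * cutoff n x).
  by apply: eq_Rintegral => x _; rewrite mulrA.
have -> : \int[mu]_(x in T) (h x * cutoff n x) =
    \int[mu]_(x in T) (u x * 'D_(bv i) phi x * cutoff n x) +
    \int[mu]_(x in T) (g x * phi x * cutoff n x).
  by rewrite -RintegralD //; [apply: eq_Rintegral => x _; rewrite mulrDl|exact: int_T|exact: int_T].
by move=> E; lra.
Qed.

Lemma side_meanD j n u v : int_on T u -> int_on T v ->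
  side_mean j n (fun x => u x + v x) = side_mean j n u + side_mean j n v.
Proof.
move=> iu iv; rewrite /side_mean -RintegralD //.
- by apply: eq_Rintegral => x _; rewrite mulrDl.
- exact: triangle_measurable.
- by apply: int_T => //; exact: continuous_stepn'_lam.
- by apply: int_T => //; exact: continuous_stepn'_lam.
Qed.

Lemma side_meanZ j n c u : int_on T u ->
  side_mean j n (fun x => c * u x) = c * side_mean j n u.
Proof.
move=> iu; rewrite /side_mean -RintegralZl //.
- by apply: eq_Rintegral => x _; rewrite mulrA.
- exact: triangle_measurable.
- by apply: int_T => //; exact: continuous_stepn'_lam.
Qed.

Lemma side_mean_sum j n I (s : seq I) (F : I -> R2 -> R) : (forall k, int_on T (F k)) ->
  side_mean j n (fun x => \sum_(k <- s) F k x) = \sum_(k <- s) side_mean j n (F k).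
Proof.
move=> iF; elim: s => [|k s IH].
  rewrite big_nil /side_mean; under eq_Rintegral do rewrite big_nil mul0r.
  by rewrite /Rintegral integral0.
under [LHS]eq_Rintegral do rewrite big_cons.
rewrite big_cons -IH -side_meanD //.
by apply: int_on_sum => //; exact: triangle_measurable.
Qed.

Lemma eq_side_mean j n u v : (forall x, T x -> u x * stepn' n (lam j x) = v x * stepn' n (lam j x)) ->
  side_mean j n u = side_mean j n v.
Proof. by move=> h; apply: eq_Rintegral => x; rewrite inE => /h. Qed.

(* A weak form of: the trace of d on the j-th side vanishes. *)
Definition trace0 (j : 'I_3) (d : R2 -> R) : Prop :=
  forall phi, smooth phi -> vertex_free phi ->
    (fun n => side_mean j n (fun x => d x * phi x)) @ \oo --> (0 : R).

End Traces.

(** * Weak derivatives and matching of traces across shared sides *)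

Section GluingTraces.
Variable R : realType.
Local Notation mR := (measurableTypeR R).
Local Notation R2 := (R * R)%type.
Local Notation mu := (@leb2 R).
Local Notation bv := (basis_vec R).
Variables (P : 'I_3 -> R2) (aiP : affinely_independent P).
Local Notation T := (triangle P).
Local Notation lam := (lam P).
Local Notation lg j i := (Defs.coord i (lam_grad P j)).
Variables (tau : 'I_7 -> R2 -> R2) (p : 'I_3 -> 'I_7 -> 'I_7) (Omega : set R2).
Hypothesis gd : glued_domain P tau p Omega.
Variables (m : 'I_7 -> 'M[R]_2) (t : 'I_7 -> R2).
Hypothesis tauE : forall k, tau k = affine_map (m k) (t k).
Hypothesis om : forall k, orthogonal2 (m k).

Lemma sum2 (V : nmodType) (F : 'I_2 -> V) : \sum_i F i = F 0 + F 1.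
Proof. by rewrite big_ord_recr big_ord1 /=; congr (_ + _); congr F; exact: val_inj. Qed.

Lemma affine_map_comp (m1 m2 : 'M[R]_2) (t1 t2 : R2) :
  affine_map m1 t1 \o affine_map m2 t2 = affine_map (m1 *m m2) (affine_map m1 t1 t2).
Proof.
apply/funext => x; rewrite /affine_map /= !mxE !sum2.
by congr pair; ring.
Qed.

Lemma affine_map_inj (m1 m2 : 'M[R]_2) (t1 t2 : R2) :
  affine_map m1 t1 = affine_map m2 t2 -> m1 = m2.
Proof.
move=> E.
have E0 := congr1 (fun f => f (0, 0)) E.
have E1 := congr1 (fun f => f (1, 0)) E.
have E2 := congr1 (fun f => f (0, 1)) E.
move: E0 E1 E2; rewrite /affine_map /= => -[a1 a2] [b1 b2] [c1 c2].
apply/matrixP => i j; case: (ord2P i) => ->; case: (ord2P j) => ->; lra.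
Qed.

Lemma gd_mx j k : p j k != k -> m (p j k) = m k *m refl_mx P j.
Proof.
move=> /(gd_reflection gd); rewrite !tauE.
have [s ->] := side_reflection_affine aiP j.
by rewrite affine_map_comp => /affine_map_inj.
Qed.

(** The a-th component of the inner normal of the j-th side of tile k, with the length of
    [lam_grad]. *)
Definition tile_normal k j (a : 'I_2) : R := \sum_q m k a q * lg j q.

(** Neighbouring tiles differ by the reflection in the common side, which reverses its normal. *)
Lemma tile_normal_partner j k a : p j k != k ->
  tile_normal (p j k) j a = - tile_normal k j a.
Proof.
move=> /gd_mx E; rewrite /tile_normal E !sum2 !mxE !sum2 !mxE.
have := gnorm2_gt0 aiP j; rewrite /gnorm2 /Defs.coord.
move: (lam_grad P j) => g /lt0r_neq0 n0 /=.
by field.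
Qed.

Lemma tile_normal_neq0 k j : exists a, tile_normal k j a != 0.
Proof.
apply/not_existsP => h.
have h0 : tile_normal k j 0 = 0 by apply/eqP/negPn/negP; exact: h.
have h1 : tile_normal k j 1 = 0 by apply/eqP/negPn/negP; exact: h.
have [ort1 ort2 ort3] := om k.
have c0 : lg j 0 = (lam_grad P j).1 by [].
have c1 : lg j 1 = (lam_grad P j).2 by [].
move: h0 h1 (lam_grad_neq0 aiP j); rewrite /tile_normal !sum2 c0 c1 {c0 c1 h}.
move: (lam_grad P j) => g h0 h1.
have g1 : g.1 = 0.
  transitivity (g.1 * (m k 0 0 ^+ 2 + m k 1 0 ^+ 2) + g.2 * (m k 0 0 * m k 0 1 + m k 1 0 * m k 1 1)).
    by rewrite ort1 ort3; ring.
  transitivity (m k 0 0 * (m k 0 0 * g.1 + m k 0 1 * g.2) + m k 1 0 * (m k 1 0 * g.1 + m k 1 1 * g.2)); first by ring.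
  by rewrite h0 h1; ring.
have g2 : g.2 = 0.
  transitivity (g.2 * (m k 0 1 ^+ 2 + m k 1 1 ^+ 2) + g.1 * (m k 0 0 * m k 0 1 + m k 1 0 * m k 1 1)).
    by rewrite ort2 ort3; ring.
  transitivity (m k 0 1 * (m k 0 0 * g.1 + m k 0 1 * g.2) + m k 1 1 * (m k 1 0 * g.1 + m k 1 1 * g.2)); first by ring.
  by rewrite h0 h1; ring.
by rewrite g1 g2 eqxx.
Qed.

Lemma smooth_tile k (phi : R2 -> R) : smooth phi -> smooth (phi \o tau k).
Proof. by move=> s n; rewrite tauE; exact: of_class_C_affine_comp. Qed.

Lemma derive_tile k (phi : R2 -> R) q x : smooth phi ->
  'D_(bv q) (phi \o tau k) x = m k 0 q * 'D_(bv 0) phi (tau k x) + m k 1 q * 'D_(bv 1) phi (tau k x).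
Proof.
move=> s; rewrite tauE.
by have [_ ->] := is_derive_affine_comp (m k) (t k) q x (s 1%N).
Qed.

Lemma derive_tile_inv k (phi : R2 -> R) a x : smooth phi ->
  'D_(bv a) phi (tau k x) = \sum_q m k a q * 'D_(bv q) (phi \o tau k) x.
Proof.
move=> s; rewrite sum2 !derive_tile //.
have [ort1 ort2 ort3] := orthogonal2_inv (om k); rewrite !mxE in ort1 ort2 ort3.
case: (ord2P a) => ->; move: ('D_(bv 0) phi (tau k x)) ('D_(bv 1) phi (tau k x)) => d0 d1.
  transitivity (d0 * (m k 0 0 ^+ 2 + m k 0 1 ^+ 2) + d1 * (m k 0 0 * m k 1 0 + m k 0 1 * m k 1 1)).
    by rewrite ort1 ort3; ring.
  by ring.
transitivity (d1 * (m k 1 0 ^+ 2 + m k 1 1 ^+ 2) + d0 * (m k 0 0 * m k 1 0 + m k 0 1 * m k 1 1)).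
  by rewrite ort2 ort3; ring.
by ring.
Qed.

(** The chain rule: if g is the gradient of u, this is the gradient of u o tau k. *)
Definition pull_grad (g : 'I_2 -> R2 -> R) k (q : 'I_2) (x : R2) : R :=
  \sum_a m k a q * g a (tau k x).

Lemma pull_grad_inv g k a x : g a (tau k x) = \sum_q m k a q * pull_grad g k q x.
Proof.
rewrite sum2 /pull_grad !sum2.
have [ort1 ort2 ort3] := orthogonal2_inv (om k); rewrite !mxE in ort1 ort2 ort3.
case: (ord2P a) => ->; move: (g 0 (tau k x)) (g 1 (tau k x)) => d0 d1.
  transitivity (d0 * (m k 0 0 ^+ 2 + m k 0 1 ^+ 2) + d1 * (m k 0 0 * m k 1 0 + m k 0 1 * m k 1 1)).
    by rewrite ort1 ort3; ring.
  by ring.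
transitivity (d1 * (m k 1 0 ^+ 2 + m k 1 1 ^+ 2) + d0 * (m k 0 0 * m k 1 0 + m k 0 1 * m k 1 1)).
  by rewrite ort2 ort3; ring.
by ring.
Qed.

Lemma int_on_tile f k : int_on Omega f -> int_on T (f \o tau k).
Proof.
move=> /integrableP[mf f0].
have mp := isometry_mpres (gd_isometry gd k).
have mt := tile_measurable aiP gd k; have mT := triangle_measurable aiP.
have mft : @measurable_fun _ _ (mR * mR)%type _ (tile P tau k) (EFin \o f).
  apply: measurable_funS mf; [exact: gd_measurable gd|exact: (gd_tile gd)].
have mfT : @measurable_fun _ _ (mR * mR)%type _ T (EFin \o (f \o tau k)).
  rewrite -(tile_preimage gd k).
  apply: (measurable_comp (F := tile P tau k)) mft _ => //.
    by move=> _ [x tx <-].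
  by apply: measurable_funTS; exact: mp.1.
apply/integrableP; split => //; apply: le_lt_trans f0.
have mabs D : @measurable_fun _ _ (mR * mR)%type _ D (EFin \o f) ->
    @measurable_fun _ _ (mR * mR)%type _ D (abse \o (EFin \o f)).
  by move=> mD; exact: measurableT_comp.
rewrite -(tile_preimage gd k).
rewrite (mpres_ge0_integral mp (g := abse \o (EFin \o f)) mt) //=.
  apply: ge0_subset_integral => //; [exact: gd_measurable gd|exact: mabs|exact: (gd_tile gd)].
exact: mabs.
Qed.

Lemma Rint_tiles f : int_on Omega f ->
  \int[mu]_(x in Omega) f x = \sum_k \int[mu]_(x in T) f (tau k x).
Proof.
move=> jf; have /integrableP[mf f0] := jf.
have mO := gd_measurable gd; have mT := triangle_measurable aiP.
rewrite /Rintegral integralE.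
rewrite (ge0_integral_tiles aiP gd (measurable_funepos mf)) //.
rewrite (ge0_integral_tiles aiP gd (measurable_funeneg mf)) //.
have jT k := int_on_tile k jf.
have eP k : (fun x => (EFin \o f)^\+%E (tau k x)) = (EFin \o (f \o tau k))^\+%E := esym (funepos_comp _ _).
have eN k : (fun x => (EFin \o f)^\-%E (tau k x)) = (EFin \o (f \o tau k))^\-%E := esym (funeneg_comp _ _).
have fP k : (\int[mu]_(x in T) (EFin \o f)^\+%E (tau k x))%E \is a fin_num.
  by rewrite eP; apply: integrable_fin_num => //; exact: (integrable_funepos mT (jT k)).
have fN k : (\int[mu]_(x in T) (EFin \o f)^\-%E (tau k x))%E \is a fin_num.
  by rewrite eN; apply: integrable_fin_num => //; exact: (integrable_funeneg mT (jT k)).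
rewrite fineB; last 2 first.
- by apply/sum_fin_numP => k _ _; exact: fP.
- by apply/sum_fin_numP => k _ _; exact: fN.
rewrite -!sum_fine // -sumrB; apply: eq_bigr => k _.
by rewrite -fineB // eP eN -integralE.
Qed.

Lemma continuous_bounded_gd (h : R2 -> R) : continuous h ->
  exists M : R, forall x, Omega x -> `|h x| <= M.
Proof.
move=> ch.
have hk k : exists2 M : R, 0 <= M & forall x, tri_cl P x -> `|(h \o tau k) x| <= M.
  apply: continuous_bounded; first exact: tri_cl_compact.
  move=> x; apply: continuous_comp; last exact: ch.
  exact: (isometry_continuous (gd_isometry gd k)).
pose M k := sval (cid2 (hk k)).
have M0 k : 0 <= M k by rewrite /M; case: cid2.
exists (\sum_k M k) => x /(gd_cover gd)[k _ /(closure_tile aiP gd)[y cy <-]].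
rewrite (bigD1 k) //= ler_wpDr ?sumr_ge0 //.
by rewrite /M; case: cid2 => N N0 /= hN; exact: hN.
Qed.

Lemma int_Omega u h : int_on Omega u -> continuous h -> int_on Omega (fun x => u x * h x).
Proof.
move=> iu ch; have [M hM] := continuous_bounded_gd ch.
exact: (int_onM (gd_measurable gd) iu ch hM).
Qed.

(** The failure of integration by parts on the triangle for a phi that reaches its boundary; by
    [side_mean_cvg] it is, up to sign, a limit of side means. *)
Definition defect (u : R2 -> R) (G : 'I_2 -> R2 -> R) (q : 'I_2) (phi : R2 -> R) : R :=
  \int[mu]_(x in T) (u x * 'D_(bv q) phi x + G q x * phi x).

Lemma int_pull_grad g k q : (forall a, int_on Omega (g a)) -> int_on T (pull_grad g k q).
Proof.
move=> ig; apply: int_on_sum; first exact: triangle_measurable.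
move=> a; apply: int_onZ; first exact: triangle_measurable.
exact: (int_on_tile k (ig a)).
Qed.

Lemma weak_defect_tiles u (g : 'I_2 -> R2 -> R) a phi :
  int_on Omega u -> (forall a, int_on Omega (g a)) -> smooth phi ->
  \int[mu]_(x in Omega) (u x * 'D_(bv a) phi x) + \int[mu]_(x in Omega) (g a x * phi x) =
  \sum_k \sum_q m k a q * defect (u \o tau k) (pull_grad g k) q (phi \o tau k).
Proof.
move=> iu ig sphi.
have mT := triangle_measurable aiP.
have cphi := smooth_continuous sphi.
have cdphi := smooth_continuous (smooth_derive a sphi).
rewrite -RintegralD; [|exact: gd_measurable gd|exact: int_Omega|exact: int_Omega].
rewrite Rint_tiles; last by apply: int_onD; [exact: gd_measurable gd|exact: int_Omega|exact: int_Omega].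
apply: eq_bigr => k _.
have sk := smooth_tile k sphi.
have ck := smooth_continuous sk.
have cdk q := smooth_continuous (smooth_derive q sk).
have i1 q : int_on T (fun x => (u \o tau k) x * 'D_(bv q) (phi \o tau k) x).
  by apply: (int_T aiP); [exact: int_on_tile|exact: cdk].
have i2 q : int_on T (fun x => pull_grad g k q x * (phi \o tau k) x).
  by apply: (int_T aiP) => //; exact: int_pull_grad.
have i3 q : int_on T (fun x => (u \o tau k) x * 'D_(bv q) (phi \o tau k) x + pull_grad g k q x * (phi \o tau k) x).
  exact: int_onD.
transitivity (\int[mu]_(x in T) (\sum_q m k a q * ((u \o tau k) x * 'D_(bv q) (phi \o tau k) x + pull_grad g k q x * (phi \o tau k) x))).
  apply: eq_Rintegral => x _.
  rewrite derive_tile_inv // pull_grad_inv mulr_sumr mulr_suml -big_split /=.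
  by apply: eq_bigr => q _; ring.
rewrite Rint_sum //; last by move=> q; exact: int_onZ.
by apply: eq_bigr => q _; rewrite /defect RintegralZl //; exact: i3.
Qed.

Lemma defect0 u G q phi : (forall x, T x -> phi x = 0) -> defect u G q phi = 0.
Proof.
move=> h; rewrite /defect -[RHS](_ : \int[mu]_(x in T) (0 : R) = 0); last by rewrite /Rintegral integral0.
apply: eq_Rintegral => x; rewrite inE => Tx.
rewrite h // mulr0 addr0.
have -> : 'D_(bv q) phi x = 'D_(bv q) (cst 0) x.
  apply: near_eq_derive.
  apply: filterS (open_nbhs_nbhs (conj (triangle_open aiP) Tx)) => y; exact: h.
by rewrite derive_cst mulr0.
Qed.

Lemma orthogonal_defect0 k (b : 'I_2 -> R) :
  (forall a, \sum_q m k a q * b q = 0) -> forall q, b q = 0.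
Proof.
move=> h; have := h 0; have := h 1; rewrite !sum2 => h1 h0.
have [ort1 ort2 ort3] := om k.
have b0 : b 0 = 0.
  transitivity (b 0 * (m k 0 0 ^+ 2 + m k 1 0 ^+ 2) + b 1 * (m k 0 0 * m k 0 1 + m k 1 0 * m k 1 1)).
    by rewrite ort1 ort3; ring.
  transitivity (m k 0 0 * (m k 0 0 * b 0 + m k 0 1 * b 1) + m k 1 0 * (m k 1 0 * b 0 + m k 1 1 * b 1)); first by ring.
  by rewrite h0 h1; ring.
have b1 : b 1 = 0.
  transitivity (b 1 * (m k 0 1 ^+ 2 + m k 1 1 ^+ 2) + b 0 * (m k 0 0 * m k 0 1 + m k 1 0 * m k 1 1)).
    by rewrite ort2 ort3; ring.
  transitivity (m k 0 1 * (m k 0 0 * b 0 + m k 0 1 * b 1) + m k 1 1 * (m k 1 0 * b 0 + m k 1 1 * b 1)); first by ring.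
  by rewrite h0 h1; ring.
by move=> q; case: (ord2P q) => ->.
Qed.

(** S may extend beyond the triangle: the lemma serves both functions supported inside a tile and
    functions straddling one of its sides. *)
Lemma test_function_push k (S : set R2) (psi : R2 -> R) : smooth psi -> compact S ->
  (forall x, psi x != 0 -> S x) -> tau k @` S `<=` Omega ->
  exists2 phi, test_function Omega phi & phi \o tau k = psi.
Proof.
move=> sp cS pS SO.
have [g [ig gK Kg]] := isometry_inverse (gd_isometry gd k).
have [mg [tg [_ gE]]] := isometry_affine ig.
have cl : compact (tau k @` S).
  apply: continuous_compact => //; apply: continuous_subspaceT.
  exact: (isometry_continuous (gd_isometry gd k)).
have sS : support_of (psi \o g) `<=` tau k @` S.
  have : [set x | (psi \o g) x != 0] `<=` tau k @` S.
    by move=> x /pS Sx; exists (g x).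
  move=> /closureS; rewrite -((closure_id (tau k @` S)).1 _) //.
  by apply: compact_closed => //; exact: norm_hausdorff.
exists (psi \o g); last by apply/funext => x; rewrite /= gK.
split.
- by move=> n; rewrite gE; exact: of_class_C_affine_comp.
- by apply: subclosed_compact cl sS; exact: closed_closure.
- by move=> x /sS/SO.
Qed.

Lemma weakd_tile u (g : 'I_2 -> R2 -> R) :
  int_on Omega u -> (forall a, int_on Omega (g a)) ->
  (forall a, weakd Omega a u (g a)) ->
  forall k q, weakd T q (u \o tau k) (pull_grad g k q).
Proof.
move=> iu ig wu k q psi tpsi.
have [spsi cpsi psiT] := tpsi.
have [phi tphi phiE] : exists2 phi, test_function Omega phi & phi \o tau k = psi.
  apply: (@test_function_push k (support_of psi)) => //.
    by move=> x nz; apply: subset_closure.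
  by move=> x [y /psiT Ty <-]; apply: (gd_tile gd); exists y.
have mT := triangle_measurable aiP.
have sphi : smooth phi by case: tphi.
suff D0 : defect (u \o tau k) (pull_grad g k) q psi = 0.
  apply/eqP; rewrite -subr_eq0 opprK; apply/eqP; rewrite -[RHS]D0 /defect RintegralD //.
    by apply: (int_T aiP); [exact: int_on_tile|exact: smooth_continuous (smooth_derive q spsi)].
  by apply: (int_T aiP); [exact: int_pull_grad|exact: smooth_continuous].
move: q; apply: (orthogonal_defect0 (k := k)) => a.
have := weak_defect_tiles a iu ig sphi.
rewrite (wu a _ tphi) addNr (bigD1 k) //= phiE [X in _ + X]big1 ?addr0 // => l lk.
apply: big1 => q _; rewrite defect0 ?mulr0 // => x Tx.
apply/eqP/negPn/negP => nz.
have [g' [ig' gK Kg]] := isometry_inverse (gd_isometry gd k).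
have : psi (g' (tau l x)) != 0 by rewrite -phiE /= Kg.
move=> h; have /psiT Ty : support_of psi (g' (tau l x)) by exact: subset_closure.
have : (tile P tau l `&` tile P tau k) (tau l x).
  by split; [exists x|exists (g' (tau l x)); rewrite ?Kg].
by rewrite (gd_disjoint gd lk).
Qed.

Lemma cvgn_unique (f : nat -> R) (a b : R) : f @ \oo --> a -> f @ \oo --> b -> a = b.
Proof. by move=> fa fb; rewrite -(cvg_lim (@norm_hausdorff _ _) fa) -(cvg_lim (@norm_hausdorff _ _) fb). Qed.

Lemma cvgn_add (f g : nat -> R) (a b : R) : f @ \oo --> a -> g @ \oo --> b ->
  (fun n => f n + g n) @ \oo --> a + b.
Proof. by move=> fa gb; exact: cvgD. Qed.

Lemma cvgn_mul (f : nat -> R) (c a : R) : f @ \oo --> a ->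
  (fun n => c * f n) @ \oo --> c * a.
Proof. by move=> fa; exact: cvgMr. Qed.

Lemma ord3_neq (i j : 'I_3) : i != j -> i = j + 1 \/ i = j + 2.
Proof.
have [e1 e2 e3 e4 [e5 e6]] := ord3_succ 0.
by case: (ord3P i) => ->; case: (ord3P j) => ->; rewrite ?eqxx // !(e1, e2, e3, e4, e5, e6); auto.
Qed.

Lemma lam_bound_compact (B : R) : compact [set x | forall i, `|lam i x| <= B].
Proof.
pose b := B * tri_bound P.
apply: subclosed_compact (@compact_box2 _ (- b) b (- b) b) _.
  have -> : [set x | forall i, `|lam i x| <= B] =
      [set x | `|lam 0 x| <= B] `&` [set x | `|lam 1 x| <= B] `&` [set x | `|lam 2%:R x| <= B].
    apply/seteqP; split=> x; first by move=> h; split; [split|]; exact: h.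
    by move=> [[h0 h1] h2] j; case: (ord3P j) => ->.
  have o j : closed [set x | `|lam j x| <= B].
    apply: (@closed_comp _ _ (fun x => `|lam j x|) [set s | s <= B]) => [x _|]; last exact: closed_le.
    by apply: cvg_norm; exact: lam_continuous.
  by apply: closedI => //; exact: closedI.
move=> x h; rewrite /mkset -!ler_norml (lam_sum aiP x) /b /tri_bound.
have B0 : 0 <= B by exact: le_trans (normr_ge0 _) (h 0).
have key i (c e : R) : `|c| <= e -> `|lam i x * c| <= B * e.
  by move=> ce; rewrite normrM ler_pM.
split.
  rewrite (_ : (\sum_j lam j x *: P j).1 = \sum_j lam j x * (P j).1); last by rewrite !sum3.
  rewrite mulr_sumr; apply: le_trans (ler_norm_sum _ _ _) _; apply: ler_sum => i _.
  by apply: key; rewrite lerDl.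
rewrite (_ : (\sum_j lam j x *: P j).2 = \sum_j lam j x * (P j).2); last by rewrite !sum3.
rewrite mulr_sumr; apply: le_trans (ler_norm_sum _ _ _) _; apply: ler_sum => i _.
by apply: key; rewrite lerDr.
Qed.

Section Localizer.
Variables (j : 'I_3) (d r : R).
Hypotheses (d0 : 0 < d) (r0 : 0 < r).

(* Localizes to a neighbourhood of the j-th side away from its end points. *)
Definition localizer (x : R2) : R :=
  step (lam (j + 1) x * (2 / d)) * step (lam (j + 2) x * (2 / d)) *
  (1 + - step (lam j x * lam j x * (r ^- 2))).

Lemma localizer_smooth : smooth localizer.
Proof.
move=> n.
have sl i : of_class_C n (lam i) by exact: of_class_C_affine_form.
have s1 i : of_class_C n (fun x => step (lam i x * (2 / d))).
  apply: (@of_class_C_step _ n (fun x => lam i x * (2 / d))).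
  by apply: of_class_CM => //; exact: of_class_C_cst.
have s2 : of_class_C n (fun x => step (lam j x * lam j x * (r ^- 2))).
  apply: (@of_class_C_step _ n (fun x => lam j x * lam j x * (r ^- 2))).
  by apply: of_class_CM; [exact: of_class_CM|exact: of_class_C_cst].
apply: (of_class_CM (of_class_CM (s1 _) (s1 _))).
exact: (of_class_CD (of_class_C_cst _ _) (of_class_CN s2)).
Qed.

(** The factors in the two other coordinates rise between d / 2 and d, and the last one falls while
    lam j ^ 2 grows from r ^ 2 to 2 r ^ 2; squaring treats both signs of lam j smoothly. The bound 2
    r leaves some room. *)
Lemma localizer_neq0 x : localizer x != 0 ->
  (forall i, i != j -> d / 2 <= lam i x) /\ `|lam j x| <= 2 * r.
Proof.
move=> nz.
have key i : step (lam i x * (2 / d)) != 0 -> d / 2 <= lam i x.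
  apply: contraNle => h; apply/eqP/step_eq0.
  by rewrite mulrA ler_pdivrMr // mul1r -ler_pdivlMr // ltW.
split.
  move=> i /ord3_neq[] ->; apply: key; apply: contra_neq nz => e; by rewrite /localizer e ?(mul0r, mulr0).
rewrite leNgt; apply: contraNN nz => h; apply/eqP; rewrite /localizer.
rewrite [step (lam j x * lam j x * r ^- 2)]step_eq1 ?subrr ?mulr0 //.
rewrite ler_pdivlMr ?exprn_gt0 // -expr2.
have h2 : (2 * r) ^+ 2 <= `|lam j x| ^+ 2.
  by rewrite ler_sqr ?nnegrE ?(ltW h) //; exact: mulr_ge0 (ler0n _ 2) (ltW r0).
rewrite real_normK ?num_real // in h2; apply: le_trans h2.
by have := sqr_ge0 r; rewrite exprMn; lra.
Qed.

Lemma localizer_eq1 x : (forall i, i != j -> d <= lam i x) -> `|lam j x| <= r -> localizer x = 1.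
Proof.
move=> h hj; rewrite /localizer.
have key i : i != j -> step (lam i x * (2 / d)) = 1.
  by move=> /h hi; apply: step_eq1; rewrite mulrA ler_pdivlMr // mulrC ler_pM2r.
have [e1 e2 e3 e4 [e5 e6]] := ord3_succ 0.
rewrite !key; last 2 first.
- by case: (ord3P j) => ->; rewrite !(e1, e2, e3, e4, e5, e6).
- by case: (ord3P j) => ->; rewrite !(e1, e2, e3, e4, e5, e6).
rewrite step_eq0 ?subr0 ?oppr0 ?addr0 ?mulr1 //.
by rewrite ler_pdivrMr ?exprn_gt0 // mul1r -expr2 -real_normK ?num_real // ler_sqr ?nnegrE // ltW.
Qed.

End Localizer.

Lemma side_mean_near0 j f : (exists2 d : R, 0 < d & forall x, T x -> lam j x < d -> f x = 0) ->
  \forall n \near \oo, side_mean P j n f = 0.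
Proof.
move=> [d d0 h]; apply: filterS (near_small d0) => n nd.
rewrite -[RHS](_ : \int[mu]_(x in T) (0 : R) = 0); last by rewrite /Rintegral integral0.
apply: eq_Rintegral => x; rewrite inE => Tx.
have [->|/stepn'_neq0 la] := eqVneq (stepn' n (lam j x)) 0; first by rewrite mulr0.
by rewrite h ?mul0r // (le_lt_trans la).
Qed.

(** The localized test function psi becomes a function on Omega straddling the shared side. The weak
    derivative on Omega makes the Green terms of the two tiles cancel; as their normals are
    opposite, the side means from both tiles agree in the limit. The neighbour is tested with the
    reflected psi, which [side_mean_reflection] replaces by psi. *)
Lemma trace0_gluing u (g : 'I_2 -> R2 -> R) :
  int_on Omega u -> (forall a, int_on Omega (g a)) ->
  (forall a, weakd Omega a u (g a)) ->
  forall j k, trace0 P j (fun x => u (tau k x) - u (tau (p j k) x)).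
Proof.
move=> iu ig wu j k phi sphi [d d0 vphi].
have mT := triangle_measurable aiP.
have [pk|nk] := eqVneq (p j k) k.
  apply: cvg_near_cst; apply: nearW => n; rewrite /side_mean.
  rewrite -[RHS](_ : \int[mu]_(x in T) (0 : R) = 0); last by rewrite /Rintegral integral0.
  by apply: eq_Rintegral => x _; rewrite pk subrr !mul0r.
pose c i := 2 / gnorm2 P j * edot (lam_grad P i) (lam_grad P j).
pose C := \sum_i `|c i| + 1.
have C0 : 0 < C by rewrite ltr_wpDl // sumr_ge0.
have cC i : `|c i| <= C by rewrite /C (bigD1 i) //= -addrA lerDl addr_ge0 // sumr_ge0.
(* On S, where |lam j| <= 2 r, reflecting changes the other coordinates by at most 2 r C = d / 4, so
   they stay above d / 4. *)
pose r := d / (8 * C).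
have r0 : 0 < r by rewrite divr_gt0 // mulr_gt0.
have rC : 2 * r * C = d / 4 by rewrite /r; field; exact: lt0r_neq0.
pose psi x := phi x * localizer j d r x.
have spsi : smooth psi by move=> n; apply: of_class_CM; [exact: sphi|exact: localizer_smooth].
pose S := [set x | (forall i, i != j -> d / 2 <= lam i x) /\ `|lam j x| <= 2 * r].
have psiS x : psi x != 0 -> S x.
  by rewrite /psi mulf_eq0 negb_or => /andP[_]; exact: localizer_neq0.
have Srho x : S x -> forall i, i != j -> d / 4 <= lam i (side_reflection P j x).
  move=> [h1 h2] i ij; rewrite lam_reflection_neq // -/(c i).
  have : `|lam j x * c i| <= d / 4.
    by rewrite -rC normrM ler_pM.
  rewrite ler_norml => /andP[_ h3]; have := h1 i ij; move: h3; set z := lam j x * c i.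
  by lra.
have S1 i x : S x -> i != j -> 0 < lam i x by move=> [h _] ij; apply: lt_le_trans (h i ij); rewrite divr_gt0.
have STpos x : S x -> 0 < lam j x -> T x.
  move=> Sx l0; rewrite triangleE // => i; have [->//|ij] := eqVneq i j; exact: S1.
have STneg x : S x -> lam j x < 0 -> T (side_reflection P j x).
  move=> Sx l0; rewrite triangleE // => i; have [->|ij] := eqVneq i j; first by rewrite lam_reflection // oppr_gt0.
  by apply: lt_le_trans (Srho x Sx i ij); rewrite divr_gt0.
have tpk x : tau (p j k) x = tau k (side_reflection P j x).
  by have := gd_reflection gd nk => ->.
have tpk' x : tau k x = tau (p j k) (side_reflection P j x).
  by rewrite tpk side_reflectionK.
have SO : tau k @` S `<=` Omega.
  move=> _ [x Sx <-]; have [l0|l0|l0] := ltgtP 0 (lam j x).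
  - by apply: (gd_tile gd); exists x => //; exact: STpos.
  - by rewrite tpk'; apply: (gd_tile gd); exists (side_reflection P j x) => //; exact: STneg.
  - apply: (gd_side gd nk); exists x => //; apply: open_side_lam => //.
    by move=> i ij; exact: S1.
have cS : compact S.
  apply: subclosed_compact (@lam_bound_compact (1 + 2 * r)) _.
    have -> : S = [set x | d / 2 <= lam (j + 1) x] `&` [set x | d / 2 <= lam (j + 2) x] `&` [set x | `|lam j x| <= 2 * r].
      have [e1 e2 e3 e4 [e5 e6]] := ord3_succ 0.
      apply/seteqP; split=> x.
        move=> [h1 h2]; split => //; split; apply: h1;
        by case: (ord3P j) => ->; rewrite !(e1, e2, e3, e4, e5, e6).
      by move=> [[h0 h1] h2]; split => // i /ord3_neq[] ->.
    have o i : closed [set x | d / 2 <= lam i x].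
      by apply: (@closed_comp _ _ (lam i) [set t | d / 2 <= t]) => [x _|]; [exact: lam_continuous|exact: closed_ge].
    apply: closedI; first exact: closedI.
    apply: (@closed_comp _ _ (fun x => `|lam j x|) [set s | s <= 2 * r]) => [x _|]; last exact: closed_le.
    by apply: cvg_norm; exact: lam_continuous.
  move=> x [h1 h2] i.
  have [->|ij] := eqVneq i j; first by apply: le_trans h2 _; rewrite lerDr.
  have li := h1 i ij; rewrite ger0_norm; last by rewrite (le_trans _ li) // divr_ge0 // ltW.
  have := sum_lam aiP x; rewrite (bigD1 j) //= (bigD1 i) //=.
  set s := \sum_(_ | _) _ => E.
  have s0 : 0 <= s.
    by apply: sumr_ge0 => l /andP[lj _]; apply: le_trans (h1 l lj); rewrite divr_ge0 // ltW.
  by move: h2; rewrite ler_norml => /andP[h3 h4]; lra.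
have [Phi tPhi PhiE] := test_function_push spsi cS psiS SO.
have sPhi : smooth Phi by case: tPhi.
have PhiP : Phi \o tau (p j k) = psi \o side_reflection P j.
  by apply/funext => x; rewrite /= tpk -PhiE.
have Phi0 l : l != k -> l != p j k -> forall x, T x -> Phi (tau l x) = 0.
  move=> lk lp x Tx; apply/eqP/negPn/negP => nz.
  have [g' [ig' gK Kg]] := isometry_inverse (gd_isometry gd k).
  pose z := g' (tau l x).
  have tz : tau k z = tau l x by rewrite /z Kg.
  have Sz : S z by apply: psiS; rewrite -PhiE /= tz.
  have tl : tile P tau l (tau k z) by rewrite tz; exists x.
  have notT y : T y -> tile P tau l (tau k y) -> False.
    move=> Ty ty; have : (tile P tau l `&` tile P tau k) (tau k y) by split => //; exists y.
    by rewrite (gd_disjoint gd lk).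
  have [l0|l0|l0] := ltgtP 0 (lam j z).
  - exact: (notT z (STpos z Sz l0)).
  - have : (tile P tau l `&` tile P tau (p j k)) (tau k z).
      by split => //; exists (side_reflection P j z); [exact: STneg|rewrite -tpk'].
    by rewrite (gd_disjoint gd lp).
  (* The remaining case is a point of the side itself: a small move towards [P j] enters the
     triangle without leaving the open tile l, against disjointness. *)
  pose y (e : R) : R2 := (1 - e) *: z + e *: P j.
  have cy : {for 0, continuous (fun e : R => tau k (y e))}.
    apply: (@continuous_comp _ _ _ y (tau k)); last exact: (isometry_continuous (gd_isometry gd k)).
    apply: cvgD; apply: cvgZr_tmp.
      by apply: cvgB; [exact: cvg_cst|exact: cvg_id].
    exact: cvg_id.
  have y0 : y 0 = z by rewrite /y subr0 scale1r scale0r addr0.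
  have /cy : nbhs (tau k (y 0)) (tile P tau l).
    by rewrite y0; apply: open_nbhs_nbhs; split => //; exact: (tile_open aiP gd).
  move=> /nbhs_ballP[e /= e0 he].
  pose e' := Num.min (e / 2) (1 / 2).
  have e'0 : 0 < e' by rewrite lt_min !divr_gt0.
  have e'1 : e' < 1 by rewrite gt_min; apply/orP; right; lra.
  have e'e : e' < e by rewrite gt_min; apply/orP; left; lra.
  apply: (notT (y e')); last first.
    by apply: he; rewrite /ball /= sub0r normrN gtr0_norm.
  rewrite triangleE // => i; rewrite lam_segment // lam_vertex //.
  have [->|ij] := eqVneq i j; first by rewrite -l0 mulr0 add0r mulr1.
  by rewrite mulr0 addr0; apply: mulr_gt0; [rewrite subr_gt0|exact: S1].
pose J n l f := side_mean P l n f.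
pose uk := u \o tau k; pose up := u \o tau (p j k).
have iuk : int_on T uk by exact: int_on_tile.
have iup : int_on T up by exact: int_on_tile.
have spr : smooth (psi \o side_reflection P j).
  by rewrite -PhiP; exact: smooth_tile.
have psi_edge : exists2 e : R, 0 < e & forall x, T x -> forall i, i != j -> lam i x < e ->
    psi x = 0 /\ psi (side_reflection P j x) = 0.
  exists (d / 4); first by rewrite divr_gt0.
  move=> x Tx i ij li; split; apply/eqP/negPn/negP => /psiS Sx.
    by have := Sx.1 i ij; move: li d0; lra.
  by have := Srho _ Sx i ij; rewrite side_reflectionK //; move: li; lra.
have vfree f : (exists2 e : R, 0 < e & forall x, T x -> forall i, i != j -> lam i x < e -> f x = 0) ->
    vertex_free P f.
  move=> [e e0 h]; exists e => // x Tx a b ab la lb.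
  have [aj|aj] := eqVneq a j; last exact: (h x Tx a aj la).
  by apply: (h x Tx b _ lb); rewrite -aj eq_sym.
have edge1 : exists2 e : R, 0 < e & forall x, T x -> forall i, i != j -> lam i x < e -> psi x = 0.
  by have [e e0 h] := psi_edge; exists e => // x Tx i ij li; have [] := h x Tx i ij li.
have edge2 : exists2 e : R, 0 < e & forall x, T x -> forall i, i != j -> lam i x < e ->
    (psi \o side_reflection P j) x = 0.
  by have [e e0 h] := psi_edge; exists e => // x Tx i ij li; have [] := h x Tx i ij li.
have lim1 l w f a : int_on T w -> (w = u \o tau l) -> smooth f ->
    (exists2 e : R, 0 < e & forall x, T x -> forall i, i != j -> lam i x < e -> f x = 0) ->
    (fun n => tile_normal l j a * J n j (fun x => w x * f x)) @ \oo -->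
    - \sum_q m l a q * defect w (pull_grad g l) q f.
  move=> iw wE sf ef.
  have c1 q : (fun n => m l a q * \sum_i lg i q * J n i (fun x => w x * f x)) @ \oo -->
      m l a q * - defect w (pull_grad g l) q f.
    apply: cvgMr; apply: (side_mean_cvg aiP iw _ _ sf (vfree _ ef)); first exact: int_pull_grad.
    by rewrite wE; exact: weakd_tile.
  have c2 := cvgn_add (c1 0) (c1 1).
  have -> : - \sum_q m l a q * defect w (pull_grad g l) q f =
      m l a 0 * - defect w (pull_grad g l) 0 f + m l a 1 * - defect w (pull_grad g l) 1 f.
    by rewrite sum2; ring.
  apply: cvg_trans c2; apply: near_eq_cvg.
  have z i : i != j -> \forall n \near \oo, J n i (fun x => w x * f x) = 0.
    move=> ij; apply: side_mean_near0; have [e e0 h] := ef; exists e => // x Tx li.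
    by rewrite (h x Tx i ij li) mulr0.
  have zz : \forall n \near \oo, forall i, i != j -> J n i (fun x => w x * f x) = 0.
    have z' i : \forall n \near \oo, i != j -> J n i (fun x => w x * f x) = 0.
      by have [->|ij] := eqVneq i j; [exact: nearW|apply: filterS (z i ij)].
    apply: filterS3 (z' 0) (z' 1) (z' 2%:R) => n h0 h1 h2 i.
    by case: (ord3P i) => ->.
  apply: filterS zz => n h.
  have s q : \sum_i lg i q * J n i (fun x => w x * f x) = lg j q * J n j (fun x => w x * f x).
    by rewrite (bigD1 j) //= big1 ?addr0 // => i ij; rewrite h // mulr0.
  by rewrite /= !s /tile_normal sum2; ring.
(* A nonzero component of the normal, by which the limit relation can be divided. *)
have [a na] := tile_normal_neq0 k j.
have L1 := lim1 k uk psi a iuk erefl spsi edge1.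
have L2 := lim1 (p j k) up _ a iup erefl spr edge2.
have E0 : \sum_q m k a q * defect uk (pull_grad g k) q psi +
    \sum_q m (p j k) a q * defect up (pull_grad g (p j k)) q (psi \o side_reflection P j) = 0.
  have := weak_defect_tiles a iu ig sPhi.
  rewrite (wu a _ tPhi) addNr (bigD1 k) //= (bigD1 (p j k)) //= PhiE PhiP.
  set s := (X in _ + (_ + X)); have -> : s = 0.
    apply: big1 => l /andP[lk lp]; apply: big1 => q _.
    by rewrite defect0 ?mulr0 // => x; exact: Phi0.
  move=> E; apply: esym; apply: etrans E _; congr (_ + _); exact: addr0.
have L3 : (fun n => J n j (fun x => uk x * psi x) - J n j (fun x => up x * psi (side_reflection P j x))) @ \oo --> (0 : R).
  have := cvgn_mul (c := (tile_normal k j a)^-1) (cvgn_add L1 L2).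
  rewrite -opprD E0 oppr0 mulr0.
  apply: cvg_trans; apply: near_eq_cvg; apply: nearW => n /=.
  by rewrite (tile_normal_partner a nk) mulNr -mulrBr mulKf.
have L4 := side_mean_reflection aiP j iup (spsi 1%N).
have := cvgn_add L3 (cvgn_mul (c := -1) L4); rewrite mulr0 addr0.
apply: cvg_trans; apply: near_eq_cvg.
have rd : 0 < Num.min r d by rewrite lt_min r0 d0.
apply: filterS (near_small rd) => n; rewrite lt_min => /andP[nr nd] /=.
have cpsi := smooth_continuous spsi; have cpr := smooth_continuous spr.
have e1 : side_mean P j n (fun x => up x * (psi x - psi (side_reflection P j x))) =
    J n j (fun x => up x * psi x) - J n j (fun x => up x * psi (side_reflection P j x)).
  rewrite -mulN1r -side_meanZ // -?side_meanD //.
  - by apply: eq_Rintegral => x _; rewrite mulrBr mulN1r.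
  - exact: (int_T aiP iup cpsi).
  - by apply: int_onZ => //; exact: (int_T aiP iup cpr).
  - exact: (int_T aiP iup cpr).
rewrite e1.
have alg (x y z : R) : x - y + -1 * (z - y) = x - z by ring.
have alg2 (x y z s : R) : (x * z + -1 * (y * z)) * s = (x - y) * z * s by ring.
rewrite alg.
rewrite -mulN1r -side_meanZ // -?side_meanD //.
- apply: eq_side_mean => x Tx.
  have [->|/stepn'_neq0 la] := eqVneq (stepn' n (lam j x)) 0; first by rewrite !mulr0.
  have lpos : 0 < lam j x by move: Tx; rewrite triangleE.
  (* Where the bump is nonzero, lam j is below both r and d. Then psi = phi: if another coordinate
     is below d both vanish, otherwise the localizer is 1. *)
  suff <- : psi x = phi x by exact: alg2.
  have ljd : lam j x < d by exact: le_lt_trans la nd.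
  have [[i [ij li]]|ni] := pselect (exists i, i != j /\ lam i x < d).
    by rewrite /psi (vphi x Tx i j ij li ljd) mul0r.
  rewrite /psi localizer_eq1 ?mulr1 //.
    by move=> i ij; rewrite leNgt; apply/negP => li; apply: ni; exists i.
  by rewrite gtr0_norm // (le_trans la) // ltW.
- exact: (int_T aiP iuk cpsi).
- by apply: int_onZ => //; exact: (int_T aiP iup cpsi).
- exact: (int_T aiP iup cpsi).
Qed.

Lemma cvg_sum_ord n (F : 'I_n -> nat -> R) (l : 'I_n -> R) :
  (forall i, F i @ \oo --> l i) -> (fun k => \sum_i F i k) @ \oo --> \sum_i l i.
Proof.
elim: n F l => [|n IH] F l h.
  rewrite big_ord0; apply: cvg_near_cst; apply: nearW => k.
  by rewrite big_ord0.
rewrite big_ord_recl; under eq_fun do rewrite big_ord_recl.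
by apply: cvgD; [exact: h|exact: (IH (fun i => F (lift ord0 i)))].
Qed.

Lemma compact_lam_gt0 (K : set R2) (f : R2 -> R) : compact K -> continuous f ->
  (forall x, K x -> 0 < f x) -> exists2 d : R, 0 < d & forall x, K x -> d <= f x.
Proof.
move=> cK cf f0.
have cfK : compact (f @` K) by apply: continuous_compact => //; exact: continuous_subspaceT.
have clo : closed (f @` K) by apply: compact_closed => //; exact: norm_hausdorff.
have : nbhs 0 (~` (f @` K)).
  apply: open_nbhs_nbhs; split; first exact: closed_openC.
  by move=> [x /f0 + E]; rewrite E ltxx.
move=> /nbhs_ballP[d /= d0 hd]; exists d => // x Kx.
rewrite leNgt; apply/negP => h; apply: (hd (f x)); last by exists x.
by rewrite /ball /= sub0r normrN gtr0_norm // f0.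
Qed.

(** The defects of the tiles are limits of side means. On unshared sides these vanish, as phi is 0
    near them; on shared sides they cancel in pairs, the normals being opposite and the traces
    equal. *)
Lemma weakd_gluing u (g : 'I_2 -> R2 -> R) :
  int_on Omega u -> (forall a, int_on Omega (g a)) ->
  (forall k q, weakd T q (u \o tau k) (pull_grad g k q)) ->
  (forall j k, trace0 P j (fun x => u (tau k x) - u (tau (p j k) x))) ->
  forall a, weakd Omega a u (g a).
Proof.
move=> iu ig wt tr a phi tphi; have [sphi cphi phiO] := tphi.
have mT := triangle_measurable aiP.
apply/eqP; rewrite -subr_eq0 opprK (weak_defect_tiles a iu ig sphi); apply/eqP.
pose f k := phi \o tau k; pose w k := u \o tau k.
have sf k : smooth (f k) by exact: smooth_tile.
have cf k := smooth_continuous (sf k).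
have iw k : int_on T (w k) by exact: int_on_tile.
pose K k := tri_cl P `&` tau k @^-1` support_of phi.
have cK k : compact (K k).
  apply: compact_closedI; first exact: tri_cl_compact.
  apply: closed_comp; last exact: closed_closure.
  by move=> x _; exact: (isometry_continuous (gd_isometry gd k)).
have fK k x : T x -> f k x != 0 -> K k x.
  by move=> Tx nz; split; [exact: sub_tri_cl|exact: subset_closure].
have vf k : vertex_free P (f k).
  (* The vertex is not in Omega, hence not in the support of phi, and 1 - lam i has a positive lower
     bound on the compact set K k. *)
  have key i : exists2 d : R, 0 < d & forall x, K k x -> d <= 1 - lam i x.
    apply: compact_lam_gt0 => //.
      by move=> x; apply: cvgB; [exact: cvg_cst|exact: lam_continuous].
    move=> x [cx sx]; rewrite subr_gt0 lt_neqAle lam_le1 // andbT; apply/eqP => l1.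
    apply: (gd_vertex gd (k := k) (i := i)); rewrite -(_ : x = P i); first exact: phiO.
    apply: vertex_lam => // j ji.
    have := sum_lam aiP x; rewrite (bigD1 i) //= l1 (bigD1 j) //=.
    set s := \sum_(_ | _) _; have s0 : 0 <= s by apply: sumr_ge0.
    by have := cx j => ? ?; apply/eqP; rewrite eq_le; apply/andP; split; lra.
  have [d0 d00 h0] := key 0; have [d1 d10 h1] := key 1; have [d2 d20 h2] := key 2%:R.
  (* If two coordinates were below d, the third would be above 1 - 2 d, too close to its vertex. *)
  pose d := Num.min d0 (Num.min d1 d2) / 2.
  have dP : [/\ 0 < d, 2 * d <= d0, 2 * d <= d1 & 2 * d <= d2].
    have -> : 2 * d = Num.min d0 (Num.min d1 d2) by rewrite /d; field.
    by rewrite !ge_min !lexx ?orbT /d divr_gt0 // !lt_min d00 d10 d20.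
  have [dp hd0 hd1 hd2] := dP; exists d => // x Tx i j ij li lj.
  apply/eqP/negPn/negP => /(fK _ _ Tx) Kx.
  have := sum_lam aiP x; rewrite sum3.
  have := h0 x Kx; have := h1 x Kx; have := h2 x Kx.
  by case: (ord3P i) ij li => ->; case: (ord3P j) lj => ->; rewrite ?eqxx // => *; lra.
have bd j k : p j k = k -> exists2 d : R, 0 < d & forall x, T x -> lam j x < d -> f k x = 0.
  move=> pk; have [d d0 hd] : exists2 d : R, 0 < d & forall x, K k x -> d <= lam j x.
    apply: compact_lam_gt0 => //; first exact: lam_continuous.
    move=> x [cx sx]; rewrite lt_neqAle cx andbT eq_sym; apply/eqP => l0.
    have : (tau k @` side P j `&` Omega) (tau k x).
      by split; [exists x => //; exact/side_lam|exact: phiO].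
    by rewrite (gd_boundary gd pk).
  exists d => // x Tx; apply: contraPP => /eqP /(fK _ _ Tx) /hd.
  by rewrite leNgt => /negP.
pose A j k n := tile_normal k j a * side_mean P j n (fun x => w k x * f k x).
have L1 : (fun n => \sum_k \sum_j A j k n) @ \oo -->
    \sum_k - \sum_q m k a q * defect (w k) (pull_grad g k) q (f k).
  apply: cvg_sum_ord => k.
  have c1 q : (fun n => m k a q * \sum_j lg j q * side_mean P j n (fun x => w k x * f k x)) @ \oo -->
      m k a q * - defect (w k) (pull_grad g k) q (f k).
    apply: cvgMr; apply: (side_mean_cvg aiP (iw k) _ (wt k q) (sf k) (vf k)).
    exact: int_pull_grad.
  have := cvgn_add (c1 0) (c1 1).
  rewrite (_ : _ + _ = - \sum_q m k a q * defect (w k) (pull_grad g k) q (f k)); last by rewrite sum2; ring.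
  apply: cvg_trans; apply: near_eq_cvg; apply: nearW => n /=.
  have gen (M : 'M[R]_2) (G : 'I_3 -> 'I_2 -> R) (J : 'I_3 -> R) :
      M a 0 * (\sum_j G j 0 * J j) + M a 1 * (\sum_j G j 1 * J j) =
      \sum_j (\sum_q M a q * G j q) * J j.
    by rewrite !sum3 !sum2; ring.
  exact: (gen (m k) (fun j q => lg j q) (fun j => side_mean P j n (fun x => w k x * f k x))).
have L2 j k : (fun n => A j k n + A j (p j k) n) @ \oo --> (0 : R).
  have [pk|nk] := eqVneq (p j k) k.
    apply: cvg_near_cst; have := @side_mean_near0 j (fun x => w k x * f k x).
    have [d d0 hd] := bd j k pk.
    have h : exists2 d : R, 0 < d & forall x, T x -> lam j x < d -> w k x * f k x = 0.
      by exists d => // x Tx lx; rewrite hd // mulr0.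
    by move=> /(_ h); apply: filterS => n e; rewrite /A pk e mulr0 addr0.
  have fp : f (p j k) = f k \o side_reflection P j.
    by rewrite /f (gd_reflection gd nk).
  have T1 := tr j k (f k) (sf k) (vf k).
  have T2 := side_mean_reflection aiP j (iw (p j k)) (sf k 1%N).
  have := cvgn_mul (c := tile_normal k j a) (cvgn_add T1 T2).
  rewrite addr0 mulr0; apply: cvg_trans; apply: near_eq_cvg; apply: nearW => n /=.
  rewrite /A tile_normal_partner // -side_meanD //; last 2 first.
  - apply: (int_T aiP); last exact: cf.
    by apply: int_onB => //; [exact: iw|exact: (iw (p j k))].
  - apply: (int_T aiP); first exact: iw.
    by move=> x; apply: cvgB; [exact: cf|have := cf (p j k); rewrite fp; exact].
  rewrite mulNr -mulrBr; congr (_ * _).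
  rewrite -[in RHS]mulN1r -side_meanZ //; last by apply: (int_T aiP); [exact: iw|exact: cf].
  rewrite -side_meanD //; last 2 first.
  - by apply: (int_T aiP); [exact: iw|exact: cf].
  - by apply: int_onZ => //; apply: (int_T aiP); [exact: iw|exact: cf].
  by apply: eq_Rintegral => x _; rewrite fp /w /=; ring.
(* As p j is an involution, the sum of the pairs over all k counts every term twice; hence the
   factor 1/2. *)
have L3 : (fun n => \sum_k \sum_j A j k n) @ \oo --> (0 : R).
  have := cvgn_mul (c := 2^-1) (cvg_sum_ord (fun j => cvg_sum_ord (fun k => L2 j k))).
  rewrite big1 ?mulr0; last by move=> j _; rewrite big1.
  apply: cvg_trans; apply: near_eq_cvg; apply: nearW => n /=.
  have E j : \sum_k (A j k n + A j (p j k) n) = 2 * \sum_k A j k n.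
    rewrite big_split /= mulr_natl mulr2n; congr (_ + _).
    by rewrite [RHS](reindex_inj (inv_inj (gd_involutive gd j))).
  rewrite (eq_bigr _ (fun j _ => E j)) -mulr_sumr mulrA mulVf // mul1r.
  exact: exchange_big.
have /eqP := cvgn_unique L1 L3.
by rewrite sumrN oppr_eq0 => /eqP.
Qed.

End GluingTraces.

(** * Uniqueness of weak derivatives *)

Section AeIntegral.
Variable R : realType.
Local Notation mR := (measurableTypeR R).
Local Notation R2 := (R * R)%type.
Local Notation mu := (@leb2 R).
Local Notation meas2 := (@measurable _ (mR * mR)%type).

Lemma ae_on_impl (D : set R2) (Q1 Q2 : R2 -> Prop) :
  (forall x, D x -> Q1 x -> Q2 x) -> ae_on D Q1 -> ae_on D Q2.
Proof.
move=> h /ae_onP n; apply/ae_onP; apply: negligibleS n => x [Dx nQ].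
by split => // /(h x Dx).
Qed.

Lemma ae_on_and (D : set R2) (Q1 Q2 : R2 -> Prop) :
  ae_on D Q1 -> ae_on D Q2 -> ae_on D (fun x => Q1 x /\ Q2 x).
Proof.
move=> /ae_onP n1 /ae_onP n2; apply/ae_onP; apply: negligibleS (negligibleU n1 n2) => x [Dx nQ].
have [q1|q1] := pselect (Q1 x); last by left.
by right; split => // q2; apply: nQ.
Qed.

Lemma ae_on_impl2 (D : set R2) (Q1 Q2 Q3 : R2 -> Prop) :
  (forall x, D x -> Q1 x -> Q2 x -> Q3 x) -> ae_on D Q1 -> ae_on D Q2 -> ae_on D Q3.
Proof. by move=> h a1 a2; apply: ae_on_impl (ae_on_and a1 a2) => x Dx []; exact: h. Qed.

Lemma ae_on_ord (D : set R2) n (Q : 'I_n -> R2 -> Prop) :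
  (forall k, ae_on D (Q k)) -> ae_on D (fun x => forall k, Q k x).
Proof.
move=> h; apply/ae_onP; apply: (@negligibleS _ _ _ mu (\bigcup_k (D `&` ~` Q k))).
  move=> x [Dx /existsNP[k nq]]; by exists k.
by apply: negligible_ord => k; exact/ae_onP.
Qed.

Lemma ae_onT (D : set R2) (Q : R2 -> Prop) : (forall x, D x -> Q x) -> ae_on D Q.
Proof. by move=> h; apply: aeW. Qed.

Import HBNNSimple.

Lemma le_ae_ge0_integral (f g : R2 -> \bar R) : ae_on setT (fun x => f x = g x) ->
  (forall x, (0 <= f x)%E) -> (forall x, (0 <= g x)%E) ->
  (\int[mu]_x f x <= \int[mu]_x g x)%E.
Proof.
move=> [N [mN N0 sN]] f0 g0; rewrite !ge0_integralTE //; apply: ub_ereal_sup => _ [h hf <-].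
have mNC := measurableC mN.
pose h' := mul_nnsfun h (indic_nnsfun R mNC).
have -> : sintegral mu h = sintegral mu h'.
  rewrite -!integralT_nnsfun; apply: ge0_ae_eq_integral => //.
  - by apply/measurable_EFinP; exact: measurable_funP.
  - by apply/measurable_EFinP; exact: measurable_funP.
  - by move=> x _; rewrite lee_fin.
  - by move=> x _; rewrite lee_fin.
  exists N; split => // x /= /not_implyP[_ nE]; apply: contrapT => nN; apply: nE.
  by rewrite mindicE mem_set ?mulr1.
apply: ereal_sup_ubound; exists h' => // x /=; rewrite mindicE.
have [/set_mem nN|_] := boolP (x \in ~` N); last by rewrite mulr0.
rewrite mulr1; suff <- : f x = g x by exact: hf.
by apply: contrapT => nE; apply: nN; apply: sN => /(_ Logic.I).
Qed.

(* No measurability is needed: the integral of a nonnegative function is a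
   supremum over simple functions, which can be cut off on a null set. *)
Lemma eq_ae_integral (D : set R2) (f g : R2 -> \bar R) :
  ae_on D (fun x => f x = g x) -> (\int[mu]_(x in D) f x = \int[mu]_(x in D) g x)%E.
Proof.
have key (f' g' : R2 -> \bar R) : ae_on D (fun x => f' x = g' x) ->
    (forall x, (0 <= f' x)%E) -> (forall x, (0 <= g' x)%E) ->
    (\int[mu]_(x in D) f' x = \int[mu]_(x in D) g' x)%E.
  move=> e f0 g0; rewrite integral_mkcond [RHS]integral_mkcond.
  have e1 : ae_on setT (fun x => (f' \_ D) x = (g' \_ D) x).
    move: e => /ae_onP n; apply/ae_onP; apply: negligibleS n => x [_]; rewrite /= !patchE.
    by case: ifP => // /set_mem Dx; split.
  have p0 (h : R2 -> \bar R) : (forall x, (0 <= h x)%E) -> forall x, (0 <= (h \_ D) x)%E.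
    by move=> h0 x; rewrite patchE; case: ifP.
  apply/eqP; rewrite eq_le; apply/andP; split; apply: le_ae_ge0_integral; try exact: p0.
    exact: e1.
  by apply: ae_on_impl e1.
move=> fg; rewrite integralE [RHS]integralE; congr (_ - _)%E; apply: key => [|x|x];
  rewrite ?funepos_ge0 ?funeneg_ge0 //.
  by apply: ae_on_impl fg => x _; rewrite !funeposE => ->.
by apply: ae_on_impl fg => x _; rewrite !funenegE => ->.
Qed.

Lemma eq_ae_Rintegral (D : set R2) (f g : R2 -> R) :
  ae_on D (fun x => f x = g x) -> \int[mu]_(x in D) f x = \int[mu]_(x in D) g x.
Proof.
move=> fg; rewrite /Rintegral; congr fine; apply: eq_ae_integral.
by apply: ae_on_impl fg => x _ ->.
Qed.

Lemma weakd_ae (D : set R2) i (u g u' g' : R2 -> R) : weakd D i u g ->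
  ae_on D (fun x => u x = u' x) -> ae_on D (fun x => g x = g' x) -> weakd D i u' g'.
Proof.
move=> w uu gg phi tphi; have := w phi tphi; congr (_ = - _); apply: eq_ae_Rintegral.
  by apply: ae_on_impl uu => x _ ->.
by apply: ae_on_impl gg => x _ ->.
Qed.

Lemma test_function_bounded (D : set R2) (phi : R2 -> R) : test_function D phi ->
  [/\ continuous phi, exists M : R, forall x, `|phi x| <= M,
    forall i, continuous (fun x => 'D_(basis_vec R i) phi x) &
    forall i, exists M : R, forall x, `|'D_(basis_vec R i) phi x| <= M].
Proof.
move=> [sphi cphi _]; have cc := smooth_continuous sphi.
have cd i := smooth_continuous (smooth_derive i sphi).
have [M M0 hM] := continuous_bounded cphi cc.
split => //.
  exists M => x; have [->|nz] := eqVneq (phi x) 0; first by rewrite normr0.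
  by apply: hM; apply: subset_closure.
move=> i; have [N N0 hN] := continuous_bounded cphi (cd i).
exists N => x; have [sx|nsx] := pselect (support_of phi x); first exact: hN.
suff -> : 'D_(basis_vec R i) phi x = 0 by rewrite normr0.
have nz : \forall y \near x, phi y = 0.
  have : nbhs x (~` support_of phi).
    by apply: open_nbhs_nbhs; split => //; apply: closed_openC; exact: closed_closure.
  apply: filterS => y ny; apply/eqP/negPn/negP => h; apply: ny; exact: subset_closure.
by rewrite (near_eq_derive (g := cst 0)) ?derive_cst.
Qed.

Lemma int_on_test (D : set R2) (u phi : R2 -> R) : meas2 D -> int_on D u -> test_function D phi ->
  int_on D (fun x => u x * phi x) /\
  forall i, int_on D (fun x => u x * 'D_(basis_vec R i) phi x).
Proof.
move=> mD iu /test_function_bounded[c [M hM] cd hd]; split.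
  by apply: (int_onM mD iu c (M := M)) => x _.
by move=> i; have [N hN] := hd i; apply: (int_onM mD iu (cd i) (M := N)) => x _.
Qed.

Lemma weakd_lin (D : set R2) i n (c : 'I_n -> R) (u g : 'I_n -> R2 -> R) : meas2 D ->
  (forall l, int_on D (u l)) -> (forall l, int_on D (g l)) ->
  (forall l, weakd D i (u l) (g l)) ->
  weakd D i (fun x => \sum_l c l * u l x) (fun x => \sum_l c l * g l x).
Proof.
move=> mD iu ig w phi tphi.
have tu l := int_on_test mD (iu l) tphi; have tg l := int_on_test mD (ig l) tphi.
transitivity (\int[mu]_(x in D) \sum_l c l * (u l x * 'D_(basis_vec R i) phi x)).
  by apply: eq_Rintegral => x _; rewrite mulr_suml; apply: eq_bigr => l _; rewrite mulrA.
rewrite Rint_sum //; last by move=> l; apply: int_onZ => //; exact: (tu l).2.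
transitivity (- \int[mu]_(x in D) \sum_l c l * (g l x * phi x)); last first.
  by congr (- _); apply: eq_Rintegral => x _; rewrite mulr_suml; apply: eq_bigr => l _; rewrite mulrA.
rewrite Rint_sum //; last by move=> l; apply: int_onZ => //; exact: (tg l).1.
rewrite -sumrN; apply: eq_bigr => l _.
rewrite RintegralZl //; last exact: (tu l).2.
by rewrite RintegralZl ?w ?mulrN //; exact: (tg l).1.
Qed.

End AeIntegral.

(** * Transfer of weak derivatives by a mixing matrix *)

Section Transfer.
Variable R : realType.
Local Notation R2 := (R * R)%type.
Variables (P : 'I_3 -> R2) (aiP : affinely_independent P).
Local Notation T := (triangle P).

Lemma trace0_ae j (d d' : R2 -> R) : trace0 P j d -> ae_on T (fun x => d x = d' x) ->
  trace0 P j d'.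
Proof.
move=> td dd phi sphi vphi; have := td phi sphi vphi.
rewrite (_ : (fun n => side_mean P j n (fun x => d' x * phi x)) =
  (fun n => side_mean P j n (fun x => d x * phi x))) //.
apply/funext => n; apply: eq_ae_Rintegral.
by apply: ae_on_impl dd => x _ ->.
Qed.

Lemma trace0_lin j n (c : 'I_n -> R) (d : 'I_n -> R2 -> R) :
  (forall l, int_on T (d l)) -> (forall l, trace0 P j (d l)) ->
  trace0 P j (fun x => \sum_l c l * d l x).
Proof.
move=> idl td phi sphi vphi.
have i l : int_on T (fun x => d l x * phi x).
  by apply: (int_T aiP); [exact: idl|exact: smooth_continuous].
rewrite [X in X @ _ --> _](_ : _ = fun m => \sum_l c l * side_mean P j m (fun x => d l x * phi x)).
  rewrite -[X in _ --> X](_ : \sum_l c l * 0 = 0); last by rewrite big1 // => l _; rewrite mulr0.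
  by apply: cvg_sum_ord => l; apply: cvgn_mul; exact: td.
apply/funext => m.
transitivity (\sum_l side_mean P j m (fun x => c l * (d l x * phi x))); last first.
  by apply: eq_bigr => l _; rewrite side_meanZ //; exact: i.
rewrite -side_mean_sum //; last by move=> l; apply: int_onZ; [exact: triangle_measurable|exact: i].
apply: eq_Rintegral => x _; congr (_ * _); rewrite mulr_suml.
by apply: eq_bigr => l _; rewrite mulrA.
Qed.

Variables (tau tau' : 'I_7 -> R2 -> R2) (p p' : 'I_3 -> 'I_7 -> 'I_7) (Omega Omega' : set R2).
Hypotheses (gd : glued_domain P tau p Omega) (gd' : glued_domain P tau' p' Omega').
Variables (m m' : 'I_7 -> 'M[R]_2) (t t' : 'I_7 -> R2).
Hypothesis tauE : forall k, tau k = affine_map (m k) (t k).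
Hypothesis tauE' : forall k, tau' k = affine_map (m' k) (t' k).
Hypothesis om : forall k, orthogonal2 (m k).
Hypothesis om' : forall k, orthogonal2 (m' k).
Variable N : 'M[R]_7.
Hypothesis NE : forall j k l, N (p' j k) (p j l) = N k l.

(** Gradients are compared after pulling them back to the triangle, because the tiles of the two
    domains are turned differently. Reindexing the second sum by p j turns the jump of the mixture
    into the mixture of the jumps. *)
Lemma weakd_transfer (u w : R2 -> R) (g h : 'I_2 -> R2 -> R) :
  int_on Omega u -> (forall a, int_on Omega (g a)) ->
  int_on Omega' w -> (forall a, int_on Omega' (h a)) ->
  (forall k, ae_on T (fun x => w (tau' k x) = \sum_l N k l * u (tau l x))) ->
  (forall k q, ae_on T (fun x => pull_grad tau' m' h k q x = \sum_l N k l * pull_grad tau m g l q x)) ->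
  (forall a, weakd Omega a u (g a)) -> forall a, weakd Omega' a w (h a).
Proof.
move=> iu ig iw ih wE hE wu.
have iul l := int_on_tile aiP gd l iu.
apply: (weakd_gluing aiP gd' tauE' om' iw ih).
  move=> k q; apply: (weakd_ae (u := fun x => \sum_l N k l * (u \o tau l) x)
      (g := fun x => \sum_l N k l * pull_grad tau m g l q x)).
  - apply: weakd_lin; first exact: triangle_measurable.
    + exact: iul.
    + by move=> l; exact: (int_pull_grad aiP gd).
    + by move=> l; exact: (weakd_tile aiP gd tauE om).
  - by apply: ae_on_impl (wE k) => x _ <-.
  - by apply: ae_on_impl (hE k q) => x _ <-.
move=> j k; apply: (@trace0_ae j (fun x => \sum_l N k l * (u (tau l x) - u (tau (p j l) x)))).
  apply: trace0_lin.
    move=> l; apply: int_onB; first exact: triangle_measurable.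
      exact: iul.
    exact: (iul (p j l)).
  by move=> l; exact: (trace0_gluing aiP gd tauE om iu ig wu).
apply: ae_on_impl2 (wE k) (wE (p' j k)) => x _ -> ->.
rewrite [X in _ = _ - X](reindex_inj (inv_inj (gd_involutive gd j))) /=.
by rewrite -sumrB; apply: eq_bigr => l _; rewrite NE mulrBr.
Qed.

End Transfer.

(** * The fundamental lemma of the calculus of variations *)

Section DuBoisReymond.
Variable R : realType.
Local Notation mR := (measurableTypeR R).
Local Notation R2 := (R * R)%type.
Local Notation mu := (@leb2 R).
Local Notation meas2 := (@measurable _ (mR * mR)%type).

(** The coordinate maps are continuous, so the rectangles generating the measurable sets lie in the
    sigma-algebra of the open sets. This lets the lambda-system argument start from open sets. *)
Lemma sub_gsigma_opens : meas2 `<=` <<s [set A : set R2 | open A] >>.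
Proof.
pose S := <<s [set A : set R2 | open A] >>.
have sS : sigma_algebra setT S by exact: smallest_sigma_algebra.
have half (f : R2 -> mR) : continuous (f : R2 -> R) -> forall A, measurable A -> S (f @^-1` A).
  move=> cf A mA.
  have : (@measurable_fun _ _ (g_sigma_algebraType [set A : set R2 | open A]) mR setT f).
    apply: (measurability _ (RGenOpens.measurableE R)) => //.
    move=> _ [_ [a [b ->]] <-]; rewrite setTI.
    apply: sub_sigma_algebra; by apply: open_comp (interval_open _ _) => // x _; exact: cf.
  by move=> /(_ measurableT A mA); rewrite setTI.
apply: smallest_sub => // A [] [B mB <-]; rewrite setTI.
  by apply: half => // x; exact: cvg_fst.
by apply: half => // x; exact: cvg_snd.
Qed.

(** A product of four steps, one for each edge of the box; it tends to the indicator of the box. *)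
Definition bump (q : R * R * R * R) (n : nat) (x : R2) : R :=
  stepn n (affine_form 1 0 (- q.1.1.1) x) * stepn n (affine_form (- 1) 0 q.1.1.2 x) *
  (stepn n (affine_form 0 1 (- q.1.2) x) * stepn n (affine_form 0 (- 1) q.2 x)).

Lemma stepn_neq0 n (s : R) : stepn n s != 0 -> n.+1%:R^-1 <= s.
Proof. exact: stepn_lam_neq0. Qed.

Lemma bump_itv q n x : 0 <= bump q n x <= 1.
Proof.
have h a b : 0 <= a <= 1 -> 0 <= b <= 1 -> 0 <= (a * b : R) <= 1.
  by move=> /andP[a0 a1] /andP[b0 b1]; rewrite mulr_ge0 // mulr_ile1.
by rewrite /bump; apply: (h); apply: (h); exact: stepn_itv.
Qed.

Lemma test_function_bump (D : set R2) q n : box q `<=` D -> test_function D (bump q n).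
Proof.
move=> qD; pose e : R := n.+1%:R^-1.
have e0 : 0 < e by rewrite invr_gt0.
pose K := [set x : R2 | q.1.1.1 + e <= x.1 <= q.1.1.2 - e /\ q.1.2 + e <= x.2 <= q.2 - e].
have cK : compact K by exact: compact_box2.
have sK : support_of (bump q n) `<=` K.
  have clK : closed K by apply: compact_closed => //; exact: norm_hausdorff.
  rewrite /support_of closureE => x; apply; split => // y /=.
  have nz4 (a b c d : R) : a * b * (c * d) != 0 -> [/\ a != 0, b != 0, c != 0 & d != 0].
    by rewrite !mulf_eq0 !negb_or => /andP[/andP[? ?] /andP[? ?]].
  move=> /nz4[/stepn_neq0 h1 /stepn_neq0 h2 /stepn_neq0 h3 /stepn_neq0 h4].
  move: h1 h2 h3 h4; rewrite -/e /affine_form => h1 h2 h3 h4.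
  by split; apply/andP; split; lra.
split.
- move=> m; have s a b c : of_class_C m (fun x => stepn n (affine_form a b c x)).
    apply: (@of_class_C_step _ m (fun x => n.+1%:R * affine_form a b c x)).
    by apply: of_class_CM; [exact: of_class_C_cst|exact: of_class_C_affine_form].
  by apply: of_class_CM; apply: of_class_CM; exact: s.
- by apply: subclosed_compact cK sK; exact: closed_closure.
- by move=> x /sK[/andP[h1 h2] /andP[h3 h4]]; apply: qD; split; apply/andP; split; lra.
Qed.

Lemma bump_out q n x : ~ box q x -> bump q n x = 0.
Proof.
move=> nb; apply/eqP/negPn/negP => h; apply: nb.
have [_ _ /(_ x)] := test_function_bump n (@subset_refl _ (box q)); apply.
exact: subset_closure.
Qed.

Lemma bump_cvg q x : box q x -> \forall n \near \oo, bump q n x = 1.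
Proof.
move=> [/andP[h1 h2] /andP[h3 h4]].
have c a b c : 0 < affine_form a b c x -> \forall n \near \oo, stepn n (affine_form a b c x) = 1.
  exact: stepn_cvg.
have c1 : \forall n \near \oo, stepn n (affine_form 1 0 (- q.1.1.1) x) = 1.
  by apply: c; rewrite /affine_form; lra.
have c2 : \forall n \near \oo, stepn n (affine_form (- 1) 0 q.1.1.2 x) = 1.
  by apply: c; rewrite /affine_form; lra.
have c3 : \forall n \near \oo, stepn n (affine_form 0 1 (- q.1.2) x) = 1.
  by apply: c; rewrite /affine_form; lra.
have c4 : \forall n \near \oo, stepn n (affine_form 0 (- 1) q.2 x) = 1.
  by apply: c; rewrite /affine_form; lra.
apply: filterS2 (filterI c1 c2) (filterI c3 c4) => n [e1 e2] [e3 e4].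
by rewrite /bump e1 e2 e3 e4 !mulr1.
Qed.

(** The combination is 1 - (1 - f) (1 - g), a smooth substitute for the union of two indicators: it
    keeps values in [0, 1] and equals 1 where f or g does. *)
Lemma test_function_or (D : set R2) f g : test_function D f -> test_function D g ->
  test_function D (fun x => f x + g x + - (f x * g x)).
Proof.
move=> [sf cf fD] [sg cg gD].
have s : support_of (fun x => f x + g x + - (f x * g x)) `<=` support_of f `|` support_of g.
  rewrite /support_of -closureU; apply: closure_subset => x /= nz.
  have [f0|] := eqVneq (f x) 0; last by left.
  by right; move: nz; rewrite f0 add0r mul0r oppr0 addr0.
split.
- move=> m; apply: (@of_class_CD _ m (fun x => f x + g x) (fun x => - (f x * g x))).
    by apply: of_class_CD; [exact: sf|exact: sg].
  by apply: of_class_CN; apply: of_class_CM; [exact: sf|exact: sg].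
- apply: subclosed_compact (compactU cf cg) s; exact: closed_closure.
- by move=> x /s[]; [exact: fD|exact: gD].
Qed.

Fixpoint bumps (F : nat -> R * R * R * R) (n k : nat) : R2 -> R :=
  if k is k'.+1 then
    fun x => bumps F n k' x + bump (F k') n x + - (bumps F n k' x * bump (F k') n x)
  else fun=> 0.

Lemma test_function_open (U D : set R2) : open U -> U `<=` D ->
  exists f : nat -> R2 -> R, [/\ forall n, test_function D (f n),
    forall n x, 0 <= f n x <= 1 & forall x, f ^~ x @ \oo --> (\1_U x : R)].
Proof.
move=> /open_bigcup_box[F UE] UD.
have bD i : box (F i) `<=` D by move=> x bx; apply: UD; rewrite UE; exists i.
(* The number of boxes and the steepness of the steps grow together. *)
exists (fun n => bumps F n n).
have itv n k x : 0 <= bumps F n k x <= 1.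
  elim: k => [|k /andP[h0 h1]] /=; first by rewrite lexx ler01.
  by have /andP[b0 b1] := bump_itv (F k) n x; apply/andP; split; nra.
split.
- move=> n; elim: {2}n => [|k IH] /=; last first.
    by apply: test_function_or => //; exact: test_function_bump.
  have s0 : support_of (fun=> 0 : R) `<=` (set0 : set R2).
    rewrite /support_of (_ : [set x | _] = set0) ?closure0 //.
    by apply/seteqP; split=> // x /=; rewrite eqxx.
  split.
  + by move=> m; exact: of_class_C_cst.
  + by apply: subclosed_compact compact0 s0; exact: closed_closure.
  + by move=> x /s0.
- by move=> n x; exact: itv.
move=> x; rewrite indicE; have [/set_mem|/negP nU] := boolP (x \in U).
  rewrite {1}UE => -[i _ bx]; apply: cvg_near_cst.
  have h n : bump (F i) n x = 1 -> forall k, (i < k)%N -> bumps F n k x = 1.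
    move=> b1; elim=> // k IH; rewrite ltnS leq_eqVlt => /orP[/eqP ik|ik] /=.
      by rewrite -ik b1; ring.
    by rewrite IH //; ring.
  have n1 := bump_cvg bx; have n2 : \forall n \near \oo, (i < n)%N by exact: nbhs_infty_gt.
  by apply: filterS2 n1 n2 => n b1; exact: h.
apply: cvg_near_cst; apply: nearW => n.
elim: {2}n => //= k IH; rewrite IH bump_out; first by ring.
by move=> bx; apply: nU; rewrite inE UE; exists k.
Qed.

(** The sets A for which g * 1_A has integral 0 over D contain the open sets and form a
    lambda-system, both by dominated convergence. So they include all Borel sets, and the sets where
    g > 0 and g < 0 yield that |g| has integral 0. *)
Lemma test_function_ae0 (D : set R2) (g : R2 -> R) : open D -> int_on D g ->
  (forall phi, test_function D phi -> \int[mu]_(x in D) (g x * phi x) = 0) ->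
  ae_on D (fun x => g x = 0).
Proof.
move=> oD ig g0; have mD := open_measurable2 oD.
have mg := int_on_measurable mD ig.
have ign : int_on D (fun x => `|g x|) by exact: integrable_norm.
have m1 A : meas2 A -> @measurable_fun _ _ (mR * mR)%type mR D (fun x => g x * \1_A x).
  by move=> mA; apply: measurable_funM => //; exact: measurable_indic.
have n1 (A : set R2) x : `|g x * \1_A x| <= `|g x|.
  by rewrite indicE; case: (_ \in _); rewrite ?mulr1 // mulr0 normr0.
have i1 A : meas2 A -> int_on D (fun x => g x * \1_A x).
  by move=> mA; apply: (int_on_le mD ign); [exact: m1|move=> x Dx; exact: n1].
pose H := [set A | meas2 A /\ \int[mu]_(x in D) (g x * \1_A x) = 0].
have Hopen : [set A : set R2 | open A] `<=` H.
  move=> A oA; split; first exact: open_measurable2.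
  have [f [tf f01 fl]] := test_function_open (openI oA oD) (@subIsetr _ A D).
  have mf n : @measurable_fun _ _ (mR * mR)%type mR D (fun x => g x * f n x).
    apply: measurable_funM => //; apply: measurable_funTS; apply: continuous_measurable2.
    by have [s _ _] := tf n; exact: smooth_continuous.
  have := @Rint_dominated _ D (fun n x => g x * f n x) (fun x => g x * \1_A x) (fun x => `|g x|) mD mf.
  have -> : (fun n => \int[mu]_(x in D) (g x * f n x)) = fun=> 0 by apply/funext => n; exact: g0.
  move=> h; apply: (@cvgn_unique _ (fun=> 0)); last exact: cvg_cst.
  apply: h => // [x Dx|n x Dx].
    have -> : (\1_A x : R) = \1_(A `&` D) x.
      by rewrite !indicE in_setI (mem_set Dx) andbT.
    by apply: cvgMr; exact: fl.
  rewrite normrM ler_piMr //; have /andP[p0 p1] := f01 n x.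
  by rewrite ger0_norm.
have Hl : lambda_system setT H.
  split=> //.
  - by apply: Hopen; exact: openT.
  - move=> A B BA [mA A0] [mB B0]; split; first exact: measurableD.
    transitivity (\int[mu]_(x in D) (g x * \1_A x - g x * \1_B x)).
      apply: eq_Rintegral => x _; rewrite -mulrBr; congr (_ * _).
      rewrite !indicE in_setD; have [/set_mem/BA/mem_set ->|_] := boolP (x \in B).
        by rewrite /= subrr.
      by rewrite andbT subr0.
    by rewrite RintegralB ?A0 ?B0 ?subr0 //; exact: i1.
  - move=> F ndF HF; have mF i : meas2 (F i) by have [] := HF i.
    have mU : meas2 (\bigcup_i F i) by exact: bigcupT_measurable.
    split => //.
    have := @Rint_dominated _ D (fun n x => g x * \1_(F n) x) (fun x => g x * \1_(\bigcup_i F i) x)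
      (fun x => `|g x|) mD (fun n => m1 _ (mF n)).
    have -> : (fun n => \int[mu]_(x in D) (g x * \1_(F n) x)) = fun=> 0.
      by apply/funext => n; have [] := HF n.
    move=> h; apply: (@cvgn_unique _ (fun=> 0)); last exact: cvg_cst.
    apply: h => // x Dx; apply: cvgMr; rewrite indicE.
    have [/set_mem[i _ Fx]|/negP nU] := boolP (x \in \bigcup_i F i).
      apply: cvg_near_cst; have : \forall n \near \oo, (i <= n)%N by exact: nbhs_infty_ge.
      apply: filterS => n ni; rewrite indicE mem_set //.
      by have /subsetPset := ndF _ _ ni; apply.
    apply: cvg_near_cst; apply: nearW => n; rewrite indicE.
    by case: (boolP (x \in F n)) => // /set_mem Fx; exfalso; apply: nU; rewrite inE; exists n.
have HA A : meas2 A -> \int[mu]_(x in D) (g x * \1_A x) = 0.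
  have H0 : <<s setT, [set A : set R2 | open A] >> `<=` H.
    by apply: lambda_system_subset => // B C oB oC; exact: openI.
  by move=> mA; have [] := H0 A (sub_gsigma_opens mA).
have mpos : meas2 (D `&` [set x | 0 < g x]).
  have -> : [set x | 0 < g x] = g @^-1` `]0, +oo[%classic.
    by apply/seteqP; split=> x; rewrite /= in_itv /= andbT.
  exact: mg.
have mneg : meas2 (D `&` [set x | g x < 0]).
  have -> : [set x | g x < 0] = g @^-1` `]-oo, 0[%classic.
    by apply/seteqP; split=> x; rewrite /= in_itv.
  exact: mg.
have E : \int[mu]_(x in D) `|g x| = 0.
  transitivity (\int[mu]_(x in D) (g x * \1_(D `&` [set x | 0 < g x]) x - g x * \1_(D `&` [set x | g x < 0]) x)).
    apply: eq_Rintegral => x /set_mem Dx; rewrite !indicE !in_setI (mem_set Dx) /=.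
    have [gx|gx|gx] := ltgtP 0 (g x).
    - rewrite [_ \in _]mem_set //= [X in _ - _ * X](_ : _ = 0).
        by rewrite gtr0_norm // mulr1 mulr0 subr0.
      by rewrite memNset //=; apply/negP; rewrite -leNgt ltW.
    - rewrite [X in _ - _ * X](_ : _ = 1); last by rewrite mem_set.
      rewrite memNset /=; last by apply/negP; rewrite -leNgt ltW.
      by rewrite ltr0_norm // mulr1 mulr0 sub0r.
    - by rewrite -gx normr0 !mul0r subr0.
  by rewrite RintegralB ?HA ?subr0 //; exact: i1.
have E' : (\int[mu]_(x in D) `|(EFin \o g) x| = 0)%E.
  have fin : (\int[mu]_(x in D) (`|g x|)%R%:E)%E \is a fin_num by exact: integrable_fin_num.
  transitivity (\int[mu]_(x in D) (`|g x|)%R%:E)%E => //.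
  by rewrite -(fineK fin); congr (_%:E); exact: E.
have [h _] := @ae_eq_integral_abs _ _ _ mu D mD (EFin \o g) ((measurable_EFinP _ _).2 mg).
by have := h E'; apply: ae_on_impl => x Dx [].
Qed.

Lemma weakd_unique (D : set R2) i (u g g' : R2 -> R) : open D -> int_on D g -> int_on D g' ->
  weakd D i u g -> weakd D i u g' -> ae_on D (fun x => g x = g' x).
Proof.
move=> oD ig ig' w w'; have mD := open_measurable2 oD.
have : ae_on D (fun x => g x - g' x = 0).
  apply: test_function_ae0 => //; first exact: int_onB.
  move=> phi tphi.
  transitivity (\int[mu]_(x in D) (g x * phi x - g' x * phi x)).
    by apply: eq_Rintegral => x _; rewrite mulrBl.
  rewrite RintegralB //; [|exact: (int_on_test mD ig tphi).1|exact: (int_on_test mD ig' tphi).1].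
  by apply/eqP; rewrite subr_eq0 -eqr_opp -(w _ tphi) -(w' _ tphi).
by apply: ae_on_impl => x _ /eqP; rewrite subr_eq0 => /eqP.
Qed.

End DuBoisReymond.

(** * The complex Hilbert space L2 *)

Section ComplexIntegral.
Variable R : realType.
Local Notation mR := (measurableTypeR R).
Local Notation R2 := (R * R)%type.
Local Notation C := R[i].
Local Notation meas2 := (@measurable _ (mR * mR)%type).
Local Notation Re := (@complex.Re _).
Local Notation Im := (@complex.Im _).

Lemma complexP (z w : C) : Re z = Re w -> Im z = Im w -> z = w.
Proof. by case: z w => [a b] [c d] /= -> ->. Qed.

Lemma cRe0 : Re (0 : C) = 0. Proof. by []. Qed.
Lemma cIm0 : Im (0 : C) = 0. Proof. by []. Qed.
Lemma cReD (z w : C) : Re (z + w) = Re z + Re w.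
Proof. by case: z w => [a b] [c d]. Qed.
Lemma cImD (z w : C) : Im (z + w) = Im z + Im w.
Proof. by case: z w => [a b] [c d]. Qed.
Lemma cReN (z : C) : Re (- z) = - Re z. Proof. by case: z. Qed.
Lemma cImN (z : C) : Im (- z) = - Im z. Proof. by case: z. Qed.
Lemma cReM (z w : C) : Re (z * w) = Re z * Re w - Im z * Im w.
Proof. by case: z w => [a b] [c d]. Qed.
Lemma cImM (z w : C) : Im (z * w) = Re z * Im w + Im z * Re w.
Proof. by case: z w => [a b] [c d]. Qed.
Lemma cReJ (z : C) : Re z^* = Re z. Proof. by case: z. Qed.
Lemma cImJ (z : C) : Im z^* = - Im z. Proof. by case: z. Qed.
Lemma cReC (x : R) : Re (x%:C%C) = x. Proof. by []. Qed.
Lemma cImC (x : R) : Im (x%:C%C) = 0. Proof. by []. Qed.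

Lemma cRe_sum I (r : seq I) (Q : pred I) (F : I -> C) :
  Re (\sum_(i <- r | Q i) F i) = \sum_(i <- r | Q i) Re (F i).
Proof. exact: (big_morph (fun z : C => Re z) cReD cRe0). Qed.

Lemma cIm_sum I (r : seq I) (Q : pred I) (F : I -> C) :
  Im (\sum_(i <- r | Q i) F i) = \sum_(i <- r | Q i) Im (F i).
Proof. exact: (big_morph (fun z : C => Im z) cImD cIm0). Qed.

Definition ReImE := (cReD, cImD, cReN, cImN, cReM, cImM, cReJ, cImJ, cReC, cImC, cRe_sum, cIm_sum).

Lemma sqmod_ge0 (z : C) : 0 <= sqmod z.
Proof. by rewrite addr_ge0 ?sqr_ge0. Qed.

Lemma sqmodM (z w : C) : sqmod (z * w) = sqmod z * sqmod w.
Proof. by rewrite /sqmod !ReImE; ring. Qed.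

Definition cint_on (D : set R2) (f : R2 -> C) : Prop :=
  int_on D (Re \o f) /\ int_on D (Im \o f).

Lemma eq_ae_cintegral (D : set R2) (f g : R2 -> C) : ae_on D (fun x => f x = g x) ->
  cintegral D f = cintegral D g.
Proof.
by move=> e; rewrite /cintegral; congr Complex; apply: eq_ae_Rintegral;
  apply: ae_on_impl e => x _ ->.
Qed.

Lemma eq_cintegral (D : set R2) (f g : R2 -> C) : (forall x, D x -> f x = g x) ->
  cintegral D f = cintegral D g.
Proof. by move=> e; apply: eq_ae_cintegral; apply: ae_onT. Qed.

Variable D : set R2.
Hypothesis mD : meas2 D.

Lemma cint_onD f g : cint_on D f -> cint_on D g -> cint_on D (fun x => f x + g x).
Proof.
move=> [rf jf] [rg jg]; split.
  by apply: int_on_eq (int_onD mD rf rg) => // x Dx; rewrite /= !ReImE.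
by apply: int_on_eq (int_onD mD jf jg) => // x Dx; rewrite /= !ReImE.
Qed.

Lemma cint_onZ c f : cint_on D f -> cint_on D (fun x => c * f x).
Proof.
move=> [rf jf]; split.
  apply: int_on_eq (int_onB mD (int_onZ (Re c) mD rf) (int_onZ (Im c) mD jf)) => // x Dx.
  by rewrite /= !ReImE.
apply: int_on_eq (int_onD mD (int_onZ (Re c) mD jf) (int_onZ (Im c) mD rf)) => // x Dx.
by rewrite /= !ReImE.
Qed.

Lemma cint_on0 : cint_on D (fun=> 0).
Proof. by split; exact: int_on0. Qed.

Lemma cint_on_sum I (s : seq I) (F : I -> R2 -> C) : (forall i, cint_on D (F i)) ->
  cint_on D (fun x => \sum_(i <- s) F i x).
Proof.
move=> iF; elim: s => [|i s IH].
  by under eq_fun do rewrite big_nil; exact: cint_on0.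
by under eq_fun do rewrite big_cons; exact: cint_onD.
Qed.

Lemma cintegralD f g : cint_on D f -> cint_on D g ->
  cintegral D (fun x => f x + g x) = cintegral D f + cintegral D g.
Proof.
move=> [rf jf] [rg jg]; apply: complexP; rewrite ?ReImE /=.
  by rewrite -RintegralD //; apply: eq_Rintegral => x _; rewrite cReD.
by rewrite -RintegralD //; apply: eq_Rintegral => x _; rewrite cImD.
Qed.

Lemma cintegralZ c f : cint_on D f -> cintegral D (fun x => c * f x) = c * cintegral D f.
Proof.
move=> [rf jf]; apply: complexP; rewrite ?ReImE /=.
  rewrite -!RintegralZl // -RintegralB //; [|exact: int_onZ|exact: int_onZ].
  by apply: eq_Rintegral => x _; rewrite !ReImE.
rewrite -!RintegralZl // -RintegralD //; [|exact: int_onZ|exact: int_onZ].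
by apply: eq_Rintegral => x _; rewrite !ReImE.
Qed.

Lemma cintegral0 : cintegral D (fun=> 0 : C) = 0.
Proof. by rewrite /cintegral /Rintegral integral0. Qed.

Lemma cintegral_sum I (s : seq I) (F : I -> R2 -> C) : (forall i, cint_on D (F i)) ->
  cintegral D (fun x => \sum_(i <- s) F i x) = \sum_(i <- s) cintegral D (F i).
Proof.
move=> iF; elim: s => [|i s IH].
  by rewrite big_nil -[RHS]cintegral0; apply: eq_cintegral => x _; rewrite big_nil.
rewrite big_cons -IH -cintegralD //; last exact: cint_on_sum.
by apply: eq_cintegral => x _; rewrite big_cons.
Qed.

Lemma borel_onE (f : R2 -> R) : borel_on D f <-> @measurable_fun _ _ (mR * mR)%type mR D f.
Proof. by rewrite /borel_on (measurable_restrictT _ mD). Qed.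

Lemma sqint_measurable f : sqintegrable D f ->
  @measurable_fun _ _ (mR * mR)%type mR D (Re \o f) /\
  @measurable_fun _ _ (mR * mR)%type mR D (Im \o f).
Proof. by move=> [/borel_onE ? /borel_onE ?]. Qed.

Lemma sqint_int_sqmod f : sqintegrable D f -> int_on D (fun x => sqmod (f x)).
Proof.
move=> sf; have [mr mi] := sqint_measurable sf; have [_ _ fin] := sf.
have m : @measurable_fun _ _ (mR * mR)%type mR D (fun x => sqmod (f x)).
  by apply: measurable_funD; exact: measurable_funX.
apply/integrableP; split; first exact/measurable_EFinP.
apply: le_lt_trans fin; rewrite le_eqVlt; apply/orP; left; apply/eqP; apply: eq_integral => x _.
by rewrite /= ger0_norm // sqmod_ge0.
Qed.

Lemma int_sqmod_sqint f : borel_on D (Re \o f) -> borel_on D (Im \o f) ->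
  int_on D (fun x => sqmod (f x)) -> sqintegrable D f.
Proof.
move=> rf jf /integrableP[_ fin]; split=> //; apply: le_lt_trans fin.
rewrite le_eqVlt; apply/orP; left; apply/eqP; apply: eq_integral => x _.
by rewrite /= ger0_norm // sqmod_ge0.
Qed.

Lemma sqint_mul f g : sqintegrable D f -> sqintegrable D g ->
  cint_on D (fun x => f x * (g x)^*).
Proof.
move=> sf sg; have [fr fi] := sqint_measurable sf; have [gr gi] := sqint_measurable sg.
have ib := int_onD mD (sqint_int_sqmod sf) (sqint_int_sqmod sg).
have key (a b c d : R) : `|a * b - c * (- d)| <= a ^+ 2 + c ^+ 2 + (b ^+ 2 + d ^+ 2).
  rewrite ler_norml; apply/andP; split.
    by have := sqr_ge0 (a + b); have := sqr_ge0 (c + d); have := sqr_ge0 a; have := sqr_ge0 b;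
       have := sqr_ge0 c; have := sqr_ge0 d; rewrite !expr2; lra.
  by have := sqr_ge0 (a - b); have := sqr_ge0 (c - d); have := sqr_ge0 a; have := sqr_ge0 b;
       have := sqr_ge0 c; have := sqr_ge0 d; rewrite !expr2; lra.
split; apply: (int_on_le mD ib).
- apply: (eq_measurable_fun (fun x => Re (f x) * Re (g x) + Im (f x) * Im (g x))).
    by move=> x _; rewrite /= !ReImE mulrN opprK.
  by apply: measurable_funD; exact: measurable_funM.
- by move=> x _; rewrite /= !ReImE; exact: key.
- apply: (eq_measurable_fun (fun x => Im (f x) * Re (g x) - Re (f x) * Im (g x))).
    by move=> x _; rewrite /= !ReImE mulrN addrC.
  by apply: measurable_funB; exact: measurable_funM.
- move=> x _; rewrite /= !ReImE addrC.
  have := key (Im (f x)) (Re (g x)) (Re (f x)) (Im (g x)).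
  have := key (Im (f x)) (Re (g x)) (- Re (f x)) (Im (g x)).
  rewrite mulrNN sqrrN /sqmod => h _; rewrite mulrN; apply: le_trans h _.
  by rewrite [X in X + _]addrC.
Qed.

End ComplexIntegral.

(** * Norm and inner product of L2 *)

Section L2Space.
Variable R : realType.
Local Notation mR := (measurableTypeR R).
Local Notation R2 := (R * R)%type.
Local Notation C := R[i].
Local Notation mu := (@leb2 R).
Local Notation meas2 := (@measurable _ (mR * mR)%type).
Local Notation Re := (@complex.Re _).
Local Notation Im := (@complex.Im _).

Section Pointwise.
Variable D : set R2.
Implicit Types u v : L2 D.

Lemma L2rep_sqint u : sqintegrable D u.
Proof. exact: set_mem (valP (repr u)). Qed.

Lemma L2sub_ae (s s' : L2sub D) : \pi_(L2 D)%qT s = \pi_(L2 D)%qT s' ->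
  ae_on D (fun x => s x = s' x).
Proof.
move=> /eqP; rewrite -Quotient.idealrBE => /set_mem /=.
apply: ae_on_impl => x _ h; apply/eqP; rewrite -subr_eq0; apply/eqP; exact: h.
Qed.

Lemma L2_ae u v : ae_on D (fun x => u x = v x) -> u = v.
Proof.
move=> h; rewrite -[u]reprK -[v]reprK; apply/eqP; rewrite -Quotient.idealrBE; apply/mem_set.
apply: ae_on_impl h => x _ h; rewrite -[RHS](subrr (u x)) [in RHS]h; exact: (congr1 (fun z => z - L2rep v x) h).
Qed.

Lemma L2rep_pi (s : L2sub D) : ae_on D (fun x => L2rep (\pi_(L2 D)%qT s) x = s x).
Proof. by apply: L2sub_ae; rewrite reprK. Qed.

Lemma L2class_ae (f : R2 -> C) : sqintegrable D f -> ae_on D (fun x => L2class D f x = f x).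
Proof.
move=> sf; have := L2rep_pi (insubd (0 : L2sub D) f); rewrite -/(L2class D f).
have -> : insubd (0 : L2sub D) f = f :> (R2 -> C) by apply: insubdK; exact: mem_set.
by [].
Qed.

(** Representatives are chosen by [repr], so the operations of [L2] agree with the pointwise ones
    only almost everywhere. *)
Lemma L2D_ae u v : ae_on D (fun x => L2rep (u + v) x = u x + v x).
Proof.
have := L2rep_pi (repr u + repr v).
by rewrite (Quotient.pi_add (@L2null R D)) !reprK.
Qed.

Lemma L2Z_ae (a : C) u : ae_on D (fun x => L2rep (a *: u) x = a * u x).
Proof.
have := L2rep_pi (a *: repr u).
by rewrite pi_L2scale reprK.
Qed.

Lemma L20_ae : ae_on D (fun x => (0 : L2 D) x = 0).
Proof. by have := L2Z_ae 0 0; rewrite scale0r; apply: ae_on_impl => x _ ->; rewrite mul0r. Qed.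

Lemma L2N_ae u : ae_on D (fun x => L2rep (- u) x = - u x).
Proof. by have := L2Z_ae (-1) u; rewrite scaleN1r; apply: ae_on_impl => x _ ->; rewrite mulN1r. Qed.

Lemma L2B_ae u v : ae_on D (fun x => L2rep (u - v) x = u x - v x).
Proof. by apply: ae_on_impl2 (L2D_ae u (- v)) (L2N_ae v) => x _ -> ->. Qed.

Lemma L2lin_ae n (c : 'I_n -> C) (u : 'I_n -> L2 D) :
  ae_on D (fun x => L2rep (\sum_l c l *: u l) x = \sum_l c l * u l x).
Proof.
elim: n c u => [|n IH] c u.
  by rewrite big_ord0; apply: ae_on_impl L20_ae => x _ ->; rewrite big_ord0.
rewrite big_ord_recl; set s := \sum_(i < n) _.
apply: ae_on_impl2 (L2D_ae (c ord0 *: u ord0) s) (ae_on_and (L2Z_ae (c ord0) (u ord0))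
  (IH (fun i => c (lift ord0 i)) (fun i => u (lift ord0 i)))).
by move=> x _ -> [-> ->]; rewrite big_ord_recl.
Qed.

End Pointwise.

Section Hilbert.
Variable D : set R2.
Hypothesis mD : meas2 D.
Implicit Types u v w : L2 D.

Lemma L2dot_int u v : cint_on D (fun x => u x * (v x)^*).
Proof. by apply: sqint_mul => //; exact: L2rep_sqint. Qed.

Lemma L2dotDl u v w : L2dot (u + v) w = L2dot u w + L2dot v w.
Proof.
rewrite /L2dot -cintegralD //; [|exact: L2dot_int|exact: L2dot_int].
by apply: eq_ae_cintegral; apply: ae_on_impl (L2D_ae u v) => x _ ->; rewrite mulrDl.
Qed.

Lemma L2dotDr u v w : L2dot w (u + v) = L2dot w u + L2dot w v.
Proof.
rewrite /L2dot -cintegralD //; [|exact: L2dot_int|exact: L2dot_int].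
by apply: eq_ae_cintegral; apply: ae_on_impl (L2D_ae u v) => x _ ->; rewrite rmorphD mulrDr.
Qed.

Lemma L2dotZl a u w : L2dot (a *: u) w = a * L2dot u w.
Proof.
rewrite /L2dot -cintegralZ //; last exact: L2dot_int.
by apply: eq_ae_cintegral; apply: ae_on_impl (L2Z_ae a u) => x _ ->; rewrite mulrA.
Qed.

Lemma L2dotZr (a : C) u w : L2dot w (a *: u) = a^* * L2dot w u.
Proof.
rewrite /L2dot -cintegralZ //; last exact: L2dot_int.
by apply: eq_ae_cintegral; apply: ae_on_impl (L2Z_ae a u) => x _ ->; rewrite rmorphM mulrCA.
Qed.

Lemma L2dot0l w : L2dot 0 w = 0.
Proof. by rewrite -(scale0r (0 : L2 D)) L2dotZl mul0r. Qed.

Lemma L2dot0r w : L2dot w 0 = 0.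
Proof. by rewrite -(scale0r (0 : L2 D)) L2dotZr rmorph0 mul0r. Qed.

Lemma L2dot_suml I (r : seq I) (F : I -> L2 D) w :
  L2dot (\sum_(i <- r) F i) w = \sum_(i <- r) L2dot (F i) w.
Proof. exact: (big_morph (fun u => L2dot u w) (fun u v => L2dotDl u v w) (L2dot0l w)). Qed.

Lemma L2dot_sumr I (r : seq I) (F : I -> L2 D) w :
  L2dot w (\sum_(i <- r) F i) = \sum_(i <- r) L2dot w (F i).
Proof. exact: (big_morph (fun u => L2dot w u) (fun u v => L2dotDr u v w) (L2dot0r w)). Qed.

Lemma Re_L2dotC u v : Re (L2dot u v) = Re (L2dot v u).
Proof. by apply: eq_Rintegral => x _; rewrite !ReImE; ring. Qed.

Lemma Re_L2dotxx u : Re (L2dot u u) = L2norm u ^+ 2.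
Proof.
rewrite /L2norm sqr_sqrtr; last by apply: Rintegral_ge0 => x _; exact: sqmod_ge0.
by apply: eq_Rintegral => x _; rewrite /sqmod !ReImE; ring.
Qed.

Lemma L2norm_ge0 u : 0 <= L2norm u.
Proof. exact: sqrtr_ge0. Qed.

Lemma L2normZ a u : L2norm (a *: u) = Num.sqrt (sqmod a) * L2norm u.
Proof.
rewrite /L2norm -sqrtrM ?sqmod_ge0 //; congr Num.sqrt.
rewrite -RintegralZl //; last by apply: sqint_int_sqmod => //; exact: L2rep_sqint.
by apply: eq_ae_Rintegral; apply: ae_on_impl (L2Z_ae a u) => x _ ->; rewrite sqmodM.
Qed.

Lemma L2normZC (a : R) u : L2norm (a%:C%C *: u) = `|a| * L2norm u.
Proof. by rewrite L2normZ /sqmod /= expr0n addr0 sqrtr_sqr. Qed.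

Lemma L2normN u : L2norm (- u) = L2norm u.
Proof.
rewrite -scaleN1r (_ : -1 = (-1)%:C%C); last by apply: complexP; rewrite !ReImE ?oppr0.
by rewrite L2normZC normrN1 mul1r.
Qed.

Lemma L2norm0 : L2norm (0 : L2 D) = 0.
Proof. by rewrite -(scale0r (0 : L2 D)) L2normZ /sqmod /= expr0n addr0 sqrtr0 mul0r. Qed.

Lemma L2normDsq u v : L2norm (u + v) ^+ 2 = L2norm u ^+ 2 + 2 * Re (L2dot u v) + L2norm v ^+ 2.
Proof.
rewrite -!Re_L2dotxx L2dotDl !L2dotDr !cReD (Re_L2dotC v u); ring.
Qed.

Lemma Re_L2dotZ (a b : R) u v : Re (L2dot (a%:C%C *: u) (b%:C%C *: v)) = a * b * Re (L2dot u v).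
Proof. by rewrite L2dotZl L2dotZr !ReImE; ring. Qed.

(** The norm of a u + b v is nonnegative for real a, b; the values a = |v|, b = - |u| give the claim
    if neither norm is 0. If one is 0 and the product positive, a large negative multiple of that
    vector would make the expansion negative. *)
Lemma L2_cauchy_schwarz u v : Re (L2dot u v) <= L2norm u * L2norm v.
Proof.
have key (a b : R) : 0 <= (a * L2norm u) ^+ 2 + 2 * (a * b * Re (L2dot u v)) + (b * L2norm v) ^+ 2.
  have := sqr_ge0 (L2norm (a%:C%C *: u + b%:C%C *: v)).
  by rewrite L2normDsq Re_L2dotZ !L2normZC !exprMn !real_normK ?num_real.
have := L2norm_ge0 u; have := L2norm_ge0 v.
move: key; set s := L2norm u; set r := L2norm v; set d := Re _ => key r0 s0.
have [r00|rn0] := eqVneq r 0.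
  rewrite r00 mulr0 leNgt; apply/negP => d0.
  have := key 1 (- ((s ^+ 2 + 1) / d)); rewrite r00 mulr0 mul1r expr0n addr0.
  have -> : s ^+ 2 + 2 * (1 * - ((s ^+ 2 + 1) / d) * d) = - (s ^+ 2 + 2) by field; exact: lt0r_neq0.
  by have := sqr_ge0 s; lra.
have [s00|sn0] := eqVneq s 0.
  rewrite s00 mul0r leNgt; apply/negP => d0.
  have := key (- ((r ^+ 2 + 1) / d)) 1; rewrite s00 mulr0 mul1r expr0n add0r.
  have -> : 2 * (- ((r ^+ 2 + 1) / d) * 1 * d) + r ^+ 2 = - (r ^+ 2 + 2) by field; exact: lt0r_neq0.
  by have := sqr_ge0 r; lra.
have sp : 0 < s * r by rewrite mulr_gt0 // lt0r ?sn0 ?rn0.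
have := key r (- s).
have -> : (r * s) ^+ 2 + 2 * (r * - s * d) + (- s * r) ^+ 2 = 2 * (s * r) * (s * r - d) by ring.
by rewrite pmulr_rge0 ?subr_ge0 // mulr_gt0.
Qed.

Lemma L2normD u v : L2norm (u + v) <= L2norm u + L2norm v.
Proof.
rewrite -(@ler_sqr R) ?nnegrE ?addr_ge0 ?L2norm_ge0 //.
have := L2_cauchy_schwarz u v; rewrite L2normDsq !expr2; lra.
Qed.

Lemma L2normB u v : L2norm (u - v) <= L2norm u + L2norm v.
Proof. by apply: le_trans (L2normD _ _) _; rewrite L2normN. Qed.

Lemma L2distC u v : L2norm (u - v) = L2norm (v - u).
Proof. by rewrite -L2normN opprB. Qed.

Lemma L2dist_tri w u v : L2norm (u - v) <= L2norm (u - w) + L2norm (w - v).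
Proof. by rewrite (le_trans _ (L2normD _ _)) // subrKA. Qed.

Lemma L2norm_sum I (r : seq I) (F : I -> L2 D) :
  L2norm (\sum_(i <- r) F i) <= \sum_(i <- r) L2norm (F i).
Proof.
elim: r => [|i r IH]; first by rewrite !big_nil L2norm0.
by rewrite !big_cons; apply: le_trans (L2normD _ _) _; rewrite lerD2l.
Qed.

Lemma L2norm_eq0 u : L2norm u = 0 -> u = 0.
Proof.
move=> n0; apply: L2_ae.
have iu := sqint_int_sqmod mD (L2rep_sqint u).
have mu1 : @measurable_fun _ _ (mR * mR)%type _ D (EFin \o (fun x => sqmod (u x))).
  by have /integrableP[] := iu.
have E : \int[mu]_(x in D) sqmod (u x) = 0.
  have g0 : 0 <= \int[mu]_(x in D) sqmod (u x) by apply: Rintegral_ge0 => x _; exact: sqmod_ge0.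
  by rewrite -(sqr_sqrtr g0) [Num.sqrt _]n0 expr0n.
have fin : (\int[mu]_(x in D) (sqmod (u x))%:E)%E \is a fin_num by exact: integrable_fin_num.
have E' : (\int[mu]_(x in D) `|(EFin \o (fun x => sqmod (u x))) x| = 0)%E.
  transitivity (\int[mu]_(x in D) (sqmod (u x))%:E)%E.
    by apply: eq_integral => x _; rewrite /= ger0_norm // sqmod_ge0.
  by rewrite -(fineK fin); congr (_%:E); exact: E.
have [h _] := @ae_eq_integral_abs _ _ _ mu D mD _ mu1.
have := h E'; apply: ae_on_impl2 (L20_ae D) => x Dx -> [] s0.
have := sqr_ge0 (Re (u x)); have := sqr_ge0 (Im (u x)); move: s0; rewrite /sqmod => s0 i0 r0.
by apply: complexP; apply/eqP; rewrite -sqrf_eq0; apply/eqP; rewrite /=; lra.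
Qed.

End Hilbert.
End L2Space.

(** * Transplantation *)

Section Unfolding.
Variable R : realType.
Local Notation mR := (measurableTypeR R).
Local Notation R2 := (R * R)%type.
Local Notation C := R[i].
Local Notation meas2 := (@measurable _ (mR * mR)%type).
Local Notation Re := (@complex.Re _).
Local Notation Im := (@complex.Im _).
Variables (P : 'I_3 -> R2) (aiP : affinely_independent P).
Local Notation T := (triangle P).

Section Domain.
Variables (tau : 'I_7 -> R2 -> R2) (p : 'I_3 -> 'I_7 -> 'I_7) (Omega : set R2).
Hypothesis gd : glued_domain P tau p Omega.
Let mT : meas2 T := triangle_measurable aiP.
Let mO : meas2 Omega := gd_measurable gd.

Lemma measurable_tile (f : R2 -> R) k : @measurable_fun _ _ (mR * mR)%type mR Omega f ->
  @measurable_fun _ _ (mR * mR)%type mR T (f \o tau k).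
Proof.
move=> mf; rewrite -(tile_preimage gd k).
apply: (measurable_comp (F := tile P tau k)).
- exact: (tile_measurable aiP gd).
- by move=> _ [x tx <-].
- by apply: measurable_funS mf => //; exact: (gd_tile gd).
- by apply: measurable_funTS; exact: (isometry_mpres (gd_isometry gd k)).1.
Qed.

Lemma sqint_tile (f : R2 -> C) k : sqintegrable Omega f -> sqintegrable T (f \o tau k).
Proof.
move=> sf; have [mr mi] := sqint_measurable mO sf.
apply: int_sqmod_sqint.
- by apply/(borel_onE mT); exact: (measurable_tile k mr).
- by apply/(borel_onE mT); exact: (measurable_tile k mi).
- exact: (int_on_tile aiP gd k (sqint_int_sqmod mO sf)).
Qed.

Lemma cintegral_tiles (f : R2 -> C) : cint_on Omega f ->
  cintegral Omega f = \sum_k cintegral T (f \o tau k).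
Proof.
move=> [rf jf]; apply: complexP; rewrite ?cRe_sum ?cIm_sum /=.
  exact: (Rint_tiles aiP gd rf).
exact: (Rint_tiles aiP gd jf).
Qed.

(** Each F k, cut off outside the triangle, is pulled back by the inverse of tau k, and the results
    are added; on a tile the disjointness of the tiles leaves one summand. *)
Lemma sqint_glue (F : 'I_7 -> R2 -> C) : (forall k, sqintegrable T (F k)) ->
  exists2 w, sqintegrable Omega w & forall k x, T x -> w (tau k x) = F k x.
Proof.
move=> sF; have [g hg] := choice (fun k => isometry_inverse (gd_isometry gd k)).
pose w y := \sum_k (if g k y \in T then F k (g k y) else 0).
have wE k x : T x -> w (tau k x) = F k x.
  move=> Tx; have [_ gK _] := hg k.
  rewrite /w (bigD1 k) //= gK mem_set // big1 ?addr0 // => l lk.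
  case: ifP => // /set_mem Tl; have [_ _ Kg] := hg l.
  have : (tile P tau l `&` tile P tau k) (tau k x).
    by split; [exists (g l (tau k x)); rewrite ?Kg|exists x].
  by rewrite (gd_disjoint gd lk).
have mpatch (h : R2 -> R) k : borel_on T h -> @measurable_fun _ _ (mR * mR)%type mR setT (fun y => (h \_ T) (g k y)).
  move=> bh; have [ig _ _] := hg k.
  by apply: (measurableT_comp (f := h \_ T)) => //; exact: (isometry_mpres ig).1.
have br : borel_on Omega (Re \o w).
  apply/(borel_onE mO); apply: measurable_funTS.
  have -> : Re \o w = fun y => \sum_k ((Re \o F k) \_ T) (g k y).
    apply/funext => y; rewrite /w /= cRe_sum; apply: eq_bigr => k _.
    by rewrite patchE; case: ifP.
  by apply: measurable_sum => k; apply: mpatch; have [] := sF k.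
have bi : borel_on Omega (Im \o w).
  apply/(borel_onE mO); apply: measurable_funTS.
  have -> : Im \o w = fun y => \sum_k ((Im \o F k) \_ T) (g k y).
    apply/funext => y; rewrite /w /= cIm_sum; apply: eq_bigr => k _.
    by rewrite patchE; case: ifP.
  by apply: measurable_sum => k; apply: mpatch; have [] := sF k.
exists w => //; split => //.
rewrite (ge0_integral_tiles aiP gd).
- apply: lte_sum_pinfty => k _; have [_ _] := sF k; apply: le_lt_trans.
  rewrite le_eqVlt; apply/orP; left; apply/eqP; apply: eq_integral => x /set_mem Tx.
  by rewrite wE.
- apply/measurable_EFinP; apply: measurable_funD; apply: measurable_funX.
    exact/(borel_onE mO).
  exact/(borel_onE mO).
- by move=> x _; rewrite lee_fin sqmod_ge0.
Qed.

Lemma Phi_ae (u : L2 Omega) k : ae_on T (fun x => Phi T tau u k x = u (tau k x)).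
Proof. by apply: L2class_ae; apply: sqint_tile; exact: L2rep_sqint. Qed.

Lemma Phi_inj : injective (@Phi R T Omega tau).
Proof.
move=> u v uv; apply: L2_ae; apply/(ae_on_tiles aiP gd) => k.
apply: ae_on_impl2 (Phi_ae u k) (Phi_ae v k) => x _ <- <-.
by rewrite uv.
Qed.

Lemma Phi_surj (F : 'I_7 -> L2 T) : exists u : L2 Omega, Phi T tau u = F.
Proof.
have [w sw wE] := sqint_glue (fun k => L2rep_sqint (F k)).
exists (L2class Omega w); apply/funext => k; apply: L2_ae.
have /(ae_on_tiles aiP gd)/(_ k) := L2class_ae sw.
by apply: ae_on_impl2 (Phi_ae (L2class Omega w) k) => x Tx -> ->; exact: wE.
Qed.

Lemma pinv_Phi (F : 'I_7 -> L2 T) : Phi T tau (pinv setT (@Phi R T Omega tau) F) = F.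
Proof.
by apply: pinvK; rewrite inE; have [u <-] := Phi_surj F; exists u.
Qed.

Lemma PhiZD (a : C) (u v : L2 Omega) k :
  Phi T tau (a *: u + v) k = a *: Phi T tau u k + Phi T tau v k.
Proof.
apply: L2_ae.
have h1 := (ae_on_tiles aiP gd _).1 (ae_on_and (L2D_ae (a *: u) v) (L2Z_ae a u)) k.
apply: ae_on_impl2 (Phi_ae (a *: u + v) k) (ae_on_and h1 (ae_on_and (ae_on_and (Phi_ae u k) (Phi_ae v k))
   (ae_on_and (L2D_ae (a *: Phi T tau u k) (Phi T tau v k)) (L2Z_ae a (Phi T tau u k))))).
by move=> x _ -> [[-> ->] [[e1 e2] [-> ->]]]; rewrite e1 e2.
Qed.

Lemma L2dot_Phi (u v : L2 Omega) : L2dot u v = \sum_k L2dot (Phi T tau u k) (Phi T tau v k).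
Proof.
rewrite /L2dot cintegral_tiles; last exact: L2dot_int.
apply: eq_bigr => k _; apply: eq_ae_cintegral.
by apply: ae_on_impl2 (Phi_ae u k) (Phi_ae v k) => x _ /= -> ->.
Qed.

Lemma L2norm_Phi (u : L2 Omega) : L2norm u ^+ 2 = \sum_k L2norm (Phi T tau u k) ^+ 2.
Proof.
by rewrite -Re_L2dotxx L2dot_Phi cRe_sum; apply: eq_bigr => k _; rewrite Re_L2dotxx.
Qed.

Lemma L2norm_Phi_le (u : L2 Omega) k : L2norm (Phi T tau u k) <= L2norm u.
Proof.
rewrite -(@ler_sqr R) ?nnegrE ?L2norm_ge0 // L2norm_Phi (bigD1 k) //= lerDl.
by apply: sumr_ge0 => l _; exact: sqr_ge0.
Qed.

Lemma L2norm_le_Phi (u : L2 Omega) : L2norm u <= \sum_k L2norm (Phi T tau u k).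
Proof.
have h0 : 0 <= \sum_k L2norm (Phi T tau u k) by apply: sumr_ge0 => k _; exact: L2norm_ge0.
rewrite -(@ler_sqr R) ?nnegrE ?L2norm_ge0 // L2norm_Phi [leRHS]expr2 mulr_suml.
apply: ler_sum => k _; rewrite expr2 ler_wpM2l ?L2norm_ge0 // (bigD1 k) //= lerDl.
by apply: sumr_ge0 => l _; exact: L2norm_ge0.
Qed.

End Domain.

Section Mixing.
Variables (tau tau' : 'I_7 -> R2 -> R2) (p p' : 'I_3 -> 'I_7 -> 'I_7) (Omega Omega' : set R2).
Hypotheses (gd : glued_domain P tau p Omega) (gd' : glued_domain P tau' p' Omega').
Let mT : meas2 T := triangle_measurable aiP.

(** Transplantation by an arbitrary real matrix between any two glued domains; it is applied to the
    mixing matrix, its transpose and its inverse. *)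
Definition mix (t t' : 'I_7 -> R2 -> R2) (O O' : set R2) (N : 'M[R]_7) (u : L2 O) : L2 O' :=
  pinv setT (@Phi R T O' t') (fun k => \sum_l (N k l)%:C%C *: Phi T t u l).

Local Notation mixN := (@mix tau tau' Omega Omega').

Lemma Phi_mix N u k : Phi T tau' (mixN N u) k = \sum_l (N k l)%:C%C *: Phi T tau u l.
Proof. by rewrite (pinv_Phi gd'). Qed.

Lemma mix_ae N u k : ae_on T (fun x => mixN N u (tau' k x) = \sum_l (N k l)%:C%C * u (tau l x)).
Proof.
have h := ae_on_ord (Phi_ae gd u).
have := L2lin_ae (fun l => (N k l)%:C%C) (Phi T tau u); rewrite -Phi_mix.
apply: ae_on_impl2 (ae_on_and h (Phi_ae gd' (mixN N u) k)) => x _ [e1 e2]; rewrite e2 => ->.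
by apply: eq_bigr => l _; rewrite e1.
Qed.

Lemma mix_linear N : linear (mixN N).
Proof.
move=> a u v; apply: (Phi_inj gd'); apply/funext => k.
rewrite (PhiZD gd') !Phi_mix scaler_sumr -big_split; apply: eq_bigr => l _.
by rewrite (PhiZD gd) scalerDr !scalerA mulrC.
Qed.

Lemma mix_bounded N : bounded_operator (mixN N).
Proof.
split; first exact: mix_linear.
exists (\sum_k \sum_l `|N k l|) => u; apply: le_trans (L2norm_le_Phi gd' _) _.
rewrite mulr_suml; apply: ler_sum => k _; rewrite Phi_mix.
apply: le_trans (L2norm_sum mT _ _) _; rewrite mulr_suml; apply: ler_sum => l _.
by rewrite (L2normZC mT) ler_wpM2l // (L2norm_Phi_le gd).
Qed.

End Mixing.

Lemma mixK (tau tau' : 'I_7 -> R2 -> R2) (p p' : 'I_3 -> 'I_7 -> 'I_7) (Omega Omega' : set R2)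
    (N N' : 'M[R]_7) :
  glued_domain P tau p Omega -> glued_domain P tau' p' Omega' -> N' *m N = 1%:M ->
  cancel (@mix tau tau' Omega Omega' N) (@mix tau' tau Omega' Omega N').
Proof.
move=> gd gd' NN u; apply: (Phi_inj gd); apply/funext => k.
rewrite (Phi_mix _ gd) (eq_bigr (fun m => \sum_l ((N' k m)%:C * (N m l)%:C)%C *: Phi T tau u l)); last first.
  by move=> m _; rewrite (Phi_mix _ gd') scaler_sumr; apply: eq_bigr => l _; rewrite scalerA.
rewrite exchange_big /=.
transitivity (\sum_l (((N' *m N) k l)%:C)%C *: Phi T tau u l).
  apply: eq_bigr => l _; rewrite -scaler_suml; congr (_ *: _).
  by rewrite mxE rmorph_sum; apply: eq_bigr => m _; rewrite rmorphM.
rewrite NN (bigD1 k) //= mxE eqxx scale1r big1 ?addr0 // => l lk.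
by rewrite mxE eq_sym (negbTE lk) scale0r.
Qed.

(** Both maps Phi preserve the inner product and N is real, so the adjoint belongs to the
    transpose. *)
Lemma L2dot_mix (tau tau' : 'I_7 -> R2 -> R2) (p p' : 'I_3 -> 'I_7 -> 'I_7) (Omega Omega' : set R2)
    (N : 'M[R]_7) (u : L2 Omega) (v : L2 Omega') :
  glued_domain P tau p Omega -> glued_domain P tau' p' Omega' ->
  L2dot (@mix tau tau' Omega Omega' N u) v = L2dot u (@mix tau' tau Omega' Omega N^T v).
Proof.
move=> gd gd'; have mT := triangle_measurable aiP.
rewrite (L2dot_Phi gd) (L2dot_Phi gd').
transitivity (\sum_k \sum_l (N k l)%:C%C * L2dot (Phi T tau u l) (Phi T tau' v k)).
  apply: eq_bigr => k _; rewrite (Phi_mix _ gd') (L2dot_suml mT).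
  by apply: eq_bigr => l _; rewrite (L2dotZl mT).
rewrite exchange_big /=; apply: eq_bigr => l _; rewrite (Phi_mix _ gd) (L2dot_sumr mT).
apply: eq_bigr => k _; rewrite (L2dotZr mT) mxE; congr (_ * _).
by apply: complexP; rewrite ?cReJ ?cImJ // cImC oppr0.
Qed.

Lemma transplantationE (tau1 tau2 : 'I_7 -> R2 -> R2) (Omega1 Omega2 : set R2) :
  @transplantation R T Omega1 Omega2 tau1 tau2 = @mix tau1 tau2 Omega1 Omega2 (real_mixing R).
Proof.
apply/funext => u; rewrite /transplantation /mix /=; congr (pinv _ _ _).
apply/funext => k; apply: eq_bigr => l _; by rewrite mixing_matrixE mxE.
Qed.

End Unfolding.

(** * Transplantation of Sobolev functions and forms *)

Section Sobolev.
Variable R : realType.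
Local Notation mR := (measurableTypeR R).
Local Notation R2 := (R * R)%type.
Local Notation C := R[i].
Local Notation mu := (@leb2 R).
Local Notation meas2 := (@measurable _ (mR * mR)%type).
Local Notation Re := (@complex.Re _).
Local Notation Im := (@complex.Im _).

(** On a set of finite measure, which is what integrability of 1 expresses, the bound |z| <= 1 +
    |z|^2 takes square-integrable functions to integrable ones. *)
Lemma sqint_int_on (D : set R2) (f : R2 -> C) : meas2 D -> int_on D (fun=> 1) ->
  sqintegrable D f -> int_on D (Re \o f) /\ int_on D (Im \o f).
Proof.
move=> mD i1 sf; have [mr mi] := sqint_measurable mD sf.
have ib := int_onD mD i1 (sqint_int_sqmod mD sf).
have key (a b : R) : `|a| <= 1 + (a ^+ 2 + b ^+ 2).
  by rewrite ler_norml; apply/andP; split; have := sqr_ge0 (a + 1); have := sqr_ge0 (a - 1);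
    have := sqr_ge0 b; rewrite !expr2; nra.
split; apply: (int_on_le mD ib) => // x _ /=; first exact: key.
by rewrite /sqmod [X in 1 + X]addrC; exact: key.
Qed.

Lemma ReZC (c : R) (z : C) : Re (c%:C%C * z) = c * Re z.
Proof. by rewrite cReM cReC cImC mul0r subr0. Qed.

Lemma ImZC (c : R) (z : C) : Im (c%:C%C * z) = c * Im z.
Proof. by rewrite cImM cReC cImC mul0r addr0. Qed.

Section WeakPartial.
Variable D : set R2.
Implicit Types u g : L2 D.

Lemma weak_partialP i u g : weak_partial i u g <->
  weakd D i (Re \o u) (Re \o g) /\ weakd D i (Im \o u) (Im \o g).
Proof.
have ReMC (z : C) (c : R) : Re (z * c%:C%C) = Re z * c by rewrite mulrC ReZC mulrC.
have ImMC (z : C) (c : R) : Im (z * c%:C%C) = Im z * c by rewrite mulrC ImZC mulrC.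
have eqR (h : R2 -> C) phi : \int[mu]_(x in D) Re (h x * (phi x)%:C%C) = \int[mu]_(x in D) ((Re \o h) x * phi x).
  by apply: eq_Rintegral => x _; exact: ReMC.
have eqI (h : R2 -> C) phi : \int[mu]_(x in D) Im (h x * (phi x)%:C%C) = \int[mu]_(x in D) ((Im \o h) x * phi x).
  by apply: eq_Rintegral => x _; exact: ImMC.
split=> [w|[wr wi] phi tphi].
  split=> phi tphi; have := w phi tphi; rewrite /cintegral !eqR !eqI => e.
    exact: (congr1 (fun z : C => Re z) e).
  exact: (congr1 (fun z : C => Im z) e).
apply: complexP.
  by rewrite cReN /cintegral /= !eqR; exact: wr.
by rewrite cImN /cintegral /= !eqI; exact: wi.
Qed.

Hypotheses (oD : open D) (i1 : int_on D (fun=> 1 : R)).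

Lemma L2_int_on u : int_on D (Re \o u) /\ int_on D (Im \o u).
Proof. by apply: sqint_int_on => //; [exact: open_measurable2|exact: L2rep_sqint]. Qed.

Lemma weak_partial_unique i u g g' : weak_partial i u g -> weak_partial i u g' -> g = g'.
Proof.
move=> /weak_partialP[wr wi] /weak_partialP[wr' wi']; apply: L2_ae.
have [ir ii] := L2_int_on g; have [ir' ii'] := L2_int_on g'.
apply: ae_on_impl2 (weakd_unique oD ir ir' wr wr') (weakd_unique oD ii ii' wi wi') => x _.
by move=> e1 e2; apply: complexP.
Qed.

Lemma wD_partial i u : sobolev_H1 u -> weak_partial i u (wD i u).
Proof. by move=> /(_ i); exact: xgetPex. Qed.

(** [wD] is a choice made by [xget]; uniqueness of weak derivatives identifies it with any
    derivative that has been found. *)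
Lemma wDE i u g : weak_partial i u g -> wD i u = g.
Proof.
move=> w; apply: (@weak_partial_unique i u) => //.
by apply: (xgetPex 0 (P := weak_partial i u)); exists g.
Qed.

End WeakPartial.

Variables (P : 'I_3 -> R2) (aiP : affinely_independent P).
Local Notation T := (triangle P).
Let mT : meas2 T := triangle_measurable aiP.

Lemma gd_int1 tau p (Omega : set R2) : glued_domain P tau p Omega -> int_on Omega (fun=> 1).
Proof.
move=> gd; apply/integrableP; split; first by apply/measurable_EFinP; exact: measurable_cst.
rewrite (eq_integral (cst 1%E)); last by move=> x _; rewrite /= normr1.
rewrite (ge0_integral_tiles aiP gd) //.
apply: lte_sum_pinfty => k _.
rewrite (eq_integral (cst 1%E)) // integral_cst // mul1e; exact: triangle_bounded_measure.
Qed.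

(* The gradient on the k-th tile, in the coordinates of the triangle. *)
Definition tile_grad (tau : 'I_7 -> R2 -> R2) (m : 'I_7 -> 'M[R]_2) (Omega : set R2)
    (u : L2 Omega) (k : 'I_7) (q : 'I_2) : L2 T :=
  \sum_a (m k a q)%:C%C *: Phi T tau (wD a u) k.

Section MixH1.
Variables (tau tau' : 'I_7 -> R2 -> R2) (p p' : 'I_3 -> 'I_7 -> 'I_7) (Omega Omega' : set R2).
Hypotheses (gd : glued_domain P tau p Omega) (gd' : glued_domain P tau' p' Omega').
Variables (m m' : 'I_7 -> 'M[R]_2) (t t' : 'I_7 -> R2).
Hypothesis tauE : forall k, tau k = affine_map (m k) (t k).
Hypothesis tauE' : forall k, tau' k = affine_map (m' k) (t' k).
Hypothesis om : forall k, orthogonal2 (m k).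
Hypothesis om' : forall k, orthogonal2 (m' k).
Variable N : 'M[R]_7.
Hypothesis NE : forall j k l, N (p' j k) (p j l) = N k l.
Local Notation mixN := (@mix R P tau tau' Omega Omega' N).

Lemma orthogonal2_sum k q (X : 'I_2 -> R) : \sum_a m' k a q * (\sum_b m' k a b * X b) = X q.
Proof.
have [e1 e2 e3] := om' k; rewrite !sum2.
case: (ord2P q) => ->.
  transitivity ((m' k 0 0 ^+ 2 + m' k 1 0 ^+ 2) * X 0 + (m' k 0 0 * m' k 0 1 + m' k 1 0 * m' k 1 1) * X 1).
    by ring.
  by rewrite e1 e3; ring.
transitivity ((m' k 0 1 ^+ 2 + m' k 1 1 ^+ 2) * X 1 + (m' k 0 0 * m' k 0 1 + m' k 1 0 * m' k 1 1) * X 0).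
  by ring.
by rewrite e2 e3; ring.
Qed.

(** The coefficients of m^T m are read off the scalar identity at unit vectors, then used for
    elements of L2. *)
Lemma orthogonal2_sumL2 k q (X : 'I_2 -> L2 T) :
  \sum_a (m' k a q)%:C%C *: (\sum_b (m' k a b)%:C%C *: X b) = X q.
Proof.
pose c b := \sum_a m' k a q * m' k a b.
transitivity (\sum_b (c b)%:C%C *: X b).
  under eq_bigr do rewrite scaler_sumr.
  rewrite exchange_big /=; apply: eq_bigr => b _; rewrite /c rmorph_sum scaler_suml.
  by apply: eq_bigr => a _; rewrite scalerA rmorphM.
have cE b : c b = (b == q)%:R.
  have := orthogonal2_sum k q (fun b' => (b' == b)%:R); rewrite eq_sym => <-.
  apply: eq_bigr => a _; congr (_ * _).
  by rewrite (bigD1 b) //= eqxx mulr1 big1 ?addr0 // => b' /negbTE ->; rewrite mulr0.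
rewrite (bigD1 q) //= cE eqxx scale1r big1 ?addr0 // => b /negbTE bq.
by rewrite cE bq scale0r.
Qed.

(** The candidate derivatives h of the mixed function are prescribed tile by tile: the pulled-back
    gradients of u are mixed to G k, then turned by m' k into the position of the new tile.
    Orthogonality says that pulling h back returns G. *)
Lemma mix_H1 (u : L2 Omega) : sobolev_H1 u ->
  sobolev_H1 (mixN u) /\
  forall k q, tile_grad tau' m' (mixN u) k q = \sum_l (N k l)%:C%C *: tile_grad tau m u l q.
Proof.
move=> hu; pose G k q : L2 T := \sum_l (N k l)%:C%C *: tile_grad tau m u l q.
have [h hE] := choice (fun a : 'I_2 => Phi_surj aiP gd' (fun k => \sum_q (m' k a q)%:C%C *: G k q)).
have iO := gd_int1 gd; have iO' := gd_int1 gd'.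
have oO := gd_open gd; have oO' := gd_open gd'.
have pull k q : \sum_a (m' k a q)%:C%C *: Phi T tau' (h a) k = G k q.
  by under eq_bigr do rewrite hE; exact: orthogonal2_sumL2.
have aeh k q : ae_on T (fun x => \sum_a (m' k a q)%:C%C * h a (tau' k x) =
    \sum_l (N k l)%:C%C * \sum_a (m l a q)%:C%C * wD a u (tau l x)).
  have e0 : ae_on T (fun x => L2rep (G k q) x = \sum_a (m' k a q)%:C%C * Phi T tau' (h a) k x).
    by rewrite -pull; exact: L2lin_ae.
  have e1 := ae_on_ord (fun a => Phi_ae aiP gd' (h a) k).
  have e2 := L2lin_ae (fun l => (N k l)%:C%C) (fun l => tile_grad tau m u l q).
  have e3 := ae_on_ord (fun l => L2lin_ae (fun a => (m l a q)%:C%C) (fun a => Phi T tau (wD a u) l)).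
  have e4 := ae_on_ord (fun l => ae_on_ord (fun a => Phi_ae aiP gd (wD a u) l)).
  apply: ae_on_impl2 (ae_on_and e0 (ae_on_and e1 e2)) (ae_on_and e3 e4) => x _ [f0 [f1 f2]] [f3 f4].
  transitivity (L2rep (G k q) x); first by rewrite f0; apply: eq_bigr => a _; rewrite f1.
  rewrite [LHS]f2; apply: eq_bigr => l _; congr (_ * _); rewrite [LHS]f3.
  by apply: eq_bigr => a _; rewrite f4.
have aem k := mix_ae aiP gd gd' N u k.
have wu a : weak_partial a u (wD a u) by exact: wD_partial.
have wh a : weak_partial a (mixN u) (h a).
  apply/weak_partialP; split.
    apply: (@weakd_transfer R P aiP tau tau' p p' Omega Omega' gd gd' m m' t t' tauE tauE' om om' N NE
      (Re \o u) (Re \o mixN u) (fun a => Re \o wD a u) (fun a => Re \o h a)).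
    - by have [] := L2_int_on oO iO u.
    - by move=> b; have [] := L2_int_on oO iO (wD b u).
    - by have [] := L2_int_on oO' iO' (mixN u).
    - by move=> b; have [] := L2_int_on oO' iO' (h b).
    - move=> k; apply: ae_on_impl (aem k) => x _ /= ->; rewrite cRe_sum.
      by apply: eq_bigr => l _; rewrite ReZC.
    - move=> k q; apply: ae_on_impl (aeh k q) => x _ /(congr1 (fun z : C => Re z)).
      rewrite !cRe_sum /pull_grad /= => e.
      transitivity (\sum_(i < 2) Re ((m' k i q)%:C%C * h i (tau' k x))).
        by apply: eq_bigr => b _; rewrite ReZC.
      rewrite e; apply: eq_bigr => l _; rewrite ReZC cRe_sum; congr (_ * _).
      by apply: eq_bigr => b _; rewrite ReZC.
    - by move=> b; have /weak_partialP[] := wu b.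
  apply: (@weakd_transfer R P aiP tau tau' p p' Omega Omega' gd gd' m m' t t' tauE tauE' om om' N NE
      (Im \o u) (Im \o mixN u) (fun a => Im \o wD a u) (fun a => Im \o h a)).
  - by have [] := L2_int_on oO iO u.
  - by move=> b; have [] := L2_int_on oO iO (wD b u).
  - by have [] := L2_int_on oO' iO' (mixN u).
  - by move=> b; have [] := L2_int_on oO' iO' (h b).
  - move=> k; apply: ae_on_impl (aem k) => x _ /= ->; rewrite cIm_sum.
    by apply: eq_bigr => l _; rewrite ImZC.
  - move=> k q; apply: ae_on_impl (aeh k q) => x _ /(congr1 (fun z : C => Im z)).
    rewrite !cIm_sum /pull_grad /= => e.
    transitivity (\sum_(i < 2) Im ((m' k i q)%:C%C * h i (tau' k x))).
      by apply: eq_bigr => b _; rewrite ImZC.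
    rewrite e; apply: eq_bigr => l _; rewrite ImZC cIm_sum; congr (_ * _).
    by apply: eq_bigr => b _; rewrite ImZC.
  - by move=> b; have /weak_partialP[] := wu b.
split; first by move=> a; exists (h a).
move=> k q; rewrite -/(G k q) -pull; apply: eq_bigr => a _.
by rewrite (wDE oO' iO' (wh a)).
Qed.

End MixH1.
End Sobolev.

(** * The elliptic form in the coordinates of the triangle *)

Section EllipticForm.
Variable R : realType.
Local Notation mR := (measurableTypeR R).
Local Notation R2 := (R * R)%type.
Local Notation C := R[i].
Local Notation meas2 := (@measurable _ (mR * mR)%type).
Local Notation Re := (@complex.Re _).
Local Notation Im := (@complex.Im _).

Lemma jacobian_affine_map (m : 'M[R]_2) (t x : R2) : Defs.jacobian (affine_map m t) x = m.
Proof.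
apply/matrixP => i j; rewrite mxE.
have -> : 'D_(basis_vec R j) (affine_map m t) x = (m 0 j, m 1 j).
  apply: cvg_lim; first exact: norm_hausdorff.
  apply: cvg_near_cst; near=> h.
  have h0 : h != 0 by near: h; exact: nbhs_dnbhs_neq.
  rewrite /affine_map /basis_vec /=.
  by case: (ord2P j) => ->; congr pair; rewrite /= /GRing.scale /=; field.
by case: (ord2P i) => ->.
Unshelve. all: by end_near. Qed.

Lemma ae_on_image (tau : R2 -> R2) (A : set R2) (Q : R2 -> Prop) : Defs.isometry tau ->
  ae_on A (fun x => Q (tau x)) -> ae_on (tau @` A) Q.
Proof.
move=> it /ae_onP h; have [g [ig gK Kg]] := isometry_inverse it.
apply/ae_onP; apply: negligibleS (mpres_negligible (isometry_mpres ig) h).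
by move=> _ [[x Ax <-] nQ]; rewrite /= gK.
Qed.

(** Integrability is placed on F, an almost everywhere equal pull-back: f itself will contain
    coefficients that are only Lebesgue measurable. *)
Lemma cintegral_image (tau : R2 -> R2) (A : set R2) (f F : R2 -> C) : meas2 A ->
  Defs.isometry tau -> cint_on A F -> ae_on A (fun x => f (tau x) = F x) ->
  cintegral (tau @` A) f = cintegral A F.
Proof.
move=> mA it [rF iF] fF; have [g [ig gK Kg]] := isometry_inverse it.
have E : tau @` A = g @^-1` A.
  apply/seteqP; split=> y; first by move=> [x Ax <-]; rewrite /= gK.
  by move=> /= Ay; exists (g y).
have -> : cintegral (tau @` A) f = cintegral (tau @` A) (F \o g).
  apply: eq_ae_cintegral; apply: ae_on_image => //.
  by apply: ae_on_impl fF => x _ ->; rewrite /= gK.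
have mp := isometry_mpres ig; rewrite E; apply: complexP.
  have /integrableP[m _] := rF.
  by rewrite /cintegral /Rintegral /= -(mpres_integral mp mA m).
have /integrableP[m _] := iF.
by rewrite /cintegral /Rintegral /= -(mpres_integral mp mA m).
Qed.

(** The Borel function equal to f almost everywhere is clamped to [-|M|, |M|] in both parts. This
    bounds it everywhere and changes nothing where it equals f. *)
Lemma bounded_borel (A : set R2) (f : R2 -> C) (M : R) : meas2 A ->
  lebesgue_measurable_on A f -> (forall x, A x -> `|f x| <= M%:C%C) ->
  exists g : R2 -> C, [/\ @measurable_fun _ _ (mR * mR)%type mR A (Re \o g),
    @measurable_fun _ _ (mR * mR)%type mR A (Im \o g),
    forall x, `|Re (g x)| <= `|M| /\ `|Im (g x)| <= `|M| & ae_on A (fun x => f x = g x)].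
Proof.
move=> mA [g [/(borel_onE mA) rg /(borel_onE mA) ig fg]] fM.
pose B := `|M|; pose clamp (a : R) := Num.max (- B) (Num.min B a).
have B0 : 0 <= B by exact: normr_ge0.
have clampP a : `|clamp a| <= B.
  by rewrite ler_norml /clamp ge_max le_max lexx /= ge_min lexx /= andbT; lra.
have clampE a : `|a| <= B -> clamp a = a.
  by rewrite ler_norml => /andP[h1 h2]; rewrite /clamp (min_idPr h2) (max_idPr h1).
have mc h : @measurable_fun _ _ (mR * mR)%type mR A h -> @measurable_fun _ _ (mR * mR)%type mR A (clamp \o h).
  by move=> mh; apply: measurable_maxr => //; exact: measurable_minr.
exists (fun x => Complex (clamp (Re (g x))) (clamp (Im (g x)))); split.
- exact: (mc _ rg).
- exact: (mc _ ig).
- by move=> x /=; split; exact: clampP.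
- apply: ae_on_impl fg => x Ax fgx; have := fM x Ax.
  rewrite fgx normc_def lecE /= => /andP[_ le].
  have {}le := le_trans le (ler_norm M).
  have h (a b : R) : `|a| <= Num.sqrt (a ^+ 2 + b ^+ 2).
    by rewrite -sqrtr_sqr ler_wsqrtr // lerDl sqr_ge0.
  have r1 := le_trans (h (Re (g x)) (Im (g x))) le.
  have i1 := h (Im (g x)) (Re (g x)); rewrite addrC in i1.
  by rewrite (clampE _ r1) (clampE _ (le_trans i1 le)); exact: complexP.
Qed.

Lemma cint_onM (A : set R2) (g f : R2 -> C) (M : R) : meas2 A ->
  @measurable_fun _ _ (mR * mR)%type mR A (Re \o g) ->
  @measurable_fun _ _ (mR * mR)%type mR A (Im \o g) ->
  (forall x, `|Re (g x)| <= M /\ `|Im (g x)| <= M) -> cint_on A f ->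
  cint_on A (fun x => g x * f x).
Proof.
move=> mA mr mi gM [rf jf].
have M0 : 0 <= M by have [h _] := gM 0; exact: le_trans h.
have key (h e : R2 -> R) : @measurable_fun _ _ (mR * mR)%type mR A h -> (forall x, `|h x| <= M) ->
    int_on A e -> int_on A (fun x => h x * e x).
  move=> mh hM ie.
  have ia : int_on A (fun x => M * `|e x|) by apply: int_onZ => //; exact: integrable_norm.
  apply: (int_on_le mA ia).
    by apply: measurable_funM => //; exact: int_on_measurable.
  by move=> x _; rewrite normrM ler_wpM2r.
have gR x : `|(Re \o g) x| <= M by have [] := gM x.
have gI x : `|(Im \o g) x| <= M by have [] := gM x.
split.
  apply: int_on_eq (int_onB mA (key _ _ mr gR rf) (key _ _ mi gI jf)) => // x _.
  by rewrite /= cReM.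
apply: int_on_eq (int_onD mA (key _ _ mr gR jf) (key _ _ mi gI rf)) => // x _.
by rewrite /= cImM.
Qed.

Lemma mx_form2 (K : comRingType) (M c : 'M[K]_2) (a b : 'I_2 -> K) :
  \sum_i \sum_j (M *m c *m M^T) i j * a i * b j =
  \sum_i \sum_j c i j * (\sum_l M l i * a l) * (\sum_l M l j * b l).
Proof. by rewrite !sum2 !mxE !sum2 !mxE !sum2; ring. Qed.

Variables (P : 'I_3 -> R2) (aiP : affinely_independent P).
Local Notation T := (triangle P).
Let mT : meas2 T := triangle_measurable aiP.
Variables (c : R2 -> 'M[C]_2) (ellc : elliptic_coefficients T c).

Definition triangle_form (g h : 'I_2 -> L2 T) : C :=
  cintegral T (fun x => \sum_i \sum_j c x i j * g i x * (h j x)^*).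

Lemma bounded_coefficients : exists c' : R2 -> 'M[C]_2,
  ae_on T (fun x => forall i j, c x i j = c' x i j) /\
  forall f i j, cint_on T f -> cint_on T (fun x => c' x i j * f x).
Proof.
have [mc [M cM] _] := ellc.
have ex (ij : 'I_2 * 'I_2) : exists g : R2 -> C,
    ae_on T (fun x => c x ij.1 ij.2 = g x) /\ forall f, cint_on T f -> cint_on T (fun x => g x * f x).
  have [g [g1 g2 g3 g4]] := bounded_borel mT (mc ij.1 ij.2) (fun x => cM x ij.1 ij.2).
  by exists g; split => // f; exact: (cint_onM mT g1 g2 g3).
have [g hg] := choice ex.
exists (fun x => \matrix_(i, j) g (i, j) x); split.
  apply: ae_on_ord => i; apply: ae_on_ord => j; have [h _] := hg (i, j).
  by apply: ae_on_impl h => x _ /= ->; rewrite mxE.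
move=> f i j iF; have [_ h] := hg (i, j).
by under eq_fun do rewrite mxE; exact: h.
Qed.

(** Sesquilinearity requires integrable integrands. The coefficients are replaced once by bounded
    Borel ones, with no effect on the form. *)
Lemma triangle_form_int : exists c' : R2 -> 'M[C]_2,
  (forall g h, triangle_form g h = cintegral T (fun x => \sum_i \sum_j c' x i j * (g i x * (h j x)^*))) /\
  [/\ ae_on T (fun x => forall i j, c x i j = c' x i j),
   forall (g h : 'I_2 -> L2 T) i j, cint_on T (fun x => c' x i j * (g i x * (h j x)^*)) &
   forall (g h : 'I_2 -> L2 T), cint_on T (fun x => \sum_i \sum_j c' x i j * (g i x * (h j x)^*))].
Proof.
have [c' [cc' ic']] := bounded_coefficients.
have h1 (g h : 'I_2 -> L2 T) i j : cint_on T (fun x => c' x i j * (g i x * (h j x)^*)).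
  by apply: ic'; exact: L2dot_int.
exists c'; split; last split => //; last first.
  by move=> g h; apply: cint_on_sum => // i; apply: cint_on_sum => // j.
move=> g h; apply: eq_ae_cintegral; apply: ae_on_impl cc' => x _ e.
by apply: eq_bigr => i _; apply: eq_bigr => j _; rewrite e mulrA.
Qed.

Lemma triangle_form_suml n (a : 'I_n -> C) (g : 'I_n -> 'I_2 -> L2 T) h :
  triangle_form (fun i => \sum_l a l *: g l i) h = \sum_l a l * triangle_form (g l) h.
Proof.
have [c' [E [_ _ ic]]] := triangle_form_int; rewrite E.
under eq_bigr do rewrite E.
transitivity (\sum_l cintegral T (fun x => a l * (\sum_i \sum_j c' x i j * (g l i x * (h j x)^*)))); last first.
  by apply: eq_bigr => l _; rewrite cintegralZ.
rewrite -cintegral_sum //; last by move=> l; apply: cint_onZ.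
apply: eq_ae_cintegral.
apply: ae_on_impl (ae_on_ord (fun i => L2lin_ae a (fun l => g l i))) => x _ e.
under eq_bigr => i _ do (under eq_bigr => j _ do rewrite e mulr_suml mulr_sumr).
under eq_bigr => i _ do rewrite exchange_big /=.
rewrite exchange_big /=; apply: eq_bigr => l _; rewrite mulr_sumr; apply: eq_bigr => i _.
by rewrite mulr_sumr; apply: eq_bigr => j _; ring.
Qed.

Lemma triangle_form_sumr n (a : 'I_n -> C) (g : 'I_n -> 'I_2 -> L2 T) h :
  triangle_form h (fun i => \sum_l a l *: g l i) = \sum_l (a l)^* * triangle_form h (g l).
Proof.
have [c' [E [_ _ ic]]] := triangle_form_int; rewrite E.
under eq_bigr do rewrite E.
transitivity (\sum_l cintegral T (fun x => (a l)^* * (\sum_i \sum_j c' x i j * (h i x * (g l j x)^*)))); last first.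
  by apply: eq_bigr => l _; rewrite cintegralZ.
rewrite -cintegral_sum //; last by move=> l; apply: cint_onZ.
apply: eq_ae_cintegral.
apply: ae_on_impl (ae_on_ord (fun i => L2lin_ae a (fun l => g l i))) => x _ e.
under eq_bigr => i _ do (under eq_bigr => j _ do rewrite e rmorph_sum mulr_sumr mulr_sumr).
under eq_bigr => i _ do rewrite exchange_big /=.
rewrite exchange_big /=; apply: eq_bigr => l _; rewrite mulr_sumr; apply: eq_bigr => i _.
by rewrite mulr_sumr; apply: eq_bigr => j _; rewrite rmorphM; ring.
Qed.

Section Domain.
Variables (tau : 'I_7 -> R2 -> R2) (p : 'I_3 -> 'I_7 -> 'I_7) (Omega : set R2).
Hypothesis gd : glued_domain P tau p Omega.
Variables (m : 'I_7 -> 'M[R]_2) (t : 'I_7 -> R2).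
Hypothesis tauE : forall k, tau k = affine_map (m k) (t k).
Hypothesis om : forall k, orthogonal2 (m k).

(** The derivative of an isometry is orthogonal, so its inverse is its transpose. *)
Lemma transport_tile k x :
  transport (tau k) c (tau k x) =
  map_mx (real_complex R) (m k) *m c x *m (map_mx (real_complex R) (m k))^T.
Proof.
have [g [_ gK _]] := isometry_inverse (gd_isometry gd k).
rewrite /transport pinvKV ?inE //; last by move=> y z _ _; exact: (can_inj gK).
rewrite tauE jacobian_affine_map; congr (_ *m _).
set M := map_mx _ _.
have MM : M *m M^T = 1%:M.
  have [ort1 ort2 ort3] := orthogonal2_inv (om k); rewrite !mxE in ort1 ort2 ort3.
  apply/matrixP => i j; rewrite mxE sum2 !mxE -!rmorphM -rmorphD.
  case: (ord2P i) => ->; case: (ord2P j) => -> /=; rewrite -?expr2 ?ort1 ?ort2 ?ort3 //.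
  by rewrite -[RHS](rmorph0 (real_complex R)) -ort3; congr (_%:C%C); ring.
have [uM _] := mulmx1_unit MM.
by rewrite -[RHS](mul1mx) -(mulVmx uM) -mulmxA MM mulmx1.
Qed.

Lemma tile_grad_ae (u : L2 Omega) k : ae_on T (fun x => forall q,
  tile_grad P tau m u k q x = \sum_a (m k a q)%:C%C * wD a u (tau k x)).
Proof.
apply: ae_on_ord => q.
have h := ae_on_ord (fun a => Phi_ae aiP gd (wD a u) k).
apply: ae_on_impl2 h (L2lin_ae (fun a => (m k a q)%:C%C) (fun a => Phi T tau (wD a u) k)) => x _ e1 e2.
by rewrite [LHS]e2; apply: eq_bigr => a _; rewrite e1.
Qed.

Lemma elliptic_formE (u v : L2 Omega) :
  elliptic_form T tau c u v =
  \sum_k triangle_form (tile_grad P tau m u k) (tile_grad P tau m v k).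
Proof.
have [c' [E [cc' _ ic]]] := triangle_form_int.
apply: eq_bigr => k _; rewrite E.
apply: cintegral_image => //; first exact: (gd_isometry gd).
apply: ae_on_impl2 cc' (ae_on_and (tile_grad_ae u k) (tile_grad_ae v k)) => x _ e [e1 e2].
rewrite transport_tile mx_form2; apply: eq_bigr => i _; apply: eq_bigr => j _.
have a1 : \sum_l map_mx (real_complex R) (m k) l i * wD l u (tau k x) = tile_grad P tau m u k i x.
  by rewrite e1; apply: eq_bigr => a _; rewrite mxE.
have a2 : \sum_l map_mx (real_complex R) (m k) l j * (wD l v (tau k x))^* = (tile_grad P tau m v k j x)^*.
  rewrite e2 rmorph_sum; apply: eq_bigr => a _; rewrite mxE rmorphM; congr (_ * _).
  by apply: complexP; rewrite ?cReJ ?cImJ // cImC oppr0.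
by rewrite a1 a2 e mulrA.
Qed.

End Domain.

Section MixOperator.
Variables (tau tau' : 'I_7 -> R2 -> R2) (p p' : 'I_3 -> 'I_7 -> 'I_7) (Omega Omega' : set R2).
Hypotheses (gd : glued_domain P tau p Omega) (gd' : glued_domain P tau' p' Omega').

Lemma elliptic_operator_mix (N : 'M[R]_7) (u f : L2 Omega) :
  (forall j k l, N (p' j k) (p j l) = N k l) ->
  elliptic_operator T tau c (u, f) ->
  elliptic_operator T tau' c (@mix R P tau tau' Omega Omega' N u, @mix R P tau tau' Omega Omega' N f).
Proof.
have [m hm] := choice (fun k => isometry_affine (gd_isometry gd k)).
have [t ht] := choice hm.
have [m' hm'] := choice (fun k => isometry_affine (gd_isometry gd' k)).
have [t' ht'] := choice hm'.
have om k : orthogonal2 (m k) by have [] := ht k.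
have om' k : orthogonal2 (m' k) by have [] := ht' k.
have tauE k : tau k = affine_map (m k) (t k) by have [] := ht k.
have tauE' k : tau' k = affine_map (m' k) (t' k) by have [] := ht' k.
move=> NE [/= hu hf].
have [hmu gmu] := mix_H1 aiP gd gd' tauE tauE' om om' NE hu.
split => //= w hw.
have NE' j k l : N^T (p j k) (p' j l) = N^T k l by rewrite !mxE NE.
have [hmw gmw] := mix_H1 aiP gd' gd tauE' tauE om' om NE' hw.
rewrite (L2dot_mix aiP N f w gd gd') -(hf _ hmw).
rewrite (elliptic_formE gd tauE om) (elliptic_formE gd' tauE' om').
(* Both forms equal this double sum: N mixes the gradients of u, and its transpose those of the test
   function w. *)
transitivity (\sum_k \sum_l (N k l)%:C%C *
    triangle_form (tile_grad P tau m u l) (tile_grad P tau' m' w k)).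
  apply: eq_bigr => k _; rewrite -triangle_form_suml; congr triangle_form.
  by apply/funext => q; exact: gmu.
rewrite exchange_big /=; apply: eq_bigr => l _.
transitivity (triangle_form (tile_grad P tau m u l)
   (fun q => \sum_k (N k l)%:C%C *: tile_grad P tau' m' w k q)).
  rewrite triangle_form_sumr; apply: eq_bigr => k _; congr (_ * _).
  by apply: complexP; rewrite ?cReJ ?cImJ // cImC oppr0.
congr triangle_form; apply/funext => q; rewrite gmw.
by apply: eq_bigr => k _; rewrite mxE.
Qed.

End MixOperator.
End EllipticForm.

(** * The inverse of the mixing matrix *)

Section MixingInverse.
Variable R : realType.

(* Any two rows of the mixing matrix N share exactly one 1 and every row has
   three, so N N^T = 2 + J, where J is the matrix of ones, and J N = 3 J. *)
Definition real_mixing_inv : 'M[R]_7 := \matrix_(k, l) (real_mixing R l k / 2 - 6^-1).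

Lemma real_mixing_sum k : \sum_l real_mixing R k l = 3 /\ \sum_l real_mixing R l k = 3.
Proof.
have c : all7 (fun k => (sumn [seq nth 0 (nth [::] mixing_table k) l | l <- iota 0 7] == 3%N) &&
    (sumn [seq nth 0 (nth [::] mixing_table l) k | l <- iota 0 7] == 3%N)) by vm_compute.
have /andP[/eqP r1 /eqP r2] := all7P k c.
have h (f : nat -> nat) : \sum_(l < 7) (f l)%:R = (sumn [seq f l | l <- iota 0 7])%:R :> R.
  by rewrite -natr_sum sumnE big_map; congr (_%:R); exact: (esym (big_mkord xpredT f)).
split.
  by rewrite -[RHS](congr1 (fun n => n%:R) r1) -h; apply: eq_bigr => l _; rewrite mxE.
by rewrite -[RHS](congr1 (fun n => n%:R) r2) -h; apply: eq_bigr => l _; rewrite mxE.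
Qed.

Lemma real_mixing_gram k k' :
  \sum_l real_mixing R k l * real_mixing R k' l = 2 * (k == k')%:R + 1 /\
  \sum_l real_mixing R l k * real_mixing R l k' = 2 * (k == k')%:R + 1.
Proof.
have c : all7 (fun k => all7 (fun k' =>
    (sumn [seq nth 0 (nth [::] mixing_table k) l * nth 0 (nth [::] mixing_table k') l | l <- iota 0 7]
       == 2 * (k == k') + 1) &&
    (sumn [seq nth 0 (nth [::] mixing_table l) k * nth 0 (nth [::] mixing_table l) k' | l <- iota 0 7]
       == 2 * (k == k') + 1)))%N by vm_compute.
have /andP[/eqP r1 /eqP r2] := all7P k' (all7P k c).
have h (f : nat -> nat) : \sum_(l < 7) (f l)%:R = (sumn [seq f l | l <- iota 0 7])%:R :> R.
  by rewrite -natr_sum sumnE big_map; congr (_%:R); exact: (esym (big_mkord xpredT f)).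
have -> : 2 * (k == k')%:R + 1 = (2 * (k == k') + 1)%N%:R :> R by rewrite natrD natrM.
split.
  by rewrite -[RHS](congr1 (fun n => n%:R) r1) -h; apply: eq_bigr => l _; rewrite !mxE natrM.
by rewrite -[RHS](congr1 (fun n => n%:R) r2) -h; apply: eq_bigr => l _; rewrite !mxE natrM.
Qed.

Lemma real_mixingV : real_mixing R *m real_mixing_inv = 1%:M.
Proof.
apply/matrixP => k k'; rewrite !mxE.
transitivity ((\sum_l real_mixing R k l * real_mixing R k' l) / 2 - (\sum_l real_mixing R k l) / 6).
  by rewrite !mulr_suml -sumrB; apply: eq_bigr => l _; rewrite [real_mixing_inv _ _]mxE; field.
by rewrite (real_mixing_gram k k').1 (real_mixing_sum k).1; field.
Qed.

Lemma real_mixing_invV : real_mixing_inv *m real_mixing R = 1%:M.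
Proof.
apply/matrixP => k k'; rewrite !mxE.
transitivity ((\sum_l real_mixing R l k * real_mixing R l k') / 2 - (\sum_l real_mixing R l k') / 6).
  by rewrite !mulr_suml -sumrB; apply: eq_bigr => l _; rewrite [real_mixing_inv _ _]mxE; field.
by rewrite (real_mixing_gram k k').2 (real_mixing_sum k').2; field.
Qed.

Lemma real_mixing_inv_partner j k l :
  real_mixing_inv (partner gluing_table1 j k) (partner gluing_table2 j l) = real_mixing_inv k l.
Proof. by rewrite [LHS]mxE [RHS]mxE real_mixing_partner. Qed.

End MixingInverse.

(** * Uniqueness of strongly continuous semigroups *)

Section Completeness.
Variable R : realType.
Local Notation mR := (measurableTypeR R).
Local Notation R2 := (R * R)%type.
Local Notation C := R[i].
Local Notation mu := (@leb2 R).
Local Notation meas2 := (@measurable _ (mR * mR)%type).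
Local Notation Re := (@complex.Re _).
Local Notation Im := (@complex.Im _).

(** Cauchy-Schwarz with weights 2^k, since the tail of the 2^-k from n on sums to 2 * 2^-n; in the
    induction this is (x + y)^2 <= 2 x^2 + 2 y^2. *)
Lemma weighted_telescope (a : nat -> R) n m :
  (a (n + m)%N - a n) ^+ 2 <=
  2 * 2 ^- n * \sum_(n <= k < n + m) 2 ^+ k * (a k.+1 - a k) ^+ 2.
Proof.
elim: m n => [|m IH] n.
  by rewrite addn0 subrr expr0n /= big_geq // mulr0.
have := IH n.+1; rewrite addSnnS => {}IH.
rewrite big_ltn; last by rewrite addnS ltnS leq_addr.
set S := \sum_(_ <= k < _) _ in IH *.
have e2 : (2 : R) ^- n = 2 * 2 ^- n.+1 by rewrite exprS invfM mulrA divff // mul1r.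
rewrite mulrDr mulrA -[2 * 2 ^- n * 2 ^+ n]mulrA mulVf ?expf_neq0 // mulr1.
rewrite (_ : a (n + m.+1)%N - a n = (a (n + m.+1)%N - a n.+1) + (a n.+1 - a n)); last by ring.
rewrite e2; move: IH; set x := a _ - a n.+1; set y := a n.+1 - a n.
set z := 2 * 2 ^- n.+1 * S => IH.
have -> : 2 * (2 * 2 ^- n.+1) * S = 2 * z by rewrite /z !mulrA.
by have := sqr_ge0 (x - y); rewrite !expr2 in IH *; lra.
Qed.

Lemma weighted_cvg (a : nat -> R) (G : R) :
  (forall m, \sum_(0 <= k < m) 2 ^+ k * (a k.+1 - a k) ^+ 2 <= G) ->
  exists l, a @ \oo --> l /\ forall n, (l - a n) ^+ 2 <= 2 * 2 ^- n * G.
Proof.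
move=> aG.
have key n m : (n <= m)%N -> (a m - a n) ^+ 2 <= 2 * 2 ^- n * G.
  move=> nm; have := weighted_telescope a n (m - n)%N; rewrite subnKC // => h.
  apply: le_trans h _; rewrite ler_wpM2l // ?mulr_ge0 ?invr_ge0 ?exprn_ge0 //.
  apply: le_trans (aG m); rewrite [leRHS](@big_cat_nat _ _ _ n) //= lerDr.
  by apply: sumr_ge0 => k _; rewrite mulr_ge0 ?sqr_ge0 ?exprn_ge0.
have G0 : 0 <= G by have := aG 0%N; rewrite big_geq.
have lim0 : (fun n => 2 * 2 ^- n * G) @ \oo --> (0 : R).
  rewrite -[X in _ --> X](mul0r G) -[X in X * G](mulr0 2).
  apply: cvgMl; apply: cvgMr.
  rewrite (_ : (fun n => 2 ^- n) = (fun n => (2^-1) ^+ n)); last by apply/funext => n; rewrite exprVn.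
  by apply: cvg_expr; rewrite gtr0_norm ?invr_gt0 // invf_lt1 // ltr1n.
have ca : cvg (a @ \oo).
  apply/cauchy_cvgP; apply: cauchy_exP => e /= e0.
  have e2 : 0 < e ^+ 2 by rewrite exprn_gt0.
  have [n _ hn] : \forall n \near \oo, 2 * 2 ^- n * G < e ^+ 2.
    by move/cvgrPdist_lt: lim0 => /(_ _ e2); apply: filterS => n; rewrite sub0r normrN; apply: le_lt_trans; exact: ler_norm.
  exists (a n); exists n => // m /= nm.
  rewrite /ball /= -(@ltr_sqr R) ?nnegrE ?(ltW e0) // real_normK ?num_real // -sqrrN opprB.
  by apply: le_lt_trans (key n m nm) _; apply: hn => /=.
exists (lim (a @ \oo)); split => // n.
have c : (fun m => (a m - a n) ^+ 2) @ \oo --> (lim (a @ \oo) - a n) ^+ 2.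
  rewrite expr2; under eq_fun do rewrite expr2.
  by apply: cvgM; apply: cvgB => //; exact: cvg_cst.
rewrite -(cvg_lim (@norm_hausdorff _ _) c); apply: limr_le.
  by apply/cvg_ex; eexists; exact: c.
by exists n => // m; exact: key.
Qed.

Variable D : set R2.
Hypothesis mD : meas2 D.

(** The series g of the 2^n (f (n+1) - f n)^2 has integral at most 2, so it is finite almost
    everywhere; there [weighted_cvg] gives the limit h with (h - f n)^2 <= 2 * 2^-n g, and
    integration gives the constant 4. *)
Lemma riesz_fischer_real (f : nat -> R2 -> R) :
  (forall n, @measurable_fun _ _ (mR * mR)%type mR D (f n)) ->
  (forall n, (\int[mu]_(x in D) ((f n.+1 x - f n x) ^+ 2)%:E <= (16 ^- n)%:E)%E) ->
  exists h, @measurable_fun _ _ (mR * mR)%type mR D h /\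
    forall n, (\int[mu]_(x in D) ((h x - f n x) ^+ 2)%:E <= (4 * 2 ^- n)%:E)%E.
Proof.
move=> mf df.
pose d n x : \bar R := (2 ^+ n * (f n.+1 x - f n x) ^+ 2)%:E.
have d0 n x : (0 <= d n x)%E by rewrite lee_fin mulr_ge0 ?sqr_ge0 ?exprn_ge0.
have mdf n : @measurable_fun _ _ (mR * mR)%type mR D (fun x => (f n.+1 x - f n x) ^+ 2).
  exact: (measurable_funX 2 (measurable_funB (mf n.+1) (mf n))).
have md n : @measurable_fun _ _ (mR * mR)%type _ D (d n).
  have mc : @measurable_fun _ _ (mR * mR)%type mR D (cst (2 ^+ n)) by exact: measurable_cst.
  apply/measurable_EFinP; exact: (measurable_funM mc (mdf n)).
pose g x : \bar R := (\sum_(0 <= n <oo) d n x)%E.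
have g0 x : (0 <= g x)%E by apply: nneseries_ge0 => n _ _.
have mg : @measurable_fun _ _ (mR * mR)%type _ D g.
  by apply: ge0_emeasurable_sum => // n x _ _.
(* The n-th term has integral at most 2^n 16^-n <= 2^-n. *)
have ig : (\int[mu]_(x in D) g x <= 2%:E)%E.
  rewrite integral_nneseries //.
  apply: (@le_trans _ _ (\sum_(0 <= n <oo) (2 / (2 ^ n.+1)%:R)%:E)%E); last exact: epsilon_trick0.
  apply: lee_nneseries => [n _ _|n _]; first by apply: integral_ge0.
  have -> : (\int[mu]_(x in D) d n x = (2 ^+ n)%:E * \int[mu]_(x in D) ((f n.+1 x - f n x) ^+ 2)%:E)%E.
    rewrite -ge0_integralZl //; first last.
    - by move=> x _; rewrite lee_fin sqr_ge0.
    by apply/measurable_EFinP; exact: mdf.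
  apply: (@le_trans _ _ ((2 ^+ n)%:E * (16 ^- n)%:E)%E).
    by apply: lee_wpmul2l; rewrite ?lee_fin ?exprn_ge0.
  rewrite -!EFinM lee_fin natrX exprS invfM mulrA divff // mul1r.
  rewrite (_ : (16 : R) = 2 * 8); last by ring.
  rewrite exprMn invfM mulrA divff ?expf_neq0 // mul1r lef_pV2 ?posrE ?exprn_gt0 //.
  by apply: lerXn2r; rewrite ?nnegrE //; lra.
have iG : mu.-integrable D g.
  apply/integrableP; split => //.
  apply: (@le_lt_trans _ _ (\int[mu]_(x in D) g x)%E); last by apply: le_lt_trans ig _; rewrite ltry.
  rewrite le_eqVlt; apply/orP; left; apply/eqP; apply: eq_integral => x _.
  by rewrite gee0_abs.
have [N [mN N0 sN]] := integrable_ae mD iG.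
pose E := ~` N; have mE : meas2 E by exact: measurableC.
have finG x : D x -> E x -> g x \is a fin_num.
  by move=> Dx Ex; apply: contrapT => nf; apply: Ex; apply: sN => /= /(_ Dx).
(* Cutting off on the exceptional set makes the sequence converge everywhere on D, so that the limit
   is measurable. *)
pose f' n x := f n x * \1_E x.
have lim_ex x : exists l, D x -> f' ^~ x @ \oo --> l /\ forall n, E x -> (l - f n x) ^+ 2 <= 2 * 2 ^- n * fine (g x).
  have [[Dx Ex]|nx] := pselect (D x /\ E x); last first.
    exists 0 => Dx; have nE : ~ E x by move=> Ex; apply: nx.
    split => // ; apply: cvg_near_cst; apply: nearW => n.
    by rewrite /f' indicE memNset // mulr0.
  have [|l [cl hl]] := @weighted_cvg (f ^~ x) (fine (g x)).
    move=> m; rewrite -lee_fin fineK ?finG // -sumEFin.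
    by apply: (@nneseries_lim_ge _ (d ^~ x) xpredT 0%N m) => k _ _.
  exists l => _; split => //.
  by rewrite /f' (_ : (fun n => _) = f ^~ x) //; apply/funext => n; rewrite indicE mem_set ?mulr1.
have [h hh] := choice lim_ex.
exists h; have mh : @measurable_fun _ _ (mR * mR)%type mR D h.
  apply: (measurable_fun_cvg (h := f')).
    have mI : @measurable_fun _ _ (mR * mR)%type mR D (\1_E) by exact: measurable_indic.
    by move=> n; exact: (measurable_funM (mf n) mI).
  by move=> x Dx; have [] := hh x Dx.
split => // n.
apply: (@le_trans _ _ (\int[mu]_(x in D) ((2 * 2 ^- n)%:E * g x))%E).
  apply: ae_ge0_le_integral => //.
  - by move=> x _; rewrite lee_fin sqr_ge0.
  - by apply/measurable_EFinP; exact: (measurable_funX 2 (measurable_funB mh (mf n))).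
  - by move=> x _; rewrite mule_ge0 // lee_fin mulr_ge0 ?invr_ge0 ?exprn_ge0.
  - exact: measurable_funeM.
  exists N; split => // x /= /not_implyP[Dx nle]; apply: contrapT => Ex; apply: nle.
  have [_ hl] := hh x Dx; rewrite -(fineK (finG x Dx Ex)) -EFinM lee_fin; exact: hl.
rewrite ge0_integralZl //.
apply: (@le_trans _ _ ((2 * 2 ^- n)%:E * 2%:E)%E).
  by apply: lee_wpmul2l => //; rewrite lee_fin mulr_ge0 ?invr_ge0 ?exprn_ge0.
rewrite -EFinM lee_fin; have : 0 <= 2 ^- n :> R by rewrite invr_ge0 exprn_ge0.
by lra.
Qed.

Lemma L2_fast_complete (u : nat -> L2 D) :
  (forall n, L2norm (u n.+1 - u n) <= 4 ^- n) ->
  exists v, forall n, L2norm (v - u n) ^+ 2 <= 8 * 2 ^- n.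
Proof.
move=> hu.
have sq (w : L2 D) : (\int[mu]_(x in D) (sqmod (w x))%:E = (L2norm w ^+ 2)%:E)%E.
  have fin : (\int[mu]_(x in D) (sqmod (w x))%:E)%E \is a fin_num.
    have iw := sqint_int_sqmod mD (L2rep_sqint w).
    exact: (integrable_fin_num mD iw).
  rewrite -(fineK fin) /L2norm sqr_sqrtr //.
  by apply: Rintegral_ge0 => x _; exact: sqmod_ge0.
have mR_ (w : L2 D) := (sqint_measurable mD (L2rep_sqint w)).1.
have mI_ (w : L2 D) := (sqint_measurable mD (L2rep_sqint w)).2.
have e16 n : L2norm (u n.+1 - u n) ^+ 2 <= 16 ^- n.
  rewrite (_ : 16 ^- n = (4 ^- n) ^+ 2 :> R).
    by apply: lerXn2r; rewrite ?nnegrE ?L2norm_ge0 // invr_ge0 exprn_ge0.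
  by rewrite exprVn exprAC; congr (_ ^- n); ring.
have part (F : C -> R) : (forall z w : C, F (z - w) = F z - F w) -> (forall z, F z ^+ 2 <= sqmod z) ->
    (forall w : L2 D, @measurable_fun _ _ (mR * mR)%type mR D (F \o w)) ->
    exists h, @measurable_fun _ _ (mR * mR)%type mR D h /\
    forall n, (\int[mu]_(x in D) ((h x - F (u n x)) ^+ 2)%:E <= (4 * 2 ^- n)%:E)%E.
  move=> FB Fs mF; apply: (riesz_fischer_real (fun n => mF (u n))) => n.
  apply: (@le_trans _ _ (\int[mu]_(x in D) (sqmod ((u n.+1 - u n : L2 D) x))%:E)%E); last first.
    by rewrite sq lee_fin.
  rewrite (eq_ae_integral (g := fun x => ((F ((u n.+1 - u n : L2 D) x)) ^+ 2)%:E)); last first.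
    by apply: ae_on_impl (L2B_ae (u n.+1) (u n)) => x _ ->; rewrite FB.
  have [m1 m2] := sqint_measurable mD (L2rep_sqint (u n.+1 - u n)).
  apply: ge0_le_integral => //.
  - by move=> x _; rewrite lee_fin sqr_ge0.
  - by apply/measurable_EFinP; exact: (measurable_funX 2 (mF (u n.+1 - u n))).
  - apply/measurable_EFinP; exact: (measurable_funD (measurable_funX 2 m1) (measurable_funX 2 m2)).
  - by move=> x _; rewrite lee_fin; exact: Fs.
have [hr [mhr ehr]] := part (fun z => Re z) (fun z w => etrans (cReD z (- w)) (congr1 _ (cReN w)))
   (fun z => ltac:(by rewrite /sqmod lerDl sqr_ge0)) mR_.
have [hi [mhi ehi]] := part (fun z => Im z) (fun z w => etrans (cImD z (- w)) (congr1 _ (cImN w)))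
   (fun z => ltac:(by rewrite /sqmod lerDr sqr_ge0)) mI_.
pose h x := Complex (hr x) (hi x).
have mdr n : @measurable_fun _ _ (mR * mR)%type mR D (fun x => (hr x - Re (u n x)) ^+ 2).
  exact: (measurable_funX 2 (measurable_funB mhr (mR_ (u n)))).
have mdi n : @measurable_fun _ _ (mR * mR)%type mR D (fun x => (hi x - Im (u n x)) ^+ 2).
  exact: (measurable_funX 2 (measurable_funB mhi (mI_ (u n)))).
have est n : (\int[mu]_(x in D) (sqmod (h x - u n x))%:E <= (8 * 2 ^- n)%:E)%E.
  rewrite (eq_integral (fun x => (((hr x - Re (u n x)) ^+ 2)%:E + ((hi x - Im (u n x)) ^+ 2)%:E)%E)); last first.
    by move=> x _; rewrite -EFinD /sqmod cReD cImD cReN cImN.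
  rewrite ge0_integralD //; first last.
  - by apply/measurable_EFinP; exact: mdi.
  - by move=> x _; rewrite lee_fin sqr_ge0.
  - by apply/measurable_EFinP; exact: mdr.
  - by move=> x _; rewrite lee_fin sqr_ge0.
  rewrite (_ : 8 * 2 ^- n = 4 * 2 ^- n + 4 * 2 ^- n); last by ring.
  by rewrite EFinD; apply: leeD; [exact: ehr|exact: ehi].
(* The estimate controls h only relative to u n; so the class of h - u 0 is taken and u 0 added
   back. *)
have sh0 : sqintegrable D (fun x => h x - u 0%N x).
  split.
  - apply/(borel_onE mD).
    rewrite (_ : Re \o _ = fun x => hr x - Re (u 0%N x)); last by apply/funext => x; rewrite /= cReD cReN.
    exact: (measurable_funB mhr (mR_ (u 0%N))).
  - apply/(borel_onE mD).
    rewrite (_ : Im \o _ = fun x => hi x - Im (u 0%N x)); last by apply/funext => x; rewrite /= cImD cImN.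
    exact: (measurable_funB mhi (mI_ (u 0%N))).
  - by apply: le_lt_trans (est 0%N) _; rewrite ltry.
exists (L2class D (fun x => h x - u 0%N x) + u 0%N) => n.
rewrite -lee_fin -sq; apply: le_trans (est n).
rewrite le_eqVlt; apply/orP; left; apply/eqP; apply: eq_ae_integral.
set w := L2class _ _.
apply: ae_on_impl2 (ae_on_and (L2B_ae (w + u 0%N) (u n)) (L2D_ae w (u 0%N))) (L2class_ae sh0).
by move=> x _ [-> ->]; rewrite -/w => ->; rewrite subrK.
Qed.

Lemma pow2_small (e : R) : 0 < e -> exists k, 2 ^- k <= e.
Proof.
move=> e0.
have h : (fun n => 2 ^- n) @ \oo --> (0 : R).
  rewrite (_ : (fun n => 2 ^- n) = (fun n => (2^-1) ^+ n)); last by apply/funext => n; rewrite exprVn.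
  by apply: cvg_expr; rewrite gtr0_norm ?invr_gt0 // invf_lt1 // ltr1n.
have [n _ hn] : \forall n \near \oo, (2 ^- n : R) < e.
  by move/cvgrPdist_lt: h => /(_ _ e0); apply: filterS => n; rewrite sub0r normrN; apply: le_lt_trans; exact: ler_norm.
by exists n; apply/ltW/hn => /=.
Qed.

Lemma L2_complete (u : nat -> L2 D) :
  (forall e : R, 0 < e -> exists n0, forall m n, (n0 <= m)%N -> (n0 <= n)%N -> L2norm (u m - u n) <= e) ->
  exists v, forall e : R, 0 < e -> exists n0, forall n, (n0 <= n)%N -> L2norm (u n - v) <= e.
Proof.
move=> cu; have ex k : exists n0, forall m n, (n0 <= m)%N -> (n0 <= n)%N -> L2norm (u m - u n) <= 4 ^- k.
  by apply: cu; rewrite invr_gt0 exprn_gt0.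
have [n0 hn0] := choice ex.
(* Partial sums make the chosen indices nondecreasing while keeping them above n0 k. *)
pose N k := (\sum_(i < k.+1) n0 i)%N.
have N0 k : (n0 k <= N k)%N by rewrite /N big_ord_recr /= leq_addl.
have N1 k : (N k <= N k.+1)%N by rewrite /N [X in (_ <= X)%N]big_ord_recr /= leq_addr.
have [|v hv] := @L2_fast_complete (u \o N).
  by move=> k; apply: hn0; [exact: leq_trans (N0 k) (N1 k)|exact: N0].
exists v => e e0.
pose e' := Num.min (e / 2) ((e / 2) ^+ 2 / 8).
have e'0 : 0 < e' by rewrite lt_min !divr_gt0 // exprn_gt0 // divr_gt0.
have [k] := pow2_small e'0; rewrite le_min => /andP[k1 k2].
have k4 : 4 ^- k <= 2 ^- k :> R.
  by rewrite lef_pV2 ?posrE ?exprn_gt0 //; apply: lerXn2r; rewrite ?nnegrE // ler_nat.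
exists (N k) => n Nn.
apply: le_trans (L2dist_tri mD (u (N k)) _ _) _; rewrite [leRHS]splitr; apply: lerD.
  apply: le_trans (le_trans k4 k1); apply: hn0; last exact: N0.
  exact: leq_trans (N0 k) Nn.
rewrite (L2distC mD) -(@ler_sqr R) ?nnegrE ?L2norm_ge0 //; last by rewrite divr_ge0 // ltW.
by apply: le_trans (hv k) _; rewrite mulrC -ler_pdivlMr.
Qed.

End Completeness.

(** * Bounds, domains and uniqueness of strongly continuous semigroups *)

Section Semigroups.
Variable R : realType.
Local Notation mR := (measurableTypeR R).
Local Notation R2 := (R * R)%type.
Local Notation C := R[i].
Local Notation meas2 := (@measurable _ (mR * mR)%type).
Variable D : set R2.
Hypothesis mD : meas2 D.
Local Notation H := (L2 D).
Local Notation "a *r u" := ((a : R)%:C%C *: u) (at level 40).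

(** Strongly continuous semigroups on [0, oo) in epsilon-delta form. The bound in [sg_bnd] is for
    each t separately; uniformity on compact intervals is proved in [sg_bound]. *)
Record semigroup (E : R -> H -> H) : Prop := Semigroup {
  sg_lin : forall t, linear (E t);
  sg_bnd : forall t, exists M : R, forall u, L2norm (E t u) <= M * L2norm u;
  sg_0 : forall u, E 0 u = u;
  sg_add : forall s t, 0 <= s -> 0 <= t -> forall u, E (s + t) u = E s (E t u);
  sg_cont0 : forall u e, 0 < e -> exists2 d : R, 0 < d &
    forall t, 0 <= t <= d -> L2norm (E t u - u) <= e }.

(** The generator maps u to f; the difference quotient is multiplied by t to avoid division. *)
Definition infinitesimal (E : R -> H -> H) (u f : H) : Prop :=
  forall e, 0 < e -> exists2 d : R, 0 < d &
    forall t, 0 < t <= d -> L2norm (E t u - u - t *r f) <= e * t.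

(** The values of S at t <= 0 are arbitrary and are replaced by the identity. *)
Definition extend0 (S : R -> H -> H) (t : R) (u : H) : H := if 0 < t then S t u else u.

Lemma L2norm_cvg0P (F : R -> H) : L2norm (F t) @[t --> 0^'+] --> (0 : R) <->
  forall e, 0 < e -> exists2 d : R, 0 < d & forall t, 0 < t <= d -> L2norm (F t) <= e.
Proof.
split=> [/cvgrPdist_le h e e0|h].
  have /h : 0 < e by [].
  rewrite near_withinE => -[d /= d0 hd]; exists (d / 2); first by rewrite divr_gt0.
  move=> t /andP[t0 td]; have := hd t; rewrite sub0r normrN ger0_norm ?L2norm_ge0 //; apply => //=.
  by rewrite sub0r normrN gtr0_norm // (le_lt_trans td) // ltr_pdivrMr // ltr_pMr // ltr1n.
apply/cvgrPdist_le => e e0; have [d d0 hd] := h e e0.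
rewrite near_withinE; exists d => //= t td t0.
rewrite sub0r normrN ger0_norm ?L2norm_ge0 //; apply: hd; rewrite t0 /=.
by move: td; rewrite /ball_ /= sub0r normrN => /ltW; apply: le_trans; exact: ler_norm.
Qed.

Lemma C0_semigroup_extend0 S : C0_semigroup S -> semigroup (extend0 S).
Proof.
move=> [Sb Sadd Sc]; rewrite /extend0; split.
- by move=> t; have [t0|_] := ltP 0 t; [have [] := Sb t t0|move=> a u v].
- move=> t; have [t0|_] := ltP 0 t; first by have [_ b] := Sb t t0.
  by exists 1 => u; rewrite mul1r.
- by move=> u; rewrite ltxx.
- move=> s t s0 t0 u.
  have [->|sn0] := eqVneq s 0; first by rewrite ltxx add0r.
  have [->|tn0] := eqVneq t 0; first by rewrite ltxx addr0.
  have sp : 0 < s by rewrite lt0r sn0.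
  have tp : 0 < t by rewrite lt0r tn0.
  by rewrite sp tp addr_gt0 // Sadd.
- move=> u e e0; have [d d0 hd] := (L2norm_cvg0P _).1 (Sc u) e e0.
  exists d => // t /andP[t0 td]; case: ifP => [tp|_]; first by apply: hd; rewrite tp.
  by rewrite subrr (L2norm0 mD) ltW.
Qed.

Lemma generator_extend0 S u f : generator S (u, f) <-> infinitesimal (extend0 S) u f.
Proof.
have key t : 0 < t -> L2norm (S t u - u - t *r f) = t * L2norm ((t^-1) *r (S t u - u) - f).
  move=> t0; transitivity (`|t| * L2norm ((t^-1) *r (S t u - u) - f)); last by rewrite gtr0_norm.
  rewrite -(L2normZC mD); congr L2norm.
  by rewrite scalerBr scalerA -rmorphM divff ?lt0r_neq0 // scale1r.
rewrite /generator /= L2norm_cvg0P /extend0; split=> h e e0; have [d d0 hd] := h e e0; exists d => // t /andP[t0 td].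
  by rewrite t0 key // mulrC ler_pM2r //; apply: hd; rewrite t0.
by have := hd t; rewrite t0 td key // mulrC ler_pM2r //; exact.
Qed.

Section OneSemigroup.
Variables (E : R -> H -> H) (sE : semigroup E).

Lemma sgB t u v : E t (u - v) = E t u - E t v.
Proof.
have := sg_lin sE t (-1) v u; rewrite !scaleN1r => h.
by rewrite addrC h addrC.
Qed.

Lemma sg00 t : E t 0 = 0.
Proof. by have := sgB t 0 0; rewrite !subrr. Qed.

Lemma sgD t u v : E t (u + v) = E t u + E t v.
Proof. by have := sg_lin sE t 1 u v; rewrite !scale1r. Qed.

Lemma sgZ t a u : E t (a *: u) = a *: E t u.
Proof. by have := sg_lin sE t a u 0; rewrite !addr0 sg00 addr0. Qed.

Lemma sg_sum t I (r : seq I) (F : I -> H) : E t (\sum_(i <- r) F i) = \sum_(i <- r) E t (F i).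
Proof. exact: (big_morph (E t) (sgD t) (sg00 t)). Qed.

(* Otherwise one finds nested balls and times t_n -> 0 with |E t_n| >= n on the
   n-th ball, against the strong continuity at a common point. *)
Lemma sg_local_bound : exists2 d : R, 0 < d & exists M : R,
  forall t u, 0 <= t <= d -> L2norm (E t u) <= M * L2norm u.
Proof.
have fin (a b c' d : R) : a + 1 + d < b -> b <= c' -> c' <= 1 + a -> 0 < d -> False by lra.
apply: contrapT => nb.
have unb (d K : R) : 0 < d -> exists t u, 0 <= t <= d /\ K * L2norm u < L2norm (E t u).
  move=> d0; apply: contrapT => h; apply: nb; exists d => //; exists K => t u td.
  by rewrite leNgt; apply/negP => lt; apply: h; exists t, u.
have step (n : nat) (x : H) (r : R) : exists y : H * R * R, 0 < r ->
    [/\ 0 < y.1.2 <= r / 2, L2norm (y.1.1 - x) <= r / 2, 0 <= y.2 <= n.+1%:R^-1 &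
     forall z, L2norm (z - y.1.1) <= y.1.2 -> n.+1%:R <= L2norm (E y.2 z)].
  have [r0|r0] := ltP 0 r; last by exists (x, r, 0).
  have n0 : 0 < n.+1%:R^-1 :> R by rewrite invr_gt0.
  have [t [xi [tn hxi]]] := unb _ (2 * (2 * n.+2%:R / r)) n0.
  have [K hK] := sg_bnd sE t.
  have xi0 : 0 < L2norm xi.
    rewrite lt0r L2norm_ge0 andbT; apply/eqP => x0; move: hxi.
    by rewrite (L2norm_eq0 mD x0) sg00 (L2norm0 mD) mulr0 ltxx.
  pose eta := (r / 2 / L2norm xi) *r xi.
  have neta : L2norm eta = r / 2.
    by rewrite /eta (L2normZC mD) ger0_norm ?divr_ge0 ?(ltW r0) ?(ltW xi0) // divfK // lt0r_neq0.
  have Eeta : 2 * n.+2%:R <= L2norm (E t eta).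
    rewrite /eta sgZ (L2normZC mD) ger0_norm ?divr_ge0 ?(ltW r0) ?(ltW xi0) //.
    rewrite mulrAC ler_pdivlMr //.
    have -> : 2 * n.+2%:R * L2norm xi = r / 2 * (2 * (2 * n.+2%:R / r) * L2norm xi).
      by field; exact: lt0r_neq0.
    by rewrite ler_pM2l ?divr_gt0 // ltW.
  (* The images of x + eta and x - eta differ by 2 E t eta, so at least one of them is large. *)
  have [y ny Ey] : exists2 y, L2norm (y - x) <= r / 2 & n.+2%:R <= L2norm (E t y).
    have [h|h] := leP n.+2%:R (L2norm (E t (x + eta))).
      by exists (x + eta) => //; rewrite addrC addKr neta.
    exists (x - eta); first by rewrite addrC addKr (L2normN mD) neta.
    rewrite leNgt; apply/negP => h'.
    have : L2norm (E t (x + eta) - E t (x - eta)) < 2 * n.+2%:R.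
      by apply: le_lt_trans (L2normB mD _ _) _; lra.
    rewrite -sgB (_ : x + eta - (x - eta) = eta + eta); last by rewrite opprB addrCA addrAC subrr add0r addrC.
    rewrite sgD -(scale1r (E t eta)) -scalerDl (_ : 1 + 1 = 2%:C%C); last by rewrite rmorphD rmorph1.
    by rewrite (L2normZC mD) ger0_norm // => h3; have := L2norm_ge0 (E t eta); lra.
  (* On a ball of radius 1 / K' the norm of E t varies by at most 1, which lowers the bound from n +
     2 to n + 1. *)
  pose K' := `|K| + 1; have K'0 : 0 < K' by rewrite ltr_wpDl.
  exists (y, Num.min (r / 2) K'^-1, t) => _; split => //=.
  - by rewrite lt_min divr_gt0 //= invr_gt0 K'0 ge_min lexx.
  - move=> z; rewrite le_min => /andP[_ zy].
    have : L2norm (E t y) - L2norm (E t z) <= 1.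
      rewrite lerBlDr -[E t y](subrK (E t z)); apply: le_trans (L2normD mD _ _) _; rewrite lerD2r.
      rewrite -sgB; apply: le_trans (hK _) _; rewrite (L2distC mD).
      apply: (@le_trans _ _ (K' * L2norm (z - y))).
        by rewrite ler_wpM2r ?L2norm_ge0 // (le_trans (ler_norm K)) // lerDl.
      by rewrite mulrC -ler_pdivlMr // mul1r.
    by move: Ey; rewrite -[n.+2]addn1 natrD; lra.
have [next hnext] := choice (fun nxr : nat * H * R => step nxr.1.1 nxr.1.2 nxr.2).
(* A state consists of centre, radius and time; the unit ball about 0 starts with a dummy time. *)
pose st := fix st (n : nat) : H * R * R := if n is k.+1 then next (k, (st k).1.1, (st k).1.2) else (0, 1, 0).
pose x n := (st n).1.1; pose r n := (st n).1.2; pose tt n := (st n.+1).2.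
have rp n : 0 < r n.
  elim: n => [|n IH]; first by rewrite /r /= ltr01.
  by have [/andP[]] := hnext (n, x n, r n) IH.
have hs n : [/\ r n.+1 <= r n / 2, L2norm (x n.+1 - x n) <= r n / 2, 0 <= tt n <= n.+1%:R^-1 &
     forall z, L2norm (z - x n.+1) <= r n.+1 -> n.+1%:R <= L2norm (E (tt n) z)].
  by have [/andP[_ h1] h2 h3 h4] := hnext (n, x n, r n) (rp n).
have nest n m : L2norm (x (n + m)%N - x n) + r (n + m)%N <= r n.
  elim: m => [|m IH]; first by rewrite addn0 subrr (L2norm0 mD) add0r.
  have [h1 h2 _ _] := hs (n + m)%N; rewrite addnS.
  by have := L2dist_tri mD (x (n + m)%N) (x (n + m).+1) (x n); lra.
have r2 n : r n <= 2 ^- n.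
  elim: n => [|n IH]; first by rewrite expr0 invr1 /r /=.
  by have [h1 _ _ _] := hs n; rewrite exprS invfM mulrC; apply: le_trans h1 _; rewrite ler_pM2r ?invr_gt0.
have close n m : (n <= m)%N -> L2norm (x m - x n) <= r n.
  by move=> nm; have := nest n (m - n)%N; rewrite subnKC //; have := rp m; lra.
have [|y hy] := L2_complete mD (u := x).
  move=> e e0; have [k hk] := pow2_small (divr_gt0 e0 (ltr0n R 2)); exists k => m n km kn.
  apply: le_trans (L2dist_tri mD (x k) _ _) _; rewrite [leRHS]splitr (L2distC mD (x k)).
  by apply: lerD; apply: le_trans (close k _ _) _ => //; exact: le_trans (r2 k) hk.
have yx n : L2norm (y - x n) <= r n.
  apply/ler_addgt0Pr => e e0; have [n0 hn0] := hy e e0.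
  apply: le_trans (L2dist_tri mD (x (maxn n n0)) _ _) _; rewrite addrC; apply: lerD.
    by apply: close; exact: leq_maxl.
  by rewrite (L2distC mD); apply: hn0; exact: leq_maxr.
have [d d0 hd] := sg_cont0 sE y (ltr01 : 0 < (1 : R)).
(* Beyond this bound the time tt n is at most d, so |E (tt n) y| <= 1 + |y|, while n + 1 is larger
   than that. *)
pose B := L2norm y + 1 + d^-1.
have B0 : 0 <= B by rewrite addr_ge0 ?invr_ge0 ?(ltW d0) // addr_ge0 // L2norm_ge0.
have := archi_boundP B0; set n := Num.bound B => Bn.
have nB : B < n.+1%:R by apply: lt_trans Bn _; rewrite ltr_nat.
have [_ _ /andP[t0 tn] h4] := hs n.
have := h4 y (yx n.+1); have := hd (tt n); rewrite t0 /=.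
have td : tt n <= d.
  apply: le_trans tn _; rewrite -[leRHS]invrK lef_pV2 ?posrE ?invr_gt0 //.
  by apply/ltW; apply: le_lt_trans nB; rewrite /B lerDr addr_ge0 // L2norm_ge0.
move=> /(_ td) h1 h2.
have h3 : L2norm (E (tt n) y) <= 1 + L2norm y.
  by rewrite -[E (tt n) y](subrK y); apply: le_trans (L2normD mD _ _) _; rewrite lerD2r.
by apply: (fin _ _ _ _ nB h2 h3); rewrite invr_gt0.
Qed.

(** The local bound is iterated over steps of length d; a constant K >= 1 lets the exponent be
    rounded up. *)
Lemma sg_bound (tau : R) : exists2 M : R, 1 <= M &
  forall t u, 0 <= t <= tau -> L2norm (E t u) <= M * L2norm u.
Proof.
have [d d0 [M hM]] := sg_local_bound.
pose K := `|M| + 1; have K1 : 1 <= K by rewrite lerDr.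
have K0 : 0 <= K by exact: le_trans ler01 K1.
have hK t u : 0 <= t <= d -> L2norm (E t u) <= K * L2norm u.
  move=> td; apply: le_trans (hM t u td) _; rewrite ler_wpM2r ?L2norm_ge0 //.
  by rewrite (le_trans (ler_norm M)) // lerDl.
have key n t u : 0 <= t <= n%:R * d -> L2norm (E t u) <= K ^+ n * L2norm u.
  elim: n t u => [|n IH] t u.
    rewrite mul0r -eq_le => /eqP <-; by rewrite (sg_0 sE) expr0 mul1r.
  move=> /andP[t0 tn]; have [td|dt] := leP t d.
    apply: (le_trans (hK t u _)); first by rewrite t0.
    by rewrite ler_wpM2r ?L2norm_ge0 // exprS ler_peMr // exprn_ege1.
  rewrite -[t](subrK d) (sg_add sE) ?subr_ge0 ?(ltW dt) ?(ltW d0) //.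
  apply: le_trans (IH _ _ _) _.
    rewrite subr_ge0 ltW //= lerBlDr; apply: le_trans tn _; by rewrite -natr1 mulrDl mul1r.
  rewrite exprSr -mulrA ler_wpM2l ?exprn_ge0 //; apply: hK; by rewrite lexx ltW.
pose B := `|tau| / d; have B0 : 0 <= B by rewrite divr_ge0 // ltW.
exists (K ^+ Num.bound B); first exact: exprn_ege1.
move=> t u /andP[t0 tt]; apply: key; rewrite t0 /=.
apply: le_trans tt _; apply: le_trans (ler_norm _) _; rewrite -ler_pdivrMr //.
exact/ltW/archi_boundP.
Qed.

(** For s <= t the difference is E s applied to E (t - s) u - u, so continuity at 0 becomes uniform
    through the bound on [0, tau]. *)
Lemma sg_modulus (tau e : R) u : 0 < e -> exists2 d : R, 0 < d &
  forall s t, 0 <= s <= tau -> 0 <= t <= tau -> `|s - t| <= d -> L2norm (E s u - E t u) <= e.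
Proof.
move=> e0; have [M M1 hM] := sg_bound tau.
have M0 : 0 < M by exact: lt_le_trans ltr01 M1.
have [d d0 hd] := sg_cont0 sE u (divr_gt0 e0 M0).
exists d => // s t; wlog st : s t / s <= t => [wl hs ht st|].
  have [h|h] := leP s t; first exact: wl.
  by rewrite (L2distC mD); apply: wl => //; rewrite ?(ltW h) // distrC.
move=> hs ht; rewrite distrC ger0_norm ?subr_ge0 // => std.
have [s0 _] := andP hs.
rewrite -[t](subrKC s) (sg_add sE) ?subr_ge0 // (L2distC mD) -sgB.
apply: le_trans (hM _ _ hs) _; rewrite mulrC -ler_pdivlMr //; apply: hd.
by rewrite subr_ge0 st.
Qed.

Lemma infinitesimal_orbit u f s : 0 <= s -> infinitesimal E u f -> infinitesimal E (E s u) (E s f).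
Proof.
move=> s0 g e e0; have [M hM] := sg_bnd sE s.
pose K := `|M| + 1; have K0 : 0 < K by rewrite ltr_wpDl.
have [d d0 hd] := g _ (divr_gt0 e0 K0).
exists d => // t td; have /andP[t0 _] := td.
have -> : E t (E s u) - E s u - t *r E s f = E s (E t u - u - t *r f).
  by rewrite !sgB sgZ -(sg_add sE (ltW t0) s0) -(sg_add sE s0 (ltW t0)) (addrC s t).
apply: le_trans (hM _) _.
apply: (@le_trans _ _ (K * L2norm (E t u - u - t *r f))).
  by rewrite ler_wpM2r ?L2norm_ge0 // (le_trans (ler_norm M)) // lerDl.
rewrite mulrC -ler_pdivlMr // mulrAC; exact: hd.
Qed.

Lemma sum_nat_blocks (V : nmodType) (F : nat -> V) n k :
  \sum_(0 <= i < n * k) F i = \sum_(0 <= a < n) \sum_(0 <= b < k) F (a * k + b)%N.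
Proof.
elim: n => [|n IH]; first by rewrite mul0n !big_geq.
rewrite big_nat_recr //= -IH mulSn addnC (@big_cat_nat _ _ _ (n * k)%N) ?leq_addr //=.
congr (_ + _); rewrite -{1}[(n * k)%N]add0n big_addn addKn.
by apply: eq_bigr => i _; rewrite addnC.
Qed.

(** The discrete form of exchanging the ends: the integral over [t, t + h] minus that over [0, h] is
    the integral over [h, h + t] minus that over [0, t]. *)
Lemma sum_shift_sub (V : zmodType) (F : nat -> V) n m :
  \sum_(0 <= i < n) F (m + i)%N - \sum_(0 <= i < n) F i =
  \sum_(0 <= i < m) (F (n + i)%N - F i).
Proof.
have h (a b : nat) : \sum_(0 <= i < a + b) F i = \sum_(0 <= i < a) F i + \sum_(0 <= i < b) F (a + i)%N.
  rewrite (@big_cat_nat _ _ _ a) ?leq_addr //=; congr (_ + _).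
  rewrite -{1}[a]add0n big_addn addKn; by apply: eq_bigr => i _; rewrite addnC.
rewrite sumrB; apply/eqP; rewrite subr_eq addrAC eq_sym subr_eq addrC -h addrC -h addnC; exact: eqxx.
Qed.

Section Riemann.
Variables (u : H) (h : R).
Hypothesis h0 : 0 < h.

(** The Riemann sum with n nodes for the mean of the orbit of u over [0, h]. *)
Definition riemann (n : nat) : H :=
  (n%:R^-1) *r (\sum_(0 <= i < n) E (i%:R * (h / n%:R)) u).

Lemma L2norm_mean n (F : nat -> H) (e : R) : (0 < n)%N ->
  (forall i, (i < n)%N -> L2norm (F i) <= e) ->
  L2norm ((n%:R^-1) *r (\sum_(0 <= i < n) F i)) <= e.
Proof.
move=> n0 hF; have nR : 0 < n%:R :> R by rewrite ltr0n.
rewrite (L2normZC mD) ger0_norm ?invr_ge0 ?(ltW nR) // mulrC ler_pdivrMr //.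
apply: le_trans (L2norm_sum mD _ _) _.
apply: (@le_trans _ _ (\sum_(0 <= i < n) e)).
  by rewrite big_nat [leRHS]big_nat; apply: ler_sum => i /andP[_ hi]; exact: hF.
by rewrite sumr_const_nat subn0 mulr_natr.
Qed.

Lemma sum_const_scale m (v : H) : \sum_(0 <= i < m) v = m%:R *r v.
Proof. by rewrite sumr_const_nat subn0 -[v *+ m]scaler_nat; congr (_ *: _); rewrite rmorph_nat. Qed.

Lemma mean_const n (v : H) : (0 < n)%N -> (n%:R^-1) *r (\sum_(0 <= i < n) v) = v.
Proof.
move=> n0; rewrite sum_const_scale scalerA -rmorphM mulVf ?rmorph1 ?scale1r //.
by rewrite pnatr_eq0 -lt0n.
Qed.

Lemma riemann_near n e : (0 < n)%N -> (forall t, 0 <= t <= h -> L2norm (E t u - u) <= e) ->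
  L2norm (riemann n - u) <= e.
Proof.
move=> n0 he; rewrite -[u in X in X <= _](mean_const u n0) /riemann -scalerBr -sumrB.
have nR : 0 < n%:R :> R by rewrite ltr0n.
apply: L2norm_mean => // i hi; apply: he.
rewrite mulr_ge0 ?divr_ge0 ?(ltW h0) ?(ltW nR) //= mulrCA ger_pMr // ler_pdivrMr // mul1r ler_nat.
exact: ltnW.
Qed.

Lemma riemann_refine n k e : (0 < n)%N -> (0 < k)%N ->
  (forall s t, 0 <= s <= h -> 0 <= t <= h -> `|s - t| <= h / n%:R -> L2norm (E s u - E t u) <= e) ->
  L2norm (riemann (n * k) - riemann n) <= e.
Proof.
move=> n0 k0 he; have nR : 0 < n%:R :> R by rewrite ltr0n.
have kR : 0 < k%:R :> R by rewrite ltr0n.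
have -> : riemann (n * k) = (n%:R^-1) *r (\sum_(0 <= a < n)
    ((k%:R^-1) *r (\sum_(0 <= b < k) E ((a * k + b)%:R * (h / (n * k)%:R)) u))).
  by rewrite /riemann sum_nat_blocks -scaler_sumr scalerA -rmorphM natrM invfM.
rewrite /riemann -scalerBr -sumrB; apply: L2norm_mean => // a an.
rewrite -[E (a%:R * _) u](mean_const _ k0) -scalerBr -sumrB; apply: L2norm_mean => // b bk.
have E1 : (a * k + b)%:R * (h / (n * k)%:R) = a%:R * (h / n%:R) + b%:R / k%:R * (h / n%:R).
  by rewrite natrD !natrM; field; rewrite !lt0r_neq0.
have hn0 : 0 <= h / n%:R by rewrite divr_ge0 ?(ltW h0) ?(ltW nR).
have b1 : 0 <= (b%:R / k%:R : R) <= 1.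
  by rewrite divr_ge0 ?(ltW kR) //= ler_pdivrMr // mul1r ler_nat ltnW.
have [b10 b11] := andP b1.
have an1 : a%:R * (h / n%:R) + h / n%:R <= h.
  by rewrite -[X in _ + X]mul1r -mulrDl natr1 mulrCA ger_pMr // ler_pdivrMr // mul1r ler_nat.
have bh : b%:R / k%:R * (h / n%:R) <= h / n%:R by rewrite ler_piMl.
have bh0 : 0 <= b%:R / k%:R * (h / n%:R) by rewrite mulr_ge0.
have ah0 : 0 <= a%:R * (h / n%:R) by rewrite mulr_ge0.
apply: he; rewrite ?E1.
- by apply/andP; split; lra.
- by apply/andP; split; lra.
- by rewrite addrC addKr ger0_norm.
Qed.

Lemma riemann_cvg : exists q, forall e, 0 < e -> exists n0, forall n, (n0 <= n)%N ->
  L2norm (riemann (2 ^ n) - q) <= e.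
Proof.
apply: (L2_complete mD) => e e0.
have [d d0 hd] := sg_modulus h u (divr_gt0 e0 (ltr0n R 2)).
have [n0 hn0] := pow2_small (divr_gt0 d0 h0).
have key m : (n0 <= m)%N -> L2norm (riemann (2 ^ m) - riemann (2 ^ n0)) <= e / 2.
  move=> nm; rewrite -(subnKC nm) expnD; apply: riemann_refine; rewrite ?expn_gt0 // => s t hs ht st.
  apply: hd => //; apply: le_trans st _; move: hn0; rewrite ler_pdivlMr // mulrC natrX.
  by [].
exists n0 => m n nm nn; rewrite [leRHS]splitr.
apply: le_trans (L2dist_tri mD (riemann (2 ^ n0)) _ _) _; apply: lerD; first exact: key.
by rewrite (L2distC mD); exact: key.
Qed.

(** Applying E t shifts the sum, so in the difference only its two ends remain. The three errors
    come from rounding t to m mesh steps, from replacing E s u by u at the ends, and from m / n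
    differing from t / h by at most 1 / n. *)
Lemma riemann_diff n t (M w1 w2 : R) : (0 < n)%N -> 0 < t <= h ->
  (forall s v, 0 <= s <= h + h -> L2norm (E s v) <= M * L2norm v) -> 1 <= M ->
  (forall s, 0 <= s <= h / n%:R -> L2norm (E s u - u) <= w1) ->
  (forall s, 0 <= s <= t -> L2norm (E s u - u) <= w2) ->
  L2norm (E t (riemann n) - riemann n - (t / h) *r (E h u - u)) <=
    M * w1 + (t / h) * ((M + 1) * w2) + n%:R^-1 * L2norm (E h u - u).
Proof.
move=> n0 /andP[t0 th] hM M1 hw1 hw2.
have M0 : 0 <= M by exact: le_trans ler01 M1.
have nR : 0 < n%:R :> R by rewrite ltr0n.
pose eta := h / n%:R; have eta0 : 0 < eta by rewrite divr_gt0.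
have neta : n%:R * eta = h by rewrite /eta mulrCA divff ?mulr1 // lt0r_neq0.
(* m whole mesh steps fit into t, and the remainder is shorter than one step. *)
pose m := Num.trunc (t / eta).
have /andP[m1 m2] : m%:R <= t / eta < m.+1%:R.
  by apply: truncn_itv; rewrite divr_ge0 // ltW.
rewrite ler_pdivlMr // in m1; rewrite ltr_pdivrMr // in m2.
pose F i := E (i%:R * eta) u.
have i0 i : 0 <= i%:R * eta by rewrite mulr_ge0 // ltW.
have Fadd i j : F (i + j)%N = E (i%:R * eta) (F j).
  by rewrite /F natrD mulrDl (sg_add sE).
have inh i : (i < n)%N -> i%:R * eta <= h by move=> ni; rewrite -neta ler_pM2r // ler_nat ltnW.
pose A := (n%:R^-1) *r (\sum_(0 <= i < n) (E t (F i) - F (m + i)%N)).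
pose B := (n%:R^-1) *r (\sum_(0 <= i < m) (F (n + i)%N - F i)).
have AB : E t (riemann n) - riemann n = A + B.
  rewrite /riemann sgZ sg_sum -scalerBr /A /B -sum_shift_sub -scalerDr; congr (_ *: _).
  by rewrite sumrB addrA subrK.
have nA : L2norm A <= M * w1.
  apply: L2norm_mean => // i ni; pose r := t - m%:R * eta.
  have r0 : 0 <= r by rewrite subr_ge0.
  have r1 : r <= eta by move: m2; rewrite -natr1 mulrDl mul1r /r => m2'; rewrite lerBlDl ltW.
  have -> : E t (F i) = E ((m + i)%:R * eta) (E r u).
    rewrite /F -!(sg_add sE) ?(ltW t0) //; congr (E _ u).
    by rewrite natrD /r; ring.
  rewrite /F -sgB; apply: le_trans (hM _ _ _) _.
    by rewrite i0 /= natrD mulrDl; apply: lerD; [exact: le_trans m1 th|exact: inh].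
  by rewrite ler_wpM2l //; apply: hw1; rewrite r0.
have mnt : m%:R / n%:R <= t / h.
  have -> : m%:R / n%:R = m%:R * eta / h by rewrite /eta; field; rewrite !lt0r_neq0.
  by rewrite ler_pM2r ?invr_gt0.
have nB : L2norm (B - (t / h) *r (E h u - u)) <= (t / h) * ((M + 1) * w2) + n%:R^-1 * L2norm (E h u - u).
  pose G i := E h (F i - u) - (F i - u).
  have BE : B = (n%:R^-1) *r (\sum_(0 <= i < m) G i) + (m%:R / n%:R) *r (E h u - u).
    rewrite /B mulrC rmorphM -scalerA -sum_const_scale -scalerDr -big_split /=; congr (_ *: _).
    apply: eq_bigr => i _; rewrite Fadd neta /G sgB.
    by rewrite opprB addrAC !subrKA.
  have GK i : (i < m)%N -> L2norm (G i) <= (M + 1) * w2.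
    move=> im; apply: le_trans (L2normB mD _ _) _; rewrite mulrDl mul1r.
    have w : L2norm (F i - u) <= w2.
      apply: hw2; rewrite i0 /=; apply: le_trans m1; rewrite ler_pM2r // ler_nat; exact: ltnW.
    apply: lerD => //; apply: le_trans (hM h _ _) _; first by rewrite (ltW h0) lerDl ltW.
    by rewrite ler_wpM2l.
  have K0 : 0 <= (M + 1) * w2.
    rewrite mulr_ge0 ?addr_ge0 //; apply: le_trans (hw2 0 _); first exact: L2norm_ge0.
    by rewrite lexx ltW.
  rewrite BE -addrA -scalerBl -rmorphB; apply: le_trans (L2normD mD _ _) _; apply: lerD.
    rewrite (L2normZC mD) ger0_norm ?invr_ge0 ?(ltW nR) //.
    apply: (@le_trans _ _ (n%:R^-1 * (m%:R * ((M + 1) * w2)))).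
      rewrite ler_wpM2l ?invr_ge0 ?(ltW nR) //.
      apply: le_trans (L2norm_sum mD _ _) _.
      apply: (@le_trans _ _ (\sum_(0 <= i < m) ((M + 1) * w2))).
        by rewrite big_nat [leRHS]big_nat; apply: ler_sum => i /andP[_ hi]; exact: GK.
      by rewrite sumr_const_nat subn0 mulr_natl.
    have -> : n%:R^-1 * (m%:R * ((M + 1) * w2)) = (m%:R / n%:R) * ((M + 1) * w2) by rewrite mulrCA mulrA.
    exact: (ler_wpM2r K0).
  rewrite (L2normZC mD) ler_wpM2r ?L2norm_ge0 // distrC ger0_norm ?subr_ge0 //.
  have -> : t / h - m%:R / n%:R = (t - m%:R * eta) / h.
    by rewrite /eta; field; rewrite !lt0r_neq0.
  rewrite ler_pdivrMr // (_ : n%:R^-1 * h = eta); last by rewrite mulrC.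
  by move: m2; rewrite -natr1 mulrDl mul1r => m2'; rewrite lerBlDl ltW.
rewrite AB -addrA; apply: le_trans (L2normD mD _ _) _; rewrite -addrA; exact: lerD.
Qed.
(** The choice of w2 makes the second error of [riemann_diff] equal to e t. With t fixed, the mesh
    is refined until the other two errors and the one from replacing q by a Riemann sum are at most
    r / 4 each, for an arbitrary r. *)
Lemma riemann_limit_infinitesimal q :
  (forall e, 0 < e -> exists n0, forall n, (n0 <= n)%N -> L2norm (riemann (2 ^ n) - q) <= e) ->
  infinitesimal E q ((h^-1) *r (E h u - u)).
Proof.
move=> hq e e0; have [M M1 hM] := sg_bound (h + h).
have M0 : 0 <= M by exact: le_trans ler01 M1.
have M2 : 0 < M + 1 by rewrite ltr_wpDl.
pose w2 := e * h / (M + 1); have w20 : 0 < w2 by rewrite divr_gt0 // mulr_gt0.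
have [d d0 hd] := sg_cont0 sE u w20.
exists (Num.min d h); first by rewrite lt_min d0.
move=> t /andP[t0]; rewrite le_min => /andP[td th].
rewrite scalerA -rmorphM.
apply/ler_addgt0Pr => r r0.
pose w1 := r / 4 / M; have w10 : 0 < w1 by rewrite !divr_gt0 // (lt_le_trans ltr01).
have [d1 d10 hd1] := sg_cont0 sE u w10.
have [Mt hMt] := sg_bnd sE t; pose K := `|Mt| + 1 + 1.
have K0 : 0 < K by rewrite ltr_wpDl // addr_ge0.
have rK : 0 < r / 4 / K by rewrite !divr_gt0.
have [n1 hn1] := hq _ rK.
pose L := L2norm (E h u - u) + 1; have L0 : 0 < L by rewrite ltr_wpDl // L2norm_ge0.
have mm : 0 < Num.min (d1 / h) (r / 4 / L) by rewrite lt_min !divr_gt0.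
have [n2 ] := pow2_small mm; rewrite le_min => /andP[n2a n2b].
pose n := maxn n1 n2.
have p2 : 2 ^- n <= 2 ^- n2 :> R.
  by rewrite lef_pV2 ?posrE ?exprn_gt0 // ler_weXn2l ?ler1n // leq_maxr.
have q1 : h / (2 ^ n)%:R <= d1.
  rewrite natrX; apply: (@le_trans _ _ (h * 2 ^- n2)); first by rewrite ler_pM2l.
  by rewrite mulrC -ler_pdivlMr.
have c1 s : 0 <= s <= h / (2 ^ n)%:R -> L2norm (E s u - u) <= w1.
  by move=> /andP[s0 s1]; apply: hd1; rewrite s0 (le_trans s1).
have c2 s : 0 <= s <= t -> L2norm (E s u - u) <= w2.
  by move=> /andP[s0 s1]; apply: hd; rewrite s0 (le_trans s1).
have n0 : (0 < 2 ^ n)%N by rewrite expn_gt0.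
have tth : 0 < t <= h by rewrite t0.
have D1 := riemann_diff n0 tth hM M1 c1 c2.
set X := (t / h) *r _ in D1 *; set Q := riemann (2 ^ n) in D1 *.
have D2 : L2norm (E t (q - Q) - (q - Q)) <= r / 4.
  have qQ : L2norm (q - Q) <= r / 4 / K by rewrite (L2distC mD); apply: hn1; exact: leq_maxl.
  apply: le_trans (L2normB mD _ _) _; rewrite -[leRHS](divfK (lt0r_neq0 K0)).
  apply: (@le_trans _ _ (L2norm (q - Q) * K)); last by rewrite ler_pM2r.
  rewrite mulrDr mulr1 lerD2r; apply: le_trans (hMt _) _; rewrite mulrC ler_wpM2l ?L2norm_ge0 //.
  by apply: le_trans (ler_norm _) _; rewrite lerDl.
have -> : E t q - q - X = E t Q - Q - X + (E t (q - Q) - (q - Q)).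
  by rewrite sgB [RHS]addrAC; congr (_ - _); rewrite addrACA -opprD !(addrC _ (_ - _)) !subrK.
apply: le_trans (L2normD mD _ _) _; apply: le_trans (lerD D1 D2) _.
have e1 : M * w1 = r / 4 by rewrite /w1 mulrC divfK // lt0r_neq0 // (lt_le_trans ltr01).
have e2 : t / h * ((M + 1) * w2) = e * t by rewrite /w2; field; rewrite !lt0r_neq0.
have e3 : (2 ^ n)%:R^-1 * L2norm (E h u - u) <= r / 4.
  rewrite natrX; apply: (@le_trans _ _ (r / 4 / L * L)); last by rewrite divfK // lt0r_neq0.
  apply: ler_pM; rewrite ?invr_ge0 ?exprn_ge0 ?L2norm_ge0 //; first exact: le_trans n2b.
  by rewrite /L lerDl.
by rewrite e1 e2; clear -e3 r0; lra.
Qed.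
End Riemann.

Lemma infinitesimal_dense u e : 0 < e -> exists v f, infinitesimal E v f /\ L2norm (v - u) <= e.
Proof.
move=> e0; have e2 : 0 < e / 2 by rewrite divr_gt0.
have [h h0 hh] := sg_cont0 sE u e2.
have [q hq] := riemann_cvg u h0.
exists q, ((h^-1) *r (E h u - u)); split; first exact: riemann_limit_infinitesimal.
have [n hn] := hq _ e2.
apply: le_trans (L2dist_tri mD (riemann u h (2 ^ n)) _ _) _; rewrite [leRHS]splitr (L2distC mD q).
by apply: lerD; [exact: hn|apply: riemann_near => //; rewrite expn_gt0].
Qed.

End OneSemigroup.

(** Continuous induction: the supremum of the times with phi s <= e s is attained by the condition
    from the left, and the condition to the right lets it be exceeded unless it is t. *)
Lemma right_growth_bound (phi : R -> R) (t e : R) : 0 <= t -> phi 0 <= 0 ->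
  (forall s, 0 <= s < t -> exists2 d : R, 0 < d & forall r, 0 < r <= d -> s + r <= t ->
    phi (s + r) <= phi s + e * r) ->
  (forall s eta, 0 < s <= t -> 0 < eta -> exists2 d : R, 0 < d & forall r, 0 <= r <= s -> s - d <= r ->
    phi s <= phi r + eta) ->
  0 <= e -> phi t <= e * t.
Proof.
move=> t0 p0 hr hl e0.
pose A := [set s | 0 <= s <= t /\ phi s <= e * s].
have A0 : A 0 by rewrite /A /= lexx t0 mulr0.
have ubA : ubound A t by move=> s [/andP[_ st] _].
have hs : has_sup A by split; [exists 0|exists t].
pose s := sup A.
have st : s <= t by apply: ge_sup => //; exists 0.
have s0 : 0 <= s by apply: ub_le_sup => //; exists t.
have As : A s.
  split; first by rewrite s0.
  have [sz|sn0] := eqVneq s 0; first by rewrite sz mulr0.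
  have sp : 0 < s by rewrite lt0r sn0.
  apply/ler_addgt0Pr => eta eta0; have sst : 0 < s <= t by rewrite sp.
  have [d d0 hd] := hl s eta sst eta0.
  have [r Ar sr] := sup_adherent d0 hs.
  have rs : r <= s by apply: ub_le_sup => //; exists t.
  have [/andP[r0 rt] pr] := Ar.
  have rr : 0 <= r <= s by rewrite r0.
  apply: le_trans (hd r rr (ltW sr)) _; rewrite lerD2r; apply: le_trans pr _.
  by rewrite ler_wpM2l.
have [_ ps] := As.
have [<-//|snt] := eqVneq s t.
have slt : 0 <= s < t by rewrite s0 lt_neqAle snt.
have [d d0 hd] := hr s slt.
pose r := Num.min d (t - s).
have r0 : 0 < r by rewrite lt_min d0 subr_gt0; case/andP: slt.
have rd : 0 < r <= d by rewrite r0 ge_min lexx.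
have srt : s + r <= t by rewrite -lerBrDl ge_min lexx orbT.
have : A (s + r).
  split; first by rewrite srt andbT addr_ge0 // ltW.
  by apply: le_trans (hd r rd srt) _; rewrite mulrDr lerD2r.
move=> /(ub_le_sup (ex_intro _ t ubA)); rewrite -/s gerDl leNgt r0.
by [].
Qed.

(** For v in the domain of the first generator, s |-> F (t - s) (E s v) has right increments of
    order o(r), as both semigroups have the same derivative at E s v; together with left continuity
    [right_growth_bound] makes its end values agree. Density and the bounds on [0, t] extend this to
    all u. *)
Lemma semigroup_unique E F : semigroup E -> semigroup F ->
  (forall u f, infinitesimal E u f -> infinitesimal F u f) ->
  forall t u, 0 <= t -> E t u = F t u.
Proof.
move=> sE sF EF t u t0.
have [ME ME1 hME] := sg_bound sE t; have [MF MF1 hMF] := sg_bound sF t.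
have ME0 : 0 < ME by exact: lt_le_trans ltr01 ME1.
have MF0 : 0 < MF by exact: lt_le_trans ltr01 MF1.
have tt : 0 <= t <= t by rewrite t0 lexx.
have core v f : infinitesimal E v f -> E t v = F t v.
  move=> gv; pose G s := F (t - s) (E s v).
  have Gt : G t = E t v by rewrite /G subrr (sg_0 sF).
  have G0 : G 0 = F t v by rewrite /G subr0 (sg_0 sE).
  have key e : 0 < e -> L2norm (G t - G 0) <= e * t.
    move=> e0; apply: (@right_growth_bound (fun s => L2norm (G s - G 0)) t e) => //.
    - by rewrite subrr (L2norm0 mD).
    - move=> s /andP[s0 st].
      have gs := infinitesimal_orbit sE s0 gv.
      have e2 : 0 < e / 2 / MF by rewrite !divr_gt0.
      have [d1 d10 h1] := gs _ e2; have [d2 d20 h2] := EF _ _ gs _ e2.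
      exists (Num.min d1 d2); first by rewrite lt_min d10.
      move=> r /andP[r0]; rewrite le_min => /andP[rd1 rd2] srt.
      apply: le_trans (L2dist_tri mD (G s) (G (s + r)) (G 0)) _; rewrite [leLHS]addrC lerD2l.
      set w := E s v in gs h1 h2.
      have -> : G (s + r) - G s = F (t - (s + r)) (E r w - F r w).
        have x1 : E (s + r) v = E r w by rewrite addrC (sg_add sE (ltW r0) s0).
        have x2 : F (t - s) w = F (t - (s + r)) (F r w).
          rewrite -(sg_add sF) ?subr_ge0 ?(ltW r0) //; congr (F _ w); ring.
        by rewrite /G x1 -/w x2 (sgB sF).
      apply: le_trans (hMF _ _ _) _; first by rewrite subr_ge0 srt gerBl addr_ge0 // ltW.
      rewrite mulrC -ler_pdivlMr //.
      have -> : E r w - F r w = (E r w - w - r *r E s f) - (F r w - w - r *r E s f).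
        by rewrite opprB addrA subrK opprB addrA subrK.
      apply: le_trans (L2normB mD _ _) _.
      have := h1 r; have := h2 r; rewrite r0 rd1 rd2 => /(_ isT) i1 /(_ isT) i2.
      apply: le_trans (lerD i2 i1) _.
      by rewrite -mulrDl -mulrDl -splitr mulrAC.
    - move=> s eta /andP[s0 st] eta0.
      have e1 : 0 < eta / 2 / MF by rewrite !divr_gt0.
      have e2 : 0 < eta / 2 / MF / MF by rewrite !divr_gt0.
      have [d1 d10 h1] := sg_modulus sE t v e2.
      have [d2 d20 h2] := sg_cont0 sF (E s v) e1.
      exists (Num.min d1 d2); first by rewrite lt_min d10.
      move=> r /andP[r0 rs]; rewrite lerBlDl -lerBlDr le_min => /andP[rd1 rd2].
      apply: le_trans (L2dist_tri mD (G r) (G s) (G 0)) _; rewrite [leLHS]addrC lerD2l.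
      have -> : G s - G r = F (t - s) (E s v - F (s - r) (E r v)).
        have x2 : F (t - r) (E r v) = F (t - s) (F (s - r) (E r v)).
          rewrite -(sg_add sF) ?subr_ge0 //; congr (F _ _); ring.
        by rewrite /G x2 (sgB sF).
      apply: le_trans (hMF _ _ _) _; first by rewrite subr_ge0 st gerBl ltW.
      rewrite mulrC -ler_pdivlMr // (L2distC mD).
      have -> : F (s - r) (E r v) - E s v = F (s - r) (E r v - E s v) + (F (s - r) (E s v) - E s v).
        by rewrite (sgB sF) addrA subrK.
      apply: le_trans (L2normD mD _ _) _; rewrite [X in _ <= X / _]splitr mulrDl; apply: lerD; last first.
        by apply: h2; rewrite subr_ge0 rs.
      apply: le_trans (hMF _ _ _) _; first by rewrite subr_ge0 rs /= lerBlDr (le_trans st) // lerDl.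
      rewrite mulrC -ler_pdivlMr //; apply: h1; rewrite ?r0 ?(ltW s0) //=; first exact: le_trans rs st.
      by rewrite distrC ger0_norm // subr_ge0.
    - exact: ltW.
  have z : L2norm (G t - G 0) = 0.
    apply/eqP; rewrite eq_le L2norm_ge0 andbT; apply/ler_addgt0Pr => e e0; rewrite add0r.
    have t1 : 0 < t + 1 by rewrite ltr_wpDl.
    apply: le_trans (key (e / (t + 1)) _) _; first by rewrite divr_gt0.
    by rewrite mulrAC ler_pdivrMr // ler_pM2l // lerDl.
  by apply/eqP; rewrite -subr_eq0 -Gt -G0 (L2norm_eq0 mD z).
have z : L2norm (E t u - F t u) = 0.
  apply/eqP; rewrite eq_le L2norm_ge0 andbT; apply/ler_addgt0Pr => e e0; rewrite add0r.
  have MM : 0 < ME + MF by rewrite addr_gt0.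
  have [v [f [gv vu]]] := infinitesimal_dense sE u (divr_gt0 e0 MM).
  have -> : E t u - F t u = E t (u - v) - F t (u - v).
    by rewrite (sgB sE) (sgB sF) (core v f gv) opprB addrA subrK.
  apply: le_trans (L2normB mD _ _) _; apply: le_trans (lerD (hME _ _ tt) (hMF _ _ tt)) _.
  by rewrite -mulrDl mulrC -ler_pdivlMr // (L2distC mD).
by apply/eqP; rewrite -subr_eq0 (L2norm_eq0 mD z).
Qed.

Lemma C0_semigroup_unique (S1 S2 : R -> H -> H) : C0_semigroup S1 -> C0_semigroup S2 ->
  generator S1 `<=` generator S2 -> forall t, 0 < t -> S1 t = S2 t.
Proof.
move=> c1 c2 g12 t t0; apply/funext => u.
have := semigroup_unique (C0_semigroup_extend0 c1) (C0_semigroup_extend0 c2) _ u (ltW t0).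
rewrite /extend0 t0; apply => v f /generator_extend0 h; apply/generator_extend0; exact: g12.
Qed.

End Semigroups.

(** * Non-congruence *)

Section SecondMoment.
Variable R : realType.
Local Notation mR := (measurableTypeR R).
Local Notation R2 := (R * R)%type.
Local Notation mu := (@leb2 R).
Local Notation meas2 := (@measurable _ (mR * mR)%type).

Definition sqdist (x y : R2) : R := edot (x - y) (x - y).

Lemma sqdistE x y : sqdist x y = (x.1 - y.1) ^+ 2 + (x.2 - y.2) ^+ 2.
Proof. by rewrite /sqdist edotE /= !expr2. Qed.

Lemma sqdist_isometry (f : R2 -> R2) x y : Defs.isometry f -> sqdist (f x) (f y) = sqdist x y.
Proof.
have ge0 a b : 0 <= sqdist a b by rewrite sqdistE addr_ge0 // sqr_ge0.
move=> fi; have := fi x y; move=> /(congr1 (fun s => s ^+ 2)).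
by rewrite /Defs.edist !sqr_sqrtr; [|exact: ge0|exact: ge0].
Qed.

Lemma sqdist_continuous z : continuous (fun x => sqdist x z).
Proof.
have -> : (fun x => sqdist x z) = fun x => (x.1 - z.1) * (x.1 - z.1) + (x.2 - z.2) * (x.2 - z.2).
  by apply/funext => x; rewrite sqdistE !expr2.
have c1 : continuous (fun x : R2 => x.1 - z.1).
  by move=> x; apply: cvgB; [exact: cvg_fst|exact: cvg_cst].
have c2 : continuous (fun x : R2 => x.2 - z.2).
  by move=> x; apply: cvgB; [exact: cvg_snd|exact: cvg_cst].
by move=> x; apply: cvgD; apply: cvgM; [exact: c1|exact: c1|exact: c2|exact: c2].
Qed.

Variables (P : 'I_3 -> R2) (aiP : affinely_independent P).
Local Notation T := (triangle P).
Let mT : meas2 T := triangle_measurable aiP.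

Definition centroid : R2 := 3^-1 *: (\sum_i P i).

Lemma lam_centroid i : lam P i centroid = 3^-1.
Proof.
by rewrite /centroid scaler_sumr (lam_comb aiP) // sum3; field.
Qed.

Lemma triangle_measure_gt0 : (0 < mu T)%E.
Proof.
have [F FE] := open_bigcup_box (triangle_open aiP).
have Tc : T centroid by rewrite triangleE // => i; rewrite lam_centroid invr_gt0.
move: Tc; rewrite {1}FE => -[n _ [/andP[a1 a2] /andP[b1 b2]]].
have sub : box (F n) `<=` T by move=> y hy; rewrite FE; exists n.
apply: (@lt_le_trans _ _ (mu (box (F n)))); last first.
  by apply: le_measure; rewrite ?inE //; exact: measurable_box.
have -> : box (F n) = `](F n).1.1.1, (F n).1.1.2[%classic `*` `](F n).1.2, (F n).2[%classic.
  by apply/seteqP; split=> z; rewrite /box /= !in_itv /=.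
have -> (X Y : set R) : measurable X -> measurable Y ->
    mu (X `*` Y) = (lebesgue_measure X * lebesgue_measure Y)%E.
- by move=> mX mY; exact: product_measure1E.
- rewrite !lebesgue_measure_itv /= !lte_fin (lt_trans a1 a2) (lt_trans b1 b2).
  by rewrite -!EFinB mule_gt0 // lte_fin subr_gt0; [exact: lt_trans a1 a2|exact: lt_trans b1 b2].
- exact: measurable_itv.
- exact: measurable_itv.
Qed.

Lemma int_T_continuous (f : R2 -> R) : continuous f -> int_on T f.
Proof.
move=> cf; have i1 : int_on T (fun=> 1 : R).
  apply/integrableP; split; first by apply/measurable_EFinP; exact: measurable_cst.
  rewrite (eq_integral (cst 1%E)); last by move=> x _; rewrite /= normr1.
  by rewrite integral_cst // mul1e; exact: triangle_bounded_measure.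
by apply: int_on_eq (int_T aiP i1 cf) => // x _; rewrite mul1r.
Qed.

(** The affine symmetry of the triangle that exchanges two vertices and fixes the third. *)
Definition swap_vertices (i j : 'I_3) (x : R2) : R2 := x + (lam P i x - lam P j x) *: (P j - P i).

Lemma lam_swap_vertices i j l x : lam P l (swap_vertices i j x) =
  lam P l x + (lam P i x - lam P j x) * ((l == j)%:R - (l == i)%:R).
Proof.
rewrite -(lam_vertex aiP l j) -(lam_vertex aiP l i) /swap_vertices; set s := _ - _.
by rewrite /lam /affine_form /= /GRing.scale /=; ring.
Qed.

(** The linear part is 1 + v g^T with v = P j - P i and g the gradient of lam i - lam j. As g . v =
    -2, its determinant is -1. *)
Lemma swap_vertices_mpres i j : i != j -> mpres (swap_vertices i j).
Proof.
move=> ij; pose gi := lam_grad P i; pose gj := lam_grad P j; pose v := P j - P i.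
pose k := (lam P i 0 - lam P j 0).
have E x : lam P i x - lam P j x = (gi.1 - gj.1) * x.1 + (gi.2 - gj.2) * x.2 + k.
  by rewrite /k /lam /affine_form /gi /gj /=; ring.
have d : (gi.1 - gj.1) * v.1 + (gi.2 - gj.2) * v.2 = - 2.
  have h := E (P j); have h' := E (P i).
  rewrite !lam_vertex // !eqxx (negbTE ij) eq_sym (negbTE ij) in h h'.
  have -> : (gi.1 - gj.1) * v.1 + (gi.2 - gj.2) * v.2 =
    ((gi.1 - gj.1) * (P j).1 + (gi.2 - gj.2) * (P j).2 + k) -
    ((gi.1 - gj.1) * (P i).1 + (gi.2 - gj.2) * (P i).2 + k) by rewrite /v /=; ring.
  by rewrite -h -h' /=; ring.
have -> : swap_vertices i j = fun x =>
   ((1 + (gi.1 - gj.1) * v.1) * x.1 + ((gi.2 - gj.2) * v.1) * x.2 + k * v.1,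
    ((gi.1 - gj.1) * v.2) * x.1 + (1 + (gi.2 - gj.2) * v.2) * x.2 + k * v.2).
  apply/funext => x; rewrite /swap_vertices E -/v.
  by apply: injective_projections; rewrite /= /GRing.scale /=; ring.
apply: mpres_affine.
rewrite (_ : _ - _ = 1 + ((gi.1 - gj.1) * v.1 + (gi.2 - gj.2) * v.2)); last by ring.
by rewrite d (_ : 1 + - 2 = -1) ?normrN1 //; ring.
Qed.

(** Exchanging vertices shows that the three integrals are equal, and the coordinates sum to 1. *)
Lemma mean_lam i : \int[mu]_(x in T) lam P i x = 3^-1 * fine (mu T).
Proof.
have il l : int_on T (lam P l) by apply: int_T_continuous; exact: lam_continuous.
have eqij l j : \int[mu]_(x in T) lam P l x = \int[mu]_(x in T) lam P j x.
  have [->//|lj] := eqVneq l j.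
  have mp := swap_vertices_mpres lj.
  have TE : swap_vertices l j @^-1` T = T.
    apply/seteqP; split=> x; rewrite /preimage /= !triangleE // => h a.
      have [->|al] := eqVneq a l.
        by have := h j; rewrite lam_swap_vertices eqxx eq_sym (negbTE lj) subr0 mulr1 addrC subrK.
      have [->|aj] := eqVneq a j.
        by have := h l; rewrite lam_swap_vertices eqxx (negbTE lj) sub0r mulrN1 opprB addrC subrK.
      by have := h a; rewrite lam_swap_vertices (negbTE al) (negbTE aj) subrr mulr0 addr0.
    rewrite lam_swap_vertices.
    have [->|al] := eqVneq a l.
      by rewrite (negbTE lj) sub0r mulrN1 opprB addrC subrK.
    have [->|aj] := eqVneq a j; first by rewrite subr0 mulr1 addrC subrK.
    by rewrite subrr mulr0 addr0.
  have m : @measurable_fun _ _ (mR * mR)%type _ T (EFin \o lam P l) by have /integrableP[] := il l.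
  rewrite /Rintegral -(mpres_integral mp mT m) TE; congr fine; apply: eq_integral => x _.
  by rewrite /= lam_swap_vertices eqxx (negbTE lj) sub0r mulrN1 opprB addrC subrK.
have s : \sum_l \int[mu]_(x in T) lam P l x = fine (mu T).
  rewrite -Rint_sum // -[RHS]mul1r -Rintegral_cst //.
  by apply: eq_Rintegral => x _; exact: sum_lam.
by rewrite -s sum3 (eqij 0 i) (eqij 1 i) (eqij 2%:R i); field.
Qed.

(** The correction term of Leibniz's formula: the weighted mean of the squared distances from z to
    the vertices exceeds that from z to x by this sum, which is independent of z. *)
Definition spread (x : R2) : R :=
  lam P 1 x * lam P 2%:R x * sqdist (P 1) (P 2%:R) + lam P 0 x * lam P 2%:R x * sqdist (P 0) (P 2%:R) +
  lam P 0 x * lam P 1 x * sqdist (P 0) (P 1).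

Lemma sqdist_affine (f : R2 -> R2) x z : Defs.isometry f ->
  sqdist (f x) z = \sum_i lam P i x * sqdist (f (P i)) z - spread x.
Proof.
move=> fi; rewrite /spread -(sqdist_isometry (P 1) (P 2%:R) fi) -(sqdist_isometry (P 0) (P 2%:R) fi)
  -(sqdist_isometry (P 0) (P 1) fi).
have [m [t [_ fE]]] := isometry_affine fi.
have s1 := sum_lam aiP x; have xE := lam_sum aiP x.
have fx : f x = \sum_i lam P i x *: f (P i).
  rewrite fE {1}xE; move: s1; rewrite !sum3 /affine_map => s1.
  move: s1; move: (lam P 0 x) (lam P 1 x) (lam P 2%:R x) => a b c s1.
  have -> : a = 1 - b - c by rewrite -s1; ring.
  by apply: injective_projections; rewrite /= /GRing.scale /=; ring.
rewrite fx; move: s1; rewrite !sum3.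
move: (lam P 0 x) (lam P 1 x) (lam P 2%:R x) (f (P 0)) (f (P 1)) (f (P 2%:R)) => a b c u v w s1.
have -> : a = 1 - b - c by rewrite -s1; ring.
by rewrite !sqdistE /= /GRing.scale /=; ring.
Qed.

(** Leibniz's formula is affine in the barycentric coordinates up to [spread]. Integrating replaces
    each coordinate by its mean 1/3, that is, x by the centroid, and what [spread] contributes
    depends on neither f nor z. *)
Lemma moment_tile : exists K : R, forall (f : R2 -> R2) z, Defs.isometry f ->
  \int[mu]_(x in T) sqdist (f x) z = fine (mu T) * sqdist (f centroid) z + K.
Proof.
have cl i : continuous (lam P i) by exact: lam_continuous.
have cs : continuous spread.
  have cc (a : R) i j : continuous (fun x => lam P i x * lam P j x * a).
    by move=> x; apply: cvgM; [apply: cvgM; exact: cl|exact: cvg_cst].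
  by move=> x; apply: cvgD; [apply: cvgD|]; exact: cc.
exists (fine (mu T) * spread centroid - \int[mu]_(x in T) spread x) => f z fi.
transitivity (\int[mu]_(x in T) (\sum_i sqdist (f (P i)) z * lam P i x - spread x)).
  apply: eq_Rintegral => x _; rewrite (sqdist_affine _ _ fi); congr (_ - _).
  by apply: eq_bigr => i _; rewrite mulrC.
have il i : int_on T (fun x => sqdist (f (P i)) z * lam P i x).
  by apply: int_onZ => //; exact: int_T_continuous.
rewrite RintegralB //; [|exact: int_on_sum|exact: int_T_continuous].
rewrite Rint_sum //.
rewrite (eq_bigr (fun i => sqdist (f (P i)) z * (3^-1 * fine (mu T)))); last first.
  by move=> i _; rewrite RintegralZl ?mean_lam //; exact: int_T_continuous.
rewrite (sqdist_affine _ _ fi) -mulr_suml !sum3 !lam_centroid; ring.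
Qed.

Variables (tau : 'I_7 -> R2 -> R2) (p : 'I_3 -> 'I_7 -> 'I_7) (Omega : set R2).
Hypothesis gd : glued_domain P tau p Omega.

Lemma moment_int z : int_on Omega (fun x => sqdist x z).
Proof.
apply: int_on_eq (int_Omega aiP gd (gd_int1 aiP gd) (sqdist_continuous (z := z))).
  exact: gd_measurable gd.
by move=> x _; rewrite mul1r.
Qed.

Lemma moment_tiles z K : (forall (f : R2 -> R2) z, Defs.isometry f ->
    \int[mu]_(x in T) sqdist (f x) z = fine (mu T) * sqdist (f centroid) z + K) ->
  \int[mu]_(x in Omega) sqdist x z = fine (mu T) * (\sum_k sqdist (tau k centroid) z) + K *+ 7.
Proof.
move=> hK; rewrite (Rint_tiles aiP gd (moment_int z)).
rewrite (eq_bigr (fun k => fine (mu T) * sqdist (tau k centroid) z + K)); last first.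
  by move=> k _; apply: hK; exact: (gd_isometry gd).
by rewrite big_split /= sumr_const card_ord mulr_sumr.
Qed.

End SecondMoment.

(** * Moments of congruent domains *)

Section Congruence.
Variable R : realType.
Local Notation R2 := (R * R)%type.
Local Notation mu := (@leb2 R).
Variables (P : 'I_3 -> R2) (aiP : affinely_independent P).
Local Notation G := (centroid P).
Variables (tau tau' : 'I_7 -> R2 -> R2) (p p' : 'I_3 -> 'I_7 -> 'I_7) (Omega Omega' : set R2).
Hypotheses (gd : glued_domain P tau p Omega) (gd' : glued_domain P tau' p' Omega').

(* The polar moment of inertia about a point z is invariant under congruence
   and, up to constants, a sum of squared distances to the tile centroids. *)
Lemma congruent_moment (f : R2 -> R2) z : Defs.isometry f -> f @` Omega = Omega' ->
  \sum_k sqdist (tau' k G) (f z) = \sum_k sqdist (tau k G) z.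
Proof.
move=> fi fO; have [g [gi gK Kg]] := isometry_inverse fi.
have E : f @^-1` Omega' = Omega.
  rewrite -fO; apply/seteqP; split=> x; last by move=> Ox; exists x.
  by move=> [y Oy /(can_inj gK) <-].
have [K hK] := moment_tile aiP.
have mT0 : fine (mu (triangle P)) != 0.
  apply/lt0r_neq0; rewrite fine_gt0 // triangle_measure_gt0 //=; exact: triangle_bounded_measure.
have I : \int[mu]_(x in Omega') sqdist x (f z) = \int[mu]_(x in Omega) sqdist x z.
  have /integrableP[m _] := moment_int aiP gd' (f z).
  rewrite /Rintegral -(mpres_integral (isometry_mpres fi) (gd_measurable gd') m) E.
  by congr fine; apply: eq_integral => x _; rewrite /= sqdist_isometry.
move: I; rewrite (moment_tiles aiP gd _ hK) (moment_tiles aiP gd' _ hK) => /addIr.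
exact: mulfI.
Qed.

Definition centroid_sum (t : 'I_7 -> R2 -> R2) : R2 := \sum_k (t k G - G).

(** The parallel axis theorem for the seven tile centroids: seen from G their mean is
    [centroid_sum t] / 7, and completing the square in z isolates the minimum. *)
Lemma sum_sqdist (t : 'I_7 -> R2 -> R2) z :
  \sum_k sqdist (t k G) z =
  \sum_k sqdist (t k G) G - edot (centroid_sum t) (centroid_sum t) / 7 +
  7 * sqdist (z - G) (7^-1 *: centroid_sum t).
Proof.
have S1 : (centroid_sum t).1 = \sum_k ((t k G).1 - G.1).
  by rewrite /centroid_sum (big_morph (fun x : R2 => x.1) (fun _ _ => erefl) erefl).
have S2 : (centroid_sum t).2 = \sum_k ((t k G).2 - G.2).
  by rewrite /centroid_sum (big_morph (fun x : R2 => x.2) (fun _ _ => erefl) erefl).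
have e k : sqdist (t k G) z = sqdist (t k G) G + sqdist z G -
    2 * (((t k G).1 - G.1) * (z.1 - G.1) + ((t k G).2 - G.2) * (z.2 - G.2)).
  by rewrite !sqdistE; ring.
under eq_bigr do rewrite e.
rewrite sumrB big_split /= sumr_const card_ord -mulr_sumr big_split /= -!mulr_suml -S1 -S2.
move: (centroid_sum t) (\sum_k sqdist _ _) => s v.
by rewrite edotE !sqdistE /= /GRing.scale /=; field.
Qed.

(** The moments are minimal at the means of the centroids. Evaluating at the mean of Omega and its
    image, and at the mean of Omega' and its preimage, compares the minima in both directions. *)
Lemma congruent_centroid_sum : congruent Omega Omega' ->
  \sum_k sqdist (tau k G) G = \sum_k sqdist (tau' k G) G ->
  edot (centroid_sum tau) (centroid_sum tau) = edot (centroid_sum tau') (centroid_sum tau').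
Proof.
move=> [f fi fO] E; have [g [gi gK Kg]] := isometry_inverse fi.
have sq0 (a b : R2) : 0 <= sqdist a b by rewrite sqdistE addr_ge0 // sqr_ge0.
have m0 (a : R2) : sqdist (G + a - G) a = 0 by rewrite (addrC G) addrK sqdistE !subrr expr0n addr0.
have h1 := congruent_moment (G + 7^-1 *: centroid_sum tau) fi fO.
have h2 := congruent_moment (g (G + 7^-1 *: centroid_sum tau')) fi fO.
rewrite sum_sqdist [RHS]sum_sqdist m0 E in h1.
rewrite Kg sum_sqdist [RHS]sum_sqdist m0 E in h2.
have := sq0 (f (G + 7^-1 *: centroid_sum tau) - G) (7^-1 *: centroid_sum tau').
have := sq0 (g (G + 7^-1 *: centroid_sum tau') - G) (7^-1 *: centroid_sum tau).
move: h1 h2; move: (sqdist _ _) (sqdist _ _) (\sum_k _) (edot _ _) (edot _ _) => x y s a b.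
by move=> *; lra.
Qed.

End Congruence.

(** * The centroids of the two propellers *)

Section Noncongruence.
Variable R : realType.
Local Notation R2 := (R * R)%type.
Variables (P : 'I_3 -> R2) (aiP : affinely_independent P).
Local Notation G := (centroid P).
Local Notation rho := (side_reflection P).

Let A := sqdist (P 1) (P 2%:R).
Let B := sqdist (P 2%:R) (P 0).
Let C := sqdist (P 0) (P 1).

Lemma sqdist_gt0 (x y : R2) : x != y -> 0 < sqdist x y.
Proof.
move=> xy; rewrite lt0r sqdistE addr_ge0 ?sqr_ge0 // andbT.
apply: contra_neq xy => h.
have := sqr_ge0 (x.1 - y.1); have := sqr_ge0 (x.2 - y.2) => h2 h1.
have e1 : x.1 - y.1 = 0 by apply/eqP; rewrite -sqrf_eq0; apply/eqP; lra.
have e2 : x.2 - y.2 = 0 by apply/eqP; rewrite -sqrf_eq0; apply/eqP; lra.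
by apply: injective_projections; apply/eqP; rewrite -subr_eq0; apply/eqP.
Qed.

Lemma vertex_neq (i j : 'I_3) : i != j -> P i != P j.
Proof.
move=> ij; apply/eqP => e; have := lam_vertex aiP i j; rewrite -e lam_vertex // eqxx (negbTE ij).
by move/eqP; rewrite oner_eq0.
Qed.

Lemma side_gt0 : [/\ 0 < A, 0 < B & 0 < C].
Proof. by split; apply: sqdist_gt0; exact: vertex_neq. Qed.

(** Heron's formula in the squared side lengths A, B, C: both sides are -16 times the squared
    area. *)
Lemma heron : (A + B + C) ^+ 2 - 4 * (A * B + B * C + C * A) = - (4 * tri_det P ^+ 2).
Proof.
rewrite /A /B /C /tri_det /cross !sqdistE /=.
by move: (P 0) (P 1) (P 2%:R) => [a b] [c d] [e f] /=; ring.
Qed.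

(** The gradients of the coordinates are the edges turned by a right angle over [tri_det], so their
    products are those of the edges, which the law of cosines expresses through A, B, C. *)
Lemma lam_reflections x :
  [/\ [/\ lam P 0 (rho 0 x) = - lam P 0 x,
          lam P 1 (rho 0 x) = lam P 1 x + lam P 0 x * ((A + B - C) / A) &
          lam P 2%:R (rho 0 x) = lam P 2%:R x + lam P 0 x * ((A + C - B) / A)],
      [/\ lam P 0 (rho 1 x) = lam P 0 x + lam P 1 x * ((A + B - C) / B),
          lam P 1 (rho 1 x) = - lam P 1 x &
          lam P 2%:R (rho 1 x) = lam P 2%:R x + lam P 1 x * ((B + C - A) / B)] &
      [/\ lam P 0 (rho 2%:R x) = lam P 0 x + lam P 2%:R x * ((A + C - B) / C),
          lam P 1 (rho 2%:R x) = lam P 1 x + lam P 2%:R x * ((B + C - A) / C) &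
          lam P 2%:R (rho 2%:R x) = - lam P 2%:R x]].
Proof.
have [A0 B0 C0] := side_gt0.
have D0 := tri_det_neq0 aiP.
have [e1 e2 e3 e4 [e5 e6]] := ord3_succ 0.
have key (i j : 'I_3) (E a : R) : tri_det P ^+ 2 * gnorm2 P j = a ->
    tri_det P ^+ 2 * edot (lam_grad P i) (lam_grad P j) = - E / 2 -> 0 < a ->
    lam P i (rho j x) = lam P i x + lam P j x * (E / a).
  move=> h1 h2 a0; rewrite lam_reflection_neq //.
  have -> : gnorm2 P j = a / tri_det P ^+ 2 by rewrite -h1 mulrAC divff ?mul1r // expf_neq0.
  have -> : edot (lam_grad P i) (lam_grad P j) = - E / 2 / tri_det P ^+ 2.
    by rewrite -h2 mulrAC divff ?mul1r // expf_neq0.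
  field; rewrite D0 andbT; exact: lt0r_neq0.
have g j : tri_det P ^+ 2 * gnorm2 P j = (tri_edge P j).1 ^+ 2 + (tri_edge P j).2 ^+ 2.
  by rewrite /gnorm2 /lam_grad /=; field.
have h i j : tri_det P ^+ 2 * edot (lam_grad P i) (lam_grad P j) =
    (tri_edge P i).1 * (tri_edge P j).1 + (tri_edge P i).2 * (tri_edge P j).2.
  by rewrite edotE /lam_grad /=; field.
by split; split; rewrite ?lam_reflection //; apply: key => //; rewrite ?g ?h /A /B /C !sqdistE /tri_edge
  !(e1, e2, e3, e4, e5, e6) /=; field.
Qed.

Lemma sqnorm_barycentric (l : 'I_3 -> R) : \sum_i l i = 0 ->
  edot (\sum_i l i *: P i) (\sum_i l i *: P i) =
  - (l 1 * l 2%:R * A + l 0 * l 2%:R * B + l 0 * l 1 * C).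
Proof.
rewrite !sum3 edotE /A /B /C !sqdistE => s.
have -> : l 0 = - l 1 - l 2%:R by lra.
by rewrite /= /GRing.scale /=; ring.
Qed.

Lemma centroid_sum_barycentric (t : 'I_7 -> R2 -> R2) :
  centroid_sum P t = \sum_i (\sum_k lam P i (t k G) - 7 / 3) *: P i.
Proof.
rewrite /centroid_sum.
transitivity (\sum_k \sum_i (lam P i (t k G) - 3^-1) *: P i).
  apply: eq_bigr => k _; rewrite {1}[t k G](lam_sum aiP) {2}/centroid scaler_sumr -sumrB.
  by apply: eq_bigr => i _; rewrite [RHS]scalerBl.
rewrite exchange_big /=; apply: eq_bigr => i _; rewrite -scaler_suml; congr (_ *: _).
by rewrite sumrB sumr_const card_ord; congr (_ - _); rewrite -[LHS]mulr_natl.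
Qed.

Lemma sum7 (V : nmodType) (F : 'I_7 -> V) (a b c d e f g : 'I_7) :
  [:: a; b; c; d; e; f; g] = [seq inord i | i <- iota 0 7] :> seq 'I_7 ->
  \sum_k F k = F a + F b + F c + F d + F e + F f + F g.
Proof.
move=> E; have n i : (i < 7)%N -> inord i = (inord i : 'I_7) by [].
have -> : \sum_k F k = \sum_(k <- [:: a; b; c; d; e; f; g]) F k.
  rewrite E big_map -[iota 0 7]/(index_iota 0 7) big_mkord; apply: eq_bigr => i _.
  by rewrite inord_val.
by rewrite !big_cons big_nil addr0 !addrA.
Qed.

Variables (tau1 tau2 : 'I_7 -> R2 -> R2).
Hypotheses (unf1 : unfolding P gluing1 tau1) (unf2 : unfolding P gluing2 tau2).

Local Notation o k := (inord k : 'I_7).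

Lemma unfolding1E : [/\ tau1 (o 0) = id, tau1 (o 1) = rho 0, tau1 (o 2) = rho 1, tau1 (o 3) = rho 2%:R &
  [/\ tau1 (o 4) = rho 0 \o rho 1, tau1 (o 5) = rho 1 \o rho 2%:R & tau1 (o 6) = rho 2%:R \o rho 0]].
Proof.
have [t0 h] := unf1; have E0 : o 0 = 0 by apply: val_inj; rewrite /= inordK.
have gl (k l : nat) (j : 'I_3) : (k < 7)%N -> (l < 7)%N -> (k.+1, l.+1, j.+1) \in gluing1 ->
    tau1 (o l) = tau1 (o k) \o rho j.
  by move=> hk hl g; apply: h; rewrite /glued !inordK.
have e0 : tau1 (o 0) = id by rewrite E0.
have e1 : tau1 (o 1) = rho 0 by rewrite (gl 0%N 1%N 0) // e0.
have e2 : tau1 (o 2) = rho 1 by rewrite (gl 0%N 2%N 1) // e0.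
have e3 : tau1 (o 3) = rho 2%:R by rewrite (gl 0%N 3%N 2%:R) // e0.
split => //; split.
- by rewrite (gl 1%N 4%N 1) // e1.
- by rewrite (gl 2%N 5%N 2%:R) // e2.
- by rewrite (gl 3%N 6%N 0) // e3.
Qed.

Lemma unfolding2E : [/\ tau2 (o 0) = id, tau2 (o 1) = rho 0, tau2 (o 2) = rho 1, tau2 (o 3) = rho 2%:R &
  [/\ tau2 (o 4) = rho 0 \o rho 2%:R, tau2 (o 5) = rho 1 \o rho 0 & tau2 (o 6) = rho 2%:R \o rho 1]].
Proof.
have [t0 h] := unf2; have E0 : o 0 = 0 by apply: val_inj; rewrite /= inordK.
have gl (k l : nat) (j : 'I_3) : (k < 7)%N -> (l < 7)%N -> (k.+1, l.+1, j.+1) \in gluing2 ->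
    tau2 (o l) = tau2 (o k) \o rho j.
  by move=> hk hl g; apply: h; rewrite /glued !inordK.
have e0 : tau2 (o 0) = id by rewrite E0.
have e1 : tau2 (o 1) = rho 0 by rewrite (gl 0%N 1%N 0) // e0.
have e2 : tau2 (o 2) = rho 1 by rewrite (gl 0%N 2%N 1) // e0.
have e3 : tau2 (o 3) = rho 2%:R by rewrite (gl 0%N 3%N 2%:R) // e0.
split => //; split.
- by rewrite (gl 1%N 4%N 2%:R) // e1.
- by rewrite (gl 2%N 5%N 0) // e2.
- by rewrite (gl 3%N 6%N 1) // e3.
Qed.

(** The two domains share four tiles, and the outer three carry the same products of two reflections
    in opposite order. Applying rho i shows that rho i (rho j G) is as far from G as rho j G is from
    rho i G, so the order does not matter. *)
Lemma unfolding_sqdist :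
  \sum_k sqdist (tau1 k G) G = \sum_k sqdist (tau2 k G) G.
Proof.
have sC (x y : R2) : sqdist x y = sqdist y x by rewrite !sqdistE; ring.
have sw i j : sqdist (rho i (rho j G)) G = sqdist (rho j (rho i G)) G.
  rewrite -(sqdist_isometry (rho i (rho j G)) G (side_reflection_isometry aiP i)) side_reflectionK //.
  rewrite sC -(sqdist_isometry (rho i G) (rho j G) (side_reflection_isometry aiP j)) side_reflectionK //.
have [a0 a1 a2 a3 [a4 a5 a6]] := unfolding1E.
have [b0 b1 b2 b3 [b4 b5 b6]] := unfolding2E.
rewrite !(@sum7 _ _ (o 0) (o 1) (o 2) (o 3) (o 4) (o 5) (o 6) erefl).
rewrite a0 a1 a2 a3 a4 a5 a6 b0 b1 b2 b3 b4 b5 b6 /=.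
rewrite (sw 0 1) (sw 1 2%:R) (sw 2%:R 0); ring.
Qed.

(** All barycentric coordinates of the tile centroids are rational in A, B, C, so the identity is
    one of rational functions. The squared factor is Heron's expression and does not vanish. *)
Lemma centroid_sum_diff :
  edot (centroid_sum P tau1) (centroid_sum P tau1) - edot (centroid_sum P tau2) (centroid_sum P tau2) =
  - (4 / 9) * ((A - B) * (B - C) * (C - A)) * ((A + B + C) ^+ 2 - 4 * (A * B + B * C + C * A)) ^+ 2 /
    (A * B * C) ^+ 2.
Proof.
have [A0 B0 C0] := side_gt0.
have s0 (t : 'I_7 -> R2 -> R2) : \sum_i (\sum_k lam P i (t k G) - 7 / 3) = 0.
  rewrite sumrB exchange_big /= (eq_bigr (fun=> 1)); last by move=> k _; exact: sum_lam.
  by rewrite !sumr_const !card_ord; field.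
rewrite !centroid_sum_barycentric !sqnorm_barycentric //.
have L0 : lam P 0 G = 3^-1 by exact: lam_centroid.
have L1 : lam P 1 G = 3^-1 by exact: lam_centroid.
have L2 : lam P 2%:R G = 3^-1 by exact: lam_centroid.
have [a0 a1 a2 a3 [a4 a5 a6]] := unfolding1E.
have [b0 b1 b2 b3 [b4 b5 b6]] := unfolding2E.
rewrite !(@sum7 _ _ (o 0) (o 1) (o 2) (o 3) (o 4) (o 5) (o 6) erefl).
rewrite a0 a1 a2 a3 a4 a5 a6 b0 b1 b2 b3 b4 b5 b6 /=.
have [[r00 r01 r02] [r10 r11 r12] [r20 r21 r22]] := lam_reflections G.
(* The outer tiles reflect twice: for each inner reflection, the coordinates under the two outer
   ones that occur. *)
have [[s00 s01 s02] [s10 s11 s12] _] := lam_reflections (rho 2%:R G).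
have [[t00 t01 t02] _ [t20 t21 t22]] := lam_reflections (rho 1 G).
have [_ [u10 u11 u12] [u20 u21 u22]] := lam_reflections (rho 0 G).
rewrite s00 s01 s02 s10 s11 s12 t00 t01 t02 t20 t21 t22 u10 u11 u12 u20 u21 u22.
rewrite r00 r01 r02 r10 r11 r12 r20 r21 r22 L0 L1 L2.
have : A != 0 by exact: lt0r_neq0. have : B != 0 by exact: lt0r_neq0. have : C != 0 by exact: lt0r_neq0.
clear; move: A B C => a b c c0 b0 a0; field.
by rewrite a0 b0 c0.
Qed.

Lemma scalene_centroid_sum : injective (side_length P) ->
  edot (centroid_sum P tau1) (centroid_sum P tau1) <> edot (centroid_sum P tau2) (centroid_sum P tau2).
Proof.
move=> inj; have [A0 B0 C0] := side_gt0.
have [e1 e2 e3 e4 [e5 e6]] := ord3_succ 0.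
have sl (i j : 'I_3) : i != j -> sqdist (P (i + 1)) (P (i + 2)) != sqdist (P (j + 1)) (P (j + 2)).
  by apply: contra_neq => h; apply: inj; rewrite /side_length /Defs.edist -/(sqdist _ _) h.
have AB : A != B by have := sl 0 1 isT; rewrite !(e1, e2, e3, e4, e5, e6).
have BC : B != C by have := sl 1 2%:R isT; rewrite !(e1, e2, e3, e4, e5, e6).
have CA : C != A by have := sl 2%:R 0 isT; rewrite !(e1, e2, e3, e4, e5, e6).
move=> E; have := centroid_sum_diff; rewrite E subrr heron => /esym/eqP.
have n1 : - (4 / 9) != 0 :> R by rewrite oppr_eq0 mulf_neq0 ?invr_eq0 ?pnatr_eq0.
have n2 : - (4 * tri_det P ^+ 2) != 0.
  by rewrite oppr_eq0 mulf_neq0 ?pnatr_eq0 ?expf_neq0 ?(tri_det_neq0 aiP).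
have n3 : A * B * C != 0 by rewrite !mulf_neq0 ?lt0r_neq0.
apply/negP; rewrite !mulf_neq0 ?expf_neq0 ?invr_eq0 ?expf_neq0 //; last 3 first.
- by rewrite subr_eq0.
- by rewrite subr_eq0.
- by rewrite subr_eq0.
Qed.

End Noncongruence.

(** * Similarity of semigroups *)

Section Similarity.
Variable R : realType.
Local Notation R2 := (R * R)%type.
Local Notation mR := (measurableTypeR R).
Local Notation C := R[i].
Local Notation meas2 := (@measurable _ (mR * mR)%type).

Lemma bounded_operator_gt0 (D1 D2 : set R2) (F : L2 D1 -> L2 D2) : bounded_operator F ->
  exists2 M, 0 < M & forall u, L2norm (F u) <= M * L2norm u.
Proof.
move=> [_ [M hM]]; exists (Num.max M 1); first by rewrite lt_max ltr01 orbT.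
by move=> u; apply: le_trans (hM u) _; rewrite ler_wpM2r ?L2norm_ge0 // le_max lexx.
Qed.

Lemma bounded_operator_comp (D1 D2 D3 : set R2) (G : L2 D2 -> L2 D3) (F : L2 D1 -> L2 D2) :
  bounded_operator G -> bounded_operator F -> bounded_operator (G \o F).
Proof.
move=> bG bF; have [MG MG0 hG] := bounded_operator_gt0 bG; have [MF MF0 hF] := bounded_operator_gt0 bF.
split; first by move=> a u v; rewrite /= bF.1 bG.1.
exists (MG * MF) => u; apply: le_trans (hG _) _.
by rewrite -mulrA ler_pM2l.
Qed.

Lemma bounded_operator_cvg0 (D1 D2 : set R2) (V : L2 D2 -> L2 D1) (F : R -> L2 D2) : bounded_operator V ->
  L2norm (F t) @[t --> 0^'+] --> (0 : R) -> L2norm (V (F t)) @[t --> 0^'+] --> (0 : R).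
Proof.
move=> bV cF; have [M M0 hM] := bounded_operator_gt0 bV.
apply: (@squeeze_cvgr _ _ _ _ (fun=> 0 : R) (fun t => M * L2norm (F t))).
- by near=> t; rewrite L2norm_ge0 hM.
- exact: cvg_cst.
- by rewrite -[X in _ --> X](mulr0 M); apply: cvgM => //; exact: cvg_cst.
Unshelve. all: by end_near. Qed.

Lemma bounded_operatorZ (D1 D2 : set R2) (F : L2 D1 -> L2 D2) (a : C) u : bounded_operator F ->
  F (a *: u) = a *: F u.
Proof.
move=> bF; have F0 : F 0 = 0.
  by have := bF.1 (-1) 0 0; rewrite scaler0 addr0 scaleN1r addNr.
by rewrite -[a *: u]addr0 bF.1 F0 addr0.
Qed.

Variables (D1 D2 : set R2) (mD1 : meas2 D1) (U : L2 D1 -> L2 D2) (V : L2 D2 -> L2 D1).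
Hypotheses (bU : bounded_operator U) (bV : bounded_operator V) (UK : cancel U V) (VK : cancel V U).

Let VB u v : V (u - v) = V u - V v.
Proof. by have := bV.1 (-1) v u; rewrite !scaleN1r !(addrC (- _)). Qed.

Lemma C0_semigroup_conj (S : R -> L2 D2 -> L2 D2) : C0_semigroup S ->
  C0_semigroup (fun t => V \o S t \o U).
Proof.
move=> [bS Sadd S0]; split.
- by move=> t t0; apply: bounded_operator_comp bU; apply: bounded_operator_comp bV _; exact: bS.
- by move=> s t s0 t0 u /=; rewrite VK Sadd.
- move=> u; have := bounded_operator_cvg0 bV (S0 (U u)).
  by under eq_fun do rewrite VB UK.
Qed.

Lemma generator_conj (S : R -> L2 D2 -> L2 D2) u f : generator S (U u, U f) ->
  generator (fun t => V \o S t \o U) (u, f).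
Proof.
by move=> /(bounded_operator_cvg0 bV); rewrite /generator /=; under eq_fun do rewrite VB (bounded_operatorZ _ _ bV) VB !UK.
Qed.

Lemma semigroup_conj (A1 : set (L2 D1 * L2 D1)) (A2 : set (L2 D2 * L2 D2)) S1 S2 :
  (forall u f, A1 (u, f) -> A2 (U u, U f)) ->
  generated_by_opp A1 S1 -> generated_by_opp A2 S2 ->
  forall t, 0 < t -> S1 t = V \o S2 t \o U.
Proof.
move=> UA [c1 g1] [c2 g2]; apply: (C0_semigroup_unique mD1 c1 (C0_semigroup_conj c2)).
(* Membership in the generator of S1 means A1 (u, - f); linearity moves the sign through U. *)
move=> [u f]; rewrite g1 /= => /UA h; apply: generator_conj; rewrite g2 /=.
by rewrite -scaleN1r -(bounded_operatorZ _ _ bU) scaleN1r.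
Qed.

End Similarity.

Theorem theorem5p2 (R : realType) (P : 'I_3 -> R * R)
    (tau1 tau2 : 'I_7 -> R * R -> R * R) (c : R * R -> 'M[R[i]]_2)
    (scaleneP : scalene P)
    (unfold1 : unfolding P gluing1 tau1) (unfold2 : unfolding P gluing2 tau2)
    (propeller1 : warped_propeller P gluing1 tau1)
    (propeller2 : warped_propeller P gluing2 tau2)
    (ellipticc : elliptic_coefficients (triangle P) c) :
  let T := triangle P in
  let Omega1 := polygon P tau1 in
  let Omega2 := polygon P tau2 in
  let A1 : set (L2 Omega1 * L2 Omega1) := elliptic_operator T tau1 c in
  let A2 : set (L2 Omega2 * L2 Omega2) := elliptic_operator T tau2 c in
  let U : L2 Omega1 -> L2 Omega2 := transplantation T Omega2 tau1 tau2 in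
  [/\ invertible_operator U,
      forall (S1 : R -> L2 Omega1 -> L2 Omega1)
             (S2 : R -> L2 Omega2 -> L2 Omega2),
        generated_by_opp A1 S1 -> generated_by_opp A2 S2 ->
        forall t : R, 0 < t -> S1 t = pinv setT U \o S2 t \o U,
      similar_operators A1 A2
    & ~ congruent Omega1 Omega2].
Proof.
move=> T Omega1 Omega2 A1 A2 U; have [aiP slP] := scaleneP.
have gd1 := warped_propeller_glued_domain gluing_check1 aiP unfold1 propeller1.
have gd2 := warped_propeller_glued_domain gluing_check2 aiP unfold2 propeller2.
rewrite -/Omega1 in gd1; rewrite -/Omega2 in gd2.
pose V : L2 Omega2 -> L2 Omega1 := @mix R P tau2 tau1 Omega2 Omega1 (real_mixing_inv R).
have UE : U = @mix R P tau1 tau2 Omega1 Omega2 (real_mixing R) by exact: transplantationE.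
have bU : bounded_operator U by rewrite UE; exact: (mix_bounded aiP gd1 gd2).
have bV : bounded_operator V by exact: (mix_bounded aiP gd2 gd1).
have UK : cancel U V by rewrite UE; exact: (mixK aiP gd1 gd2 (real_mixing_invV R)).
have VK : cancel V U by rewrite UE; exact: (mixK aiP gd2 gd1 (real_mixingV R)).
have UA u f : A1 (u, f) -> A2 (U u, U f).
  by rewrite UE; apply: (elliptic_operator_mix aiP ellipticc gd1 gd2); exact: real_mixing_partner.
have VA u f : A2 (u, f) -> A1 (V u, V f).
  by apply: (elliptic_operator_mix aiP ellipticc gd2 gd1); exact: real_mixing_inv_partner.
have iU : invertible_operator U by split=> //; exists V.
split; first exact: iU.
- move=> S1 S2 g1 g2 t t0.
  (* U is injective and onto, so [pinv] has only one preimage to choose. *)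
  have -> : pinv setT U = V.
    apply/funext => v; have [u ->] : exists u, v = U u by exists (V v); exact: esym (VK v).
    by rewrite UK; apply: pinvKV; [apply: in2W; exact: can_inj UK|exact: in_setT].
  exact: (semigroup_conj (gd_measurable gd1) bU bV UK VK UA g1 g2).
- exists U; split=> //; apply/seteqP; split=> [_ [u [f uf] <-]|v [f vf]].
    by exists (U f); exact: UA.
  by exists (V v); [exists (V f); exact: VA|exact: VK].
- move=> /(congruent_centroid_sum aiP gd1 gd2) h.
  apply: (scalene_centroid_sum aiP unfold1 unfold2 slP); apply: h.
  exact: (unfolding_sqdist aiP unfold1 unfold2).
Qed.
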